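(* Let $G$ be a complex semisimple algebraic group of adjoint type. Let $w\in W$ and $J\subseteq\mathcal{I}_w$. If $X_{wB}$ is a horospherical $L_J$-variety, then the stabilizer in $L_J$ of a point in general position in $X_{wB}$ is a connected strongly solvable group.
   Context: $G$ is connected, $B\subset G$ a Borel subgroup, $T\subset B$ a maximal torus, $W$ the Weyl group of $(G,T)$, $\mathcal{S}$ the set of simple roots determined by $(G,B,T)$. For $w\in W$ let $\dot w\in N_G(T)$ be a representative and $X_{wB}:=\overline{B\dot wB/B}\subseteq G/B$. Put $\mathcal{I}_w:=\{\alpha\in\mathcal{S}\mid w^{-1}(\alpha)<0\}$. For $J\subseteq\mathcal{S}$, $P_J$ is the standard parabolic subgroup generated by $B$ and the root subgroups $U_{-\alpha}$, $\alpha\in J$, and $L_J$ is its Levi subgroup containing $T$. The stabilizer of $X_{wB}$ in $G$ is $P_{\mathcal{I}_w}$, so $L_J$ acts on $X_{wB}$ for every $J\subseteq\mathcal{I}_w$. Adjoint type means that the center of $G$ is trivial. For a connected reductive group $K$: a point of an irreducible $K$-variety is in general position if its $K$-orbit has maximal dimension; a normal irreducible $K$-variety is horospherical if it has an open $K$-orbit and the stabilizer in $K$ of a point in general position contains a maximal unipotent subgroup of $K$; a subgroup of $K$ is strongly solvable if it is contained in a Borel subgroup of $K$. *)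

(* Defs.v *)
From HB Require Import structures.
From mathcomp Require Import all_boot all_order all_algebra.
From mathcomp Require Import all_classical reals topology complex.
From mathcomp Require Import mpoly.

Set Implicit Arguments.
Unset Strict Implicit.
Unset Printing Implicit Defensive.

Import GRing.Theory.
Local Open Scope classical_set_scope.
Local Open Scope ring_scope.

Section Zariski.
Variables (F : fieldType) (n : nat).

(* n x n matrices with the Zariski topology of affine n^2-space; the alias keeps
   it apart from the entrywise topology that 'M[F]_n may carry. *)
Definition zmx : Type := 'M[F]_n.

Definition mxeval (p : {mpoly F[n * n]}) (A : 'M[F]_n) : F :=
  p.@[mxvec A 0].

Definition zeros (I : set ({mpoly F[n * n]})) : set 'M[F]_n :=
  [set A | forall p, I p -> mxeval p A = 0].

Definition zopen (U : set zmx) := exists I, U = ~` zeros I.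

Lemma zopenP (U : set zmx) :
  zopen U <-> forall A, U A -> exists p, mxeval p A != 0 /\
    forall A', mxeval p A' != 0 -> U A'.
Proof.
split=> [[I ->] A /existsNP[p /not_implyP[Ip /eqP pA]]|UP].
  by exists p; split=> // A' /eqP pA' /(_ p Ip).
exists [set p | forall A', mxeval p A' != 0 -> U A'].
apply/seteqP; split=> A.
  move=> /UP[p [pA pU]] /(_ p pU) pA0.
  by rewrite pA0 eqxx in pA.
by move=> /existsNP[p /not_implyP[pU /eqP pA]]; exact: pU.
Qed.

Lemma zopenT : zopen setT.
Proof.
apply/zopenP => A _; exists 1; split=> //.
by rewrite /mxeval meval1 oner_eq0.
Qed.

Lemma zopenI : setI_closed zopen.
Proof.
move=> U V /zopenP Uo /zopenP Vo; apply/zopenP => A [/Uo[p [pA pU]] /Vo[q [qA qV]]].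
have pq B : mxeval (p * q) B = mxeval p B * mxeval q B.
  by rewrite /mxeval mevalM.
exists (p * q); split=> [|B]; rewrite pq mulf_eq0 negb_or; first by rewrite pA.
by move=> /andP[pB qB]; split; [exact: pU|exact: qV].
Qed.

Lemma zopen_bigU (J : Type) (f : J -> set zmx) :
  (forall i, zopen (f i)) -> zopen (\bigcup_i f i).
Proof.
move=> fo; apply/zopenP => A [i _ /(zopenP _).1 - /(_ (fo i))[p [pA pf]]].
by exists p; split=> // B /pf; exists i.
Qed.

HB.instance Definition _ := Choice.on zmx.
HB.instance Definition _ := isOpenTopological.Build zmx zopenT zopenI zopen_bigU.

Definition regular_on (S : set 'M[F]_n) (f : 'M[F]_n -> F) :=
  forall x, S x -> exists p q, mxeval q x != 0 /\
    forall y, S y -> mxeval q y != 0 -> f y = mxeval p y / mxeval q y.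

End Zariski.

Section LinearAlgebraicGroups.
Variable F : fieldType.

Definition maximal_for (T : Type) (Q : set T -> Prop) (H : set T) :=
  Q H /\ forall H', Q H' -> H `<=` H' -> H' = H.

Section Fixed_n.
Variable n : nat.
Implicit Types (G H K B T P L U : set 'M[F]_n) (g k : 'M[F]_n).

Definition GLset : set 'M[F]_n := [set A | A \in unitmx].

Definition mxgroup H :=
  [/\ H `<=` GLset, H 1%:M,
      forall a b, H a -> H b -> H (a *m b) &
      forall a, H a -> H (invmx a)].

Definition alg_group H :=
  mxgroup H /\ exists2 Z : set (zmx F n), closed Z & H = Z `&` GLset.

Definition alg_subgroup K H := alg_group H /\ H `<=` K.

Definition zconnected H := connected (H : set (zmx F n)).

Definition normalised_by K H :=
  forall k h, K k -> H h -> H (k *m h *m invmx k).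

Definition generated (A : set 'M[F]_n) : set 'M[F]_n :=
  [set g | forall H, mxgroup H -> A `<=` H -> H g].

Definition derived H : set 'M[F]_n :=
  generated [set g | exists a b, [/\ H a, H b &
    g = a *m b *m invmx a *m invmx b]].

Definition solvable H := exists m, iter m derived H `<=` [set 1%:M].

Definition unipotent H := forall h, H h -> exists m, (h - 1%:M) ^+ m = 0.

Definition trivial_center G :=
  forall g, G g -> (forall h, G h -> g *m h = h *m g) -> g = 1%:M.

Definition semisimple G :=
  [/\ alg_group G, zconnected G &
      forall H, alg_subgroup G H -> zconnected H -> solvable H ->
        normalised_by G H -> H `<=` [set 1%:M]].

Definition borel K :=
  maximal_for (fun H => [/\ alg_subgroup K H, zconnected H & solvable H]).

Definition maximal_unipotent K :=
  maximal_for (fun H => alg_subgroup K H /\ unipotent H).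

Definition strongly_solvable K H := exists2 B, borel K B & H `<=` B.

Definition unipotent_radical P U :=
  let Q V := [/\ alg_subgroup P V, zconnected V, unipotent V &
                 normalised_by P V] in
  Q U /\ forall V, Q V -> V `<=` U.

Definition levi P L :=
  alg_subgroup P L /\ exists U, [/\ unipotent_radical P U,
    P = [set l *m u | l in L & u in U] & L `&` U = [set 1%:M]].

(* Tangent space at the identity: the vectors killed by the differential at 1
   of every polynomial vanishing on G. *)
Definition lie_algebra G : set 'M[F]_n :=
  [set X | forall p : {mpoly F[n * n]},
    (forall g, G g -> mxeval p g = 0) ->
    \sum_k mxeval (mderiv k p) 1%:M * mxvec X 0 k = 0].

End Fixed_n.

Definition alg_morphism (m n : nat) (H : set 'M[F]_m) (H' : set 'M[F]_n)
    (f : 'M[F]_m -> 'M[F]_n) :=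
  [/\ forall a, H a -> H' (f a),
      forall a b, H a -> H b -> f (a *m b) = f a *m f b &
      forall i j, regular_on H (fun a => f a i j)].

Definition alg_isomorphic (m n : nat) (H : set 'M[F]_m) (H' : set 'M[F]_n) :=
  exists f g, [/\ alg_morphism H H' f, alg_morphism H' H g,
    forall a, H a -> g (f a) = a & forall b, H' b -> f (g b) = b].

Definition diag_group (r : nat) : set 'M[F]_r :=
  [set A | is_diag_mx A /\ A \in unitmx].

Section Roots.
Variable n : nat.
Implicit Types (G H K B T P L U : set 'M[F]_n) (g k w : 'M[F]_n).
Implicit Types (a b : 'M[F]_n -> F) (J : set ('M[F]_n -> F)).

Definition torus T := alg_group T /\ exists r, alg_isomorphic T (@diag_group r).

Definition maximal_torus K := maximal_for (fun T => torus T /\ T `<=` K).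

Definition normalizer G T : set 'M[F]_n :=
  [set g | G g /\ forall t, T t <-> T (g *m t *m invmx g)].

(* g . S = {g s | s in S}: for S a subgroup this is the coset gS, and for S a
   coset xB it is the action of g on the point xB of G/B. *)
Definition mxact g (S : set 'M[F]_n) : set 'M[F]_n := [set g *m s | s in S].

Definition weyl_group G T : set (set 'M[F]_n) :=
  [set mxact g T | g in normalizer G T].

(* Characters are functions on all matrices, made to vanish off T so that
   equality of characters is equality of functions. The character group is
   written multiplicatively: the product is pointwise, and the opposite of a
   root a is the pointwise inverse char_opp a (recall 0^-1 = 0). *)
Definition character T a :=
  [/\ regular_on T a, forall t, T t -> a t != 0,
      forall s t, T s -> T t -> a (s *m t) = a s * a t &
      forall g, ~ T g -> a g = 0].

Definition char_opp a : 'M[F]_n -> F := fun t => (a t)^-1.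
Definition char_add a b : 'M[F]_n -> F := fun t => a t * b t.
Definition char_act w a : 'M[F]_n -> F := fun t => a (invmx w *m t *m w).

(* The nontrivial weights of T in the Lie algebra of H; for H = B these are
   the positive roots of (G, B, T). *)
Definition roots H T : set ('M[F]_n -> F) :=
  [set a | [/\ character T a, exists2 t, T t & a t != 1 &
    exists X, [/\ X != 0, lie_algebra H X &
      forall t, T t -> t *m X *m invmx t = a t *: X]]].

Definition simple_roots B T : set ('M[F]_n -> F) :=
  [set a | roots B T a /\
    ~ exists b c, [/\ roots B T b, roots B T c & a = char_add b c]].

Definition negative_root B T a := roots B T (char_opp a).

Definition left_descents B T w : set ('M[F]_n -> F) :=
  [set a | simple_roots B T a /\ negative_root B T (char_act (invmx w) a)].

(* U is the image of an isomorphism x from the additive group onto a closed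
   subgroup of G such that t x(c) t^-1 = x(a(t) c). *)
Definition root_subgroup G T a U :=
  alg_subgroup G U /\
  exists (x : 'M[{poly F}]_n) (y : 'M[F]_n -> F),
    let x_ c := map_mx (fun p : {poly F} => p.[c]) x in
    [/\ forall c d, x_ (c + d) = x_ c *m x_ d,
        U = range x_,
        regular_on U y,
        forall c, y (x_ c) = c &
        forall t c, T t -> t *m x_ c *m invmx t = x_ (a t * c)].

Definition parabolic G B T J : set 'M[F]_n :=
  generated (B `|` [set g | exists a U,
    [/\ J a, root_subgroup G T (char_opp a) U & U g]]).

End Roots.
End LinearAlgebraicGroups.

(* Points of G/B are the cosets gB, g in G, as sets of matrices. The topology
   is the quotient topology of the Zariski topology of G; sets of matrices that
   are not such cosets are isolated points of the type, and G/B is a closed and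
   open subset of it. The unused arguments let the topology depend on G and B. *)
Definition flag (F : fieldType) (n : nat) (G B : set 'M[F]_n) : Type :=
  set 'M[F]_n.

Section FlagVariety.
Variables (F : fieldType) (n : nat) (G B : set 'M[F]_n).
Local Notation flag := (flag G B).

Definition flag_open (U : set flag) :=
  exists2 V : set (zmx F n), open V &
    forall g, G g -> U (mxact g B) <-> V g.

Lemma flag_openT : flag_open setT.
Proof. by exists setT; first exact: openT. Qed.

Lemma flag_openI : setI_closed flag_open.
Proof.
move=> U1 U2 [V1 o1 h1] [V2 o2 h2]; exists (V1 `&` V2); first exact: openI.
move=> g Gg; split=> -[u1 u2]; split.
- exact/h1.
- exact/h2.
- exact/h1.
- exact/h2.
Qed.

Lemma flag_open_bigU (I : Type) (f : I -> set flag) :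
  (forall i, flag_open (f i)) -> flag_open (\bigcup_i f i).
Proof.
move=> fo; have /choice[V hV] : forall i, exists V : set (zmx F n),
    open V /\ forall g, G g -> f i (mxact g B) <-> V g.
  by move=> i; have [V oV hV] := fo i; exists V.
exists (\bigcup_i V i); first by apply: bigcup_open => i _; exact: (hV i).1.
by move=> g Gg; split=> -[i _ h]; exists i => //; apply/((hV i).2 g Gg).
Qed.

HB.instance Definition _ := Choice.on flag.
HB.instance Definition _ :=
  isOpenTopological.Build flag flag_openT flag_openI flag_open_bigU.

(* Structure sheaf of G/B: the functions on U whose pullback to the preimage of
   U in G is regular. *)
Definition flag_regular (U : set flag) (f : flag -> F) :=
  regular_on [set g | G g /\ U (mxact g B)] (fun g => f (mxact g B)).

Definition schubert (w : 'M[F]_n) : set flag :=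
  closure [set x : flag | exists2 b, B b & x = mxact (b *m w) B].

Definition flag_act (g : 'M[F]_n) (x : flag) : flag := mxact g x.

End FlagVariety.
Arguments flag_regular {F n} G B.
Arguments schubert {F n} G B.
Arguments flag_act {F n} G B.

(* A variety is given by a topological space X, a structure sheaf (O U f means
   that f restricts to a regular function on the open set U), and a subset Z of
   X, which carries the induced topology and the induced sheaf. *)
Section Varieties.
Variables (F : fieldType) (X : topologicalType) (O : set X -> (X -> F) -> Prop).
Implicit Types (Z S : set X) (f h : X -> F).

Definition irreducible Z :=
  Z !=set0 /\ forall C D : set X, closed C -> closed D ->
    Z `<=` C `|` D -> Z `<=` C \/ Z `<=` D.

(* Krull dimension of the subspace S is at least d. *)
Definition dim_ge S (d : nat) := exists Y : nat -> set X,
  (forall i, (i <= d)%N -> irreducible (Y i) /\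
     exists2 C, closed C & Y i = S `&` C) /\
  (forall i, (i < d)%N -> Y i `<` Y i.+1).

Definition dim_le S S' := forall d, dim_ge S d -> dim_ge S' d.

Definition regular_at Z (x : X) h := exists U f,
  [/\ open U, U x, O U f & forall y, U y -> Z y -> h y = f y].

(* Every local ring of the irreducible variety Z is integrally closed in the
   function field: a rational function h, regular on the nonempty open subset
   Z `&` V, which is a root of a monic polynomial with coefficients regular at
   x, is itself regular at x. *)
Definition normal_variety Z :=
  forall x (V : set X) h, Z x -> open V -> Z `&` V !=set0 ->
    (forall y, Z y -> V y -> regular_at Z y h) ->
    (exists (d : nat) (c : 'I_d -> X -> F) (N : set X),
      [/\ forall i, regular_at Z x (c i), open N, N x &
          forall y, Z y -> V y -> N y ->
            h y ^+ d + \sum_(i < d) c i y * h y ^+ i = 0]) ->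
    exists h' (N : set X), [/\ regular_at Z x h', open N, N x &
      forall y, Z y -> V y -> N y -> h' y = h y].

Section Action.
Variables (n : nat) (K : set 'M[F]_n) (act : 'M[F]_n -> X -> X).

Definition action_orbit (x : X) : set X := [set act k x | k in K].

Definition stabilizer (x : X) : set 'M[F]_n := [set k | K k /\ act k x = x].

Definition general_position Z (x : X) :=
  Z x /\ forall y, Z y -> dim_le (action_orbit y) (action_orbit x).

Definition horospherical Z :=
  [/\ irreducible Z, normal_variety Z,
      forall k z, K k -> Z z -> Z (act k z),
      exists x V, [/\ Z x, open V & action_orbit x = Z `&` V] &
      forall x, general_position Z x ->
        exists2 U, maximal_unipotent K U & U `<=` stabilizer x].

End Action.
End Varieties.

(* Main.v *)
(** Let [P = L V] be the parabolic subgroup with its Levi decomposition, [x0] the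
    point [wdot B] of [G/B] and [C = wdot B wdot^-1] its stabiliser in [G].

    A point in general position lies in the open [L]-orbit: otherwise its orbit
    would have smaller Krull dimension, as one sees by comparing the growth of
    the Hilbert functions of the two orbits. The open orbit also contains a point
    [x = v x0] with [v] in [V]. The projection to [L] of the unipotent part of
    [P `&` C] is then a maximal unipotent subgroup [U] of [L] which is normalised
    by [T] and fixes [x], so the stabiliser [H] of [x] in [L] is [T_x U], where
    [T_x] is the stabiliser in [T]. It lies in the Borel subgroup [T U] of [L].

    It remains to see that [T_x] is connected. The points of [V x0] in the open
    orbit belong to [T x], and [V] is irreducible, so [H] fixes [V x0] pointwise.
    Let [K] be the normal subgroup of the maximal unipotent subgroup [U V] of [G]
    that fixes [V x0] pointwise. An element [t] of [T] belongs to [T_x] if and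
    only if it acts trivially on [U V / K], that is, if [a(t) = 1] for the simple
    roots [a] that occur in [Lie (U V)] modulo [Lie K] and the brackets. The
    simple roots are linearly independent, by the trace form and [sl_2]-strings,
    and since their common kernel is central in [G] it is trivial. Hence the
    cocharacters that are dual to them up to a factor generate [T], and those
    dual to the remaining simple roots generate [T_x]. *)

Require Import Defs.
From mathcomp Require Import all_boot all_order all_algebra.
From mathcomp Require Import all_classical reals topology complex.
From mathcomp Require Import mpoly closed_field ring lra zify.

Set Implicit Arguments.
Unset Strict Implicit.
Unset Printing Implicit Defensive.

Import Order.TTheory GRing.Theory Num.Theory.
Local Open Scope classical_set_scope.
Local Open Scope ring_scope.
(** * Polynomial functions and Zariski closure *)

Section PolyFun.
Variable F : fieldType.

(** The carrier of the argument is the tangent space: in characteristic 0 it determines a connected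
    closed subgroup ([lie_eq]), and its nilpotent elements exponentiate into the group. The obstacle
    is that a tangent vector has two Jordan parts, and that the semisimple one is seen in the group
    only through the tori it spans; Chevalley's replicas supply both. They force the radical of the
    trace form on [Lie G] to be nilpotent, so semisimplicity kills it, and orthogonal complements do
    the work of root space decompositions. Simple roots are read off from [U V] itself, since [U]
    arrives as an arbitrary maximal unipotent subgroup of [L]. The factor in the dual cocharacters
    is harmless because roots can be extracted in the field. In the dimension comparison a strict
    inclusion of irreducible sets gains a factor [k] in the Hilbert function, after a linear change
    of [k], while sweeping by one unipotent curve costs at most a linear factor: one inclusion more
    than sweeps gives [k h(k) <= M h(Qk)], which polynomial growth forbids. *)

Definition polyf n (f : 'M[F]_n -> F) := exists p, f =1 mxeval p.

Definition polymap m n (h : 'M[F]_m -> 'M[F]_n) :=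
  forall i j, polyf (fun A => h A i j).

Section Fixed.
Variable n : nat.
Implicit Types (f g : 'M[F]_n -> F) (A B : 'M[F]_n).

Lemma polyf_ext f g : f =1 g -> polyf f -> polyf g.
Proof. by move=> fg [p fp]; exists p => A; rewrite -fg fp. Qed.

Lemma polyf_mxeval p : polyf (@mxeval F n p).
Proof. by exists p. Qed.

Lemma polyfC c : polyf (fun _ : 'M[F]_n => c).
Proof. by exists c%:MP => A; rewrite /mxeval mevalC. Qed.

Lemma polyf_entry i j : polyf (fun A : 'M[F]_n => A i j).
Proof. by exists 'X_(mxvec_index i j) => A; rewrite /mxeval mevalXU mxvecE. Qed.

Lemma polyfD f g : polyf f -> polyf g -> polyf (fun A => f A + g A).
Proof. by move=> [p fp] [q gq]; exists (p + q) => A; rewrite /mxeval mevalD fp gq. Qed.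

Lemma polyfM f g : polyf f -> polyf g -> polyf (fun A => f A * g A).
Proof. by move=> [p fp] [q gq]; exists (p * q) => A; rewrite /mxeval mevalM fp gq. Qed.

Lemma polyfN f : polyf f -> polyf (fun A => - f A).
Proof. by move=> [p fp]; exists (- p) => A; rewrite /mxeval mevalN fp. Qed.

Lemma polyfB f g : polyf f -> polyf g -> polyf (fun A => f A - g A).
Proof. by move=> fp gp; apply: polyfD => //; apply: polyfN. Qed.

Lemma polyfZ c f : polyf f -> polyf (fun A => c * f A).
Proof. by apply: polyfM; apply: polyfC. Qed.

Lemma polyf_sum (I : Type) (r : seq I) (P : pred I) (f : I -> 'M[F]_n -> F) :
  (forall i, P i -> polyf (f i)) -> polyf (fun A => \sum_(i <- r | P i) f i A).
Proof.
move=> fP; elim: r => [|i r IH].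
  by apply: polyf_ext (polyfC 0) => A; rewrite big_nil.
case Pi: (P i); last first.
  by apply: polyf_ext IH => A; rewrite big_cons Pi.
by apply: polyf_ext (polyfD (fP i Pi) IH) => A; rewrite big_cons Pi.
Qed.

Lemma polyf_prod (I : Type) (r : seq I) (P : pred I) (f : I -> 'M[F]_n -> F) :
  (forall i, P i -> polyf (f i)) -> polyf (fun A => \prod_(i <- r | P i) f i A).
Proof.
move=> fP; elim: r => [|i r IH].
  by apply: polyf_ext (polyfC 1) => A; rewrite big_nil.
case Pi: (P i); last first.
  by apply: polyf_ext IH => A; rewrite big_cons Pi.
by apply: polyf_ext (polyfM (fP i Pi) IH) => A; rewrite big_cons Pi.
Qed.

Lemma polyfX f k : polyf f -> polyf (fun A => f A ^+ k).
Proof.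
move=> fp; elim: k => [|k IH]; first by apply: polyf_ext (polyfC 1) => A; rewrite expr0.
by apply: polyf_ext (polyfM fp IH) => A; rewrite exprS.
Qed.

End Fixed.

Lemma polyf_comp m n (f : 'M[F]_n -> F) (h : 'M[F]_m -> 'M[F]_n) :
  polyf f -> polymap h -> polyf (fun A => f (h A)).
Proof.
move=> [p fp] hp.
apply: (@polyf_ext _ (fun A => mxeval p (h A))); first by move=> A; rewrite fp.
apply: (@polyf_ext _ (fun A => \sum_(u <- msupp p)
   p@_u * \prod_i (mxvec (h A) 0 i) ^+ u i)).
  by move=> A; rewrite /mxeval mevalE.
apply: polyf_sum => u _; apply: polyfZ; apply: polyf_prod => k _; apply: polyfX.
case/mxvec_indexP: k => i j.
by apply: polyf_ext (hp i j) => A; rewrite mxvecE.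
Qed.

Section Maps.
Variables m n : nat.
Implicit Types (h k : 'M[F]_m -> 'M[F]_n).

Lemma polymapC B : polymap (fun _ : 'M[F]_m => B : 'M[F]_n).
Proof. by move=> i j; apply: polyfC. Qed.

Lemma polymap_id : polymap (fun A : 'M[F]_m => A).
Proof. by move=> i j; apply: polyf_entry. Qed.

Lemma polymapD h k : polymap h -> polymap k -> polymap (fun A => h A + k A).
Proof.
by move=> hp kp i j; apply: polyf_ext (polyfD (hp i j) (kp i j)) => A; rewrite mxE.
Qed.

Lemma polymapB h k : polymap h -> polymap k -> polymap (fun A => h A - k A).
Proof.
by move=> hp kp i j; apply: polyf_ext (polyfB (hp i j) (kp i j)) => A; rewrite !mxE.
Qed.

Lemma polymapM h k : polymap h -> polymap k -> polymap (fun A => h A *m k A).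
Proof.
move=> hp kp i j; apply: (@polyf_ext _ (fun A => \sum_l h A i l * k A l j)).
  by move=> A; rewrite mxE.
by apply: polyf_sum => l _; apply: polyfM.
Qed.

Lemma polyf_det h : polymap h -> polyf (fun A => \det (h A)).
Proof.
move=> hp; apply: polyf_sum => s _; apply: polyfZ; apply: polyf_prod => i _.
exact: hp.
Qed.

Lemma polyf_tr h : polymap h -> polyf (fun A => \tr (h A)).
Proof. by move=> hp; apply: polyf_sum => i _; apply: hp. Qed.

End Maps.

Lemma polymap_adj m n (h : 'M[F]_m -> 'M[F]_n) :
  polymap h -> polymap (fun A => \adj (h A)).
Proof.
move=> hp i j; apply: (@polyf_ext _ (fun A => cofactor (h A) j i)).
  by move=> A; rewrite mxE.
apply: polyfZ; apply: polyf_det => k l.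
by apply: polyf_ext (hp (lift j k) (lift i l)) => A; rewrite !mxE.
Qed.

Lemma polymapX m n (h : 'M[F]_m -> 'M[F]_n) k :
  polymap h -> polymap (fun A => h A ^+ k).
Proof.
move=> hp; elim: k => [|k IH]; first exact: polymapC.
move=> i j; apply: polyf_ext (polymapM hp IH i j) => A; by rewrite exprS.
Qed.

Section Closure.
Variable n : nat.
Implicit Types (S Z H : set 'M[F]_n) (A B g : 'M[F]_n).

Definition vanish S (f : 'M[F]_n -> F) := forall A, S A -> f A = 0.

Definition zcl S : set 'M[F]_n :=
  [set A | forall f, polyf f -> vanish S f -> f A = 0].

Lemma sub_zcl S : S `<=` zcl S.
Proof. by move=> A SA f _; apply. Qed.

Lemma zclS S Z : S `<=` Z -> zcl S `<=` zcl Z.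
Proof. by move=> SZ A SA f fp fZ; apply: SA => // B /SZ; apply: fZ. Qed.

Lemma zcl_id S : zcl (zcl S) `<=` zcl S.
Proof. by move=> A SA f fp fZ; apply: SA => // B; apply. Qed.

Lemma closed_zeros (I : set {mpoly F[n * n]}) : closed (zeros I : set (zmx F n)).
Proof. by rewrite -openC; exists I. Qed.

Lemma closed_zcl (Z : set (zmx F n)) : closed Z -> Z = zcl Z.
Proof.
move=> cZ; apply/seteqP; split; first exact: sub_zcl.
have [I ZI] : zopen (~` Z) by rewrite -openC in cZ.
move/(congr1 (@setC _)): ZI; rewrite !setCK => -> A ZA p Ip.
by apply: ZA; [apply: polyf_mxeval | move=> B; apply].
Qed.

Lemma zcl_closed S : closed (zcl S : set (zmx F n)).
Proof.
suff -> : zcl S = zeros [set p | vanish S (mxeval p)] by apply: closed_zeros.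
apply/seteqP; split=> A SA.
  by move=> p /= pS; apply: SA => //; apply: polyf_mxeval.
by move=> f [p fp] fS; rewrite fp; apply: SA => B SB; rewrite -fp fS.
Qed.

End Closure.

Lemma zcl_comp m n (h : 'M[F]_m -> 'M[F]_n) S Z A :
  polymap h -> (forall B, S B -> Z (h B)) -> zcl S A -> zcl Z (h A).
Proof.
move=> hp SZ SA f fp fZ; apply: (SA (fun B => f (h B))); first exact: polyf_comp.
by move=> B /SZ; apply: fZ.
Qed.

End PolyFun.

Arguments polyfC {F n}.
Arguments polyf_entry {F n}.
Arguments polymapC {F m n}.
Arguments polymap_id {F m}.

(** * Matrix groups: closures and generation *)

Section MxGroups.
Variables (F : fieldType) (n : nat).
Implicit Types (S Z H K M : set 'M[F]_n) (A B g : 'M[F]_n).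

Section Basic.
Variable H : set 'M[F]_n.
Hypothesis gH : mxgroup H.

Lemma grpU g : H g -> g \in unitmx.
Proof. by have [h _ _ _] := gH; apply: h. Qed.
Lemma grp1 : H 1%:M.
Proof. by case: gH. Qed.
Lemma grpM a b : H a -> H b -> H (a *m b).
Proof. by case: gH => _ _ h _; apply: h. Qed.
Lemma grpV a : H a -> H (invmx a).
Proof. by case: gH => _ _ _ h; apply: h. Qed.
Lemma grpJ a b : H a -> H b -> H (a *m b *m invmx a).
Proof. by move=> Ha Hb; apply: grpM; [apply: grpM|apply: grpV]. Qed.
End Basic.

(** By Cramer's rule a monomial of degree [d] in the entries of the inverse becomes polynomial after
    multiplication by [\det A ^+ d]; further powers of the determinant give all terms the same
    denominator. *)
Lemma polyf_inv (f : 'M[F]_n -> F) : polyf f ->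
  exists2 g, polyf g & exists k, forall A, A \in unitmx -> g A = \det A ^+ k * f (invmx A).
Proof.
move=> [p fp]; elim/mpolyind: p f fp => [|c m p _ _ IH] f fp.
  exists (fun _ => 0); first exact: polyfC.
  by exists 0%N => A _; rewrite fp /mxeval meval0 mulr0.
have [g gp [k gk]] := IH (mxeval p) (fun _ => erefl).
pose mon A := c * \prod_i mxvec (\adj A) 0 i ^+ m i.
pose d := mdeg m.
exists (fun A => \det A ^+ d * g A + \det A ^+ k * mon A).
  apply: polyfD; apply: polyfM => //; try by apply: polyfX; apply: polyf_det; apply: polymap_id.
  apply: polyfZ; apply: polyf_prod => i _; apply: polyfX.
  case/mxvec_indexP: i => i j.
  by apply: polyf_ext (polymap_adj polymap_id i j) => A; rewrite mxvecE.
exists (k + d)%N => A uA.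
have dA : \det A != 0 by rewrite -unitfE -unitmxE.
rewrite fp /mxeval mevalD mevalZ mevalX gk // mulrDr addrC exprD.
congr (_ + _); last by rewrite mulrA [in RHS](mulrC (\det A ^+ k)).
rewrite -!mulrA; congr (_ * _); rewrite /mon mulrCA; congr (_ * _).
rewrite /d mdegE -prodrXr -big_split /=; apply: eq_bigr => i _.
rewrite -exprMn; congr (_ ^+ _); case/mxvec_indexP: i => i j.
by rewrite !mxvecE /invmx uA [in RHS]mxE mulrA divff ?mul1r.
Qed.

Lemma zcl_inv S Z A : (forall B, S B -> B \in unitmx) ->
  (forall B, S B -> Z (invmx B)) -> zcl S A -> A \in unitmx -> zcl Z (invmx A).
Proof.
move=> SU SZ SA uA f fp fZ.
have [g gp [k gk]] := polyf_inv fp.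
have dA : \det A != 0 by rewrite -unitfE -unitmxE.
have : g A = 0.
  by apply: SA => // B SB; rewrite gk ?SU // fZ ?mulr0 //; apply: SZ.
rewrite gk // => /eqP; rewrite mulf_eq0 expf_eq0 (negPf dA) andbF /=.
by move/eqP.
Qed.

Definition zclg S : set 'M[F]_n := zcl S `&` @GLset F n.

Lemma alg_groupP H : alg_group H <-> mxgroup H /\ zclg H `<=` H.
Proof.
split=> [[gH [Z cZ HZ]]|[gH cH]].
  split=> // A [HA uA]; rewrite HZ; split=> //.
  by rewrite (closed_zcl cZ); apply: zclS HA => B; rewrite HZ => -[].
split=> //; exists (zcl H); first exact: zcl_closed.
apply/seteqP; split=> [A HA|]; last exact: cH.
by split; [apply: sub_zcl|apply: grpU HA].
Qed.

Lemma alg_grp H : alg_group H -> mxgroup H.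
Proof. by case. Qed.

Lemma alg_zcl H A : alg_group H -> zcl H A -> A \in unitmx -> H A.
Proof. by move=> /alg_groupP[_ cH] HA uA; apply: cH. Qed.

Lemma zclg_sub S H : alg_group H -> S `<=` H -> zclg S `<=` H.
Proof. by move=> aH SH A [SA uA]; apply: alg_zcl => //; apply: zclS SA. Qed.

(** One factor is moved into the closure at a time: translations by a fixed matrix are polynomial
    maps, so they preserve closures. *)
Lemma zclg_group H : mxgroup H -> alg_group (zclg H).
Proof.
move=> gH; apply/alg_groupP; split; last first.
  move=> A [HA uA]; split=> //; apply: zcl_id; apply: zclS HA.
  by move=> B [].
split.
- by move=> A [].
- by split; [apply: sub_zcl; apply: grp1|apply: unitmx1].
- move=> a b [Ha ua] [Hb ub]; split; last by rewrite /GLset /= unitmx_mul ua.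
  apply: zcl_id; apply: (@zcl_comp _ _ _ (fun B => B *m b) H) => //.
    by apply: polymapM; [apply: polymap_id|apply: polymapC].
  move=> B HB; apply: (@zcl_comp _ _ _ (fun C => B *m C) H) => //.
    by apply: polymapM; [apply: polymapC|apply: polymap_id].
  by move=> C HC; apply: grpM.
- move=> a [Ha ua]; split; last by rewrite /GLset /= unitmx_inv.
  by apply: (zcl_inv _ _ Ha ua) => B HB; [apply: grpU HB|apply: grpV].
Qed.

Lemma gen_group S : S `<=` @GLset F n -> mxgroup (generated S).
Proof.
move=> SU; split.
- move=> A; apply => //; split=> //.
  + exact: unitmx1.
  + by move=> a b; rewrite /GLset /= unitmx_mul => -> ->.
  + by move=> a; rewrite /GLset /= unitmx_inv.
- by move=> H gH _; apply: grp1.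
- by move=> a b Sa Sb H gH SH; apply: grpM; [|apply: Sa|apply: Sb].
- by move=> a Sa H gH SH; apply: grpV; [|apply: Sa].
Qed.

Lemma sub_gen S : S `<=` generated S.
Proof. by move=> A SA H _; apply. Qed.

Lemma gen_min S H : mxgroup H -> S `<=` H -> generated S `<=` H.
Proof. by move=> gH SH A; apply. Qed.

Lemma invmxM (a b : 'M[F]_n) : a \in unitmx -> b \in unitmx ->
  invmx (a *m b) = invmx b *m invmx a.
Proof.
move=> ua ub; apply: (can_inj (mulKmx (_ : a *m b \in unitmx))).
  by rewrite unitmx_mul ua.
by rewrite mulmxV ?unitmx_mul ?ua // mulmxA -(mulmxA a) mulmxV // mulmx1 mulmxV.
Qed.

Lemma invmx_eq (a b : 'M[F]_n) : a *m b = 1%:M -> invmx a = b.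
Proof.
move=> ab; have ua : a \in unitmx by have [] := mulmx1_unit ab.
by rewrite -[LHS]mulmx1 -ab mulKmx.
Qed.

(** The invertible matrices such that right multiplication by them and by their inverses preserves
    [P] form a group; it contains [S], hence all of [generated S]. *)
Lemma gen_ind S (P : set 'M[F]_n) : S `<=` @GLset F n -> P 1%:M ->
  (forall a s, P a -> S s -> P (a *m s) /\ P (a *m invmx s)) ->
  generated S `<=` P.
Proof.
move=> SU P1 PS A SA.
pose Q := [set g : 'M[F]_n | g \in unitmx /\
   (forall a, P a -> P (a *m g) /\ P (a *m invmx g))].
have [] : Q A.
  apply: SA; last by move=> s Ss; split; [apply: SU|move=> a Pa; apply: PS].
  split.
  - by move=> g [].
  - by split; [apply: unitmx1|move=> a Pa; rewrite invmx1 !mulmx1].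
  - move=> a b [ua Pa] [ub Pb]; split; first by rewrite unitmx_mul ua.
    move=> c Pc; split; first by rewrite mulmxA; apply: (Pb _ (Pa _ Pc).1).1.
    rewrite invmxM //.
    by rewrite mulmxA; apply: (Pa _ (Pb _ Pc).2).2.
  - move=> a [ua Pa]; split; first by rewrite unitmx_inv.
    by move=> c Pc; rewrite invmxK; have [] := Pa _ Pc.
by move=> _ /(_ _ P1)[]; rewrite mul1mx.
Qed.

End MxGroups.

(** * Rational curves, irreducibility and connectedness *)

Section Curves.
Variable F : numClosedFieldType.

Lemma poly_inf (p : {poly F}) : (forall c, p.[c] = 0) -> p = 0.
Proof.
move=> p0; apply/eqP; apply: contraT => pN0.
pose rs := [seq i%:R | i <- iota 0 (size p)] : seq F.
have := @max_poly_roots _ p rs pN0; rewrite size_map size_iota ltnn => -> //.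
  by apply/allP => x _; rewrite rootE p0.
by rewrite map_inj_uniq ?iota_uniq // => i j /eqP; rewrite eqr_nat => /eqP.
Qed.

Lemma poly_inf_ne (d p : {poly F}) :
  d != 0 -> (forall c, d.[c] != 0 -> p.[c] = 0) -> p = 0.
Proof.
move=> dN0 p0; have : p * d = 0.
  apply: poly_inf => c; rewrite hornerM.
  by have [->|/p0 ->] := eqVneq d.[c] 0; rewrite ?mulr0 ?mul0r.
by move/eqP; rewrite mulf_eq0 (negPf dN0) orbF => /eqP.
Qed.

Lemma poly_infN (p : {poly F}) : (forall i : nat, p.[i%:R] = 0) -> p = 0.
Proof.
move=> p0; apply/eqP; apply: contraT => pN0.
pose rs := [seq i%:R | i <- iota 0 (size p)] : seq F.
have := @max_poly_roots _ p rs pN0; rewrite size_map size_iota ltnn => -> //.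
  by apply/allP => x /mapP[i _ ->]; rewrite rootE p0.
by rewrite map_inj_uniq ?iota_uniq // => i j /eqP; rewrite eqr_nat => /eqP.
Qed.

(* [v] is the derivative of [q / d ^+ k] at [c]. *)
Definition rfun_der (d : {poly F}) (u : F -> F) (c v : F) :=
  exists (q : {poly F}) (k : nat),
    (forall x, d.[x] != 0 -> u x = q.[x] / d.[x] ^+ k) /\
    v = (q^`().[c] * d.[c] - k%:R * q.[c] * d^`().[c]) / d.[c] ^+ k.+1.

(** The coordinate ring of the affine line minus the zeros of [d]. Allowing a denominator covers
    curves in tori as well as unipotent ones. *)
Definition rfun (d : {poly F}) (u : F -> F) :=
  exists (q : {poly F}) (k : nat), forall x, d.[x] != 0 -> u x = q.[x] / d.[x] ^+ k.

Section RFun.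
Variable d : {poly F}.
Implicit Types (u v : F -> F).

Lemma rfunP u c : rfun d u <-> exists a, rfun_der d u c a.
Proof.
split=> [[q [k h]]|[a [q [k [h _]]]]]; last by exists q, k.
by eexists; exists q, k; split.
Qed.

Lemma rfun_der_ext u v c a : (forall x, d.[x] != 0 -> u x = v x) ->
  rfun_der d u c a -> rfun_der d v c a.
Proof.
by move=> uv [q [k [uE ->]]]; exists q, k; split=> // x dx; rewrite -uv // uE.
Qed.

Lemma rfun_ext u v : (forall x, d.[x] != 0 -> u x = v x) -> rfun d u -> rfun d v.
Proof. by move=> uv [q [k uE]]; exists q, k => x dx; rewrite -uv // uE. Qed.

Lemma rfun_der_poly (q : {poly F}) c : d.[c] != 0 ->
  rfun_der d (fun x => q.[x]) c q^`().[c].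
Proof.
move=> dc; exists q, 0%N; split=> [x dx|]; first by rewrite expr0 divr1.
by rewrite !mul0r subr0 expr1 mulfK.
Qed.

Lemma rfun_derC a c : d.[c] != 0 -> rfun_der d (fun _ => a) c 0.
Proof.
move=> dc; have := rfun_der_poly a%:P dc; rewrite derivC horner0.
by apply: rfun_der_ext => x _; rewrite hornerC.
Qed.

Lemma rfun_derD u v c a b : d.[c] != 0 -> rfun_der d u c a -> rfun_der d v c b ->
  rfun_der d (fun x => u x + v x) c (a + b).
Proof.
move=> dc [q [k [uE ->]]] [r [l [vE ->]]].
exists (q * d ^+ l + r * d ^+ k), (k + l)%N; split=> [x dx|].
  rewrite uE // vE // hornerD !hornerM !horner_exp exprD.
  by field; rewrite !expf_neq0.
have dX m : (d ^+ m)^`().[c] * d.[c] = m%:R * d.[c] ^+ m * d^`().[c].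
  case: m => [|m]; first by rewrite expr0 -[1]/(1%:P) derivC horner0 !mul0r.
  by rewrite deriv_exp hornerMn !(hornerM,horner_exp) /= exprS; ring.
rewrite derivD !derivM !(hornerD,hornerM) !horner_exp.
rewrite !mulrDl -![_ * (_ ^+ _)^`().[c] * d.[c]]mulrA !dX natrD !exprS exprD.
by field; rewrite !expf_neq0.
Qed.

Lemma rfun_derM u v c a b : d.[c] != 0 -> rfun_der d u c a -> rfun_der d v c b ->
  rfun_der d (fun x => u x * v x) c (a * v c + u c * b).
Proof.
move=> dc [q [k [uE ->]]] [r [l [vE ->]]].
exists (q * r), (k + l)%N; split=> [x dx|].
  by rewrite uE // vE // !hornerM exprD; field; rewrite !expf_neq0.
rewrite derivM !(hornerD,hornerM) natrD !exprS exprD uE // vE //.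
by field; rewrite !expf_neq0.
Qed.

Lemma rfun_der_uniq u c a : d != 0 -> d.[c] != 0 -> (forall x, d.[x] != 0 -> u x = 0) ->
  rfun_der d u c a -> a = 0.
Proof.
move=> dN0 dc u0 [q [k [uE ->]]].
suff -> : q = 0 by rewrite deriv0 !horner0 mulr0 !mul0r subrr mul0r.
apply: (poly_inf_ne dN0) => x dx; move: (uE x dx); rewrite u0 // => /esym/eqP.
by rewrite mulf_eq0 invr_eq0 expf_eq0 (negPf dx) andbF orbF => /eqP.
Qed.

Lemma rfun_poly (q : {poly F}) : rfun d (fun x => q.[x]).
Proof. by exists q, 0%N => x _; rewrite expr0 divr1. Qed.

Lemma rfunC a : rfun d (fun _ => a).
Proof. by apply: rfun_ext (rfun_poly a%:P) => x _; rewrite hornerC. Qed.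

Lemma rfunD u v : rfun d u -> rfun d v -> rfun d (fun x => u x + v x).
Proof.
move=> [q [k uE]] [r [l vE]]; exists (q * d ^+ l + r * d ^+ k), (k + l)%N => x dx.
rewrite uE // vE // hornerD !hornerM !horner_exp exprD.
by field; rewrite !expf_neq0.
Qed.

Lemma rfunM u v : rfun d u -> rfun d v -> rfun d (fun x => u x * v x).
Proof.
move=> [q [k uE]] [r [l vE]]; exists (q * r), (k + l)%N => x dx.
by rewrite uE // vE // hornerM exprD; field; rewrite !expf_neq0.
Qed.

Lemma rfun_sum (I : Type) (r : seq I) (P : pred I) (u : I -> F -> F) :
  (forall i, P i -> rfun d (u i)) -> rfun d (fun x => \sum_(i <- r | P i) u i x).
Proof.
move=> uP; elim: r => [|i r IH].
  by apply: rfun_ext (rfunC 0) => x _; rewrite big_nil.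
case Pi: (P i); last by apply: rfun_ext IH => x _; rewrite big_cons Pi.
by apply: rfun_ext (rfunD (uP i Pi) IH) => x _; rewrite big_cons Pi.
Qed.

Lemma rfun_prod (I : Type) (r : seq I) (P : pred I) (u : I -> F -> F) :
  (forall i, P i -> rfun d (u i)) -> rfun d (fun x => \prod_(i <- r | P i) u i x).
Proof.
move=> uP; elim: r => [|i r IH].
  by apply: rfun_ext (rfunC 1) => x _; rewrite big_nil.
case Pi: (P i); last by apply: rfun_ext IH => x _; rewrite big_cons Pi.
by apply: rfun_ext (rfunM (uP i Pi) IH) => x _; rewrite big_cons Pi.
Qed.

Lemma rfunX u k : rfun d u -> rfun d (fun x => u x ^+ k).
Proof.
move=> ru; elim: k => [|k IH]; first by apply: rfun_ext (rfunC 1).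
by apply: rfun_ext (rfunM ru IH) => x _; rewrite exprS.
Qed.

Definition rcurve m n (h : F -> 'M[F]_(m, n)) := forall i j, rfun d (fun x => h x i j).

Lemma rcurveC m n (A : 'M[F]_(m, n)) : rcurve (fun _ => A).
Proof. by move=> i j; apply: rfunC. Qed.

Lemma rcurveM m n p (h : F -> 'M[F]_(m, n)) (k : F -> 'M[F]_(n, p)) :
  rcurve h -> rcurve k -> rcurve (fun x => h x *m k x).
Proof.
move=> hr kr i j; apply: (@rfun_ext (fun x => \sum_l h x i l * k x l j)).
  by move=> x _; rewrite mxE.
by apply: rfun_sum => l _; apply: rfunM.
Qed.

Lemma rcurveD m n (h k : F -> 'M[F]_(m, n)) :
  rcurve h -> rcurve k -> rcurve (fun x => h x + k x).
Proof.
move=> hr kr i j; apply: rfun_ext (rfunD (hr i j) (kr i j)) => x _.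
by rewrite mxE.
Qed.

Lemma rcurveZ m n u (h : F -> 'M[F]_(m, n)) :
  rfun d u -> rcurve h -> rcurve (fun x => u x *: h x).
Proof.
by move=> ur hr i j; apply: rfun_ext (rfunM ur (hr i j)) => x _; rewrite mxE.
Qed.

Lemma rfun_polyf n (f : 'M[F]_n -> F) h : polyf f -> rcurve h -> rfun d (fun x => f (h x)).
Proof.
move=> [p fp] hr; apply: (@rfun_ext (fun x => \sum_(u <- msupp p)
   p@_u * \prod_i (mxvec (h x) 0 i) ^+ u i)).
  by move=> x _; rewrite fp /mxeval mevalE.
apply: rfun_sum => u _; apply: rfunM; first exact: rfunC.
apply: rfun_prod => k _; apply: rfunX; case/mxvec_indexP: k => i j.
by apply: rfun_ext (hr i j) => x _; rewrite mxvecE.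
Qed.

Lemma rfun_prod0 u v : d != 0 -> rfun d u -> rfun d v ->
  (forall x, d.[x] != 0 -> u x * v x = 0) ->
  (forall x, d.[x] != 0 -> u x = 0) \/ (forall x, d.[x] != 0 -> v x = 0).
Proof.
move=> dN0 [q [k uE]] [r [l vE]] uv.
have : q * r = 0.
  apply: (poly_inf_ne dN0) => x dx; move: (uv x dx); rewrite uE // vE //.
  move/eqP; rewrite mulrACA mulf_eq0 -invfM invr_eq0 -exprD expf_eq0 (negPf dx) andbF orbF.
  by rewrite hornerM => /eqP.
move/eqP; rewrite mulf_eq0 => /orP[] /eqP z; [left|right] => x dx.
  by rewrite uE // z horner0 mul0r.
by rewrite vE // z horner0 mul0r.
Qed.

End RFun.

Section Irr.
Variable n : nat.
Implicit Types (S Z H I : set 'M[F]_n).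

(** The vanishing ideal of [S] is prime. This expresses irreducibility without asking [S] to be
    closed, and it passes to images under polynomial maps at once. *)
Definition zirr S := S !=set0 /\ forall f g, polyf f -> polyf g ->
  vanish S (fun A => f A * g A) -> vanish S f \/ vanish S g.

(** If a product vanishes on a rational curve, one factor does. A point where [f] is nonzero is
    joined inside [S] to every other point, so [g] vanishes throughout. *)
Lemma zirr_curves S : S !=set0 ->
  (forall A B, S A -> S B -> exists d h a b, [/\ d != 0, rcurve d h,
     d.[a] != 0 /\ h a = A, d.[b] != 0 /\ h b = B & forall c, d.[c] != 0 -> S (h c)]) ->
  zirr S.
Proof.
move=> S0 SC; split=> // f g fp gp fg.
have [|/existsNP[A /not_implyP[SA fA]]] := pselect (vanish S f); [by left|].
right=> B SB; have [d [h [a [b [dN0 hr [da hA] [db hB] hS]]]]] := SC _ _ SA SB.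
case: (@rfun_prod0 d _ _ dN0 (rfun_polyf fp hr) (rfun_polyf gp hr)).
- by move=> x dx; apply: fg; apply: hS.
- by move=> /(_ a da); rewrite hA.
- by move=> /(_ b db); rewrite hB.
Qed.

(** The conclusion spells out [zirr] because the image consists of matrices of size [m], while
    [zirr] is bound to the size [n] of the section. *)
Lemma zirr_im m (h : 'M[F]_n -> 'M[F]_m) S : polymap h -> zirr S ->
  (fun T => T !=set0 /\ forall f g, polyf f -> polyf g ->
  vanish T (fun A => f A * g A) -> vanish T f \/ vanish T g) (h @` S).
Proof.
move=> hp [[A SA] Si]; split; first by exists (h A); exists A.
move=> f g fp gp fg.
case: (Si (fun A => f (h A)) (fun A => g (h A))); try exact: polyf_comp.
- by move=> B SB; apply: fg; exists B.
- by move=> h0; left=> _ [B SB <-]; apply: h0.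
- by move=> h0; right=> _ [B SB <-]; apply: h0.
Qed.

Lemma zirr_mull a S : zirr S -> zirr [set a *m s | s in S].
Proof.
by apply: zirr_im; apply: polymapM; [apply: polymapC|apply: polymap_id].
Qed.

Lemma zirr_sub2 S (C D : set (zmx F n)) : zirr S -> closed C -> closed D ->
  S `<=` C `|` D -> S `<=` C \/ S `<=` D.
Proof.
move=> [_ Si] cC cD SCD; apply: contrapT => /not_orP[].
move=> /existsNP[A /not_implyP[SA]]; rewrite (closed_zcl cC) => /existsNP[f /not_implyP[fp]].
move=> /not_implyP[fC fA].
move=> /existsNP[B /not_implyP[SB]]; rewrite (closed_zcl cD) => /existsNP[g /not_implyP[gp]].
move=> /not_implyP[gD gB].
case: (Si f g fp gp) => [E SE|h|h].
- by have [CE|DE] := SCD _ SE; [rewrite (fC E CE) mul0r|rewrite (gD E DE) mulr0].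
- by apply: fA; apply: h.
- by apply: gB; apply: h.
Qed.

(** Both the piece and its complement carry a closed witness, since closed sets are the ones given
    directly by polynomials. *)
Definition clopen_in S (B : set 'M[F]_n) := [/\ B `<=` S,
  exists2 C : set (zmx F n), closed C & B = S `&` C &
  exists2 C : set (zmx F n), closed C & S `\` B = S `&` C].

Lemma clopen_inP S B : clopen_in S B <->
  (exists2 C : set (zmx F n), open C & B = S `&` C) /\
  (exists2 C : set (zmx F n), closed C & B = S `&` C).
Proof.
split=> [[BS cB [C cC SB]]|[[C oC BC] [D cD BD]]].
  split=> //; exists (~` C); first by rewrite openC.
  apply/seteqP; split=> A.
    move=> BA; split; first exact: BS.
    move=> CA; have : (S `\` B) A by rewrite SB; split=> //; apply: BS.
    by case.
  move=> [SA CA]; apply: contrapT => BA; apply: CA.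
  by have : (S `\` B) A by []; rewrite SB => -[].
split.
- by rewrite BC => A [].
- by exists D.
- exists (~` C); first by rewrite closedC.
  by rewrite BC; apply/seteqP; split=> A [SA h]; split=> // CA; apply: h => //; case: CA.
Qed.

Lemma clopen_irr S B I a : clopen_in S B -> zirr I -> I `<=` S -> I a -> B a -> I `<=` B.
Proof.
move=> [BS [C cC BC] [D cD BD]] iI IS Ia Ba.
case: (zirr_sub2 iI cC cD).
- move=> A IA; have [BA|BA] := pselect (B A); first by left; move: BA; rewrite BC => -[].
  right; have : (S `\` B) A by split=> //; apply: IS.
  by rewrite BD => -[].
- by move=> IC A IA; rewrite BC; split; [apply: IS|apply: IC].
- move=> ID; have : (S `\` B) a by rewrite BD; split; [apply: IS|apply: ID].
  by case.
Qed.

Lemma zconnected_base S a : S a ->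
  (forall B, clopen_in S B -> B a -> S `<=` B) -> zconnected S.
Proof.
move=> Sa h B [b Bb] oB cB.
have cl : clopen_in S B by apply/clopen_inP.
have BS : B `<=` S by case: cl.
apply/seteqP; split=> //.
have [Ba|Ba] := pselect (B a); first exact: h.
have cl' : clopen_in S (S `\` B).
  case: cl => _ c1 c2; split=> //.
  case: c1 => C cC BC; exists C => //; rewrite -BC.
  by rewrite setDD; apply/seteqP; split=> [x []|x Bx] //; split=> //; apply: BS.
by have /(_ b (BS b Bb))[] := h _ cl' (conj Sa Ba).
Qed.

Lemma zconnected_clopen S B a : zconnected S -> clopen_in S B -> B a -> B = S.
Proof. by move=> cS /clopen_inP[oB cB] Ba; apply: cS => //; exists a. Qed.

(** Words grow by one generator at a time: the translate by [a] of an irreducible set through 1 and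
    [s] cannot leave a clopen piece containing [a]. *)
Lemma zconnected_gen S : S `<=` @GLset F n -> (forall s, S s -> S (invmx s)) ->
  (forall s, S s -> exists I, [/\ zirr I, I `<=` S, I 1%:M & I s]) ->
  zconnected (generated S).
Proof.
move=> SU SV SI; have gS := gen_group SU.
apply: (zconnected_base (grp1 gS)) => B cB B1.
have BS : B `<=` generated S by case: cB.
apply: gen_ind => // a s Ba Ss.
have stp t : S t -> B (a *m t).
  move=> St; have [I [iI IS I1 It]] := SI t St.
  apply: (clopen_irr cB (zirr_mull a iI) _ _ Ba).
  - by move=> _ [i Ii <-]; apply: (grpM gS); [apply: BS|apply: sub_gen; apply: IS].
  - by exists 1%:M => //; rewrite mulmx1.
  - by exists t.
by split; apply: stp => //; apply: SV.
Qed.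

Lemma zconnected_zcl S Z : zconnected S -> S `<=` Z -> Z `<=` zcl S -> S !=set0 -> zconnected Z.
Proof.
move=> cS SZ ZS [a Sa]; apply: (zconnected_base (SZ a Sa)) => B [BZ [C cC BC] [D cD BD]] Ba.
have SB : S `<=` B.
  have <- : S `&` B = S.
    apply: (@zconnected_clopen _ _ a cS _ (conj Sa Ba)); split.
    - by move=> ? [].
    - by exists C => //; rewrite BC setIA (setIidl SZ).
    - exists D => //; have -> : S `\` (S `&` B) = S `&` (Z `\` B).
        apply/seteqP; split=> x [Sx h]; split=> //.
          by split; [apply: SZ|move=> Bx; apply: h].
        by move=> [_ Bx]; case: h.
      by rewrite BD setIA (setIidl SZ).
  by move=> ? [].
move=> A ZA; rewrite BC; split=> //; rewrite (closed_zcl cC).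
by apply: zclS (ZS A ZA) => x /SB; rewrite BC => -[].
Qed.

(** The fibre over [f a] is closed, and so is its complement, being the union of the finitely many
    other fibres. *)
Lemma zconnected_const (T : eqType) (vals : seq T) S (f : 'M[F]_n -> T) a :
  zconnected S -> S a -> (forall A, S A -> f A \in vals) ->
  (forall v, exists2 C : set (zmx F n), closed C & forall A, S A -> f A = v <-> C A) ->
  forall A, S A -> f A = f a.
Proof.
move=> cS Sa fv fC A SA.
suff eS : [set B | S B /\ f B = f a] = S by move: SA; rewrite -{1}eS => -[].
apply: (@zconnected_clopen _ _ a cS) => //; split.
- by move=> B [].
- have [C cC hC] := fC (f a); exists C => //.
  by apply/seteqP; split=> B [SB h]; split=> //; apply/(hC B SB).
- have /choice[Cv hC] : forall v, exists C : set (zmx F n),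
      closed C /\ forall A, S A -> f A = v <-> C A.
    by move=> v; have [C cC hC] := fC v; exists C.
  pose U (s : seq T) := [set B : zmx F n | exists2 v, v \in s & Cv v B].
  exists (U [seq v <- vals | v != f a]).
    elim: [seq _ <- _ | _] => [|v s IH].
      have -> : U [::] = set0 by apply/seteqP; split=> // B [].
      exact: closed0.
    have -> : U (v :: s) = Cv v `|` U s.
      apply/seteqP; split=> B.
        by case=> u; rewrite inE => /orP[/eqP->|us] h; [left|right; exists u].
      by case=> [h|[u us h]]; [exists v; rewrite ?inE ?eqxx|exists u; rewrite ?inE ?us ?orbT].
    by apply: closedU => //; have [] := hC v.
  apply/seteqP; split=> B [SB h]; split=> //.
    exists (f B); last by apply/((hC (f B)).2 B SB).
    by rewrite mem_filter fv // andbT; apply/eqP => e; apply: h.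
  move=> [_ fB]; case: h => v; rewrite mem_filter => /andP[/eqP vN _].
  by move/((hC v).2 B SB); rewrite fB => /esym.
Qed.

End Irr.
End Curves.

(** * Exponentials of nilpotent matrices *)

Section Exp.
Variables (F : numClosedFieldType) (n' : nat).
Local Notation n := n'.+1.
Implicit Types (X Y Z A g : 'M[F]_n).

Definition mnilp X := X ^+ n = 0.

(** The minimal polynomial divides a power of the indeterminate, so it is one itself, and its degree
    is at most [n] by Cayley-Hamilton. Hence [mnilp] may fix the exponent to [n]. *)
Lemma mnilpP X m : X ^+ m = 0 -> mnilp X.
Proof.
move=> Xm; have : mxminpoly X %| ('X - 0%:P) ^+ m.
  by apply: mxminpoly_min; rewrite subr0 rmorphXn /= horner_mx_X.
case/dvdp_exp_XsubCP => k _; rewrite subr0 => eX.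
have kn : (k <= n)%N.
  have := dvdp_leq (monic_neq0 (char_poly_monic X)) (mxminpoly_dvd_char X).
  by rewrite (eqp_size eX) size_polyXn size_char_poly ltnS.
have : mxminpoly X %| 'X^n by rewrite (eqp_dvdl _ eX) dvdp_exp2l.
by move/mxminpoly_minP; rewrite rmorphXn /= horner_mx_X.
Qed.

Lemma nilp_ge X k : mnilp X -> (n <= k)%N -> X ^+ k = 0.
Proof. by move=> nX /subnKC <-; rewrite exprD nX mul0r. Qed.

Lemma nilp0 : mnilp 0.
Proof. by rewrite /mnilp expr0n. Qed.

Lemma nilpZ c X : mnilp X -> mnilp (c *: X).
Proof. by rewrite /mnilp exprZn => ->; rewrite scaler0. Qed.

Lemma nilpMc X Y : GRing.comm X Y -> mnilp X -> mnilp (X * Y).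
Proof. by rewrite /mnilp => cXY nX; rewrite exprMn_comm // nX mul0r. Qed.

Lemma nilpDc X Y : GRing.comm X Y -> mnilp X -> mnilp Y -> mnilp (X + Y).
Proof.
move=> cXY nX nY; apply: (@mnilpP _ (n + n)); rewrite exprDn_comm // big1 // => i _.
have [ni|ni] := leqP n i; first by rewrite (nilp_ge nY ni) mulr0 mul0rn.
by rewrite (nilp_ge nX) ?mul0r ?mul0rn //; lia.
Qed.

Lemma nilpN X : mnilp X -> mnilp (- X).
Proof. by move=> nX; rewrite -scaleN1r; apply: nilpZ. Qed.

Lemma nilp_tr X : mnilp X -> \tr X = 0.
Proof.
move=> nX; have : mxminpoly X %| ('X - 0%:P) ^+ n.
  by apply: mxminpoly_min; rewrite subr0 rmorphXn /= horner_mx_X.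
case/dvdp_exp_XsubCP => k _; rewrite subr0 => eX.
have cX : char_poly X = 'X^n.
  have [rs rsE] := closed_field_poly_normal (char_poly X).
  rewrite (monicP (char_poly_monic X)) scale1r in rsE.
  have rs0 : all (pred1 0) rs.
    apply/allP => z zrs; apply/eqP.
    have : root (char_poly X) z by rewrite rsE root_prod_XsubC.
    rewrite -root_mxminpoly (eqp_root eX) rootE hornerXn.
    by rewrite expf_eq0 => /andP[_ /eqP].
  have -> : char_poly X = 'X^(size rs).
    rewrite rsE; elim: (rs) rs0 => [|z s IH]; first by rewrite big_nil.
    by rewrite big_cons /= exprS => /andP[/eqP -> /IH ->]; rewrite subr0.
  congr ('X^ _); have := size_char_poly X.
  by rewrite rsE size_prod_XsubC => -[].
have := @char_poly_trace _ _ X (ltn0Sn n'); rewrite cX coefXn /=.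
by rewrite ltn_eqF // => /eqP; rewrite eq_sym oppr_eq0 => /eqP.
Qed.

Lemma conj_exp g X k : g \in unitmx ->
  (g * X * invmx g) ^+ k = g * X ^+ k * invmx g.
Proof.
move=> ug; elim: k => [|k IH]; first by rewrite !expr0 mulr1 -mulmxE mulmxV.
rewrite !exprS IH -!mulmxE !mulmxA; congr (_ *m _ *m _).
by rewrite mulmxKV.
Qed.

Lemma nilp_conj g X : g \in unitmx -> mnilp X -> mnilp (g * X * invmx g).
Proof. by rewrite /mnilp => ug nX; rewrite conj_exp // nX mulr0 mul0r. Qed.

Definition mexp X : 'M[F]_n := \sum_(k < n) (k`!%:R)^-1 *: X ^+ k.

Lemma factN0 k : (k`!%:R : F) != 0.
Proof. by rewrite pnatr_eq0 -lt0n fact_gt0. Qed.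

Lemma mexp0 : mexp 0 = 1.
Proof.
rewrite /mexp big_ord_recl expr0 fact0 invr1 scale1r big1 ?addr0 // => i _.
by rewrite expr0n scaler0.
Qed.

(** Both sides are values at 1 of polynomials with matrix coefficients. Nilpotency hides the
    truncation, so the coefficients are those of the full series and the binomial theorem
    applies. *)
Lemma mexpD X Y : GRing.comm X Y -> mnilp X -> mnilp Y ->
  mexp (X + Y) = mexp X * mexp Y.
Proof.
move=> cXY nX nY; have nXY := nilpDc cXY nX nY.
pose E Z : {poly 'M[F]_n} := \poly_(k < n) ((k`!%:R)^-1 *: Z ^+ k).
have Ec Z k : mnilp Z -> (E Z)`_k = (k`!%:R)^-1 *: Z ^+ k.
  move=> nZ; rewrite coef_poly; case: ltnP => // nk.
  by rewrite (nilp_ge nZ nk) scaler0.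
have E1 Z : (E Z).[1] = mexp Z.
  by rewrite horner_poly; apply: eq_bigr => i _; rewrite expr1n mulr1.
rewrite -!E1 -hornerM_comm; last by apply: commr_sym; apply: commr1.
congr (_.[_]); apply/polyP => m; rewrite Ec // coefM.
rewrite exprDn_comm // scaler_sumr (reindex_inj rev_ord_inj) /=.
apply: eq_bigr => i _; have im : (i <= m)%N by rewrite -ltnS.
rewrite (Ec X) // (Ec Y) // subSS subKn // -scaler_nat.
rewrite -scalerAl -scalerAr !scalerA; congr (_ *: _).
rewrite -(bin_fact im) bin_sub // !natrM.
have bN : ('C(m, i)%:R : F) != 0 by rewrite pnatr_eq0 -lt0n bin_gt0.
by field; rewrite !factN0 bN.
Qed.

Lemma mexpN X : mnilp X -> mexp X * mexp (- X) = 1.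
Proof.
move=> nX; rewrite -mexpD ?subrr ?mexp0 //; last exact: nilpN.
by apply: commrN.
Qed.

Lemma mexp_unit X : mnilp X -> mexp X \in unitmx.
Proof. by move/mexpN/mulmx1_unit => []. Qed.

Lemma mexpV X : mnilp X -> invmx (mexp X) = mexp (- X).
Proof. by move=> nX; apply: invmx_eq; apply: mexpN. Qed.

Lemma mexp_conj g X : g \in unitmx -> mexp (g * X * invmx g) = g * mexp X * invmx g.
Proof.
move=> ug; rewrite /mexp mulr_sumr mulr_suml; apply: eq_bigr => i _.
by rewrite conj_exp // -scalerAr -scalerAl.
Qed.

Lemma mexpDZ X a b : mnilp X -> mexp ((a + b) *: X) = mexp (a *: X) * mexp (b *: X).
Proof.
move=> nX; rewrite scalerDl mexpD //; try exact: nilpZ.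
by rewrite /GRing.comm -!scalerAl -!scalerAr !scalerA mulrC.
Qed.

Lemma mexp_nat X k : mnilp X -> mexp (k%:R *: X) = mexp X ^+ k.
Proof.
move=> nX; elim: k => [|k IH]; first by rewrite scale0r mexp0 expr0.
by rewrite -natr1 mexpDZ // IH scale1r exprSr.
Qed.

Lemma mexpE X : exists2 S, GRing.comm X S & mexp X = 1 + X * S.
Proof.
exists (\sum_(k < n') (k.+1`!%:R)^-1 *: X ^+ k).
  by apply: commr_sum => i _; rewrite /GRing.comm -scalerAl -scalerAr -exprS -exprSr.
rewrite /mexp big_ord_recl expr0 fact0 invr1 scale1r; congr (_ + _).
by rewrite mulr_sumr; apply: eq_bigr => i _; rewrite -scalerAr -exprS.
Qed.

Lemma mexp_unip X : mnilp X -> (mexp X - 1%:M) ^+ n = 0.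
Proof.
have [S cS ->] := mexpE X => nX.
by rewrite addrC addKr; apply: nilpMc.
Qed.

Definition pmx_at (x : 'M[{poly F}]_n) c : 'M[F]_n := map_mx (fun p : {poly F} => p.[c]) x.

(** Differentiating the group law at 0 gives [x' = x C_1], hence [C_k = C_1^k / k!] for the
    coefficients. As [x] is polynomial, almost all of them vanish, which makes [C_1] nilpotent. *)
Lemma mexp_oneparam (x : 'M[{poly F}]_n) :
  (forall c d, pmx_at x (c + d) = pmx_at x c *m pmx_at x d) -> pmx_at x 0 = 1 ->
  exists2 X, mnilp X & forall c, pmx_at x c = mexp (c *: X).
Proof.
move=> xD x0; pose C k : 'M[F]_n := map_mx (fun p : {poly F} => p`_k) x.
have dx i j : (x i j)^`() = \sum_l C 1 l j *: x i l.
  apply/eqP; rewrite -subr_eq0; apply/eqP; apply: poly_inf => c.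
  rewrite hornerD hornerN horner_sum; apply/eqP; rewrite subr_eq0; apply/eqP.
  have : x i j \Po ('X + c%:P) = \sum_l (x i l).[c] *: x l j.
    apply/eqP; rewrite -subr_eq0; apply/eqP; apply: poly_inf => d.
    rewrite hornerD hornerN horner_comp horner_sum; apply/eqP; rewrite subr_eq0; apply/eqP.
    have /matrixP/(_ i j) := xD c d; rewrite !mxE => e.
    rewrite hornerD hornerX hornerC addrC e; apply: eq_bigr => l _.
    by rewrite !mxE hornerZ.
  move/(congr1 (fun p : {poly F} => p^`().[0])).
  rewrite deriv_comp derivD derivX derivC addr0 mulr1 horner_comp hornerD hornerX hornerC.
  rewrite add0r => ->; rewrite raddf_sum horner_sum; apply: eq_bigr => l _ /=.
  by rewrite derivZ !hornerZ !mxE horner_coef0 coef_deriv mulrC.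
have CS k : k.+1%:R *: C k.+1 = C k * C 1%N.
  apply/matrixP => i j; rewrite !mxE -[RHS]/(\sum_l _).
  have := congr1 (fun p : {poly F} => p`_k) (dx i j).
  rewrite /= coef_deriv mulr_natl => ->; rewrite coef_sum; apply: eq_bigr => l _.
  by rewrite coefZ !mxE mulrC.
have C0 : C 0%N = 1.
  by rewrite -x0; apply/matrixP => i j; rewrite !mxE horner_coef0.
have CE k : C k = (k`!%:R)^-1 *: C 1%N ^+ k.
  elim: k => [|k IH]; first by rewrite fact0 invr1 scale1r expr0.
  have kN : (k.+1%:R : F) != 0 by rewrite pnatr_eq0.
  apply: (scalerI kN); rewrite CS IH -scalerAl -exprSr scalerA; congr (_ *: _).
  by rewrite factS natrM invfM mulrA divff // mul1r.
pose K := \max_i \max_j size (x i j).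
have Kp i j : (size (x i j) <= K)%N.
  by apply: leq_trans (leq_bigmax i); apply: (leq_bigmax j).
have CK k : (K <= k)%N -> C k = 0.
  move=> Kk; apply/matrixP => i j; rewrite !mxE nth_default //.
  exact: leq_trans (Kp i j) Kk.
have nX : mnilp (C 1%N).
  apply: (@mnilpP _ K); apply: (scalerI (_ : (K`!%:R)^-1 != 0)).
    by rewrite invr_eq0 factN0.
  by rewrite -CE CK // scaler0.
exists (C 1%N) => // c; apply/matrixP => i j.
rewrite mxE (@horner_coef_wide _ (maxn K n)); last by rewrite leq_max Kp.
rewrite /mexp (big_ord_widen (maxn K n) (fun k => (k`!%:R)^-1 *: (c *: C 1%N) ^+ k)); last first.
  by rewrite leq_max leqnn orbT.
rewrite summxE [RHS]big_mkcond /=; apply: eq_bigr => k _.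
have -> : (x i j)`_k = C k i j by rewrite mxE.
have -> : (k`!%:R)^-1 *: (c *: C 1%N) ^+ k = c ^+ k *: C k.
  by rewrite exprZn scalerA mulrC -scalerA -CE.
case: ifP => [_|/negbT]; first by rewrite [RHS]mxE mulrC.
by rewrite -leqNgt => nk; rewrite CE (nilp_ge nX nk) scaler0 mxE mul0r.
Qed.

(** The logarithm comes from interpolation: with [u = 1 + N], the binomial expansion makes [u ^+ a]
    a polynomial in [a], which is a one-parameter group because it is one at natural numbers. *)
Lemma mexp_log u m : (u - 1%:M) ^+ m = 0 -> exists2 X, mnilp X & mexp X = u.
Proof.
move=> /mnilpP; set N := u - 1%:M => nN.
(* The binomial coefficient of the indeterminate over [k]. *)
pose b k : {poly F} := (k`!%:R)^-1 *: \prod_(i < k) ('X - i%:R%:P).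
have bE k a : (b k).[a%:R] = 'C(a, k)%:R.
  rewrite /b hornerZ horner_prod; under eq_bigr => i _ do rewrite hornerXsubC.
  apply: (mulfI (factN0 k)); rewrite mulrA divff ?factN0 // mul1r.
  rewrite -natrM mulnC bin_ffact.
  have [ka|ak] := leqP k a; last first.
    by rewrite ffact_small // (bigD1 (Ordinal ak)) //= subrr mul0r.
  elim: k ka => [|k IH] ka; first by rewrite big_ord0 ffactn0.
  rewrite big_ord_recr /= IH; last exact: ltnW.
  by rewrite ffactnSr natrM natrB // ltnW.
pose x : 'M[{poly F}]_n := \matrix_(i, j) \sum_(k < n) (N ^+ k) i j *: b k.
have xE a : pmx_at x a%:R = u ^+ a.
  have -> : u = N + 1 by rewrite /N subrK.
  apply/matrixP => i j; rewrite !mxE horner_sum exprDn_comm; last exact: commr1.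
  rewrite summxE (big_ord_widen (maxn n a.+1) (fun k => ((N ^+ k) i j *: b k).[a%:R])); last first.
    by rewrite leq_max leqnn.
  rewrite (reindex_inj rev_ord_inj) /= [RHS](_ : _ = \sum_(k < a.+1) (N ^+ k) i j *+ 'C(a, k)); last first.
    rewrite (reindex_inj rev_ord_inj) /=; apply: eq_bigr => k _.
    have ka : (k <= a)%N by rewrite -ltnS.
    by rewrite subSS subKn // expr1n mulr1 -scaler_nat mxE mulr_natl bin_sub.
  rewrite [RHS](big_ord_widen (maxn n a.+1) (fun k => (N ^+ k) i j *+ 'C(a, k))); last first.
    by rewrite leq_max leqnn orbT.
  rewrite [RHS](reindex_inj rev_ord_inj) /= [LHS]big_mkcond [RHS]big_mkcond /=.
  apply: eq_bigr => k _; set l := (_ - _)%N; rewrite hornerZ bE mulr_natr.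
  case: ltnP => ln; case: ltnP => la //; first by rewrite bin_small.
  by rewrite (nilp_ge nN ln) mxE mul0rn.
(* Additivity is extended from the natural numbers to the field in one argument after the other. *)
clearbody x; have xD c d : pmx_at x (c + d) = pmx_at x c *m pmx_at x d.
  pose e i j d : {poly F} := (x i j) \Po ('X + d%:P) - \sum_l (x l j).[d] *: x i l.
  have eE i j a b0 : (e i j a).[b0] = pmx_at x (b0 + a) i j - (pmx_at x b0 *m pmx_at x a) i j.
    rewrite hornerD hornerN horner_comp hornerD hornerX hornerC !mxE horner_sum.
    by congr (_ - _); apply: eq_bigr => l _; rewrite hornerZ !mxE mulrC.
  have e0 i j (a : nat) : e i j a%:R = 0.
    apply: poly_infN => k; rewrite eE -natrD !xE exprD -mulmxE subrr //.
  pose e' i j c : {poly F} := (x i j) \Po ('X + c%:P) - \sum_l (x i l).[c] *: x l j.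
  have e'E i j a b0 : (e' i j a).[b0] = pmx_at x (a + b0) i j - (pmx_at x a *m pmx_at x b0) i j.
    rewrite hornerD hornerN horner_comp hornerD hornerX hornerC !mxE horner_sum.
    by rewrite [b0 + a]addrC; congr (_ - _); apply: eq_bigr => l _; rewrite hornerZ !mxE.
  apply/matrixP => i j; apply/eqP; rewrite -subr_eq0 -e'E; apply/eqP.
  suff -> : e' i j c = 0 by rewrite horner0.
  by apply: poly_infN => k; rewrite e'E -eE e0 horner0.
have [|X nX XE] := mexp_oneparam xD.
  by rewrite -[0]/(0%:R) xE expr0.
exists X => //; have := XE 1; rewrite scale1r => <-.
by rewrite -[1]/(1%:R) xE expr1.
Qed.

Lemma rcurve_mexp d X (u : F -> F) : rfun d u -> rcurve d (fun c => mexp (u c *: X)).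
Proof.
move=> ru i j; apply: (@rfun_ext _ _ (fun c => \sum_(k < n) (k`!%:R)^-1 * u c ^+ k * (X ^+ k) i j)).
  move=> c _; rewrite /mexp summxE; apply: eq_bigr => k _.
  by rewrite exprZn !mxE mulrA.
apply: rfun_sum => k _; apply: rfunM; last exact: rfunC.
by apply: rfunM; [apply: rfunC|apply: rfunX].
Qed.

Lemma rcurve_mexp_line d X Y : rcurve d (fun c => mexp (X + c *: (Y - X))).
Proof.
have rp k : rcurve d (fun c => (X + c *: (Y - X)) ^+ k).
  elim: k => [|k IH]; first exact: rcurveC.
  move=> i j; apply: (@rfun_ext _ _ (fun c => ((X + c *: (Y - X)) *m (X + c *: (Y - X)) ^+ k) i j)).
    by move=> c _; rewrite exprS.
  apply: rcurveM => //; apply: rcurveD; first exact: rcurveC.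
  apply: rcurveZ; last exact: rcurveC.
  by apply: rfun_ext (rfun_poly d 'X) => c _; rewrite hornerX.
move=> i j; apply: (@rfun_ext _ _ (fun c => \sum_(k < n) (k`!%:R)^-1 * ((X + c *: (Y - X)) ^+ k) i j)).
  by move=> c _; rewrite /mexp summxE; apply: eq_bigr => k _; rewrite mxE.
by apply: rfun_sum => k _; apply: rfunM; [apply: rfunC|apply: rp].
Qed.

End Exp.

(** * Tangent spaces of matrix groups *)

Lemma mpoly_ring_ind m (R : nzRingType) (P : {mpoly R[m]} -> Prop) :
  (forall c, P c%:MP) -> (forall i, P 'X_i) ->
  (forall p q, P p -> P q -> P (p + q)) -> (forall p q, P p -> P q -> P (p * q)) ->
  forall p, P p.
Proof.
move=> PC PX PD PM; apply: mpolyind => [|c u p _ _ Pp]; first by rewrite -mpolyC0.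
apply: (PD) => //; rewrite -mul_mpolyC; apply: (PM) => //.
rewrite mpolyXE_id; elim: (index_enum _) => [|i s IH].
  by rewrite big_nil -mpolyC1.
rewrite big_cons; apply: (PM) => //.
elim: (u i) => [|k IHk]; first by rewrite expr0 -mpolyC1.
by rewrite exprS; apply: PM.
Qed.

(** A row space of maximal rank among those contained in [P] exhausts it, since any further vector
    of [P] could be adjoined. *)
Lemma rv_basis (F : fieldType) d (P : set 'rV[F]_d) : P 0 ->
  (forall a u v, P u -> P v -> P (a *: u + v)) ->
  exists U : 'M[F]_d, forall v, P v <-> (v <= U)%MS.
Proof.
move=> P0 PZ.
pose Q k := `[< exists U : 'M[F]_d, \rank U = k /\ forall v : 'rV_d, (v <= U)%MS -> P v >].
have Q0 : exists k, Q k.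
  exists 0%N; apply/asboolP; exists 0; split; first exact: mxrank0.
  by move=> v; rewrite submx0 => /eqP ->.
have Qn k : Q k -> (k <= d)%N.
  by move=> /asboolP[U [<- _]]; apply: rank_leq_row.
have [k /asboolP[U [rU PU]] kmax] := ex_maxnP Q0 Qn.
exists U => v; split=> [Pv|/PU//].
apply: contrapT => /negP vU.
have /kmax : Q (\rank (U + <<v>>)%MS).
  apply/asboolP; exists (U + <<v>>)%MS; split=> // u /sub_addsmxP[[a b] /= ->].
  have /submxP[c ->] : (b *m <<v>>%MS <= v)%MS.
    by apply: submx_trans (submxMl _ _) _; rewrite genmxE.
  rewrite [c]mx11_scalar mul_scalar_mx addrC; apply: PZ => //.
  by apply: PU; apply: submxMl.
rewrite leqNgt -rU ltn_neqAle mxrankS ?addsmxSl // andbT negbK => /eqP e.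
have : (U + <<v>> <= U)%MS by rewrite -(mxrank_leqif_sup (addsmxSl U _)) e.
by rewrite addsmx_sub genmxE (negPf vU) andbF.
Qed.

Section Subspaces.
Variables (F : fieldType) (n : nat).

Definition subsp (W : set 'M[F]_n) := W 0 /\ forall a X Y, W X -> W Y -> W (a *: X + Y).

Lemma mxtrace_mxvec (X Y : 'M[F]_n) : \tr (X *m Y^T) = \sum_k mxvec X 0 k * mxvec Y 0 k.
Proof.
rewrite (reindex _ (curry_mxvec_bij n n)) /mxtrace.
transitivity (\sum_i \sum_j X i j * Y^T j i); first by apply: eq_bigr => i _; rewrite mxE.
by rewrite pair_bigA /=; apply: eq_bigr => -[i j] _ /=; rewrite !mxvecE mxE.
Qed.

Section One.
Variable W : set 'M[F]_n.
Hypothesis sW : subsp W.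

Lemma subspZ a X : W X -> W (a *: X).
Proof. by move=> WX; rewrite -[a *: X]addr0; apply: sW.2 => //; apply: sW.1. Qed.
Lemma subspD X Y : W X -> W Y -> W (X + Y).
Proof. by move=> WX WY; rewrite -[X]scale1r; apply: sW.2. Qed.
Lemma subspN X : W X -> W (- X).
Proof. by move=> WX; rewrite -scaleN1r; apply: subspZ. Qed.
Lemma subspB X Y : W X -> W Y -> W (X - Y).
Proof. by move=> WX WY; apply: subspD => //; apply: subspN. Qed.
Lemma subsp_sum (I : Type) (r : seq I) (P : pred I) (f : I -> 'M[F]_n) :
  (forall i, P i -> W (f i)) -> W (\sum_(i <- r | P i) f i).
Proof. by move=> Wf; apply: big_ind => //; [apply: sW.1|apply: subspD]. Qed.

Lemma subsp_basis : exists U : 'M[F]_(n * n), forall X, W X <-> (mxvec X <= U)%MS.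
Proof.
have [||U UP] := @rv_basis F (n * n) [set v | W (vec_mx v)].
- by rewrite /= linear0; apply: sW.1.
- by move=> a u v /= Wu Wv; rewrite linearP; apply: sW.2.
by exists U => X; rewrite -UP /= mxvecK.
Qed.

(** Biduality for the pairing by the trace: the columns of the cokernel of a basis matrix, reshaped
    as matrices, are functionals that cut out [W]. *)
Lemma perp_perp Z :
  (forall Y, (forall X, W X -> \tr (X *m Y) = 0) -> \tr (Z *m Y) = 0) -> W Z.
Proof.
have [U UP] := subsp_basis => h; apply/UP.
have tc X j : \tr (X *m (vec_mx (col j (cokermx U))^T)^T) = (mxvec X *m cokermx U) 0 j.
  by rewrite mxtrace_mxvec mxE; apply: eq_bigr => k _; rewrite vec_mxK !mxE.
rewrite submxE; apply/eqP/rowP => j; rewrite -tc mxE; apply: h => X /UP XU.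
by rewrite tc; move: XU; rewrite submxE => /eqP ->; rewrite mxE.
Qed.

End One.
End Subspaces.

Section Tangent.
Variables (F : numClosedFieldType) (n' : nat).
Local Notation n := n'.+1.
Implicit Types (X Y Z A g : 'M[F]_n) (M H : set 'M[F]_n) (p q : {mpoly F[n * n]}).

Definition dp p A X := \sum_k mxeval (mderiv k p) A * mxvec X 0 k.

Lemma dpC c A X : dp c%:MP A X = 0.
Proof. by rewrite /dp big1 // => k _; rewrite mderivC /mxeval meval0 mul0r. Qed.

Lemma dpX k A X : dp 'X_k A X = mxvec X 0 k.
Proof.
rewrite /dp (bigD1 k) //= big1 ?addr0 => [|l lk]; rewrite mderivX mnmE.
  have -> : (U_(k) - U_(k) = 0)%MM by apply/mnmP => i; rewrite !mnmE subnn.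
  by rewrite eqxx scale1r /mxeval mpolyX0 meval1 mul1r.
by rewrite eq_sym (negPf lk) scale0r /mxeval meval0 mul0r.
Qed.

Lemma dpD p q A X : dp (p + q) A X = dp p A X + dp q A X.
Proof.
rewrite /dp -big_split; apply: eq_bigr => k _ /=.
by rewrite mderivD /mxeval mevalD mulrDl.
Qed.

Lemma dpM p q A X : dp (p * q) A X = dp p A X * mxeval q A + mxeval p A * dp q A X.
Proof.
rewrite /dp mulr_suml mulr_sumr -big_split; apply: eq_bigr => k _ /=.
by rewrite mderivM /mxeval mevalD !mevalM; ring.
Qed.

Lemma dpDr p A X Y a : dp p A (a *: X + Y) = a * dp p A X + dp p A Y.
Proof.
rewrite /dp mulr_sumr -big_split; apply: eq_bigr => k _ /=.
by rewrite linearP /= !mxE; ring.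
Qed.

Lemma dp_curve d (h : F -> 'M[F]_n) c X p : d.[c] != 0 ->
  (forall i j, rfun_der d (fun x => h x i j) c (X i j)) ->
  rfun_der d (fun x => mxeval p (h x)) c (dp p (h c) X).
Proof.
move=> dc hX; elim/mpoly_ring_ind: p => [a|k|p q Hp Hq|p q Hp Hq].
- rewrite dpC; apply: rfun_der_ext (rfun_derC _ dc) => x _.
  by rewrite /mxeval mevalC.
- rewrite dpX; case/mxvec_indexP: k => i j; rewrite mxvecE.
  by apply: rfun_der_ext (hX i j) => x _; rewrite /mxeval mevalXU mxvecE.
- rewrite dpD; apply: rfun_der_ext (rfun_derD dc Hp Hq) => x _.
  by rewrite /mxeval mevalD.
- rewrite dpM; apply: rfun_der_ext (rfun_derM dc Hp Hq) => x _.
  by rewrite /mxeval mevalM.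
Qed.

Lemma rfun_der_line A X c i j :
  rfun_der 1 (fun x => (A + x *: X) i j) c (X i j).
Proof.
have d1 : (1 : {poly F}).[c] != 0 by rewrite hornerC oner_eq0.
have := @rfun_der_poly _ 1 ((A i j)%:P + X i j *: 'X) c d1.
rewrite derivD derivC derivZ derivX add0r hornerZ hornerC mulr1.
by apply: rfun_der_ext => x _; rewrite !mxE hornerD hornerC hornerZ hornerX mulrC.
Qed.

Lemma dp_line p A X : rfun_der 1 (fun x => mxeval p (A + x *: X)) 0 (dp p A X).
Proof.
have d1 : (1 : {poly F}).[0] != 0 by rewrite hornerC oner_eq0.
have := @dp_curve 1 (fun x => A + x *: X) 0 X p d1 (rfun_der_line A X 0).
by rewrite scale0r addr0.
Qed.

Lemma rfun_der_fun (d : {poly F}) u v c a b : d != 0 -> d.[c] != 0 -> (forall x, d.[x] != 0 -> u x = v x) ->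
  rfun_der d u c a -> rfun_der d v c b -> a = b.
Proof.
move=> dN dc uv ua vb; apply/eqP; rewrite -subr_eq0; apply/eqP.
have := rfun_derD dc ua (rfun_derM dc (rfun_derC (-1) dc) vb).
rewrite mul0r add0r mulN1r => h.
by apply: (rfun_der_uniq dN dc _ h) => x dx; rewrite uv // mulN1r subrr.
Qed.

Lemma dp_map p q A X (h : 'M[F]_n -> 'M[F]_n) B Y :
  (forall x, h (A + x *: X) = B + x *: Y) ->
  (forall Z, mxeval q Z = mxeval p (h Z)) -> dp q A X = dp p B Y.
Proof.
move=> hE qE; have d1 : (1 : {poly F}).[0] != 0 by rewrite hornerC oner_eq0.
apply: (rfun_der_fun (oner_neq0 _) d1 _ (dp_line q A X) (dp_line p B Y)).
by move=> x _; rewrite qE hE.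
Qed.

Lemma lie_algebraP M X : lie_algebra M X <->
  forall p, vanish M (mxeval p) -> dp p 1%:M X = 0.
Proof. by []. Qed.

Lemma lie_subsp M : subsp (lie_algebra M).
Proof.
split=> [p _|a X Y MX MY p pM].
  by rewrite big1 // => k _; rewrite linear0 mxE mulr0.
by have := dpDr p 1%:M X Y a; rewrite /dp (MX p pM) (MY p pM) mulr0 addr0.
Qed.

Lemma lieS M H : M `<=` H -> lie_algebra M `<=` lie_algebra H.
Proof. by move=> MH X MX p pH; apply: MX => g /MH; apply: pH. Qed.

Lemma lie_curve M d (h : F -> 'M[F]_n) c X : d != 0 -> d.[c] != 0 -> h c = 1%:M ->
  (forall x, d.[x] != 0 -> M (h x)) ->
  (forall i j, rfun_der d (fun x => h x i j) c (X i j)) -> lie_algebra M X.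
Proof.
move=> dN dc hc hM hX; apply/lie_algebraP => p pM.
have := dp_curve p dc hX; rewrite hc.
by apply: (rfun_der_uniq dN dc) => x dx; apply: pM; apply: hM.
Qed.

Definition gmx : 'M[{mpoly F[n * n]}]_n := \matrix_(i, j) 'X_(mxvec_index i j).

(* The left invariant vector field of [Y]; it is sealed because comparing two
   instances by unfolding is very slow. *)
Fact ldiff_sig : {D : 'M[F]_n -> {mpoly F[n * n]} -> {mpoly F[n * n]} |
  forall Y p, D Y p = \sum_k mderiv k p * mxvec (gmx *m map_mx (@mpolyC _ _) Y) 0 k}.
Proof. by eexists=> Y p. Qed.

Definition ldiff := sval ldiff_sig.

Lemma ldiff_def Y p :
  ldiff Y p = \sum_k mderiv k p * mxvec (gmx *m map_mx (@mpolyC _ _) Y) 0 k.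
Proof. exact: (svalP ldiff_sig). Qed.

Lemma ldiffE Y p A : mxeval (ldiff Y p) A = dp p A (A *m Y).
Proof.
rewrite ldiff_def /mxeval raddf_sum; apply: eq_bigr => k _ /=.
rewrite mevalM; congr (_ * _); case/mxvec_indexP: k => i j; rewrite !mxvecE !mxE.
rewrite raddf_sum; apply: eq_bigr => l _ /=.
by rewrite !mxE mevalM mevalXU mevalC mxvecE.
Qed.

(** Left translation by [g] in [M] preserves the ideal of [M] and carries the tangent vector [Y] at
    1 to the vector [g *m Y] at [g]. *)
Lemma lie_ldiff M Y p : mxgroup M -> lie_algebra M Y ->
  vanish M (mxeval p) -> vanish M (mxeval (ldiff Y p)).
Proof.
move=> gM MY pM g Mg; rewrite ldiffE.
have [q qE] : polyf (fun A => mxeval p (g *m A)).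
  apply: polyf_comp; first exact: polyf_mxeval.
  by apply: polymapM; [apply: polymapC|apply: polymap_id].
rewrite -(@dp_map p q 1%:M Y (fun A => g *m A)) //.
- by apply: MY => h Mh; rewrite -qE pM //; apply: grpM.
- by move=> x; rewrite mulmxDr mulmx1 -scalemxAr.
Qed.

Lemma lie_iter M Y p k : mxgroup M -> lie_algebra M Y ->
  vanish M (mxeval p) -> vanish M (mxeval (iter k (ldiff Y) p)).
Proof. by move=> gM MY pM; elim: k => //= k IH; apply: lie_ldiff. Qed.

Lemma lie_Ad M g X : mxgroup M -> M g -> lie_algebra M X ->
  lie_algebra M (g *m X *m invmx g).
Proof.
move=> gM Mg MX; apply/lie_algebraP => p pM; have ug := grpU gM Mg.
have [q qE] : polyf (fun A => mxeval p (g *m A *m invmx g)).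
  apply: polyf_comp; first exact: polyf_mxeval.
  apply: polymapM; last exact: polymapC.
  by apply: polymapM; [apply: polymapC|apply: polymap_id].
rewrite -(@dp_map p q 1%:M X (fun A => g *m A *m invmx g)) //.
- by apply: MX => h Mh; rewrite -qE pM //; apply: grpJ.
- by move=> x; rewrite mulmxDr mulmx1 mulmxDl mulmxV // -scalemxAr -scalemxAl.
Qed.

Lemma poly_taylor0 (w : nat -> {poly F}) :
  (forall k, (w k)^`() = w k.+1) -> (forall k, (w k).[0] = 0) -> w 0%N = 0.
Proof.
move=> wS w0; apply/polyP => i; rewrite coef0.
suff : forall k, (w k)`_i = 0 by apply.
elim: i => [|i IH] k; first by rewrite -horner_coef0 w0.
have := IH k.+1; rewrite -wS coef_deriv => /eqP.
by rewrite mulrn_eq0 /= => /eqP.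
Qed.

Lemma mexp_der X c i j : mnilp X ->
  rfun_der 1 (fun x => mexp (x *: X) i j) c ((mexp (c *: X) *m X) i j).
Proof.
move=> nX; have d1 : (1 : {poly F}).[c] != 0 by rewrite hornerC oner_eq0.
pose q : {poly F} := \sum_(k < n) ((k`!%:R)^-1 * (X ^+ k) i j) *: 'X^k.
have qE x : q.[x] = mexp (x *: X) i j.
  rewrite /q horner_sum /mexp summxE; apply: eq_bigr => k _.
  by rewrite hornerZ hornerXn exprZn !mxE; ring.
suff <- : q^`().[c] = (mexp (c *: X) *m X) i j.
  by apply: rfun_der_ext (rfun_der_poly q d1) => x _.
have -> : mexp (c *: X) *m X = \sum_(k < n') (k`!%:R)^-1 *: (c ^+ k *: X ^+ k.+1).
  rewrite mulmx_suml big_ord_recr /= [X in _ + X](_ : _ = 0) ?addr0.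
    apply: eq_bigr => k _.
    by rewrite exprZn -scalemxAl -scalemxAl mulmxE exprSr.
  by rewrite exprZn -!scalemxAl mulmxE -exprSr nX !scaler0.
rewrite /q raddf_sum horner_sum big_ord_recl /= derivZ expr0 derivC scaler0 horner0 add0r.
rewrite summxE; apply: eq_bigr => k _.
rewrite derivZ derivXn /= hornerZ hornerMn hornerXn !mxE factS natrM invfM -mulr_natr /bump /= add1n add0n mul1r.
have kN : (k.+1%:R : F) != 0 by rewrite pnatr_eq0.
have cancel4 (x a y z : F) : x != 0 -> x^-1 * a * y * (z * x) = a * (z * y).
  by move=> xN; field.
by rewrite -[c ^+ k *+ _]mulr_natr; apply: cancel4.
Qed.

Lemma mexp_poly p X : mnilp X -> exists q : {poly F}, forall c, mxeval p (mexp (c *: X)) = q.[c].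
Proof.
move=> nX; have [q [k qE]] : rfun 1 (fun c => mxeval p (mexp (c *: X))).
  apply: rfun_polyf; first exact: polyf_mxeval.
  by apply: rcurve_mexp; apply: rfun_ext (rfun_poly 1 'X) => c _; rewrite hornerX.
exists q => c; rewrite qE hornerC ?oner_eq0 //.
by rewrite expr1n divr1.
Qed.

(** The derivatives at 0 of [p] along the curve [mexp (c *: X)] are the values at 1 of iterated
    invariant derivatives of [p]. They vanish for [p] in the ideal of [M], and the function of [c]
    is polynomial. *)
Lemma lie_exp M X c : alg_group M -> lie_algebra M X -> mnilp X -> M (mexp (c *: X)).
Proof.
move=> aM MX nX; apply: (alg_zcl aM); last by apply: mexp_unit; apply: nilpZ.
move=> f [p fp] fM; rewrite fp.
have pM : vanish M (mxeval p) by move=> g Mg; rewrite -fp fM.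
have /choice[w wE] : forall k, exists q : {poly F},
    forall c, mxeval (iter k (ldiff X) p) (mexp (c *: X)) = q.[c].
  by move=> k; apply: mexp_poly.
rewrite (wE 0%N) (_ : w 0%N = 0) ?horner0 //; apply: poly_taylor0 => k.
  apply/eqP; rewrite -subr_eq0; apply/eqP; apply: poly_inf => x.
  have d1 : (1 : {poly F}).[x] != 0 by rewrite hornerC oner_eq0.
  rewrite hornerD hornerN -wE /= ldiffE; apply/eqP; rewrite subr_eq0; apply/eqP.
  apply: (rfun_der_fun (oner_neq0 _) d1 _ (rfun_der_poly (w k) d1)
     (dp_curve _ d1 (fun i j => mexp_der x i j nX))).
  by move=> y _ /=; rewrite wE.
rewrite -wE scale0r mexp0; apply: (lie_iter k (alg_grp aM) MX pM).
by apply: grp1; apply: alg_grp.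
Qed.

Lemma exp_lie M X : (forall c, M (mexp (c *: X))) -> mnilp X -> lie_algebra M X.
Proof.
move=> MX nX; have d1 : (1 : {poly F}).[0] != 0 by rewrite hornerC oner_eq0.
apply: (@lie_curve M 1 (fun x => mexp (x *: X)) 0) => //; first exact: oner_neq0.
- by rewrite scale0r mexp0.
- by move=> i j; have := @mexp_der X 0 i j nX; rewrite scale0r mexp0 mul1mx.
Qed.

(** At natural numbers [c] the point is a power of [mexp X], and a polynomial in [c] vanishing there
    is zero. *)
Lemma exp_grp M X c : alg_group M -> mnilp X -> M (mexp X) -> M (mexp (c *: X)).
Proof.
move=> aM nX MX; have gM := alg_grp aM.
apply: (alg_zcl aM); last by apply: mexp_unit; apply: nilpZ.
move=> f [p fp] fM; rewrite fp; have [q qE] := mexp_poly p nX.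
rewrite qE (_ : q = 0) ?horner0 //; apply: poly_infN => k.
rewrite -qE mexp_nat // -fp fM //; elim: k => [|k IH]; first by rewrite expr0; apply: grp1.
by rewrite exprS; apply: grpM.
Qed.

Lemma log_lie M u : alg_group M -> M u -> (exists m, (u - 1%:M) ^+ m = 0) ->
  exists2 X, mnilp X /\ lie_algebra M X & u = mexp X.
Proof.
move=> aM Mu [m um]; have [X nX XE] := mexp_log um.
exists X => //; split=> //; apply: exp_lie => // c.
by apply: exp_grp => //; rewrite XE.
Qed.

(** A functional vanishing on [W] turns the curve into a polynomial in [c] that is zero everywhere,
    so it kills each coefficient; biduality concludes. *)
Lemma subsp_coef (W : set 'M[F]_n) K (C : nat -> 'M[F]_n) : subsp W ->
  (forall c, W (\sum_(k < K) c ^+ k *: C k)) -> forall k, (k < K)%N -> W (C k).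
Proof.
move=> sW Wh k kK; apply: (perp_perp sW) => Y WY.
pose q : {poly F} := \poly_(k < K) \tr (C k *m Y).
suff q0 : q = 0 by have := coef0 F k; rewrite -q0 coef_poly kK.
apply: poly_inf => c; rewrite horner_poly; have := WY _ (Wh c); rewrite mulmx_suml raddf_sum => {2}<-.
by apply: eq_bigr => i _; rewrite -scalemxAl /= mxtraceZ mulrC.
Qed.

(* [C 1] below is the coefficient of [c] in [exp(cX) Y exp(-cX)]. *)
Lemma lie_bracket M X Y : alg_group M -> mnilp X -> lie_algebra M X -> lie_algebra M Y ->
  lie_algebra M (X *m Y - Y *m X).
Proof.
move=> aM nX MX MY; have gM := alg_grp aM.
pose a i := (i`!%:R : F)^-1.
pose C k : 'M[F]_n := \sum_(i < n) \sum_(j < n | (i + j == k)%N)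
   (a i * a j * (-1) ^+ j) *: (X ^+ i *m Y *m X ^+ j).
have sW := lie_subsp M.
suff WC k : (k < n + n)%N -> lie_algebra M (C k).
  have := WC 1%N; rewrite addSn ltnS addn_gt0 orbT => /(_ isT).
  suff -> : C 1%N = X *m Y - Y *m X by [].
  rewrite /C /a; case: (n') X Y {nX MX MY C WC sW gM aM} (M) => [|m] X Y _.
    rewrite big_ord1 big1 => [|i]; last by rewrite (ord1 i).
    by apply/eqP; rewrite eq_sym subr_eq0 [X]mx11_scalar [Y]mx11_scalar scalar_mxC.
  rewrite big_ord_recl big_ord_recl [X in _ + (_ + X)]big1 ?addr0; last first.
    by move=> i _; rewrite big_pred0.
  rewrite (big_pred1 (lift ord0 ord0)); last by move=> j /=; rewrite add0n; apply/eqP/eqP => [e|->//]; apply/val_inj.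
  rewrite (big_pred1 ord0); last by move=> j /=; rewrite /bump /= add1n eqSS; apply/eqP/eqP => [e|->//]; apply/val_inj.
  rewrite !lift0 /= !expr0 !expr1 !invr1 !mul1r mul1mx mulmx1 ?mulr1 ?scale1r ?scaleN1r.
  by rewrite addrC.
apply: (@subsp_coef _ (n + n) C sW) => {k} c.
suff -> : \sum_(k < n + n) c ^+ k *: C k = mexp (c *: X) *m Y *m invmx (mexp (c *: X)).
  by apply: lie_Ad => //; apply: lie_exp.
rewrite mexpV; last exact: nilpZ.
rewrite /mexp; under eq_bigr => k _ do rewrite /C scaler_sumr.
rewrite exchange_big mulmx_suml mulmx_suml; apply: eq_bigr => i _ /=.
rewrite mulmx_sumr; under eq_bigr => k _ do rewrite big_mkcond scaler_sumr.
rewrite exchange_big; apply: eq_bigr => j _ /=.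
have ij : (i + j < n + n)%N by rewrite -addnS leq_add // ltnW.
rewrite (bigD1 (Ordinal ij)) //= eqxx big1 ?addr0; last first.
  by move=> k /eqP kN; case: eqP => [e|_]; [case: kN; apply/val_inj|rewrite scaler0].
rewrite -scaleNr !exprZn !scalerA -!scalemxAl -scalemxAr scalerA; congr (_ *: _).
rewrite [(- c) ^+ _]exprNn exprD /a; move: (c ^+ i) (c ^+ j) ((-1) ^+ j) => x y z; ring.
Qed.

End Tangent.

(** * Noetherian polynomial rings and Krull's intersection theorem *)

Section Noether.
Implicit Type R : comNzRingType.

Definition ideal R (I : set R) :=
  [/\ I 0, forall x y, I x -> I y -> I (x + y) & forall a x, I x -> I (a * x)].

Definition inspan R (s : seq R) (x : R) :=
  exists c : nat -> R, x = \sum_(i < size s) c i * s`_i.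

Definition noeth R := forall I : set R, ideal I ->
  exists2 s : seq R, (forall i, I s`_i) & forall x, I x -> inspan s x.

Lemma ideal_sum R (I : set R) (J : Type) (r : seq J) (P : pred J) (f : J -> R) :
  ideal I -> (forall i, P i -> I (f i)) -> I (\sum_(i <- r | P i) f i).
Proof. by case=> I0 ID _ If; apply: big_ind. Qed.

Lemma idealB R (I : set R) x y : ideal I -> I x -> I y -> I (x - y).
Proof. by case=> I0 ID IM Ix Iy; apply: ID => //; rewrite -mulN1r; apply: IM. Qed.

Lemma inspan_ideal R (s : seq R) : ideal (inspan s).
Proof.
split.
- by exists (fun _ => 0); rewrite big1 // => i _; rewrite mul0r.
- move=> _ _ [c ->] [d ->]; exists (fun i => c i + d i); rewrite -big_split.
  by apply: eq_bigr => i _; rewrite mulrDl.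
- move=> a _ [c ->]; exists (fun i => a * c i); rewrite mulr_sumr.
  by apply: eq_bigr => i _; rewrite mulrA.
Qed.

Lemma inspan_min R (s : seq R) (I : set R) : ideal I -> (forall i, (i < size s)%N -> I s`_i) ->
  forall x, inspan s x -> I x.
Proof.
move=> iI Is _ [c ->]; apply: ideal_sum => // i _.
by case: iI => _ _; apply; apply: Is.
Qed.

Lemma inspan_nth R (s : seq R) i : (i < size s)%N -> inspan s s`_i.
Proof.
move=> si; exists (fun j => (j == i)%:R); rewrite (bigD1 (Ordinal si)) //= eqxx mul1r.
by rewrite big1 ?addr0 // => j /eqP ji; case: eqP => [e|_]; [case: ji; apply/val_inj|rewrite mul0r].
Qed.

Lemma noeth_seq R (f : nat -> R) : noeth R ->
  exists K (c : nat -> R), f K = \sum_(i < K) c i * f i.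
Proof.
move=> nR; pose I := [set x | exists K, inspan (mkseq f K) x].
have mono K K' x : (K <= K')%N -> inspan (mkseq f K) x -> inspan (mkseq f K') x.
  move=> KK; apply: inspan_min; first exact: inspan_ideal.
  move=> i; rewrite size_mkseq => iK; have iK' := leq_trans iK KK.
  by rewrite nth_mkseq // -(nth_mkseq 0 f iK'); apply: inspan_nth; rewrite size_mkseq.
have iI : ideal I.
  split.
  - by exists 0%N; case: (inspan_ideal (mkseq f 0)).
  - move=> x y [K Kx] [K' Ky]; exists (maxn K K').
    have [_ h _] := inspan_ideal (mkseq f (maxn K K')).
    by apply: h; [apply: mono Kx; rewrite leq_maxl|apply: mono Ky; rewrite leq_maxr].
  - by move=> a x [K Kx]; exists K; case: (inspan_ideal (mkseq f K)) => _ _; apply.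
have [s Is sI] := nR I iI.
have [K sK] : exists K, forall i, (i < size s)%N -> inspan (mkseq f K) s`_i.
  have /choice[k kP] := Is; exists (\max_(i < size s) k i) => i si.
  by apply: mono (kP i); apply: (leq_bigmax (Ordinal si)).
have : I (f K).
  by exists K.+1; rewrite -(nth_mkseq 0 f (ltnSn K)); apply: inspan_nth; rewrite size_mkseq.
move/sI/(inspan_min (inspan_ideal _) sK) => [c cE]; exists K, c.
by rewrite cE size_mkseq; apply: eq_bigr => i _; rewrite nth_mkseq.
Qed.

Lemma noeth_field (F : fieldType) : noeth F.
Proof.
move=> I [I0 ID IM]; have [[x [Ix xN]]|h] := pselect (exists x, I x /\ x != 0).
  exists [:: x]; first by case=> [|i] //=; rewrite nth_nil.
  by move=> y Iy; exists (fun _ => y / x); rewrite big_ord1 /= divfK.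
exists [::]; first by move=> i; rewrite nth_nil.
move=> x Ix; exists (fun _ => 0); rewrite big_ord0.
by apply: contrapT => /eqP xN; apply: h; exists x.
Qed.

Lemma noeth_surj R R' (f : R -> R') : (forall x y, f (x + y) = f x + f y) ->
  (forall x y, f (x * y) = f x * f y) -> f 0 = 0 -> (forall y, exists x, f x = y) ->
  noeth R -> noeth R'.
Proof.
move=> fD fM f0 fS nR I [I0 ID IM].
have [|s Is sI] := nR [set x | I (f x)].
  split; [by rewrite /= f0|by move=> x y Ix Iy; rewrite /= fD; apply: ID|].
  by move=> a x Ix; rewrite /= fM; apply: IM.
have nf i : (map f s)`_i = f s`_i.
  have [si|si] := ltnP i (size s); first by rewrite (nth_map 0).
  by rewrite !nth_default ?size_map.
exists (map f s); first by move=> i; rewrite nf; apply: Is.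
move=> y Iy; have [x xy] := fS y.
have [|c cE] := sI x; first by rewrite /= xy.
exists (fun i => f (c i)); rewrite -xy cE size_map.
rewrite (big_morph f fD f0); apply: eq_bigr => i _.
by rewrite fM nf.
Qed.

(* If [I] is not finitely generated, choose recursively elements of minimal size
   outside the ideal generated by the previous ones; a relation between their
   leading coefficients then produces a smaller one. *)
Lemma noeth_poly R : noeth R -> noeth {poly R}.
Proof.
move=> nR I iI; apply: contrapT => nfg; have [I0 ID IM] := iI.
have ex s : (forall i, I s`_i) -> exists x, [/\ I x, ~ inspan s x &
    forall y, I y -> ~ inspan s y -> (size x <= size y)%N].
  move=> Is.
  have [x Ix xs] : exists2 x, I x & ~ inspan s x.
    apply: contrapT => h; apply: nfg; exists s => // x Ix.
    by apply: contrapT => xs; apply: h; exists x.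
  pose Q k := `[< exists x, [/\ I x, ~ inspan s x & size x = k] >].
  have exQ : exists k, Q k by exists (size x); apply/asboolP; exists x.
  have [k /asboolP[z [Iz zs zk]] kmin] := ex_minnP exQ.
  exists z; split=> // y Iy ys; rewrite zk; apply: kmin.
  by apply/asboolP; exists y.
have exT s : exists x, (forall i, I s`_i) -> [/\ I x, ~ inspan s x &
    forall y, I y -> ~ inspan s y -> (size x <= size y)%N].
  by have [/ex[x xP]|h] := pselect (forall i, I s`_i); [exists x|exists 0].
have [nx nxP] := choice exT.
pose s k := iter k (fun s => rcons s (nx s)) [::].
have ss k : size (s k) = k by elim: k => //= k IH; rewrite size_rcons IH.
have Is k : forall i, I (s k)`_i.
  elim: k => [|k IH] i; first by rewrite nth_nil.
  rewrite /= nth_rcons; case: ifP => // _; case: ifP => // _.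
  by case: (nxP _ IH).
pose g k := nx (s k).
have sE k : s k = mkseq g k.
  elim: k => // k IH; rewrite /mkseq -addn1 iotaD map_cat /= -/(mkseq g k) -IH cats1.
  by rewrite addn1.
have [K [c cE]] := noeth_seq (fun k => lead_coef (g k)) nR.
have gN k : g k != 0.
  apply/eqP => g0; case: (nxP _ (Is k)) => _; rewrite -/(g k) g0 => h _.
  by case: h; case: (inspan_ideal (s k)).
have gS i : (i < K)%N -> (size (g i) <= size (g K))%N.
  move=> iK; case: (nxP _ (Is i)) => _ _; apply; first by case: (nxP _ (Is K)).
  case: (nxP _ (Is K)) => _ h _ h'; apply: h; apply: inspan_min h'; first exact: inspan_ideal.
  move=> j; rewrite ss => ji; have jK := ltn_trans ji iK.
  by rewrite !sE nth_mkseq // -(nth_mkseq 0 g jK); apply: inspan_nth; rewrite size_mkseq.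
pose h := \sum_(i < K) (c i)%:P * 'X^(size (g K) - size (g i)) * g i.
have hs : inspan (s K) h.
  rewrite /h; apply: ideal_sum; first exact: inspan_ideal.
  move=> i _; have [_ _ m] := inspan_ideal (s K); apply: m.
  by rewrite sE -(nth_mkseq 0 g (ltn_ord i)); apply: inspan_nth; rewrite size_mkseq.
have Ih : I h by apply: inspan_min hs => // i _; apply: Is.
case: (nxP _ (Is K)); rewrite -/(g K) => IgK gKs /(_ (g K - h)) /=.
have -> : (size (g K) <= size (g K - h)%R)%N = false.
  have d0 : (0 < size (g K))%N by rewrite size_poly_gt0.
  apply/negbTE; rewrite -ltnNge -[X in (_ < X)%N](prednK d0) ltnS.
  apply/leq_sizeP => j dj; rewrite coefB; apply/eqP; rewrite subr_eq0; apply/eqP.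
  have hj : h`_j = \sum_(i < K) c i * (g i)`_(j - (size (g K) - size (g i))).
    rewrite /h coef_sum; apply: eq_bigr => i _; rewrite -mulrA coefCM coefXnM.
    have gi0 : (0 < size (g i))%N by rewrite size_poly_gt0.
    by rewrite ltnNge; have -> : (size (g K) - size (g i) <= j)%N by have := gS i (ltn_ord i); lia.
  rewrite hj; case: (ltngtP j (size (g K)).-1) => [|jd|->]; first by rewrite ltnNge dj.
    have gKj : (size (g K) <= j)%N by rewrite -(prednK d0).
    rewrite (nth_default _ gKj) big1 // => i _; rewrite nth_default ?mulr0 //.
    by rewrite leq_subRL ?(leq_trans (leq_subr _ _) gKj) // subnK // gS.
  rewrite -lead_coefE cE; apply: eq_bigr => i _; rewrite lead_coefE.
  have gi0 : (0 < size (g i))%N by rewrite size_poly_gt0.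
  by congr (_ * _`_ _); have := gS i (ltn_ord i); lia.
move=> h0; have : false by apply: h0; [apply: idealB|move=> hh; apply: gKs;
  rewrite -[g K](subrK h); have [_ hD _] := inspan_ideal (s K); apply: hD].
by [].
Qed.

Lemma noeth_mpoly R m : noeth R -> noeth {mpoly R[m]}.
Proof.
move=> nR; elim: m => [|m IH].
  apply: (@noeth_surj R _ (@mpolyC 0 R)) => //.
  - by move=> x y; rewrite mpolyCD.
  - by move=> x y; rewrite mpolyCM.
  - move=> p; elim/mpoly_ring_ind: p => [c|[]|p q [x <-] [y <-]|p q [x <-] [y <-]] //.
    + by exists c.
    + by exists (x + y); rewrite mpolyCD.
    + by exists (x * y); rewrite mpolyCM.
pose f (p : {poly {mpoly R[m]}}) : {mpoly R[m.+1]} := (map_poly (@mwiden m R) p).['X_ord_max].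
apply: (@noeth_surj _ _ f _ _ _ _ (noeth_poly IH)).
- by move=> x y; rewrite /f rmorphD hornerD.
- by move=> x y; rewrite /f rmorphM hornerM.
- by rewrite /f rmorph0 horner0.
move=> p; elim/mpoly_ring_ind: p => [c|i|p q [x <-] [y <-]|p q [x <-] [y <-]].
- by exists (c%:MP)%:P; rewrite /f map_polyC hornerC /= mwidenC.
- have [im|mi] := ltnP i m.
    exists ('X_(Ordinal im))%:P; rewrite /f map_polyC hornerC /= mwidenX mnmwiden1.
    by congr 'X_[U_(_)]; apply/val_inj.
  exists 'X; rewrite /f map_polyX hornerX; congr 'X_[U_(_)]; apply/val_inj => /=.
  by apply/eqP; rewrite eqn_leq mi -ltnS ltn_ord.
- by exists (x + y); rewrite /f rmorphD hornerD.
- by exists (x * y); rewrite /f rmorphM hornerM.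
Qed.

Lemma pihomogM R m d e (p q : {mpoly R[m]}) : q \is e.-homog -> (e <= d)%N ->
  pihomog mdeg d (p * q) = pihomog mdeg (d - e) p * q.
Proof.
move=> hq ed; elim/mpolyind: p => [|c u p _ _ IH]; first by rewrite mul0r !linear0 mul0r.
rewrite mulrDl !linearD /= IH mulrDl; congr (_ + _).
rewrite -scalerAl !linearZ /= -scalerAl; congr (_ *: _); rewrite pihomogX.
have hX : 'X_[u] * q \is (mdeg u + e).-homog.
  by apply: dhomogM => //; rewrite dhomogX.
have [ue|ue] := eqVneq (mdeg u) (d - e)%N.
  by rewrite pihomog_dE //; move: hX; rewrite ue subnK.
rewrite mul0r (pihomog_ne0 _ hX) //; apply: contra ue => /eqP <-.
by rewrite addnK.
Qed.

Lemma mnm_split m (u : 'X_{1..m}) k : (k <= mdeg u)%N ->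
  exists u1 u2 : 'X_{1..m}, u = (u1 + u2)%MM /\ mdeg u1 = k.
Proof.
elim: k => [|k IH] ku; first by exists 0%MM, u; rewrite add0m mdeg0.
have [u1 [u2 [uE u1k]]] := IH (ltnW ku).
have [i ui] : exists i, (0 < u2 i)%N.
  apply: contrapT => h; move: ku; rewrite uE mdegD u1k (_ : mdeg u2 = 0%N) ?addn0 ?ltnn //.
  rewrite mdegE big1 // => i _; apply/eqP; rewrite -leqn0 leqNgt.
  by apply/negP => ui; apply: h; exists i.
exists (u1 + U_(i))%MM, (u2 - U_(i))%MM; split; last by rewrite mdegD mdeg1 u1k addn1.
apply/mnmP => j; rewrite uE !mnmE; case: eqP => [<-|_] /=; lia.
Qed.

End Noether.

Section Krull.
Variables (F : fieldType) (N : nat).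
Implicit Types (p q r : {mpoly F[N]}).

Let var : 'I_N -> {mpoly F[N]} := fun i => 'X_i.

(** Each monomial is split into a factor of degree [k], which becomes a monomial of the form [P],
    and a remainder, which goes into its coefficient. *)
Lemma homog_lift k r : (forall u, (mdeg u < k)%N -> r@_u = 0) ->
  exists2 P : {mpoly {mpoly F[N]}[N]}, P \is k.-homog & P.@[var] = r.
Proof.
move=> rk.
have rS u : u \in msupp r -> (k <= mdeg u)%N.
  by move=> us; rewrite leqNgt; apply/negP => /rk/eqP; rewrite mcoeff_eq0 us.
rewrite [r]mpolyE; elim: (msupp r) rS => [|u s IH] sk.
  exists 0; first exact: dhomog0.
  by rewrite big_nil meval0.
have [|P hP PE] := IH; first by move=> v vs; apply: sk; rewrite inE vs orbT.
have [u1 [u2 [uE u1k]]] := mnm_split (sk u (mem_head _ _)).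
exists ((r@_u *: 'X_[u2]) *: 'X_[u1] + P).
  by apply: dhomogD => //; apply: dhomogZ; rewrite dhomogX; apply/eqP.
rewrite big_cons mevalD PE mevalZ mevalX; congr (_ + _).
rewrite (_ : \prod_i var i ^+ u1 i = 'X_[u1]); last by rewrite [RHS]mpolyXE_id.
by rewrite -scalerAl -mpolyXD uE addmC.
Qed.

Lemma homog_low e (P : {mpoly {mpoly F[N]}[N]}) : P \is e.-homog -> (0 < e)%N ->
  (P.@[var]).@[fun _ => 0] = 0.
Proof.
move=> /dhomogP hP e0; rewrite [P.@[var]]mevalE raddf_sum big_seq big1 // => u us /=.
rewrite mevalM rmorph_prod.
have [i ui] : exists i, (0 < u i)%N.
  have uE : mdeg u = e := hP u us.
  apply: contrapT => h; move: e0; rewrite -uE mdegE big1 // => i _.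
  by apply/eqP; rewrite -leqn0 leqNgt; apply/negP => ui; apply: h; exists i.
rewrite (bigD1 i) //= rmorphXn /= mevalXU expr0n eqn0Ngt ui mul0r mulr0 //.
Qed.

(** Krull's intersection theorem at the origin, with the forms [P k] playing the part of the Rees
    algebra: modulo [I], [p] is the value of a form of every degree [k], and by the Noetherian
    property some [P K] is a combination of earlier ones. *)
Lemma krull (I : set {mpoly F[N]}) p : ideal I ->
  (forall k, exists2 g, I g & forall u, (mdeg u < k)%N -> (p - g)@_u = 0) ->
  exists2 q, q.@[fun _ => 0] = 0 & I ((1 - q) * p).
Proof.
move=> iI pI; have [I0 ID IM] := iI.
have /choice[P PP] : forall k, exists P : {mpoly {mpoly F[N]}[N]},
    P \is k.-homog /\ I (p - P.@[var]).
  move=> k; have [g Ig gk] := pI k; have [P hP PE] := homog_lift gk.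
  by exists P; split=> //; rewrite PE opprB addrC subrK.
have [K [c cE]] := noeth_seq P (@noeth_mpoly _ N (@noeth_mpoly _ N (@noeth_field F))).
(* Only the part of [c i] of degree [K - i] contributes to the degree of [P K]. That degree is
   positive, so its value at the variables vanishes at the origin. *)
pose c' i := pihomog mdeg (K - i) (c i).
have PK : P K = \sum_(i < K) c' i * P i.
  have [hK _] := PP K; rewrite -[LHS](pihomog_dE hK) cE raddf_sum.
  apply: eq_bigr => i _ /=; rewrite (@pihomogM _ _ _ i) //; first by case: (PP i).
  exact: ltnW.
pose d i := (c' i).@[var]; exists (\sum_(i < K) d i).
  rewrite raddf_sum big1 // => i _ /=; apply: (homog_low (pihomogP _ _ _)).
  by rewrite subn_gt0.
have -> : (1 - \sum_(i < K) d i) * p =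
    (p - (P K).@[var]) - \sum_(i < K) d i * (p - (P i).@[var]).
  have -> : (P K).@[var] = \sum_(i < K) d i * (P i).@[var].
    by rewrite PK raddf_sum; apply: eq_bigr => i _ /=; rewrite mevalM.
  have -> : \sum_(i < K) d i * (p - (P i).@[var]) =
      (\sum_(i < K) d i) * p - \sum_(i < K) d i * (P i).@[var].
    by rewrite mulr_suml -sumrB; apply: eq_bigr => i _; rewrite mulrBr.
  by ring.
apply: idealB => //; first by case: (PP K).
by apply: ideal_sum => // i _; apply: IM; case: (PP i).
Qed.

End Krull.

(** * A closed subgroup with the same tangent space is open *)

Section OpenSubgroup.
Variables (F : numClosedFieldType) (n' : nat).
Local Notation n := n'.+1.
Implicit Types (X Y Z A g : 'M[F]_n) (M H : set 'M[F]_n) (p q : {mpoly F[n * n]}).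

Lemma poly1N c : (1 : {poly F}).[c] != 0.
Proof. by rewrite hornerC oner_eq0. Qed.

Lemma dp_delta p A k : dp p A (vec_mx (delta_mx 0 k)) = mxeval (mderiv k p) A.
Proof.
rewrite /dp vec_mxK (bigD1 k) //= mxE !eqxx mulr1 big1 ?addr0 // => i ik.
by rewrite mxE (negPf ik) andbF mulr0.
Qed.

Lemma mpoly_fun0 p : (forall A, mxeval p A = 0) -> p = 0.
Proof.
move=> p0; apply/mpolyP => u; rewrite mcoeff0; move dE : (mdeg u) => d.
elim: d u dE p p0 => [|d IH] u dE p p0.
  move/eqP: dE; rewrite mdeg_eq0 => /eqP ->.
  have := p0 0; rewrite /mxeval linear0 mevalE.
  have [us|us] := boolP (0%MM \in msupp p); last first.
    by move=> _; apply/eqP; rewrite mcoeff_eq0.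
  rewrite (bigD1_seq 0%MM) ?msupp_uniq //= [X in X + _](_ : _ = p@_0%MM); last first.
    by rewrite big1 ?mulr1 // => i _; rewrite mnm0E expr0.
  rewrite big1 ?addr0 // => v v0.
  have [i vi] : exists i, v i != 0%N.
    apply: contrapT => h; case/eqP: v0; apply/mnmP => i; rewrite mnm0E.
    by apply: contrapT => /eqP vi; apply: h; exists i.
  by rewrite (bigD1 i) //= mxE expr0n (negPf vi) mul0r mulr0.
have [i ui] : exists i, (0 < u i)%N.
  apply: contrapT => h; move: dE; rewrite mdegE big1 // => i _.
  by apply/eqP; rewrite -leqn0 leqNgt; apply/negP => ui; apply: h; exists i.
have uE : u = (u - U_(i) + U_(i))%MM.
  by apply/mnmP => j; rewrite !mnmE; case: eqP => [<-|_] /=; lia.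
have : (mderiv i p)@_(u - U_(i))%MM = 0.
  apply: IH.
    by move: dE; rewrite {1}uE mdegD mdeg1 addn1 => -[].
  move=> A; rewrite -dp_delta; apply: (rfun_der_uniq (oner_neq0 _) (poly1N 0) _ (dp_line _ _ _)).
  by move=> x _; apply: p0.
by rewrite mcoeff_deriv -uE => /eqP; rewrite mulrn_eq0 /= => /eqP.
Qed.

(** Order of vanishing at the zero matrix; [plead k] is then the leading form, possibly zero. *)
Definition ord k p := forall u, (mdeg u < k)%N -> p@_u = 0.
Definition plead k p := \sum_(u <- msupp p | mdeg u == k) p@_u *: 'X_[u].

Lemma plead_coef k p u : mdeg u = k -> (plead k p)@_u = p@_u.
Proof.
move=> uk; rewrite /plead raddf_sum /=.
have [us|us] := boolP (u \in msupp p); last first.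
  rewrite (memN_msupp_eq0 us) big_seq_cond big1 // => v /andP[vs _].
  rewrite mcoeffZ mcoeffX; case: eqP => [e|_]; last by rewrite mulr0.
  by rewrite -e vs in us.
rewrite big_mkcond (bigD1_seq u) ?msupp_uniq //= uk eqxx mcoeffZ mcoeffX eqxx mulr1.
rewrite big1 ?addr0 // => v vu; case: ifP => // _.
by rewrite mcoeffZ mcoeffX (negPf vu) mulr0.
Qed.

Lemma ord_curve k p (S : 'M[{poly F}]_n) : ord k p ->
  exists2 s : {poly F}, forall c, mxeval p (c *: pmx_at S c) = c ^+ k * s.[c] &
    s.[0] = mxeval (plead k p) (pmx_at S 0).
Proof.
move=> pk.
have sk u : u \in msupp p -> (k <= mdeg u)%N.
  by move=> us; rewrite leqNgt; apply/negP => /pk/eqP; rewrite mcoeff_eq0 us.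
have hv i c : mxvec (pmx_at S c) 0 i = (mxvec S 0 i).[c].
  by case/mxvec_indexP: i => i j; rewrite !mxvecE mxE.
exists (\sum_(u <- msupp p) p@_u *: ('X^(mdeg u - k) * \prod_i (mxvec S 0 i) ^+ u i)).
  move=> c; rewrite /mxeval mevalE horner_sum mulr_sumr big_seq [RHS]big_seq.
  apply: eq_bigr => u us; rewrite hornerZ hornerM hornerXn horner_prod.
  rewrite mulrCA; congr (_ * _); rewrite mulrA -exprD subnKC ?sk //.
  rewrite mdegE -prodrXr -big_split /=; apply: eq_bigr => i _.
  by rewrite linearZ mxE exprMn hv horner_exp.
rewrite horner_sum /mxeval /plead raddf_sum big_seq [RHS]big_seq_cond [RHS]big_mkcond /=.
rewrite [LHS]big_mkcond /=.
apply: eq_bigr => u _; have [us|//] := boolP (u \in msupp p); rewrite /= hornerZ hornerM hornerXn.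
case: eqP => [uk|uk].
  rewrite uk subnn expr0 mul1r mevalZ mevalX horner_prod; congr (_ * _).
  by apply: eq_bigr => i _; rewrite horner_exp hv.
rewrite expr0n (_ : (mdeg u - k == 0)%N = false) ?mul0r ?mulr0 //.
by apply/negbTE; rewrite subn_eq0 -ltnNge ltn_neqAle sk // andbT eq_sym; apply/eqP.
Qed.

Lemma ord_curve_next k p S : ord k p -> mxeval (plead k p) (pmx_at S 0) = 0 ->
  exists s : {poly F}, forall c, mxeval p (c *: pmx_at S c) = c ^+ k.+1 * s.[c].
Proof.
move=> pk p0; have [s sE s0] := ord_curve S pk.
have : root s 0 by rewrite rootE s0 p0.
case/factor_theorem => t st; exists t => c.
by rewrite sE st hornerM hornerXsubC subr0 exprSr; ring.
Qed.

Lemma pmx_atC A c : pmx_at (map_mx polyC A) c = A.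
Proof. by apply/matrixP => i j; rewrite !mxE hornerC. Qed.

(** On the line through 0 and [Y] the lowest form takes the value that governs the order in [c]. If
    this order is too high for every [Y], the form is zero as a function, hence as a polynomial. *)
Lemma ord_crit k p :
  (forall Y, exists s : {poly F}, forall c, mxeval p (c *: Y) = c ^+ k * s.[c]) -> ord k p.
Proof.
move=> h; suff : forall j, (j <= k)%N -> ord j p by apply.
elim=> [//|j IH] jk u; have oj := IH (ltnW jk).
rewrite ltnS leq_eqVlt => /orP[/eqP uj|]; last exact: oj.
rewrite -(plead_coef p uj) (_ : plead j p = 0) ?mcoeff0 //; apply: mpoly_fun0 => Y.
have [s sE] := h Y; have [t tE t0] := ord_curve (map_mx polyC Y) oj.
rewrite pmx_atC in t0; rewrite -t0.
suff -> : t = 'X^(k - j) * s by rewrite hornerM hornerXn expr0n subn_eq0 leqNgt jk mul0r.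
apply/eqP; rewrite -subr_eq0; apply/eqP; apply: (@poly_inf_ne _ 'X); first by rewrite polyX_eq0.
move=> c; rewrite hornerX => cN; apply/eqP; rewrite hornerD hornerN subr_eq0; apply/eqP.
apply: (mulfI (expf_neq0 j cN)); rewrite -tE pmx_atC sE hornerM hornerXn mulrA -exprD.
by rewrite subnKC // ltnW.
Qed.

(** The cut-off exponential series also serves tangent vectors that are not nilpotent: its curve
    stays on the group up to order [k] in [c], by [texp_vanish]. *)
Definition texp k Y c : 'M[F]_n := \sum_(j < k.+1) (c ^+ j / j`!%:R) *: Y ^+ j.

Lemma texp_der k Y c i j : rfun_der 1 (fun x => texp k Y x i j) c
  ((texp k Y c *m Y - (c ^+ k / k`!%:R) *: Y ^+ k.+1) i j).
Proof.
pose q : {poly F} := \sum_(l < k.+1) ((l`!%:R)^-1 * (Y ^+ l) i j) *: 'X^l.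
have qE x : q.[x] = texp k Y x i j.
  rewrite /q horner_sum /texp summxE; apply: eq_bigr => l _.
  by rewrite hornerZ hornerXn !mxE; ring.
suff <- : q^`().[c] = (texp k Y c *m Y - (c ^+ k / k`!%:R) *: Y ^+ k.+1) i j.
  by apply: rfun_der_ext (rfun_der_poly q (poly1N c)) => x _.
have -> : texp k Y c *m Y - (c ^+ k / k`!%:R) *: Y ^+ k.+1 =
    \sum_(l < k) (c ^+ l / l`!%:R) *: Y ^+ l.+1.
  rewrite /texp mulmx_suml big_ord_recr /= -scalemxAl mulmxE -exprSr addrK.
  by apply: eq_bigr => l _; rewrite -scalerAl -exprSr.
rewrite /q raddf_sum horner_sum big_ord_recl /= derivZ expr0 derivC scaler0 horner0 add0r.
rewrite summxE; apply: eq_bigr => l _.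
rewrite derivZ derivXn /= hornerZ hornerMn hornerXn !mxE factS natrM invfM /bump /= add1n.
have lN : (l.+1%:R : F) != 0 by rewrite pnatr_eq0.
have cancel4 (x a y z : F) : x != 0 -> x^-1 * a * y * (z * x) = z * a * y.
  by move=> xN; field.
by rewrite -[c ^+ l *+ _]mulr_natr; apply: cancel4.
Qed.

Lemma texp_poly k Y (f : 'M[F]_n -> F) : polyf f ->
  exists q : {poly F}, forall c, f (texp k Y c) = q.[c].
Proof.
move=> fp; have [q [l qE]] : rfun 1 (fun c => f (texp k Y c)).
  apply: rfun_polyf => // i j.
  apply: (@rfun_ext _ _ (fun c => \sum_(l < k.+1) c ^+ l / l`!%:R * (Y ^+ l) i j)).
    by move=> c _; rewrite /texp summxE; apply: eq_bigr => l _; rewrite mxE.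
  apply: rfun_sum => l _; apply: rfunM; last exact: rfunC.
  apply: rfunM; last exact: rfunC.
  by apply: rfun_ext (rfun_poly 1 'X^l) => c _; rewrite hornerXn.
by exists q => c; rewrite qE ?poly1N // hornerC expr1n divr1.
Qed.

Lemma polyf_dp p X : polyf (fun A => dp p A X).
Proof. by apply: polyf_sum => k _; apply: polyfM; [apply: polyf_mxeval|apply: polyfC]. Qed.

Lemma texp_vanish M Y p k : mxgroup M -> lie_algebra M Y -> vanish M (mxeval p) ->
  exists t : {poly F}, forall c, mxeval p (texp k Y c) = c ^+ k.+1 * t.[c].
Proof.
move=> gM MY pM.
have /choice[w wE] : forall j, exists q : {poly F},
    forall c, mxeval (iter j (ldiff Y) p) (texp k Y c) = q.[c].
  by move=> j; apply: texp_poly; apply: polyf_mxeval.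
have /choice[v vE] : forall j, exists q : {poly F},
    forall c, dp (iter j (ldiff Y) p) (texp k Y c) (Y ^+ k.+1) = q.[c].
  by move=> j; apply: (@texp_poly k Y (fun A => dp _ A _)); apply: polyf_dp.
have wS j : (w j)^`() = w j.+1 - (k`!%:R)^-1 *: ('X^k * v j).
  apply/eqP; rewrite -subr_eq0; apply/eqP; apply: poly_inf => x.
  rewrite hornerD hornerN; apply/eqP; rewrite subr_eq0; apply/eqP.
  have := @dp_curve _ _ 1 (texp k Y) x _ (iter j (ldiff Y) p) (poly1N x) (texp_der k Y x).
  move/(rfun_der_fun (oner_neq0 _) (poly1N x) _ (rfun_der_poly (w j) (poly1N x))) => ->; last first.
    by move=> y _; rewrite wE.
  rewrite [texp k Y x *m Y - _]addrC -scaleNr dpDr vE -ldiffE -[ldiff Y _]/(iter j.+1 (ldiff Y) p) wE.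
  rewrite !(hornerD,hornerN,hornerZ,hornerM,hornerXn); ring.
have w0 i j : (i <= k)%N -> (w j)`_i = 0.
  elim: i j => [|i IH] j ik.
    rewrite -horner_coef0 -wE (_ : texp k Y 0 = 1%:M).
      exact: (lie_iter j gM MY pM (grp1 gM)).
    rewrite /texp big_ord_recl expr0 fact0 divr1 scale1r expr0 big1 ?addr0 // => l _.
    by rewrite expr0n mul0r scale0r.
  have := congr1 (fun q : {poly F} => q`_i) (wS j).
  rewrite /= coef_deriv coefB coefZ coefXnM ik mulr0 subr0 IH; last exact: ltnW.
  by move/eqP; rewrite mulrn_eq0 /= => /eqP.
exists (\poly_(i < size (w 0%N)) (w 0%N)`_(i + k.+1)) => c.
rewrite (wE 0%N) -[c ^+ _]hornerXn -hornerM; congr (_.[_]); apply/polyP => i.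
rewrite coefXnM; case: ltnP => ik; first by rewrite w0 // -ltnS.
rewrite coef_poly subnK //; case: ltnP => // h.
by rewrite nth_default // (leq_trans h) // leq_subr.
Qed.

(* Cartier's argument: the leading form of a function on [M] that vanishes on
   [M1] vanishes on the tangent space of [M], so it is the leading form of a
   function vanishing on [M]. *)
Section Cartier.
Variables M M1 : set 'M[F]_n.
Hypotheses (gM : mxgroup M) (gM1 : mxgroup M1).
Hypothesis lieM : lie_algebra M `<=` lie_algebra M1.

Definition van1 H : set {mpoly F[n * n]} := [set p | forall g, H g -> mxeval p (g - 1%:M) = 0].

Lemma van1_ideal H : ideal (van1 H).
Proof.
split=> [g _|p q hp hq g Hg|a p hp g Hg]; rewrite /mxeval ?meval0 //.
  by rewrite mevalD [X in X + _]hp // [X in _ + X]hq // addr0.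
by rewrite mevalM [X in _ * X]hp ?mulr0.
Qed.

Lemma van1_shift H p : van1 H p -> exists2 q, vanish H (mxeval q) &
  forall A, mxeval q A = mxeval p (A - 1%:M).
Proof.
move=> hp; have [q qE] : polyf (fun A => mxeval p (A - 1%:M)).
  apply: polyf_comp; first exact: polyf_mxeval.
  by apply: polymapB; [apply: polymap_id|apply: polymapC].
by exists q => // A HA; rewrite -qE hp.
Qed.

Lemma van1_texp H p Y k : mxgroup H -> lie_algebra H Y -> van1 H p ->
  exists t : {poly F}, forall c, mxeval p (texp k Y c - 1%:M) = c ^+ k.+1 * t.[c].
Proof.
move=> gH HY /van1_shift[q qH qE]; have [t tE] := texp_vanish k gH HY qH.
by exists t => c; rewrite -qE.
Qed.

(** Both [p] and [g] vanish to order [k.+1] along the truncated exponential, which begins as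
    [1 + c Y]; hence the form of degree [k] of their difference vanishes at [Y]. *)
Lemma plead_lie k p (g : {mpoly F[n * n]}) Y : van1 M1 p -> van1 M g -> ord k (p - g) -> lie_algebra M Y ->
  mxeval (plead k (p - g)) Y = 0.
Proof.
move=> pM gM0 ok MY.
have [t tE] := van1_texp k gM1 (lieM MY) pM.
have [t' t'E] := van1_texp k gM MY gM0.
pose S : 'M[{poly F}]_n := \sum_(j < k) ((j.+1)`!%:R^-1 *: 'X^j) *: map_mx polyC (Y ^+ j.+1).
have SE c : c *: pmx_at S c = texp k Y c - 1%:M.
  rewrite /texp big_ord_recl expr0 fact0 divr1 scale1r expr0 [X in X - _]addrC addrK.
  apply/matrixP => i j; rewrite !mxE summxE horner_sum summxE mulr_sumr.
  apply: eq_bigr => l _; rewrite !mxE !hornerE /= /bump /= add1n [c ^+ l.+1]exprS.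
  by move: (c ^+ l) ((Y ^+ l.+1) i j) => x y; ring.
have [k0|k0] := posnP k.
  subst k; have := ord_curve (map_mx polyC Y) ok.
  rewrite pmx_atC => -[s sE <-]; have := sE 0; rewrite scale0r expr0 mul1r => <-.
  rewrite -(subrr 1%:M) /mxeval mevalB [X in X - _]pM ?[X in _ - X]gM0 ?subrr //; exact: grp1.
have S0 : pmx_at S 0 = Y.
  apply/matrixP => i j; rewrite !mxE summxE horner_sum (bigD1 (Ordinal k0)) //= big1 ?addr0.
    by rewrite !mxE !hornerE ?expr1 ?fact1 ?invr1 ?mul1r ?mulr1.
  by move=> l /eqP lN; rewrite !mxE !hornerE expr0n;
     case: eqP => [e|_]; [case: lN; apply/val_inj|rewrite mulr0 mul0r].
have [s sE s0] := ord_curve S ok; rewrite S0 in s0; rewrite -s0.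
have -> : s = 'X * (t - t').
  apply/eqP; rewrite -subr_eq0; apply/eqP; apply: (@poly_inf_ne _ 'X); first by rewrite polyX_eq0.
  move=> c; rewrite hornerX => cN; rewrite hornerD hornerN; apply/eqP; rewrite subr_eq0; apply/eqP.
  apply: (mulfI (expf_neq0 k cN)); rewrite -sE SE.
  have -> : mxeval (p - g) (texp k Y c - 1%:M) =
      mxeval p (texp k Y c - 1%:M) - mxeval g (texp k Y c - 1%:M) by rewrite /mxeval mevalB.
  by rewrite tE t'E hornerM hornerX hornerD hornerN exprSr; ring.
by rewrite hornerM hornerX mul0r.
Qed.

(** The differentials at 1 of functions vanishing on [M] form a subspace whose annihilator is the
    tangent space by definition; biduality recovers every functional that vanishes there. *)
Lemma van1_linear Z : (forall Y, lie_algebra M Y -> \tr (Y *m Z) = 0) ->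
  exists2 q, van1 M q & forall X, dp q 0 X = \tr (X *m Z).
Proof.
move=> MZ.
pose W := [set Y : 'M[F]_n | exists2 q, vanish M (mxeval q) & forall X, dp q 1%:M X = \tr (X *m Y)].
have sW : subsp W.
  split=> [|a X Y [q qM qE] [r rM rE]].
    exists 0; first by move=> A _; rewrite /mxeval meval0.
    by move=> X; rewrite -mpolyC0 dpC mulmx0 mxtrace0.
  exists (a%:MP * q + r).
    by move=> A MA; rewrite /mxeval mevalD mevalM [X in _ * X + _]qM // [X in _ + X]rM // mulr0 addr0.
  move=> B; rewrite dpD dpM dpC mul0r add0r /mxeval mevalC qE rE.
  by rewrite mulmxDr -scalemxAr mxtraceD mxtraceZ.
have : W Z.
  apply: (perp_perp sW) => Y WY; rewrite mxtrace_mulC; apply: MZ.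
  apply/lie_algebraP => q qM.
  pose D : 'M[F]_n := (vec_mx (\row_k mxeval (mderiv k q) 1%:M))^T.
  have DE X : dp q 1%:M X = \tr (X *m D).
    by rewrite mxtrace_mxvec vec_mxK; apply: eq_bigr => k _; rewrite mxE mulrC.
  by rewrite DE mxtrace_mulC; apply: WY; exists q.
case=> q qM qE.
have [r rE] : polyf (fun A => mxeval q (A + 1%:M)).
  apply: polyf_comp; first exact: polyf_mxeval.
  by apply: polymapD; [apply: polymap_id|apply: polymapC].
exists r; first by move=> g Mg; rewrite -rE subrK qM.
move=> X; rewrite -qE; apply: (@dp_map _ _ q r 0 X (fun A => A + 1%:M)) => // x.
by rewrite add0r addrC.
Qed.

Lemma cartier p k : van1 M1 p -> exists2 g, van1 M g & ord k (p - g).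
Proof.
move=> pM; elim: k => [|k [g gM0 ok]]; first by exists 0 => //; case: (van1_ideal M).
have sL := lie_subsp M; have [U UP] := subsp_basis sL.
pose pr X : 'M[F]_n := vec_mx (mxvec X *m pinvmx U *m U).
have prL X : lie_algebra M (pr X) by apply/UP; rewrite vec_mxK submxMl.
have prid X : lie_algebra M X -> pr X = X.
  by move/UP => XU; rewrite /pr mulmxKpV // mxvecK.
pose P := pinvmx U *m U.
have /choice[q qP] : forall a, exists q, van1 M q /\
    forall X, dp q 0 X = mxvec (X - pr X) 0 a.
  move=> a; pose D : 'M[F]_n := (vec_mx (\row_k ((k == a)%:R - P k a)))^T.
  have DE X : \tr (X *m D) = mxvec (X - pr X) 0 a.
    rewrite mxtrace_mxvec vec_mxK linearB /= /pr vec_mxK -mulmxA -/P.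
    rewrite [RHS]mxE [X in _ + X]mxE [in RHS]mxE.
    under eq_bigr => k0 _ do rewrite mxE mulrBr.
    rewrite sumrB (bigD1 a) //= eqxx mulr1 big1 ?addr0 // => i /negPf ia.
    by rewrite ia mulr0.
  have [|r rM rE] := @van1_linear D.
    by move=> Y MY; rewrite DE prid // subrr linear0 mxE.
  by exists r; split=> // X; rewrite rE DE.
(* [G] vanishes at [h - 1] for [h] in [M], and its differential at 0 is [X - pr X]. Substituting
   [A - G A] changes [p - g] by an element of the ideal of [M] and composes its leading form with
   the projection to the tangent space, where that form is zero. *)
pose G A : 'M[F]_n := vec_mx (\row_a mxeval (q a) A).
have Gp : polymap G.
  move=> i j; apply: polyf_ext (polyf_mxeval (q (mxvec_index i j))) => A.
  by rewrite /G mxE mxE.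
have GM h : M h -> G (h - 1%:M) = 0.
  move=> Mh; apply/matrixP => i j; rewrite !mxE; by case: (qP (mxvec_index i j)) => h0 _; apply: h0.
have [r rE] : polyf (fun A => mxeval (p - g) (A - G A)).
  apply: polyf_comp; first exact: polyf_mxeval.
  by apply: polymapB => //; apply: polymap_id.
exists (g + (p - g - r)).
  have [_ hD _] := van1_ideal M; apply: hD => // h Mh.
  rewrite /mxeval mevalB [X in _ - X](_ : _ = mxeval r (h - 1%:M)) // -rE GM // subr0 subrr //.
have -> : p - (g + (p - g - r)) = r by ring.
apply: ord_crit => Y.
have /choice[v vP] : forall a, exists v : {poly F},
    (forall c, mxeval (q a) (c *: Y) = c * v.[c]) /\ v.[0] = mxvec (Y - pr Y) 0 a.
  move=> a; have [qM qd] := qP a.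
  have rl : rcurve 1 (fun c => 0 + c *: Y).
    move=> i j; apply: rfun_ext (rfun_poly 1 (Y i j *: 'X)) => c _.
    by rewrite !mxE hornerZ hornerX add0r mulrC.
  have [u0 [l uE]] := rfun_polyf (polyf_mxeval (q a)) rl.
  have {}uE c : mxeval (q a) (c *: Y) = u0.[c].
    by have := uE c (poly1N c); rewrite add0r hornerC expr1n divr1.
  have : root u0 0.
    rewrite rootE -uE scale0r -(subrr 1%:M) qM //; exact: grp1.
  case/factor_theorem => v uv; exists v; split=> [c|].
    by rewrite uE uv hornerM hornerXsubC subr0 mulrC.
  rewrite -qd; have h1 := rfun_der_poly u0 (poly1N 0).
  have := rfun_der_fun (oner_neq0 _) (poly1N 0) _ h1 (dp_line (q a) 0 Y).
  move=> <-; last by move=> x _; rewrite add0r uE.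
  by rewrite uv subr0 derivM derivX mulr1 hornerD hornerM hornerX mulr0 add0r.
pose S : 'M[{poly F}]_n := \matrix_(i, j) ((Y i j)%:P - v (mxvec_index i j)).
have SE c : c *: pmx_at S c = c *: Y - G (c *: Y).
  apply/matrixP => i j; rewrite !mxE hornerD hornerN hornerC mulrBr.
  by case: (vP (mxvec_index i j)) => ->.
have S0 : pmx_at S 0 = pr Y.
  apply/matrixP => i j; rewrite [LHS]mxE [S i j]mxE hornerD hornerN hornerC.
  case: (vP (mxvec_index i j)) => _ ->; rewrite mxvecE [(Y - _) i j]mxE [(- pr Y) i j]mxE.
  by rewrite opprB addrC subrK.
have [|s sE] := @ord_curve_next k (p - g) S ok.
  by rewrite S0; apply: plead_lie.
by exists s => c; rewrite -rE -SE sE.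
Qed.

End Cartier.

(** Krull's theorem gives, for each of finitely many generators of the ideal of [M1], a function
    with value 1 at the identity that multiplies it into the ideal of [M]. Where the product of
    these functions is nonzero, all generators vanish on [M]. *)
Lemma open_subgroup M M1 : mxgroup M -> alg_group M1 -> M1 `<=` M ->
  lie_algebra M `<=` lie_algebra M1 ->
  exists f, [/\ polyf f, f 1%:M != 0 & forall g, M g -> f g != 0 -> M1 g].
Proof.
move=> gM aM1 M1M lieM; have gM1 := alg_grp aM1.
have [s sM1 sP] := @noeth_mpoly _ (n * n) (@noeth_field F) _ (van1_ideal M1).
have /choice[q qP] : forall i, exists q : {mpoly F[n * n]},
    q.@[fun _ => 0] = 0 /\ van1 M ((1 - q) * s`_i).
  move=> i; have [k|q q0 qM] := @krull _ _ _ s`_i (van1_ideal M).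
    by have [g gM0 ok] := cartier gM gM1 lieM k (sM1 i); exists g.
  by exists q.
pose f A := \prod_(i < size s) mxeval (1 - q i) (A - 1%:M).
exists f; split.
- apply: polyf_prod => i _; apply: polyf_comp; first exact: polyf_mxeval.
  by apply: polymapB; [apply: polymap_id|apply: polymapC].
- rewrite /f big1 ?oner_neq0 // => i _; rewrite subrr /mxeval linear0 mevalB meval1.
  have [q0 _] := qP i; rewrite (_ : (q i).@[_] = 0) ?subr0 // -[RHS]q0.
  by apply: meval_eq => j; rewrite mxE.
- move=> g Mg fg; apply: (alg_zcl aM1); last exact: (grpU gM Mg).
  move=> h [p hp] hM.
  have [r rE] : polyf (fun A => mxeval p (A + 1%:M)).
    apply: polyf_comp; first exact: polyf_mxeval.
    by apply: polymapD; [apply: polymap_id|apply: polymapC].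
  have rM : van1 M1 r by move=> x Mx; rewrite -rE subrK -hp hM.
  have [c cE] := sP r rM.
  have -> : h g = mxeval r (g - 1%:M) by rewrite -rE subrK hp.
  rewrite cE /mxeval raddf_sum big1 // => i _ /=; rewrite mevalM.
  have [_ /(_ g Mg)] := qP i; rewrite /mxeval mevalM => /eqP; rewrite mulf_eq0 => /orP[]/eqP e.
    by case/eqP: fg; rewrite /f (bigD1 i) //= /mxeval e mul0r.
  by rewrite e mulr0.
Qed.

Lemma lie_eq M M1 : alg_group M -> zconnected M -> alg_group M1 -> M1 `<=` M ->
  lie_algebra M `<=` lie_algebra M1 -> M = M1.
Proof.
move=> aM cM aM1 M1M lieM; have gM := alg_grp aM; have gM1 := alg_grp aM1.
have [f [fp f1 fM]] := open_subgroup gM aM1 M1M lieM.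
symmetry; apply: (@zconnected_clopen _ _ _ _ 1%:M cM); last exact: grp1.
split=> //.
- exists (zcl M1); first exact: zcl_closed.
  apply/seteqP; split=> [g Mg|g [Mg cg]]; first by split; [apply: M1M|apply: sub_zcl].
  by apply: (alg_zcl aM1) => //; apply: grpU Mg.
(* The complement of [M1] in [M] consists of the points [g] at which all translates of [f] by [M1]
   vanish: a nonzero value puts [g] into [M1], and for [g] in [M1] the translate by [g] itself has
   the value [f 1]. *)
- exists [set g : zmx F n | forall h, M1 h -> f (invmx h *m g) = 0].
    rewrite (_ : [set g | _] = zcl [set g | forall h, M1 h -> f (invmx h *m g) = 0]).
      exact: zcl_closed.
    apply/seteqP; split; first exact: sub_zcl.
    move=> g cg h M1h; apply: (cg (fun A => f (invmx h *m A))).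
      by apply: polyf_comp => //; apply: polymapM; [apply: polymapC|apply: polymap_id].
    by move=> A /(_ h M1h).
  apply/seteqP; split=> g [Mg hg]; split=> //.
    move=> h M1h; apply: contrapT => /eqP fN; apply: hg.
    have : M1 (invmx h *m g).
      by apply: fM => //; apply: grpM => //; apply: grpV => //; apply: M1M.
    by move/(grpM gM1 M1h); rewrite mulKVmx // (grpU gM1 M1h).
  by move=> M1g; case/eqP: f1; rewrite -[RHS](hg g M1g) mulVmx // (grpU gM1 M1g).
Qed.

End OpenSubgroup.

(** * Products of closed subgroups *)

Section Constructible.
Variables (F : numClosedFieldType) (n : nat).
Local Notation N := (n * n)%N.
Implicit Types (e : seq F) (A : 'M[F]_n) (H : set 'M[F]_n).

(** Definability by a first-order term without inverses; [fm] is its analogue for formulas. A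
    product of closed sets is a projection, to which quantifier elimination over an algebraically
    closed field applies. *)
Definition tm (f : seq F -> F) :=
  exists t : GRing.term F, GRing.rterm t /\ forall e, GRing.eval e t = f e.

Definition fm (P : seq F -> Prop) :=
  exists f : GRing.formula F, GRing.rformula f /\ forall e, GRing.holds e f <-> P e.

Lemma tm_ext f g : f =1 g -> tm f -> tm g.
Proof. by move=> fg [t [rt te]]; exists t; split=> // e; rewrite te fg. Qed.

Lemma tmC c : tm (fun _ => c).
Proof. by exists (GRing.Const c). Qed.

Lemma tm_var i : tm (fun e => e`_i).
Proof. by exists (GRing.Var F i). Qed.

Lemma tmD f g : tm f -> tm g -> tm (fun e => f e + g e).
Proof.
move=> [s [rs se]] [t [rt te]]; exists (GRing.Add s t); split=> [|e] /=; first exact/andP.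
by rewrite se te.
Qed.

Lemma tmM f g : tm f -> tm g -> tm (fun e => f e * g e).
Proof.
move=> [s [rs se]] [t [rt te]]; exists (GRing.Mul s t); split=> [|e] /=; first exact/andP.
by rewrite se te.
Qed.

Lemma tm_sum (I : Type) (r : seq I) (f : I -> seq F -> F) :
  (forall i, tm (f i)) -> tm (fun e => \sum_(i <- r) f i e).
Proof.
move=> fP; elim: r => [|i r IH].
  by apply: tm_ext (tmC 0) => e; rewrite big_nil.
by apply: tm_ext (tmD (fP i) IH) => e; rewrite big_cons.
Qed.

Lemma fm_eq f g : tm f -> tm g -> fm (fun e => f e = g e).
Proof.
move=> [s [rs se]] [t [rt te]]; exists (GRing.Equal s t); split=> [|e] /=; first exact/andP.
by rewrite se te.
Qed.

Lemma fmN P : fm P -> fm (fun e => ~ P e).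
Proof. by move=> [s [rs se]]; exists (GRing.Not s); split=> // e /=; rewrite se. Qed.

Lemma fmI P Q : fm P -> fm Q -> fm (fun e => P e /\ Q e).
Proof.
move=> [s [rs se]] [t [rt te]]; exists (GRing.And s t); split=> [|e] /=; first exact/andP.
by rewrite se te.
Qed.

Lemma fm_all (I : eqType) (r : seq I) (P : I -> seq F -> Prop) :
  (forall i, fm (P i)) -> fm (fun e => forall i, i \in r -> P i e).
Proof.
move=> fP; elim: r => [|i r [s [rs se]]].
  by exists (GRing.Bool true); split.
have [t [rt te]] := fP i; exists (GRing.And t s); split=> [|e] /=; first exact/andP.
rewrite se te; split=> [[Pi Pr] j|h].
  by rewrite inE => /orP[/eqP->//|]; apply: Pr.
by split=> [|j jr]; apply: h; rewrite inE ?eqxx ?jr ?orbT.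
Qed.

(** Block [k] of the environment stores one matrix. Blocks 0, 1 and 2 will hold a product and its
    two factors. *)
Definition env_mx k e : 'M[F]_n := \matrix_(i, j) e`_(k * N + mxvec_index i j).

Lemma tm_entry k i j : tm (fun e => env_mx k e i j).
Proof. by apply: tm_ext (tm_var _) => e; rewrite mxE. Qed.

Lemma tm_mxeval p k : tm (fun e => mxeval p (env_mx k e)).
Proof.
elim/mpoly_ring_ind: p => [c|i|p q Hp Hq|p q Hp Hq].
- by apply: tm_ext (tmC c) => e; rewrite /mxeval mevalC.
- case/mxvec_indexP: i => i j; apply: tm_ext (tm_entry k i j) => e.
  by rewrite /mxeval mevalXU mxvecE.
- by apply: tm_ext (tmD Hp Hq) => e; rewrite /mxeval mevalD.
- by apply: tm_ext (tmM Hp Hq) => e; rewrite /mxeval mevalM.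
Qed.

Lemma fm_unit k : fm (fun e => env_mx k e \in unitmx).
Proof.
have [p pd] := polyf_det (@polymap_id F n).
have [f [rf fe]] := fmN (fm_eq (tm_mxeval p k) (tmC 0)).
exists f; split=> // e; rewrite fe -pd unitmxE unitfE.
by split=> [/eqP//|/eqP].
Qed.

Lemma alg_fin H : alg_group H -> exists s : seq {mpoly F[N]},
  forall A, H A <-> A \in unitmx /\ forall p, p \in s -> mxeval p A = 0.
Proof.
move=> aH; have gH := alg_grp aH.
pose I := [set p : {mpoly F[N]} | vanish H (mxeval p)].
have iI : ideal I.
  split=> [A _|p q Ip Iq A HA|p q Iq A HA]; rewrite /mxeval ?meval0 //.
    by rewrite mevalD -/(mxeval p A) -/(mxeval q A) Ip // Iq // addr0.
  by rewrite mevalM -/(mxeval q A) Iq // mulr0.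
have [s sI sspan] := noeth_mpoly (@noeth_field F) iI.
exists s => A; split=> [HA|[uA sA]].
  split=> [|p ps]; first exact: grpU HA.
  by move: (sI (index p s) A HA); rewrite nth_index.
apply: alg_zcl => // f [p fp] fH; rewrite fp.
have [|c ->] := sspan p; first by move=> B HB; rewrite -fp fH.
rewrite /mxeval raddf_sum big1 // => i _ /=.
by rewrite mevalM -/(mxeval s`_i A) sA ?mulr0 // mem_nth.
Qed.

Lemma fm_grp H k : alg_group H -> fm (fun e => H (env_mx k e)).
Proof.
move=> /alg_fin[s sH].
have [f [rf fe]] := fmI (fm_unit k) (@fm_all _ s (fun p e => mxeval p (env_mx k e) = 0)
  (fun p => fm_eq (tm_mxeval p k) (tmC 0))).
by exists f; split=> // e; rewrite fe sH.
Qed.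

(** Constructible sets in the shape delivered by a disjunctive normal form: each pair lists
    equations and inequations. *)
Definition cstr (bcs : seq (seq ('M[F]_n -> F) * seq ('M[F]_n -> F))) : set 'M[F]_n :=
  [set A | exists i, [/\ (i < size bcs)%N,
     (forall j, (j < size (nth ([::], [::]) bcs i).1)%N ->
        nth (fun _ => 0) (nth ([::], [::]) bcs i).1 j A = 0) &
     (forall j, (j < size (nth ([::], [::]) bcs i).2)%N ->
        nth (fun _ => 0) (nth ([::], [::]) bcs i).2 j A != 0)]].

Definition pseq (s : seq ('M[F]_n -> F)) :=
  forall j, (j < size s)%N -> polyf (nth (fun _ => 0) s j).

(** A nonempty constructible set contains a nonempty relatively open subset of its closure. A piece
    inside the closure of the others is dropped; any other piece is isolated from them by a
    polynomial [f]. *)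
Lemma cstr_open bcs :
  (forall i, (i < size bcs)%N -> pseq (nth ([::], [::]) bcs i).1 /\
     pseq (nth ([::], [::]) bcs i).2) -> cstr bcs !=set0 ->
  exists q A0, [/\ polyf q, cstr bcs A0, q A0 != 0 &
    forall A, zcl (cstr bcs) A -> q A != 0 -> cstr bcs A].
Proof.
elim: bcs => [|bc bcs IH] pb [A1 CA1]; first by case: CA1 => i [].
set C := cstr _; set C' := cstr bcs.
pose C1 := [set A | (forall j, (j < size bc.1)%N -> nth (fun _ => 0) bc.1 j A = 0) /\
  (forall j, (j < size bc.2)%N -> nth (fun _ => 0) bc.2 j A != 0)].
have CE A : C A <-> C1 A \/ C' A.
  split=> [[[|i] [ib h1 h2]]|[[h1 h2]|[i [ib h1 h2]]]].
  - by left.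
  - by right; exists i.
  - by exists 0%N.
  - by exists i.+1.
have [sub|/existsNP[A0 /not_implyP[C1A0]]] := pselect (C1 `<=` zcl C').
  have zC : zcl C `<=` zcl C'.
    move=> A CA; apply: zcl_id; apply: zclS CA => B /CE[/sub//|]; exact: sub_zcl.
  have [|q [A0 [qp CA0 qA0 qC]]] := IH (fun i ib => pb i.+1 ib).
    apply: contrapT => C'0; have /CE := CA1; case=> [/sub z|z]; last by apply: C'0; exists A1.
    have /eqP := z (fun _ => 1) (polyfC 1) (fun B CB => False_ind _ (C'0 (ex_intro _ B CB))).
    by rewrite oner_eq0.
  exists q, A0; split=> //; first by apply/CE; right.
  by move=> A /zC zA qA; apply/CE; right; apply: qC.
move=> /existsNP[f /not_implyP[fp /not_implyP[fC' fA0]]].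
have [p1 p2] := pb 0%N isT.
exists (fun A => f A * \prod_(j < size bc.2) nth (fun _ => 0) bc.2 j A), A0; split.
- by apply: polyfM => //; apply: polyf_prod => j _; apply: p2.
- by apply/CE; left.
- rewrite mulf_neq0 //; first exact/eqP.
  by apply/prodf_neq0 => j _; apply: C1A0.2.
- move=> A zA; rewrite mulf_eq0 negb_or => /andP[fA /prodf_neq0 gA].
  apply/CE; left; split=> j jb; last exact: (gA (Ordinal jb)).
  have : (nth (fun _ => 0) bc.1 j A) * f A = 0.
    apply: (zA (fun A => (nth (fun _ => 0) bc.1 j A) * f A)).
      by apply: polyfM => //; apply: p1.
    by move=> B /CE[[h _]|/fC' ->]; rewrite ?mulr0 // h // mul0r.
  by move/eqP; rewrite mulf_eq0 (negPf fA) orbF => /eqP.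
Qed.

Definition mx_env (A : 'M[F]_n) : seq F := [seq mxvec A 0 i | i <- enum 'I_N].

Lemma mx_envK A : env_mx 0 (mx_env A) = A.
Proof.
apply/matrixP => i j; rewrite mxE mul0n add0n /mx_env.
by rewrite (nth_map (mxvec_index i j)) ?size_enum_ord // nth_ord_enum mxvecE.
Qed.

Lemma polyf_term t : GRing.rterm t -> polyf (fun A => GRing.eval (mx_env A) t).
Proof.
elim: t => //= [i _|x _|k _|s IHs t IHt /andP[rs rt]|s IHs rs|s IHs k rs|s IHs t IHt /andP[rs rt]|s IHs k rs].
- have [ib|ib] := ltnP i N; last first.
    apply: polyf_ext (polyfC 0) => A; rewrite nth_default // /mx_env size_map.
    by rewrite size_enum_ord.
  exists 'X_(Ordinal ib) => A; rewrite /mxeval mevalXU /mx_env.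
  by rewrite (nth_map (Ordinal ib)) ?size_enum_ord // (nth_ord_enum _ (Ordinal ib)).
- exact: polyfC.
- exact: polyfC.
- by apply: polyfD; [apply: IHs|apply: IHt].
- by apply: polyfN; apply: IHs.
- apply: polyf_ext (polyfZ k%:R (IHs rs)) => A.
  by rewrite mulr_natl.
- by apply: polyfM; [apply: IHs|apply: IHt].
- by apply: polyfX; apply: IHs.
Qed.

Lemma fm_cstr P : fm P -> exists bcs,
  (forall i, (i < size bcs)%N -> pseq (nth ([::], [::]) bcs i).1 /\
     pseq (nth ([::], [::]) bcs i).2) /\
  forall A, cstr bcs A <-> P (mx_env A).
Proof.
move=> [f [rf fe]].
have wfQ := @ClosedFieldQE.wf_ex_elim F.
have okQ := @ClosedFieldQE.holds_ex_elim F (@solve_monicpoly F).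
pose g := GRing.quantifier_elim (@ClosedFieldQE.ex_elim F) f.
have gwf := GRing.quantifier_elim_wf wfQ rf; rewrite -/g in gwf.
have gP e := GRing.quantifier_elim_rformP wfQ okQ e rf.
pose bs := GRing.qf_to_dnf g false.
have rbs : all (@GRing.dnf_rterm F) bs.
  by apply: GRing.qf_to_dnf_rterm; case/andP: gwf.
pose ev (s : seq (GRing.term F)) := [seq (fun A => GRing.eval (mx_env A) t) | t <- s].
have P1 A : P (mx_env A) <-> GRing.qf_eval (mx_env A) (GRing.dnf_to_form bs).
  by rewrite -fe GRing.qf_to_dnfP //; split=> /gP.
have evp s : all (@GRing.rterm F) s -> pseq (ev s).
  move=> rs j; rewrite size_map => js.
  by rewrite (nth_map (GRing.Const 0)) //; apply: polyf_term; apply: (all_nthP _ rs).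
exists [seq (ev bc.1, ev bc.2) | bc <- bs]; split=> [i|A].
  rewrite size_map => ib; rewrite (nth_map ([::], [::])) //=.
  have /andP[r1 r2] : GRing.dnf_rterm (nth ([::], [::]) bs i).
    exact: (all_nthP _ rbs).
  by split; apply: evp.
rewrite P1; elim: (bs) => [|bc b IH] /=; first by split=> [[i []]|].
have ev1 s : GRing.qf_eval (mx_env A) (foldr (fun t => GRing.And (GRing.Equal t (GRing.NatConst F 0))) (GRing.Bool true) s)
   <-> forall j, (j < size (ev s))%N -> nth (fun _ => 0) (ev s) j A = 0.
  elim: s => [|t s IHs] //=; split=> [/andP[/eqP t0 /IHs h] [|j] // |h].
    by move=> /h.
  by apply/andP; split; [apply/eqP; apply: (h 0%N)|apply/IHs => j; apply: (h j.+1)].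
have ev2 s : GRing.qf_eval (mx_env A) (foldr (fun t => GRing.And (GRing.Not (GRing.Equal t (GRing.NatConst F 0)))) (GRing.Bool true) s)
   <-> forall j, (j < size (ev s))%N -> nth (fun _ => 0) (ev s) j A != 0.
  elim: s => [|t s IHs] //=; split=> [/andP[t0 /IHs h] [|j] // |h].
    by move=> /h.
  by apply/andP; split; [apply: (h 0%N)|apply/IHs => j; apply: (h j.+1)].
split.
  case=> -[|i] [ib h1 h2].
    by apply/orP; left; apply/andP; split; [apply/ev1|apply/ev2].
  by apply/orP; right; apply/IH; exists i.
case/orP=> [/andP[/ev1 h1 /ev2 h2]|/IH[i [ib h1 h2]]]; first by exists 0%N.
by exists i.+1.
Qed.

(** The product is constructible, hence contains a nonempty open part of its closure. A translate of
    the group by a closure point must meet this part, which brings the point into the group. *)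
Lemma alg_prod (A B : set 'M[F]_n) : alg_group A -> alg_group B ->
  mxgroup [set a *m b | a in A & b in B] -> alg_group [set a *m b | a in A & b in B].
Proof.
move=> aA aB; set H := [set _ | _ in A & _ in B] => gH.
have fmH : fm (fun e => H (env_mx 0 e)).
  have [f [rf fe]] := fmI (fmI (fm_grp 1 aA) (fm_grp 2 aB))
    (@fm_all _ (enum [set: 'I_n * 'I_n]%SET)
       (fun ij e => env_mx 0 e ij.1 ij.2 = \sum_k env_mx 1 e ij.1 k * env_mx 2 e k ij.2)
       (fun ij => fm_eq (tm_entry _ _ _) (tm_sum _ (fun k => tmM (tm_entry _ _ _) (tm_entry _ _ _))))).
  (* The quantified variables, from [N] up to [3N - 1], are the entries of the two factors. *)
  exists (foldr GRing.Exists f (iota N (2 * N))); split.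
    by elim: (iota _ _).
  move=> e; rewrite -GRing.foldExistsP.
  have env0 e1 e2 : {in [predC iota N (2 * N)], GRing.same_env e1 e2} -> env_mx 0 e1 = env_mx 0 e2.
    move=> s12; apply/matrixP => i j; rewrite !mxE mul0n add0n s12 // !inE mem_iota.
    by rewrite leqNgt ltn_ord.
  split=> [[e' /env0 ee' /fe[[A1 B2] AB]]|[a Aa [b Bb ab]]].
    exists (env_mx 1 e') => //; exists (env_mx 2 e') => //; rewrite ee'.
    apply/matrixP => i j; rewrite [LHS]mxE.
    by rewrite (AB (i, j)) // mem_enum inE.
  pose e' := mkseq (fun i => if (i < N)%N then e`_i else
     if (i < 2 * N)%N then (mx_env a)`_(i - N) else
     if (i < 3 * N)%N then (mx_env b)`_(i - 2 * N) else e`_i) (maxn (size e) (3 * N)).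
  have e'E i : e'`_i = if (i < N)%N then e`_i else
     if (i < 2 * N)%N then (mx_env a)`_(i - N) else
     if (i < 3 * N)%N then (mx_env b)`_(i - 2 * N) else e`_i.
    have [ib|ib] := ltnP i (maxn (size e) (3 * N)); first by rewrite nth_mkseq.
    rewrite nth_default ?size_mkseq //; move: ib; rewrite geq_max => /andP[ie iN].
    by rewrite nth_default //; do ! case: ifP => //; move: iN; lia.
  have ee' : {in [predC iota N (2 * N)], GRing.same_env e e'}.
    move=> i; rewrite !inE mem_iota e'E => ib.
    by do ! case: ifP => //; move: ib; lia.
  have e1 : env_mx 1 e' = a.
    rewrite -[RHS]mx_envK; apply/matrixP => i j; rewrite !mxE e'E.
    have := ltn_ord (mxvec_index i j); set k := nat_of_ord _ => kN.
    rewrite ifF; last by lia.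
    by rewrite ifT; [congr (nth _ _ _)|]; lia.
  have e2 : env_mx 2 e' = b.
    rewrite -[RHS]mx_envK; apply/matrixP => i j; rewrite !mxE e'E.
    have := ltn_ord (mxvec_index i j); set k := nat_of_ord _ => kN.
    rewrite ifF; last by lia.
    rewrite ifF; last by lia.
    by rewrite ifT; [congr (nth _ _ _)|]; lia.
  exists e' => //; apply/fe; rewrite e1 e2 -(env0 _ _ ee'); split=> // -[i j] _ /=.
  by rewrite -ab mxE.
have [bcs [pb hb]] := fm_cstr fmH.
have CH : cstr bcs = H.
  by apply/seteqP; split=> x; rewrite hb mx_envK.
have [|q [A0 [qp CA0 qA0 qC]]] := cstr_open pb.
  by rewrite CH; exists 1%:M; apply: grp1.
rewrite CH in CA0 qC.
apply/alg_groupP; split=> // z [zz uz].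
have aH := zclg_group gH.
have [//|nz] := pselect (H z).
have uA0 := grpU gH CA0.
suff /eqP : q (A0 *m invmx z *m z) = 0 by rewrite mulmxKV // (negPf qA0).
apply: (zz (fun y => q (A0 *m invmx z *m y))).
  by apply: polyf_comp => //; apply: polymapM; [apply: polymapC|apply: polymap_id].
move=> y Hy; apply/eqP; apply: contraT => qy; exfalso; apply: nz.
have Hz : H (A0 *m invmx z *m y).
  apply: qC qy; have [] // : zclg H (A0 *m invmx z *m y).
  apply: (grpM (alg_grp aH)); last by split; [apply: sub_zcl|apply: grpU Hy].
  apply: (grpM (alg_grp aH)); first by split; [apply: sub_zcl|].
  by apply: (grpV (alg_grp aH)).
have -> : z = y *m invmx (A0 *m invmx z *m y) *m A0.
  rewrite !invmxM ?unitmx_mul ?uA0 ?unitmx_inv ?uz ?(grpU gH Hy) //.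
  by rewrite invmxK mulKVmx ?(grpU gH Hy) // mulmxKV.
by apply: (grpM gH) => //; apply: (grpM gH) => //; apply: (grpV gH).
Qed.

End Constructible.

(** * Replicas *)

Section Components.
Variables (F : fieldType) (V : lmodType F) (I : set V) (D : V -> V).
Hypotheses (I0 : I 0) (IZ : forall a u v, I u -> I v -> I (a *: u + v)).
Hypotheses (DZ : forall a u v, D (a *: u + v) = a *: D u + D v) (ID : forall v, I v -> I (D v)).
Let E mu v := D v - mu *: v.

Let EZ mu a u v : E mu (a *: u + v) = a *: E mu u + E mu v.
Proof.
by rewrite /E DZ scalerDr !scalerBr !scalerA (mulrC mu) opprD addrACA.
Qed.

Let E0 mu : E mu 0 = 0.
Proof. by have := EZ mu 1 0 0; rewrite !scale1r addr0 => /esym/eqP; rewrite addrC -subr_eq0 addrK => /eqP. Qed.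

Let ED mu u v : E mu (u + v) = E mu u + E mu v.
Proof. by rewrite -[u]scale1r EZ !scale1r. Qed.

Let Esum mu (r : seq F) f : E mu (\sum_(x <- r) f x) = \sum_(x <- r) E mu (f x).
Proof. by elim: r => [|x r IH]; rewrite ?big_nil ?E0 // !big_cons ED IH. Qed.

Let EC mu nu v : E mu (E nu v) = E nu (E mu v).
Proof.
have DE x u : D (E x u) = E x (D u) by rewrite /E addrC -scaleNr DZ scaleNr addrC.
rewrite {1}/E DE [in RHS]/E DE /E !scalerBr !opprB !scalerA mulrC.
set x := nu *: D v; set y := mu *: D v; set z := _ *: v.
by rewrite [z - y]addrC [z - x]addrC !addrA; congr (_ + _); rewrite addrAC.
Qed.

Let I_add u v : I u -> I v -> I (u + v).
Proof. by move=> Iu Iv; rewrite -[u]scale1r; apply: IZ. Qed.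
Let I_scale a u : I u -> I (a *: u).
Proof. by move=> Iu; rewrite -[_ *: u]addr0; apply: IZ. Qed.
Let I_opp u : I u -> I (- u).
Proof. by rewrite -scaleN1r; apply: I_scale. Qed.
Let IE mu v : I v -> I (E mu v).
Proof. by move=> Iv; apply: I_add; [apply: ID|apply/I_opp/I_scale]. Qed.

(** Induction on the nilpotency length at the first eigenvalue [m]: applying [E m] shortens it
    there, and the components at other [mu] are recovered because [E m] and [E mu] differ by the
    nonzero scalar [mu - m]. *)
Lemma components_in (r : seq F) (f : F -> V) : uniq r ->
  (forall mu, mu \in r -> exists k, iter k (fun v => D v - mu *: v) (f mu) = 0) ->
  I (\sum_(mu <- r) f mu) -> forall mu, mu \in r -> I (f mu).
Proof.
rewrite -/E; elim: r f => [|m r IH] f //= /andP[mr ur] nf.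
have [k] := nf m (mem_head _ _).
have {}nf mu : mu \in r -> exists k, iter k (E mu) (f mu) = 0.
  by move=> h; apply: nf; rewrite inE h orbT.
elim: k f nf => [|k IHk] f nf fk If.
  move=> mu; rewrite /= in fk; rewrite inE => /orP[/eqP->|]; first by rewrite fk.
  by apply: (IH f ur nf); move: If; rewrite big_cons fk add0r.
have If' : I (\sum_(mu <- m :: r) E m (f mu)) by rewrite -Esum; apply: IE.
have itC mu j v : iter j (E mu) (E m v) = E m (iter j (E mu) v).
  by elim: j => //= j ->; rewrite EC.
have IEf mu : mu \in m :: r -> I (E m (f mu)).
  apply: (IHk (fun mu => E m (f mu))) => //.
  - by move=> nu nr; have [j fj] := nf nu nr; exists j; rewrite itC fj E0.
  - by rewrite -iterSr.
have Ir mu : mu \in r -> I (f mu).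
  move=> h; have mmu : mu - m != 0.
    by rewrite subr_eq0; apply: contraNneq mr => <-.
  have [j fj] := nf mu h.
  have step i : I (iter i (E mu) (f mu)) -> forall i', i = i'.+1 -> I (iter i' (E mu) (f mu)).
    move=> Ii i' ii'; rewrite ii' /= in Ii.
    have -> : iter i' (E mu) (f mu) = (mu - m)^-1 *: (E m (iter i' (E mu) (f mu)) - E mu (iter i' (E mu) (f mu))).
      set v := iter _ _ _; have -> : E m v - E mu v = (mu - m) *: v.
        by rewrite /E scalerBl opprB addrC addrA subrK.
      by rewrite scalerA mulVf // scale1r.
    apply: I_scale; apply: I_add; last exact: I_opp.
    rewrite -itC; elim: (i') => [|l IHl] /=; last exact: IE.
    by apply: IEf; rewrite inE h orbT.
  elim: j fj => [|j IHj] fj; first by rewrite /= in fj; rewrite fj.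
  have : forall i, (i <= j.+1)%N -> I (iter (j.+1 - i) (E mu) (f mu)).
    elim=> [_|i IHi ij]; first by rewrite subn0 fj.
    by apply: (step _ (IHi (ltnW ij))); rewrite -subSn.
  by move=> /(_ j.+1 (leqnn _)); rewrite subnn.
move=> mu; rewrite inE => /orP[/eqP->|/Ir//].
have -> : f m = \sum_(mu <- m :: r) f mu - \sum_(mu <- r) f mu by rewrite big_cons addrK.
apply: I_add => //; apply: I_opp; rewrite big_seq; elim/big_ind: _ => //.
Qed.

End Components.

Section Replicas.
Variables (F : numClosedFieldType) (n' : nat).
Local Notation n := n'.+1.
Implicit Types (X Y Z A g V : 'M[F]_n) (M H : set 'M[F]_n) (p q : {mpoly F[n * n]}).

Lemma mxevalD p q A : mxeval (p + q) A = mxeval p A + mxeval q A.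
Proof. by rewrite /mxeval mevalD. Qed.

Lemma mxevalM p q A : mxeval (p * q) A = mxeval p A * mxeval q A.
Proof. by rewrite /mxeval mevalM. Qed.

Lemma mxevalZ c p A : mxeval (c *: p) A = c * mxeval p A.
Proof. by rewrite /mxeval mevalZ. Qed.

Lemma mxeval0 A : mxeval (0 : {mpoly F[n * n]}) A = 0.
Proof. by rewrite /mxeval meval0. Qed.

Lemma mxeval_sum (I : Type) (r : seq I) (P : pred I) (f : I -> {mpoly F[n * n]}) A :
  mxeval (\sum_(i <- r | P i) f i) A = \sum_(i <- r | P i) mxeval (f i) A.
Proof. by rewrite /mxeval raddf_sum. Qed.

Lemma mpoly_ext p q : (forall A, mxeval p A = mxeval q A) -> p = q.
Proof.
move=> pq; apply/eqP; rewrite -subr_eq0; apply/eqP; apply: mpoly_fun0 => A.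
by rewrite -scaleN1r mxevalD mxevalZ pq mulN1r subrr.
Qed.

Lemma ldiffZr Y a p q : ldiff Y (a *: p + q) = a *: ldiff Y p + ldiff Y q.
Proof.
rewrite !ldiff_def scaler_sumr -big_split; apply: eq_bigr => k _ /=.
by rewrite mderivD mderivZ mulrDl scalerAl.
Qed.

Lemma ldiffDl Y Z p : ldiff (Y + Z) p = ldiff Y p + ldiff Z p.
Proof.
move: {-2}(Y + Z) (erefl (Y + Z)) => W WE; apply: mpoly_ext => A.
rewrite [RHS]mxevalD (ldiffE Z) (ldiffE Y) (ldiffE W) WE.
by rewrite mulmxDr; have := dpDr p A (A *m Y) (A *m Z) 1; rewrite scale1r mul1r.
Qed.

Lemma ldiffM Y p q : ldiff Y (p * q) = ldiff Y p * q + p * ldiff Y q.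
Proof.
move: {-2}(p * q) (erefl (p * q)) => r rE; apply: mpoly_ext => A.
rewrite [RHS]mxevalD ![in RHS]mxevalM (ldiffE Y r) (ldiffE Y p) (ldiffE Y q) rE.
by rewrite dpM.
Qed.

Lemma ldiffC Y c : ldiff Y c%:MP = 0.
Proof.
by apply: mpoly_ext => A; rewrite ldiffE dpC mxeval0.
Qed.

Lemma ldiffD Y p q : ldiff Y (p + q) = ldiff Y p + ldiff Y q.
Proof. by have := ldiffZr Y 1 p q; rewrite !scale1r. Qed.

Lemma ldiff0 Y : ldiff Y 0 = 0.
Proof. by rewrite -mpolyC0 ldiffC. Qed.

Lemma ldiff_sum Y (I : Type) (r : seq I) (P : pred I) (f : I -> {mpoly F[n * n]}) :
  ldiff Y (\sum_(i <- r | P i) f i) = \sum_(i <- r | P i) ldiff Y (f i).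
Proof. by apply: (big_morph (ldiff Y)); [apply: ldiffD|apply: ldiff0]. Qed.

Definition mlin V i j : {mpoly F[n * n]} := \sum_k V k j *: 'X_(mxvec_index i k).

Lemma mlinE V i j A : mxeval (mlin V i j) A = (A *m V) i j.
Proof.
rewrite /mlin mxeval_sum mxE; apply: eq_bigr => k _.
by rewrite mxevalZ /mxeval mevalXU mxvecE mulrC.
Qed.

Lemma ldiff_mlin Y V i j : ldiff Y (mlin V i j) = mlin (Y *m V) i j.
Proof.
apply: mpoly_ext => A; rewrite ldiffE mlinE mulmxA mxE /dp.
rewrite /mlin [in LHS](eq_bigr (fun k => \sum_l V l j * (mxeval (mderiv k 'X_(mxvec_index i l)) A * mxvec (A *m Y) 0 k))); last first.
  move=> k _; rewrite raddf_sum mxeval_sum mulr_suml; apply: eq_bigr => l _ /=.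
  by rewrite mderivZ mxevalZ mulrA.
rewrite exchange_big /=; apply: eq_bigr => l _; rewrite -mulr_sumr mulrC.
congr (_ * _); have := dpX (mxvec_index i l) A (A *m Y); rewrite /dp => ->.
by rewrite mxvecE.
Qed.

Lemma mpolyX_mlin k : exists i j, 'X_k = mlin 1%:M i j.
Proof.
case/mxvec_indexP: k => i j; exists i, j; apply: mpoly_ext => A.
by rewrite mlinE mulmx1 /mxeval mevalXU mxvecE.
Qed.

Lemma ldiff_comm Y Z p : Y *m Z = Z *m Y -> ldiff Y (ldiff Z p) = ldiff Z (ldiff Y p).
Proof.
move=> YZ; elim/mpoly_ring_ind: p => [c|k|p q Hp Hq|p q Hp Hq].
- by rewrite !ldiffC ?ldiff0.
- by have [i [j ->]] := mpolyX_mlin k; rewrite !ldiff_mlin !mulmx1 YZ.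
- by rewrite !ldiffD Hp Hq.
- by rewrite !ldiffM !ldiffD !ldiffM Hp Hq; ring.
Qed.

Lemma iter_ldiffD Y k p q : iter k (ldiff Y) (p + q) = iter k (ldiff Y) p + iter k (ldiff Y) q.
Proof. by elim: k => //= k ->; rewrite ldiffD. Qed.

Lemma iter_ldiff0 Y k : iter k (ldiff Y) 0 = 0.
Proof. by elim: k => //= k ->; rewrite ldiff0. Qed.

Lemma iter_ldiff_ge Y k l p : iter k (ldiff Y) p = 0 -> (k <= l)%N -> iter l (ldiff Y) p = 0.
Proof. by move=> pk kl; rewrite -(subnK kl) iterD pk iter_ldiff0. Qed.

Lemma ldiff_nilp Y p : mnilp Y -> exists k, iter k (ldiff Y) p = 0.
Proof.
move=> nY; elim/mpoly_ring_ind: p => [c|k|p q [k pk] [l ql]|p q [k pk] [l ql]].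
- by exists 1%N; rewrite /= ldiffC.
- exists n; have [i [j ->]] := mpolyX_mlin k.
  have it m V : iter m (ldiff Y) (mlin V i j) = mlin (Y ^+ m *m V) i j.
    elim: m => [|m IH] /=; first by rewrite expr0 mul1mx.
    by rewrite IH ldiff_mlin exprS mulmxA.
  rewrite it nY mul0mx; apply: mpoly_ext => A; rewrite mlinE mulmx0 mxE.
  by rewrite mxeval0.
- exists (k + l)%N; rewrite iter_ldiffD (iter_ldiff_ge pk) ?leq_addr //.
  by rewrite (iter_ldiff_ge ql) ?leq_addl ?addr0.
- exists (k + l)%N; move: {2}(k + l)%N (erefl (k + l)%N) => m.
  elim: m k l p q pk ql => [|m IH] [|k] [|l] p q pk ql //= e.
  + by rewrite /= in pk; rewrite pk mul0r.
  + by rewrite /= in pk; rewrite pk mul0r -/(iter l.+1 (ldiff Y) 0) iter_ldiff0.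
  + by rewrite /= in ql; rewrite ql mulr0 -/(iter (k + 0).+1 (ldiff Y) 0) iter_ldiff0.
  + rewrite -/(iter (k + l.+1).+1 (ldiff Y) _) iterSr ldiffM iter_ldiffD.
    rewrite (IH k l.+1) //; [|by rewrite -iterSr|by move: e; lia].
    by rewrite -addSnnS (IH k.+1 l) ?addr0 //; [rewrite -iterSr|move: e; lia].
Qed.

Section Semisimple.
Variables (Q : 'M[F]_n) (lam : 'rV[F]_n).
Hypothesis uQ : Q \in unitmx.
Definition qdiag (x : 'rV[F]_n) : 'M[F]_n := Q *m diag_mx x *m invmx Q.
Definition wmu (a : 'I_n -> nat) : F := \sum_j (a j)%:R * lam 0 j.
Definition wchar (a : 'I_n -> nat) (x : 'rV[F]_n) : F := \prod_j x 0 j ^+ a j.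

(** Weight vectors for right translation by the whole diagonal torus attached to [Q], and not only
    for the derivation along [qdiag lam]; replicas come from comparing the two kinds of weights. *)
Definition wvec (a : 'I_n -> nat) p :=
  (forall g x, mxeval p (g *m qdiag x) = wchar a x * mxeval p g) /\
  ldiff (qdiag lam) p = wmu a *: p.

(** The polynomial ring is generated by the entries of [A *m Q], which are weight vectors, and
    weights add under products. *)
Lemma wvec_decomp p : exists l : seq (('I_n -> nat) * {mpoly F[n * n]}),
  p = \sum_(i < size l) (nth (fun _ => 0%N, 0) l i).2 /\
  forall i : 'I_(size l), wvec (nth (fun _ => 0%N, 0) l i).1 (nth (fun _ => 0%N, 0) l i).2.
Proof.
suff [I [a [f [-> wf]]]] : exists (I : finType) a (f : I -> {mpoly F[n * n]}), p = \sum_i f i /\ forall i, wvec (a i) (f i).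
  exists [seq (a i, f i) | i <- enum I]; split.
    rewrite [RHS](eq_bigr (fun i : 'I__ => snd (nth (fun _ => 0%N, 0) [seq (a i, f i) | i <- enum I] i))) //.
    rewrite -(big_mkord predT (fun i => snd (nth (fun _ => 0%N, 0) [seq (a i, f i) | i <- enum I] i))).
    by rewrite -(big_nth _ predT (fun z : _ * _ => z.2)) big_map big_enum.
  move=> [i ib] /=; rewrite size_map in ib.
  have i0 : I by case: (enum I) ib => // i0 _ _.
  by rewrite (nth_map i0) //=.
elim/mpoly_ring_ind: p => [c|k|p q|p q].
- exists unit, (fun _ _ => 0%N), (fun _ => c%:MP); split.
    by rewrite (big_pred1 tt) // => -[].
  move=> _; split=> [g x|]; last by rewrite ldiffC /wmu big1 ?scale0r // => j; rewrite mul0r.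
  by rewrite /mxeval !mevalC /wchar big1 ?mul1r.
- have [i [j ->]] := mpolyX_mlin k.
  exists 'I_n, (fun k l => (k == l) : nat), (fun k => invmx Q k j *: mlin Q i k); split.
    apply: mpoly_ext => A; rewrite mlinE mxeval_sum -{1}(mulmxV uQ) mulmxA mxE.
    by apply: eq_bigr => l _; rewrite mxevalZ mlinE mulrC.
  move=> l; split=> [g x|].
    rewrite !mxevalZ !mlinE mulrCA; congr (_ * _).
    rewrite /qdiag !mulmxA mulmxKV // mul_mx_diag mxE mulrC; congr (_ * _).
    by rewrite /wchar (bigD1 l) //= eqxx big1 ?mulr1 // => m /negPf; rewrite eq_sym => ->.
  rewrite -[_ *: mlin Q i l]addr0 ldiffZr ldiff0 !addr0 ldiff_mlin scalerA mulrC -scalerA.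
  congr (_ *: _); rewrite /qdiag mulmxKV //; apply: mpoly_ext => A.
  rewrite mxevalZ !mlinE mulmxA mul_mx_diag mxE mulrC; congr (_ * _).
  by rewrite /wmu (bigD1 l) //= eqxx mul1r big1 ?addr0 // => m /negPf; rewrite eq_sym => ->; rewrite mul0r.
- move=> [I [a [f [-> wf]]]] [J [b [g [-> wg]]]].
  exists (I + J)%type, (fun z => match z with inl i => a i | inr j => b j end),
    (fun z => match z with inl i => f i | inr j => g j end); split.
    by rewrite big_sumType.
  by case.
- move=> [I [a [f [-> wf]]]] [J [b [g [-> wg]]]].
  exists (I * J)%type, (fun z j => a z.1 j + b z.2 j)%N, (fun z => f z.1 * g z.2); split.
    by rewrite big_distrlr /= pair_big.
  move=> [i j] /=; have [fi1 fi2] := wf i; have [gj1 gj2] := wg j; split=> [h x|].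
    rewrite !mxevalM fi1 gj1 mulrACA; congr (_ * _).
    by rewrite /wchar -big_split; apply: eq_bigr => k _; rewrite exprD.
  rewrite ldiffM fi2 gj2 -scalerAl -scalerAr -scalerDl; congr (_ *: _).
  by rewrite /wmu -big_split; apply: eq_bigr => k _ /=; rewrite natrD mulrDl.
Qed.

Variables (nn : 'M[F]_n) (M : set 'M[F]_n).
Hypotheses (nnn : mnilp nn) (comm_n : qdiag lam *m nn = nn *m qdiag lam).
Hypotheses (aM : alg_group M) (lieM : lie_algebra M (qdiag lam + nn)).

(** Grouping weight vectors by [wmu] gives generalised eigenvectors of the derivation along
    [qdiag lam + nn], as its nilpotent part commutes with the semisimple one. This derivation
    preserves the ideal of [M], so the ideal contains each group. *)
Lemma replica_comp p : vanish M (mxeval p) ->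
  exists (r : seq F) (f : F -> {mpoly F[n * n]}), [/\ p = \sum_(mu <- r) f mu,
    forall mu, mu \in r -> vanish M (mxeval (f mu)),
    forall mu, mu \in r -> ldiff (qdiag lam) (f mu) = mu *: f mu &
    forall mu, mu \in r -> exists l : seq (('I_n -> nat) * {mpoly F[n * n]}),
      f mu = \sum_(i < size l) (nth (fun _ => 0%N, 0) l i).2 /\
      forall i : 'I_(size l), wvec (nth (fun _ => 0%N, 0) l i).1 (nth (fun _ => 0%N, 0) l i).2 /\
         wmu (nth (fun _ => 0%N, 0) l i).1 = mu].
Proof.
move=> pM; have [l [pl wl]] := wvec_decomp p.
pose nl i := nth (fun _ => 0%N, 0) l i.
pose r := undup [seq wmu (nl i).1 | i <- iota 0 (size l)].
pose f mu := \sum_(i < size l | wmu (nl i).1 == mu) (nl i).2.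
have fs mu : ldiff (qdiag lam) (f mu) = mu *: f mu.
  rewrite /f ldiff_sum scaler_sumr; apply: eq_bigr => i /eqP e.
  by rewrite (wl i).2 e.
have pr : p = \sum_(mu <- r) f mu.
  rewrite pl /f (exchange_big_dep predT) //=; apply: eq_bigr => i _.
  rewrite -big_filter (@eq_filter _ _ (pred1 (wmu (nl i).1))); last first.
    by move=> mu; rewrite /= eq_sym.
  rewrite filter_pred1_uniq ?undup_uniq ?big_seq1 // mem_undup.
  by apply/mapP; exists (nat_of_ord i); rewrite ?mem_iota ?add0n ?ltn_ord.
exists r, f; split=> //.
- apply: (@components_in F _ [set q | vanish M (mxeval q)] (ldiff (qdiag lam + nn))).
  + by move=> A _; rewrite mxeval0.
  + move=> a u v Iu Iv A MA; rewrite mxevalD mxevalZ Iu // Iv //.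
    by rewrite mulr0 addr0.
  + by move=> a u v; rewrite ldiffZr.
  + by move=> v Iv; apply: lie_ldiff => //; apply: alg_grp.
  + exact: undup_uniq.
  + move=> mu _; have [k fk] := ldiff_nilp (f mu) nnn; exists k.
    have : ldiff (qdiag lam) (iter k (ldiff nn) (f mu)) = mu *: iter k (ldiff nn) (f mu) /\
       iter k (fun v => ldiff (qdiag lam + nn) v - mu *: v) (f mu) = iter k (ldiff nn) (f mu).
      elim: k {fk} => [|k [IH1 IH2]] /=; first by rewrite fs.
      rewrite IH2 ldiffDl IH1 addrAC subrr add0r; split=> //.
      rewrite ldiff_comm // IH1 -[_ *: iter _ _ _]addr0 ldiffZr ldiff0 addr0.
      by [].
    by rewrite fk => -[].
  + by rewrite -pr.
- move=> mu mr; exists [seq nl i | i <- iota 0 (size l) & wmu (nl i).1 == mu]; split.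
    rewrite -(big_mkord predT (fun i => snd (nth (fun _ => 0%N, 0) [seq nl i | i <- iota 0 (size l) & wmu (nl i).1 == mu] i))).
    rewrite -(big_nth _ predT (fun z : _ * _ => z.2)) big_map big_filter.
    by rewrite /f -(big_mkord (fun i => wmu (nl i).1 == mu) (fun i => (nl i).2)) /index_iota subn0.
  move=> [i ib] /=; rewrite size_map in ib.
  rewrite (nth_map 0%N) //; set j := nth 0%N _ i.
  have : j \in [seq i <- iota 0 (size l) | wmu (nl i).1 == mu] by rewrite mem_nth.
  rewrite mem_filter mem_iota => /andP[/eqP e /andP[_ jb]].
  by split=> //; apply: (wl (Ordinal jb)).
Qed.

(** On an eigencomponent in the ideal, the derivations along [nn] and along the whole tangent vector
    differ by a scalar multiple, which vanishes at 1. *)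
Lemma replica_nilp : lie_algebra M nn.
Proof.
apply/lie_algebraP => p pM.
have [r [f [-> fM fs _]]] := replica_comp pM.
suff : mxeval (ldiff nn (\sum_(mu <- r) f mu)) 1%:M = 0 by rewrite ldiffE mul1mx.
rewrite ldiff_sum mxeval_sum big_seq big1 // => mu mr.
have M1 : M 1%:M by apply: grp1; apply: alg_grp.
have := lie_ldiff (alg_grp aM) lieM (fM mu mr) M1.
rewrite ldiffDl fs // mxevalD mxevalZ fM //.
by rewrite mulr0 add0r.
Qed.

(** All weight vectors in one eigencomponent have the same [wmu], hence the same [wchar] at [x].
    Translation by [qdiag x] therefore scales the component, whose value at 1 is 0. *)
Lemma replica (x : 'rV[F]_n) : (forall j, x 0 j != 0) ->
  (forall a b, wmu a = wmu b -> wchar a x = wchar b x) -> M (qdiag x).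
Proof.
move=> x0 xab; apply: alg_zcl => //; last first.
  rewrite /qdiag !unitmx_mul uQ unitmx_inv uQ andbT unitmxE det_diag unitfE.
  exact/prodf_neq0.
move=> h [p hp] hM; rewrite hp.
have [|r [f [-> fM _ fl]]] := @replica_comp p; first by move=> A MA; rewrite -hp hM.
rewrite mxeval_sum big_seq big1 // => mu mr.
have [l [fE lw]] := fl mu mr.
have M1 : M 1%:M by apply: grp1; apply: alg_grp.
have := fM mu mr _ M1; rewrite fE; case sl: (size l) fE lw => [|k] fE lw.
  by rewrite big_ord0 !mxeval0.
rewrite !mxeval_sum => f1.
rewrite (eq_bigr (fun i : 'I_k.+1 => wchar (nth (fun _ => 0%N, 0) l 0).1 x *
   mxeval (nth (fun _ => 0%N, 0) l i).2 1%:M)).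
  by rewrite -mulr_sumr f1 mulr0.
move=> i _; have [[wi _] ei] := lw i; have [_ e0] := lw ord0.
rewrite -[qdiag x]mul1mx wi; congr (_ * _); apply: xab.
by rewrite ei -e0.
Qed.

End Semisimple.
End Replicas.

(** * Jordan decomposition and one-parameter replicas *)

Section Jordan.
Variables (F : numClosedFieldType) (n' : nat).
Local Notation n := n'.+1.
Implicit Types (X Y Z A g V Q : 'M[F]_n) (M H : set 'M[F]_n).

Lemma poly_crt (rs : seq F) N : uniq rs ->
  exists P : {poly F}, forall c, c \in rs -> ('X - c%:P) ^+ N %| P - c%:P.
Proof.
elim: rs => [|a rs IH] /=; first by exists 0.
case/andP=> ars /IH[P HP].
pose W := \prod_(c <- rs) ('X - c%:P) ^+ N.
have co : coprimep W (('X - a%:P) ^+ N).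
  apply: coprimep_expr; rewrite /W; elim: (rs) ars => [|c l IHl] /=.
    by rewrite big_nil coprime1p.
  rewrite inE negb_or => /andP[ac al]; rewrite big_cons coprimepMl IHl // andbT.
  apply: coprimep_expl; rewrite coprimep_XsubC rootE !hornerE subr_eq0 //.
have [[u v] /= uv] := Bezout_eq1_coprimepP _ _ co.
exists (P + (a%:P - P) * (u * W)) => c; rewrite inE => /orP[/eqP->|crs].
  have -> : P + (a%:P - P) * (u * W) - a%:P = (P - a%:P) * v * ('X - a%:P) ^+ N.
    have -> : u * W = 1 - v * ('X - a%:P) ^+ N by rewrite -uv addrK.
    ring.
  by rewrite dvdp_mull.
rewrite addrAC dvdp_add ?HP // !dvdp_mull // /W (big_rem c) //= dvdp_mulr //.
Qed.

(** [P] is congruent to [c] modulo [(X - c)^N] for each eigenvalue [c]. Having the semisimple part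
    as a polynomial in [Y] makes it commute with everything that commutes with [Y]. *)
Lemma jordan Y : exists Q lam P, [/\ Q \in unitmx, qdiag Q lam = horner_mx Y P & mnilp (Y - qdiag Q lam)].
Proof.
have [rs rsE] := closed_field_poly_normal (char_poly Y).
rewrite (monicP (char_poly_monic Y)) scale1r in rsE.
pose us := undup rs; pose N := size rs.
have [P HP] := poly_crt N (undup_uniq rs).
pose W := \prod_(c <- us) ('X - c%:P).
have cW : char_poly Y %| W ^+ N.
  rewrite rsE /N; have : {subset rs <= us} by move=> c; rewrite mem_undup.
  elim: (rs) => [|c l IH] sub /=; first by rewrite big_nil dvd1p.
  rewrite big_cons exprS dvdp_mul //.
    by rewrite /W (big_rem c) ?sub ?mem_head //= dvdp_mulr.
  by apply: IH => x xl; apply: sub; rewrite inE xl orbT.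
have WY : horner_mx Y (W ^+ N) = 0.
  by case/dvdpP: cW => q ->; rewrite rmorphM /= Cayley_Hamilton mulr0.
have coW (R : {poly F}) : (forall c, c \in us -> ('X - c%:P) ^+ N %| R) -> W ^+ N %| R.
  rewrite /W -prodrXl; have := undup_uniq rs; rewrite -/us.
  elim: (us) => [|a l IHl] /=; first by rewrite big_nil dvd1p.
  case/andP=> al ul h; rewrite big_cons Gauss_dvdp ?h ?mem_head //=.
    by apply: IHl => // c cl; apply: h; rewrite inE cl orbT.
  apply: coprimep_expl; elim: (l) al => [|c l' IH'] /=.
    by rewrite big_nil coprimep1.
  rewrite inE negb_or => /andP[ac al']; rewrite big_cons coprimepMr IH' // andbT.
  apply: coprimep_expr; rewrite coprimep_sym coprimep_XsubC rootE !hornerE subr_eq0.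
  by [].
have sW : horner_mx (horner_mx Y P) W = 0.
  rewrite /W rmorph_prod /=.
  have -> : \prod_(c <- us) horner_mx (horner_mx Y P) ('X - c%:P) =
    horner_mx Y (\prod_(c <- us) (P - c%:P)).
    rewrite rmorph_prod; apply: eq_bigr => c _.
    by rewrite !rmorphB /= horner_mx_X !horner_mx_C.
  have /dvdpP[q ->] : W ^+ N %| \prod_(c <- us) (P - c%:P).
    by apply: coW => c cus; rewrite (big_rem c) //= dvdp_mulr // HP.
  by rewrite rmorphM /= WY mulr0.
have : diagonalizable (horner_mx Y P).
  apply/diagonalizableP; exists us; first exact: undup_uniq.
  by apply: mxminpoly_min.
case=> V uV /(diagonalizable_forLR uV)[d dE].
exists (invmx V), d, P; split.
- by rewrite unitmx_inv.
- by rewrite dE mxpoly.conjVmx // /qdiag invmxK.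
have -> : qdiag (invmx V) d = horner_mx Y P by rewrite dE mxpoly.conjVmx // /qdiag invmxK.
apply: (@mnilpP _ _ _ N).
have -> : (Y - horner_mx Y P) ^+ N = horner_mx Y (('X - P) ^+ N).
  by rewrite rmorphXn rmorphB /= horner_mx_X.
have /dvdpP[q ->] : W ^+ N %| ('X - P) ^+ N; last by rewrite rmorphM /= WY mulr0.
case: (posnP N) => [->|N0]; first by rewrite !expr0.
apply: coW => c cus; apply: dvdp_exp2r.
have -> : 'X - P = ('X - c%:P) - (P - c%:P) by ring.
rewrite dvdp_sub ?dvdpp //; apply: dvdp_trans (HP c cus).
by rewrite -{1}[_ - c%:P]expr1 dvdp_exp2l.
Qed.

Definition zindep r (w : nat -> F) := forall d : nat -> int,
  \sum_(k < r) (d k)%:~R * w k = 0 -> forall k, (k < r)%N -> d k = 0.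

(** If the next eigenvalue depends on the basis only up to a factor [N], the whole basis is divided
    by [N], which keeps all coefficients integral. *)
Lemma zbasis (lam : nat -> F) m : exists r (w : nat -> F) (c : nat -> nat -> int),
  zindep r w /\ forall j, (j < m)%N -> lam j = \sum_(k < r) (c k j)%:~R * w k.
Proof.
elim: m => [|m [r [w [c [iw cw]]]]].
  by exists 0%N, (fun _ => 0), (fun _ _ => 0); split=> // d _ k.
have [[N [d [N0 Nd]]]|nNd] := pselect (exists (N : int) (d : nat -> int), N != 0 /\
   N%:~R * lam m = \sum_(k < r) (d k)%:~R * w k).
  have NF : N%:~R != 0 :> F by rewrite intr_eq0.
  exists r, (fun k => w k / N%:~R), (fun k j => if j == m then d k else N * c k j); split.
    move=> e e0; apply: iw; apply: (mulIf (invr_neq0 NF)).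
    by rewrite mul0r mulr_suml -[RHS]e0; apply: eq_bigr => k _; rewrite mulrA.
  move=> j; rewrite ltnS leq_eqVlt => /orP[/eqP->|jm].
    apply: (mulfI NF); rewrite Nd mulr_sumr; apply: eq_bigr => k _; rewrite eqxx.
    by field.
  rewrite cw //; apply: eq_bigr => k _; rewrite ltn_eqF // intrM; by field.
exists r.+1, (fun k => if k == r then lam m else w k),
  (fun k j => if k == r then (j == m)%:R else if j == m then 0 else c k j); split.
  move=> d; rewrite big_ord_recr /= eqxx => dE.
  have dE' : \sum_(k < r) (d k)%:~R * w k = - ((d r)%:~R * lam m).
    apply/eqP; rewrite -addr_eq0; apply/eqP; rewrite -[RHS]dE; congr (_ + _).
    by apply: eq_bigr => k _; rewrite ltn_eqF.
  have dr : d r = 0.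
    apply/eqP; apply: contraT => drN; case: nNd; exists (- d r), d.
    by rewrite oppr_eq0 drN dE' rmorphN mulNr.
  move=> k; rewrite ltnS leq_eqVlt => /orP[/eqP->//|kr].
  by apply: iw kr; rewrite dE' dr mul0r oppr0.
move=> j; rewrite big_ord_recr /= eqxx ltnS leq_eqVlt => /orP[/eqP->|jm].
  rewrite eqxx mul1r big1 ?add0r // => k _; rewrite ltn_eqF // mul0r //.
rewrite (ltn_eqF jm) mul0r addr0 cw //; apply: eq_bigr => k _.
by rewrite ltn_eqF.
Qed.

Lemma qdiagM Q x y : Q \in unitmx ->
  qdiag Q x *m qdiag Q y = qdiag Q (\row_j (x 0 j * y 0 j)).
Proof.
move=> uQ; rewrite /qdiag !mulmxA mulmxKV //; congr (_ *m _).
by rewrite -!mulmxA; congr (_ *m _); rewrite mulmx_diag.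
Qed.

Lemma qdiag_comm Q (x y : 'rV[F]_n) g : Q \in unitmx -> (forall i j, x 0 i = x 0 j -> y 0 i = y 0 j) ->
  g *m qdiag Q x = qdiag Q x *m g -> g *m qdiag Q y = qdiag Q y *m g.
Proof.
move=> uQ xy gx.
pose h := invmx Q *m g *m Q.
have gE : g = Q *m h *m invmx Q by rewrite /h !mulmxA mulmxV // mul1mx mulmxK.
have hx : h *m diag_mx x = diag_mx x *m h.
  have -> : h *m diag_mx x = invmx Q *m (g *m qdiag Q x) *m Q.
    by rewrite /h /qdiag !mulmxA mulmxKV.
  by rewrite gx /h /qdiag !mulmxA mulVmx // mul1mx.
move: h hx gE => h hx gE.
have hy : h *m diag_mx y = diag_mx y *m h.
  apply/matrixP => i j; move/matrixP/(_ i j): hx.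
  rewrite !mul_mx_diag !mul_diag_mx !mxE => /eqP; rewrite mulrC -subr_eq0 -mulrBl mulf_eq0.
  case/orP=> [|/eqP->]; last by rewrite mul0r mulr0.
  by rewrite subr_eq0 => /eqP/xy ->; rewrite mulrC.
by rewrite gE /qdiag !mulmxA !mulmxKV // -(mulmxA Q h) hy mulmxA.
Qed.

Definition qexp Q (c : 'I_n -> int) (b : F) := qdiag Q (\row_j b ^ c j).

(** In an integral basis [w] of the eigenvalues, a relation among eigenvalues with integer
    coefficients holds for each row [c k] separately; hence each one-parameter torus [qexp Q (c k)]
    consists of replicas of the semisimple part. *)
Lemma replicas M Y : alg_group M -> lie_algebra M Y ->
  exists Q lam nn r (w : nat -> F) (c : nat -> 'I_n -> int),
  [/\ [/\ Q \in unitmx, Y = qdiag Q lam + nn, mnilp nn & lie_algebra M nn],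
      zindep r w, forall j, lam 0 j = \sum_(k < r) (c k j)%:~R * w k,
      forall k b, (k < r)%N -> b != 0 -> M (qexp Q (c k) b) &
      forall g, g *m Y = Y *m g -> g *m qdiag Q lam = qdiag Q lam *m g /\
        forall k b, (k < r)%N -> g *m qexp Q (c k) b = qexp Q (c k) b *m g].
Proof.
move=> aM MY; have [Q [lam [P [uQ sE nN]]]] := jordan Y.
have [r [w [c [iw cw]]]] := zbasis (fun j => lam 0 (inord j)) n.
have cE j : lam 0 j = \sum_(k < r) (c k j)%:~R * w k by rewrite -cw ?inord_val.
have com : qdiag Q lam *m (Y - qdiag Q lam) = (Y - qdiag Q lam) *m qdiag Q lam.
  rewrite mulmxBl mulmxBr sE; congr (_ - _).
  by apply: comm_horner_mx; apply: comm_mx_refl.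
have MY' : lie_algebra M (qdiag Q lam + (Y - qdiag Q lam)) by rewrite addrC subrK.
exists Q, lam, (Y - qdiag Q lam), r, w, (fun k j => c k j).
split=> //.
- by split=> //; [rewrite addrC subrK|apply: (replica_nilp uQ nN com aM MY')].
- move=> k b kr b0; apply: (replica uQ nN com aM MY').
    by move=> j; rewrite mxE expfz_neq0.
  move=> a a' aa'.
  have wE (d : 'I_n -> nat) : wchar d (\row_j b ^ c k j) = b ^ (\sum_(j < n) c k j * d j).
    rewrite (big_morph (fun m => b ^ m) (fun m n => expfzDr m n b0) (expr0z b)).
    by apply: eq_bigr => j _; rewrite mxE -exprz_exp.
  rewrite !wE; congr (b ^ _).
  have muE (d : 'I_n -> nat) : wmu lam d = \sum_(l < r) (\sum_(j < n) c l j * d j)%:~R * w l.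
    rewrite /wmu; under eq_bigr do rewrite cE mulr_sumr.
    rewrite exchange_big /=; apply: eq_bigr => l _.
    rewrite rmorph_sum mulr_suml; apply: eq_bigr => j _ /=.
    by rewrite rmorphM /= mulrA [(d j)%:R * _]mulrC.
  move: aa'; rewrite !muE => /eqP; rewrite -subr_eq0 -sumrB => /eqP aa'.
  apply/eqP; rewrite -subr_eq0; apply/eqP.
  apply: (iw (fun l => \sum_(j < n) c l j * a j - \sum_(j < n) c l j * a' j)) kr.
  by rewrite -[RHS]aa'; apply: eq_bigr => l _; rewrite rmorphB mulrBl.
move=> g gY; have gs : g *m qdiag Q lam = qdiag Q lam *m g.
  by rewrite sE; apply: comm_mx_horner.
split=> // k b kr; apply: (qdiag_comm uQ _ gs) => i j; rewrite !mxE !cE => /eqP.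
rewrite -subr_eq0 -sumrB => /eqP h; congr (b ^ _); apply/eqP; rewrite -subr_eq0; apply/eqP.
apply: (iw (fun l => c l i - c l j)) kr.
by rewrite -[RHS]h; apply: eq_bigr => l _; rewrite rmorphB mulrBl.
Qed.

End Jordan.

(** * Tori *)

Section Monomials.
Variable F : numClosedFieldType.

Definition nz m (x : 'rV[F]_m) := forall j, x 0 j != 0.

(** The homomorphism of split tori with exponent matrix [S]; composition is matrix multiplication by
    [mono_comp]. *)
Definition mono m k (x : 'rV[F]_m) (S : 'M[int]_(m, k)) : 'rV[F]_k :=
  \row_l \prod_j x 0 j ^ S j l.

Lemma mono_nz m k (x : 'rV[F]_m) (S : 'M[int]_(m, k)) : nz x -> nz (mono x S).
Proof. by move=> x0 l; rewrite mxE; apply/prodf_neq0 => j _; apply: expfz_neq0. Qed.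

Lemma exprz_sum (I : finType) (f : I -> int) (b : F) : b != 0 ->
  b ^ (\sum_i f i) = \prod_i b ^ f i.
Proof.
by move=> b0; apply: (big_morph (fun m => b ^ m) (fun m n => expfzDr m n b0) (expr0z b)).
Qed.

Lemma exprz_prod (I : finType) (f : I -> F) (d : int) :
  (\prod_i f i) ^ d = \prod_i f i ^ d.
Proof.
by apply: (big_morph (fun y => y ^ d)) => [u v|]; rewrite ?expfzMl ?exp1rz.
Qed.

Lemma mono_comp m k l (x : 'rV[F]_m) (S : 'M[int]_(m, k)) (R : 'M[int]_(k, l)) :
  nz x -> mono (mono x S) R = mono x (S *m R).
Proof.
move=> x0; apply/rowP => i; rewrite !mxE.
under eq_bigr do rewrite mxE exprz_prod.
rewrite exchange_big /=; apply: eq_bigr => j _; rewrite mxE exprz_sum //.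
by apply: eq_bigr => h _; rewrite exprz_exp.
Qed.

Lemma mono1 m (x : 'rV[F]_m) : mono x 1%:M = x.
Proof.
apply/rowP => i; rewrite !mxE (bigD1 i) //= mxE eqxx expr1z big1 ?mulr1 // => j /negPf ji.
by rewrite mxE ji expr0z.
Qed.

Lemma rootz (y : F) (d : int) : d != 0 -> y != 0 -> exists2 x, x != 0 & x ^ d = y.
Proof.
move=> d0 y0.
have rt m z : z != 0 -> exists2 x : F, x != 0 & x ^+ m.+1 = z.
  move=> z0; exists (m.+1.-root z); last by rewrite rootCK.
  by rewrite rootC_eq0.
case: d d0 => [[|m]|m] // _; first by have [x x0 xE] := rt m y y0; exists x.
by have [x x0 xE] := rt m y^-1 (invr_neq0 y0); exists x => //; rewrite -[LHS]/((x ^+ m.+1)^-1) xE invrK.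
Qed.

(** In Smith normal form the map raises coordinates to the powers [d_i]. It is onto where [d_i] is
    nonzero, since roots exist, and constantly 1 elsewhere; [fr] marks the former coordinates. *)
Lemma tor_smith r m (A : 'M[int]_(r, m)) : exists (R S : 'M[int]_m) (fr : pred 'I_m),
  [/\ R *m S = 1%:M, S *m R = 1%:M &
  forall x : 'rV[F]_m, (exists2 c : 'rV[F]_r, nz c & x = mono c A) <->
    nz x /\ forall k, ~~ fr k -> mono x S 0 k = 1].
Proof.
have [L uL [R uR [d _ AE]]] := int_Smith_normal_form A.
set D := (\matrix_(i, j) _) in AE.
have D0 i (k : 'I_m) : ~~ [exists i : 'I_r, (i == k :> nat) && (d`_i != 0)] -> D i k = 0.
  move=> frk; rewrite mxE; have [ik|] := eqVneq (i : nat) k; last by rewrite mulr0n.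
  have [->|di] := eqVneq d`_i 0; first by rewrite mul0rn.
  by case/negP: frk; apply/existsP; exists i; rewrite di andbT; apply/eqP.
exists R, (invmx R), (fun k : 'I_m => [exists i : 'I_r, (i == k :> nat) && (d`_i != 0)]).
split; [exact: mulmxV|exact: mulVmx|move=> x; split].
  move=> [c c0 ->]; split=> [|k]; first exact: mono_nz.
  rewrite mono_comp // AE mulmxK // -mono_comp // => frk.
  by rewrite mxE big1 // => i _; rewrite D0 // expr0z.
move=> [x0 xS].
have y0 := mono_nz (invmx R) x0.
pose y := mono x (invmx R).
have /choice[c' c'P] : forall i : 'I_r, exists c : F, c != 0 /\
   forall k : 'I_m, (i == k :> nat) -> d`_i != 0 -> c ^ d`_i = y 0 k.
  move=> i; have [im|im] := ltnP i m; last first.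
    by exists 1; split=> [|k /eqP ik]; rewrite ?oner_neq0 //; move: (ltn_ord k); rewrite -ik ltnNge im.
  have [di|di] := eqVneq d`_i 0; first by exists 1; rewrite oner_neq0.
  have [c cN cE] := rootz di (y0 (Ordinal im)).
  by exists c; split=> // k /eqP ik _; rewrite cE; congr (_ 0 _); apply: val_inj.
pose c1 := \row_i c' i.
have c10 : nz c1 by move=> i; rewrite mxE; have [] := c'P i.
exists (mono c1 (invmx L)); first exact: mono_nz.
rewrite mono_comp // AE !mulmxA mulVmx // mul1mx -mono_comp //.
have -> : mono c1 D = y.
  apply/rowP => k; rewrite mxE.
  have [frk|frk] := boolP [exists i : 'I_r, (i == k :> nat) && (d`_i != 0)].
    case/existsP: frk => i /andP[ik di].
    rewrite (bigD1 i) //= [c1 0 i]mxE [D i k]mxE ik mulr1n (proj2 (c'P i) k ik di) big1 ?mulr1 // => j ji.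
    rewrite !mxE; have [jk|] := eqVneq (j : nat) k; last by rewrite mulr0n expr0z.
    by case/eqP: ji; apply: val_inj; rewrite /= jk (eqP ik).
  by rewrite [RHS]xS // big1 // => i _; rewrite D0 // expr0z.
by rewrite /y mono_comp // mulVmx // mono1.
Qed.

Section Regular.
Variables (m : nat) (S : set 'M[F]_m).
Implicit Types (f h : 'M[F]_m -> F).

Definition gregular f := exists p q, [/\ polyf p, polyf q, forall A, S A -> q A != 0 &
  forall A, S A -> f A = p A / q A].

Lemma gregular_on f : gregular f -> regular_on S f.
Proof.
move=> [p [q [[p' pp] [q' qp] q0 fE]]] x Sx; exists p', q'; rewrite -qp; split.
  exact: q0.
by move=> y Sy _; rewrite fE // pp qp.
Qed.

Lemma gregular_poly f : polyf f -> gregular f.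
Proof.
move=> fp; exists f, (fun _ => 1); split=> //; first exact: polyfC.
  by move=> A _; rewrite oner_neq0.
by move=> A _; rewrite divr1.
Qed.

Lemma gregular_ext f h : (forall A, S A -> f A = h A) -> gregular f -> gregular h.
Proof. by move=> fh [p [q [pp pq q0 fE]]]; exists p, q; split=> // A SA; rewrite -fh // fE. Qed.

Lemma gregularM f h : gregular f -> gregular h -> gregular (fun A => f A * h A).
Proof.
move=> [p [q [pp pq q0 fE]]] [p' [q' [pp' pq' q0' hE]]].
exists (fun A => p A * p' A), (fun A => q A * q' A); split; try exact: polyfM.
  by move=> A SA; rewrite mulf_neq0 ?q0 ?q0'.
by move=> A SA; rewrite fE // hE // mulf_div.
Qed.

Lemma gregularD f h : gregular f -> gregular h -> gregular (fun A => f A + h A).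
Proof.
move=> [p [q [pp pq q0 fE]]] [p' [q' [pp' pq' q0' hE]]].
exists (fun A => p A * q' A + p' A * q A), (fun A => q A * q' A); split.
- by apply: polyfD; apply: polyfM.
- exact: polyfM.
- by move=> A SA; rewrite mulf_neq0 ?q0 ?q0'.
- by move=> A SA; rewrite fE // hE // addf_div ?q0 ?q0'.
Qed.

Lemma gregular_sum (I : Type) (r : seq I) (f : I -> 'M[F]_m -> F) :
  (forall i, gregular (f i)) -> gregular (fun A => \sum_(i <- r) f i A).
Proof.
move=> fr; elim: r => [|i r IH].
  by apply: gregular_ext (gregular_poly (polyfC 0)) => A _; rewrite big_nil.
by apply: gregular_ext (gregularD (fr i) IH) => A _; rewrite big_cons.
Qed.

Lemma gregular_prod (I : Type) (r : seq I) (f : I -> 'M[F]_m -> F) :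
  (forall i, gregular (f i)) -> gregular (fun A => \prod_(i <- r) f i A).
Proof.
move=> fr; elim: r => [|i r IH].
  by apply: gregular_ext (gregular_poly (polyfC 1)) => A _; rewrite big_nil.
by apply: gregular_ext (gregularM (fr i) IH) => A _; rewrite big_cons.
Qed.

Lemma gregularXz f (d : int) : polyf f -> (forall A, S A -> f A != 0) ->
  gregular (fun A => f A ^ d).
Proof.
move=> fp f0; case: d => d; first by apply: gregular_poly; apply: polyfX.
exists (fun _ => 1), (fun A => f A ^+ d.+1); split.
- exact: polyfC.
- exact: polyfX.
- by move=> A SA; rewrite expf_neq0 ?f0.
- by move=> A SA; rewrite div1r.
Qed.

End Regular.
End Monomials.

Section Tori.
Variables (F : numClosedFieldType) (n' : nat).
Local Notation n := n'.+1.
Implicit Types (X Y Z A g V Q t : 'M[F]_n) (M H T : set 'M[F]_n) (x y : 'rV[F]_n).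

Definition qcoord Q t : 'rV[F]_n := \row_j (invmx Q *m t *m Q) j j.

Lemma qcoordK Q x : Q \in unitmx -> qcoord Q (qdiag Q x) = x.
Proof.
move=> uQ; apply/rowP => j; rewrite mxE /qdiag !mulmxA mulVmx // mul1mx mulmxKV //.
by rewrite mxE eqxx.
Qed.

Lemma polyf_qcoord Q j : polyf (fun t => qcoord Q t 0 j).
Proof.
apply: polyf_ext (polymapM (polymapM (polymapC (invmx Q)) polymap_id) (polymapC Q) j j) => t.
by rewrite [RHS]mxE.
Qed.

Lemma qdiag_inj Q x y : Q \in unitmx -> qdiag Q x = qdiag Q y -> x = y.
Proof. by move=> uQ e; rewrite -(qcoordK x uQ) e qcoordK. Qed.

Lemma qdiag1 Q : Q \in unitmx -> qdiag Q (const_mx 1) = 1%:M.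
Proof. by move=> uQ; rewrite /qdiag diag_const_mx mulmx1 mulmxV. Qed.

Lemma qdiag_unit Q x : Q \in unitmx -> (qdiag Q x \in unitmx) <-> nz x.
Proof.
move=> uQ; rewrite /qdiag !unitmx_mul uQ unitmx_inv uQ andbT unitmxE det_diag unitfE.
by split=> [/prodf_neq0 h j|h]; [apply: h|apply/prodf_neq0 => j _; apply: h].
Qed.

Lemma qdiagV Q x : Q \in unitmx -> nz x -> invmx (qdiag Q x) = qdiag Q (\row_j (x 0 j)^-1).
Proof.
move=> uQ x0; have ux : qdiag Q x \in unitmx by apply/qdiag_unit.
apply: (can_inj (mulKmx ux)); rewrite mulmxV // qdiagM // -(qdiag1 uQ).
by congr qdiag; apply/rowP => j; rewrite !mxE mulfV.
Qed.

(* The torus with parameters [c k] for [k] in [fr], acting on the [j]-th column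
   of [Q] by the monomial [\prod_k c k ^ R k j]; the unimodularity of [R] makes
   the monomials [mono x S] coordinates on it. *)
Definition torN Q (S : 'M[int]_n) (fr : pred 'I_n) : set 'M[F]_n :=
  [set t | exists2 x, nz x /\ (forall k, ~~ fr k -> mono x S 0 k = 1) & t = qdiag Q x].

Section Normal.
Variables (Q : 'M[F]_n) (R S : 'M[int]_n) (fr : pred 'I_n).
Hypotheses (uQ : Q \in unitmx) (RS : R *m S = 1%:M) (SR : S *m R = 1%:M).

Lemma monoM k (x y : 'rV[F]_n) (B : 'M[int]_(n, k)) :
  mono (\row_j (x 0 j * y 0 j)) B = \row_l (mono x B 0 l * mono y B 0 l).
Proof.
apply/rowP => l; rewrite !mxE -big_split; apply: eq_bigr => j _ /=.
by rewrite !mxE expfzMl.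
Qed.

Lemma monoV k (x : 'rV[F]_n) (B : 'M[int]_(n, k)) :
  mono (\row_j (x 0 j)^-1) B = \row_l (mono x B 0 l)^-1.
Proof.
apply/rowP => l; rewrite !mxE -prodfV; apply: eq_bigr => j _ /=.
by rewrite !mxE exprz_inv invr_expz.
Qed.

Lemma torN_alg : alg_group (torN Q S fr).
Proof.
apply/alg_groupP; split.
  split.
  - by move=> _ [x [x0 _] ->]; apply/qdiag_unit.
  - exists (const_mx 1); last by rewrite qdiag1.
    split=> [j|k _]; first by rewrite mxE oner_neq0.
    by rewrite mxE big1 // => j _; rewrite mxE exp1rz.
  - move=> _ _ [x [x0 xS] ->] [y [y0 yS] ->]; rewrite qdiagM //; eexists; last by [].
    split=> [j|k kf]; first by rewrite mxE mulf_neq0.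
    by rewrite monoM mxE xS // yS // mulr1.
  - move=> _ [x [x0 xS] ->]; rewrite qdiagV //; eexists; last by [].
    split=> [j|k kf]; first by rewrite mxE invr_neq0.
    by rewrite monoV mxE xS // invr1.
move=> t [zt ut]; have tE : t = qdiag Q (qcoord Q t).
  suff h i j : i != j -> (invmx Q *m t *m Q) i j = 0.
    rewrite /qdiag; have -> : diag_mx (qcoord Q t) = invmx Q *m t *m Q.
      apply/matrixP => i j; rewrite mxE; have [->|ij] := eqVneq i j; first by rewrite [LHS]mxE.
      by rewrite h.
    by rewrite !mulmxA mulmxV // mul1mx mulmxK.
  move=> ij; apply: (zt (fun t => (invmx Q *m t *m Q) i j)).
    exact: (polymapM (polymapM (polymapC (invmx Q)) polymap_id) (polymapC Q) i j).
  move=> _ [x _ ->]; rewrite /qdiag !mulmxA mulVmx // mul1mx mulmxKV //.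
  by rewrite mxE (negPf ij).
have x0 : nz (qcoord Q t) by apply/(qdiag_unit _ uQ); rewrite -tE.
exists (qcoord Q t) => //; split=> // k kf.
(* The Laurent monomial is a quotient [pp / pn] of honest monomials, so that the condition of being
   1 becomes a polynomial equation. *)
pose pp (x : 'rV[F]_n) := \prod_j x 0 j ^+ (if S j k is Posz m then m else 0%N).
pose pn (x : 'rV[F]_n) := \prod_j x 0 j ^+ (if S j k is Negz m then m.+1 else 0%N).
have monoE x : nz x -> mono x S 0 k = pp x / pn x.
  move=> xN; rewrite mxE /pp /pn -prodf_div; apply: eq_bigr => j _.
  by case: (S j k) => d; rewrite ?expr0 ?divr1 ?div1r.
have pnN x : nz x -> pn x != 0.
  by move=> xN; apply/prodf_neq0 => j _; rewrite expf_neq0.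
rewrite monoE //; have : pp (qcoord Q t) - pn (qcoord Q t) = 0.
  apply: (zt (fun t => pp (qcoord Q t) - pn (qcoord Q t))).
    by apply: polyfB; apply: polyf_prod => j _; apply: polyfX; apply: polyf_qcoord.
  move=> _ [x [xN xS] ->]; rewrite qcoordK //; have := xS k kf; rewrite monoE // => /eqP.
  by rewrite -subr_eq0 -(divff (pnN x xN)) -mulrBl mulf_eq0 invr_eq0 (negPf (pnN x xN)) orbF => /eqP.
by move/eqP; rewrite subr_eq0 => /eqP ->; rewrite divff ?pnN.
Qed.

Lemma torN_torus : torus (torN Q S fr).
Proof.
split; first exact: torN_alg.
exists #|fr|.
(* The diagonal entries of [D] are the coordinates in [fr]; all other coordinates default to 1. *)
pose cc (D : 'M[F]_#|fr|) (k : 'I_n) : F :=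
  if [pick i : 'I_#|fr| | enum_val i == k] is Some i then D i i else 1.
have ccf D i : cc D (enum_val i) = D i i.
  rewrite /cc; case: pickP => [j /eqP/enum_val_inj -> //|/(_ i)].
  by rewrite eqxx.
have ccN D k : ~~ fr k -> cc D k = 1.
  move=> kf; rewrite /cc; case: pickP => // j /eqP jk.
  by move: (enum_valP j); rewrite jk /in_mem /= (negPf kf).
have cc0 D k : @diag_group F _ D -> cc D k != 0.
  move=> [dD uD]; rewrite /cc; case: pickP => [i _|]; last by rewrite oner_neq0.
  move: uD; move/is_diag_mxP: dD => dD.
  have -> : D = diag_mx (\row_i D i i).
    apply/matrixP => a b; rewrite !mxE; have [->|ab] := eqVneq a b; rewrite ?mulr1n //.
    by rewrite mulr0n dD.
  by rewrite unitmxE det_diag unitfE => /prodf_neq0/(_ i isT); rewrite !mxE eqxx mulr1n.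
exists (fun t => diag_mx (\row_i mono (qcoord Q t) S 0 (enum_val i))).
exists (fun D => qdiag Q (mono (\row_k cc D k) R)).
have ccz D : @diag_group F _ D -> nz (\row_k cc D k).
  by move=> dD k; rewrite mxE cc0.
have ccM D E : @diag_group F _ D -> @diag_group F _ E ->
    \row_k cc (D *m E) k = \row_j ((\row_k cc D k) 0 j * (\row_k cc E k) 0 j) :> 'rV[F]_n.
  move=> [/is_diag_mxP dD _] _; apply/rowP => k; rewrite !mxE.
  rewrite /cc; case: pickP => [i _|_]; last by rewrite mulr1.
  by rewrite mxE (bigD1 i) //= big1 ?addr0 // => j ji; rewrite dD ?mul0r // eq_sym.
split.
- split.
  + move=> _ [x [x0 xS] ->]; rewrite qcoordK //; split; first exact: diag_mx_is_diag.
    rewrite unitmxE det_diag unitfE; apply/prodf_neq0 => i _; rewrite mxE.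
    exact: mono_nz.
  + move=> _ _ [x [x0 xS] ->] [y [y0 yS] ->]; rewrite qdiagM // !qcoordK // monoM mulmx_diag.
    by congr diag_mx; apply/rowP => i; rewrite !mxE.
  + move=> i j; apply: gregular_on; have [->|ij] := eqVneq i j; last first.
      by apply: gregular_ext (gregular_poly _ (polyfC 0)) => t _; rewrite !mxE (negPf ij).
    apply: (@gregular_ext _ _ _ (fun t => \prod_l qcoord Q t 0 l ^ S l (enum_val j))).
      by move=> t _; rewrite !mxE eqxx mulr1n.
    apply: gregular_prod => l; apply: gregularXz; first exact: polyf_qcoord.
    by move=> _ [x [x0 xS] ->]; rewrite qcoordK.
- split.
  + move=> D dD; exists (mono (\row_k cc D k) R) => //; split=> [|k kf].
      by apply: mono_nz; apply: ccz.
    by rewrite mono_comp ?RS ?mono1 ?mxE ?ccN //; apply: ccz.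
  + move=> D E dD dE; rewrite qdiagM // -monoM; congr (qdiag Q (mono _ R)).
    exact: ccM.
  + move=> i j; apply: gregular_on.
    apply: (@gregular_ext _ _ _ (fun D => \sum_l Q i l * (\prod_k cc D k ^ R k l) * invmx Q l j)).
      move=> D _; rewrite /qdiag mul_mx_diag [RHS]mxE; apply: eq_bigr => l _.
      by rewrite mxE; congr (_ * _ * _); rewrite mxE; apply: eq_bigr => k _; rewrite mxE.
    apply: gregular_sum => l; apply: gregularM; last exact: gregular_poly (polyfC _).
    apply: gregularM; first exact: gregular_poly (polyfC _).
    apply: gregular_prod => k; apply: gregularXz; last by move=> D dD; apply: cc0.
    rewrite /cc; case: pickP => [h _|_]; first exact: polyf_entry.
    exact: polyfC.
- move=> _ [x [x0 xS] ->]; rewrite qcoordK //; congr qdiag.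
  rewrite -[RHS]mono1 -SR -mono_comp //; congr mono; apply/rowP => k; rewrite mxE.
  have [kf|kf] := boolP (fr k); last by rewrite ccN // xS.
  have kf' : k \in fr by [].
  by rewrite -(enum_rankK_in kf' kf') ccf !mxE eqxx mulr1n.
- move=> D dD; rewrite qcoordK // mono_comp; last exact: ccz.
  rewrite RS mono1; case: dD => /is_diag_mxP dD _.
  apply/matrixP => i j; rewrite !mxE; have [->|ij] := eqVneq i j; first by rewrite mulr1n ccf.
  by rewrite mulr0n dD.
Qed.

End Normal.
End Tori.

(** * Parametrisation of tori by monomials, and maximal tori *)

Section TorusNormalForm.
Variables (F : numClosedFieldType) (n' : nat).
Local Notation n := n'.+1.
Implicit Types (X Y Z A g V Q t : 'M[F]_n) (M H T G : set 'M[F]_n) (x y : 'rV[F]_n).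

Definition locrat (u : F -> F) := forall c0, c0 != 0 -> exists p q : {poly F},
  q.[c0] != 0 /\ forall c, c != 0 -> q.[c] != 0 -> u c = p.[c] / q.[c].

(** The reduced fraction that represents [u] near 1 represents it everywhere, so its denominator
    vanishes at most at 0 and is a multiple of a power of the indeterminate. *)
Lemma laurent (u : F -> F) : locrat u ->
  exists (P : {poly F}) N, forall c, c != 0 -> u c = P.[c] / c ^+ N.
Proof.
move=> ru; have [p [q [q1 uE]]] := ru 1 (oner_neq0 _).
have qN0 : q != 0 by apply: contraNneq q1 => ->; rewrite horner0.
pose g := gcdp p q; pose p1 := p %/ g; pose r := q %/ g.
have gN0 : g != 0 by rewrite gcdp_eq0 negb_and qN0 orbT.
have pE : p = p1 * g by rewrite divpK ?dvdp_gcdl.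
have qE : q = r * g by rewrite divpK ?dvdp_gcdr.
have co : coprimep p1 r by apply: coprimep_div_gcd; rewrite qN0 orbT.
have loc c1 : c1 != 0 -> exists p2 q2 : {poly F},
   [/\ q2.[c1] != 0, u c1 = p2.[c1] / q2.[c1] & p1 * q2 = p2 * r].
  move=> c10; have [p2 [q2 [q20 uE2]]] := ru c1 c10; exists p2, q2; split=> //; first exact: uE2.
  have q2N0 : q2 != 0 by apply: contraNneq q20 => ->; rewrite horner0.
  apply/eqP; rewrite -subr_eq0; apply/eqP.
  have dN0 : 'X * q * q2 != 0 by rewrite !mulf_neq0 ?polyX_eq0.
  apply: (poly_inf_ne dN0) => c; rewrite !hornerM hornerX !mulf_eq0 !negb_or.
  move=> /andP[/andP[c0 qc] q2c]; have := uE c c0 qc; rewrite (uE2 c c0 q2c).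
  move: qc; rewrite qE pE !hornerM mulf_eq0 negb_or => /andP[rc gc].
  rewrite invfM mulrACA mulfV // mulr1 => /eqP.
  by rewrite eqr_div // => /eqP e; rewrite hornerD hornerN !hornerM -e subrr.
have rN c : c != 0 -> r.[c] != 0.
  move=> c0; apply/negP => /eqP rc; have [p2 [q2 [q20 _ e]]] := loc c c0.
  have : (p1 * q2).[c] = 0 by rewrite e hornerM rc mulr0.
  rewrite hornerM => /eqP; rewrite mulf_eq0 (negPf q20) orbF => p1c.
  by have := coprimep_root co p1c; rewrite rc eqxx.
have u1 c : c != 0 -> u c = p1.[c] / r.[c].
  move=> c0; have [p2 [q2 [q20 -> e]]] := loc c c0.
  apply/eqP; rewrite eqr_div ?rN //; apply/eqP.
  by rewrite -!hornerM -e.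
have rN0 : r != 0 by apply: contraNneq (rN 1 (oner_neq0 _)) => ->; rewrite horner0.
have [rs rsE] := closed_field_poly_normal r.
have {}rsE : r = lead_coef r *: 'X^(size rs).
  rewrite {1}rsE; congr (_ *: _).
  have : all (pred1 0) rs.
    apply/allP => z zr; apply: contraT => zN; have := rN z zN.
    by rewrite rsE hornerZ horner_prod (big_rem z) //= hornerXsubC subrr mul0r mulr0 eqxx.
  elim: (rs) => [_|z s IH /= /andP[/eqP-> /IH h]]; first by rewrite big_nil expr0.
  by rewrite big_cons h subr0 exprS.
exists ((lead_coef r)^-1 *: p1), (size rs) => c c0; rewrite u1 // hornerZ.
rewrite {1}rsE hornerZ hornerXn invfM mulrA; congr (_ / _); rewrite mulrC //.
Qed.

Lemma mx_coef0 K (C : nat -> 'M[F]_n) :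
  (forall c, c != 0 -> \sum_(k < K) c ^+ k *: C k = 0) -> forall k, (k < K)%N -> C k = 0.
Proof.
move=> h k kK; pose C' i := if i is j.+1 then C j else 0.
have s0 : subsp [set (0 : 'M[F]_n)] by split=> // a X Y -> ->; rewrite scaler0 addr0.
apply: (@subsp_coef _ _ _ K.+1 C' s0 _ k.+1) => // c.
rewrite big_ord_recl scaler0 add0r.
have [->|c0] := eqVneq c 0; first by rewrite big1 // => i _; rewrite exprS mul0r scale0r.
transitivity (c *: \sum_(k < K) c ^+ k *: C k); last by rewrite h // scaler0.
by rewrite scaler_sumr; apply: eq_bigr => i _; rewrite scalerA -exprS.
Qed.

(** Multiplicativity makes the Laurent coefficients orthogonal idempotents with sum 1. After
    simultaneous diagonalisation each basis vector belongs to exactly one of them, and its weight is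
    that index shifted by the pole order [N]. *)
Lemma gm_hom (gam : F -> 'M[F]_n) : (forall i j, locrat (fun c => gam c i j)) ->
  (forall c d, c != 0 -> d != 0 -> gam (c * d) = gam c *m gam d) -> gam 1 = 1%:M ->
  exists Q a, Q \in unitmx /\ forall c, c != 0 -> gam c = qexp Q a c.
Proof.
move=> lr gM g1.
have /choice[P HP] : forall ij : 'I_n * 'I_n, exists PN : {poly F} * nat,
    forall c, c != 0 -> gam c ij.1 ij.2 = PN.1.[c] / c ^+ PN.2.
  by move=> [i j]; have [P [N h]] := laurent (lr i j); exists (P, N).
pose N := (\sum_ij (P ij).2)%N.
have PN ij : ((P ij).2 <= N)%N by rewrite /N (bigD1 ij) //= leq_addr.
pose P' ij := (P ij).1 * 'X^(N - (P ij).2).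
pose K := (\sum_ij size (P' ij))%N.
have PK ij : (size (P' ij) <= K)%N by rewrite /K (bigD1 ij) //= leq_addr.
pose C k : 'M[F]_n := \matrix_(i, j) (P' (i, j))`_k.
have gC c : c != 0 -> gam c = (c ^+ N)^-1 *: \sum_(k < K) c ^+ k *: C k.
  move=> c0; apply/matrixP => i j; rewrite (HP (i, j)) // mxE summxE.
  have -> : \sum_(k < K) (c ^+ k *: C k) i j = (P' (i, j)).[c].
    rewrite (horner_coef_wide _ (PK (i, j))); apply: eq_bigr => k _.
    by rewrite !mxE mulrC.
  rewrite hornerM hornerXn mulrCA; congr (_ * _).
  by rewrite -{1}(subnK (PN (i, j))) exprD invfM mulrAC mulVf ?mul1r // expf_neq0.
pose CC := \sum_(k < K) C k.
have C1 : CC = 1%:M.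
  rewrite -g1 gC ?oner_neq0 // expr1n invr1 scale1r; apply: eq_bigr => k _.
  by rewrite expr1n scale1r.
have prodC c d : c != 0 -> d != 0 ->
   (\sum_(k < K) c ^+ k *: C k) *m (\sum_(k < K) d ^+ k *: C k) =
   \sum_(k < K) (c * d) ^+ k *: C k.
  move=> c0 d0; have := gM c d c0 d0; rewrite !gC ?mulf_neq0 //.
  rewrite -scalemxAl -scalemxAr scalerA exprMn invfM => /scalerI -> //.
  by rewrite mulf_neq0 // invr_neq0 // expf_neq0.
have CM k l : (k < K)%N -> (l < K)%N -> C k *m C l = if k == l then C k else 0.
  move=> kK lK.
  have h1 d : d != 0 -> C k *m (\sum_(l < K) d ^+ l *: C l) = d ^+ k *: C k.
    move=> d0; apply/eqP; rewrite -subr_eq0; apply/eqP.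
    apply: (@mx_coef0 K (fun k => C k *m (\sum_(l < K) d ^+ l *: C l) - d ^+ k *: C k)) => // c c0.
    rewrite -[RHS](subrr (\sum_(k < K) (c * d) ^+ k *: C k)) -{1}prodC // mulmx_suml -sumrB.
    by apply: eq_bigr => i _; rewrite scalerBr scalemxAl scalerA -exprMn.
  apply/eqP; rewrite -subr_eq0; apply/eqP.
  apply: (@mx_coef0 K (fun l => C k *m C l - if k == l then C k else 0)) => // d d0.
  rewrite -[RHS](subrr (d ^+ k *: C k)) -{1}h1 // mulmx_sumr.
  rewrite (eq_bigr (fun l : 'I_K => C k *m (d ^+ l *: C l) - (if k == l then d ^+ l *: C k else 0))).
    rewrite sumrB; congr (_ - _); rewrite (bigD1 (Ordinal kK)) //= eqxx big1 ?addr0 // => i ik.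
    by case: eqP => // ki; case/eqP: ik; apply: val_inj.
  by move=> i _; rewrite scalerBr scalemxAr; case: eqP => // _; rewrite scaler0.
have : codiagonalizable [seq C k | k <- iota 0 K].
  apply/codiagonalizableP; split.
    move=> _ _ /mapP[k + ->] /mapP[l + ->]; rewrite !mem_iota !add0n /comm_mx => kK lK.
    by rewrite !CM //; have [->|] := eqVneq k l; rewrite // eqxx.
  move=> _ /mapP[k + ->]; rewrite mem_iota add0n => kK.
  apply/diagonalizableP; exists [:: 0; 1]; first by rewrite /= inE eq_sym oner_eq0.
  apply: mxminpoly_min; rewrite big_cons big_seq1 rmorphM /= !rmorphB /= horner_mx_X.
  rewrite !horner_mx_C raddf0 subr0 mulrBr mulr1 -[C k * C k]/(C k *m C k) CM // eqxx.
  by rewrite subrr.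
case=> V uV /allP/= dV.
have /choice[e eE] : forall k, exists e, (k < K)%N -> C k = qdiag (invmx V) e.
  move=> k; have [kK|kK] := ltnP k K; last by exists 0.
  have /(diagonalizable_forLR uV)[d dE] : diagonalizable_for V (C k).
    by apply: dV; apply/mapP; exists k; rewrite ?mem_iota.
  by exists d => _; rewrite dE mxpoly.conjVmx // /qdiag invmxK.
have uV' : invmx V \in unitmx by rewrite unitmx_inv.
have qsum (x : nat -> 'rV[F]_n) : \sum_(k < K) qdiag (invmx V) (x k) = qdiag (invmx V) (\sum_(k < K) x k).
  by rewrite /qdiag [in RHS]linear_sum mulmx_sumr mulmx_suml.
have esum j : \sum_(k < K) e k 0 j = 1.
  have : qdiag (invmx V) (\sum_(k < K) e k) = qdiag (invmx V) (const_mx 1).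
    by rewrite qdiag1 // -C1 -qsum; apply: eq_bigr => k _; rewrite eE.
  by move/(qdiag_inj uV')/rowP/(_ j); rewrite summxE mxE.
have eM k l j : (k < K)%N -> (l < K)%N -> e k 0 j * e l 0 j = if k == l then e k 0 j else 0.
  move=> kK lK; have := CM k l kK lK; rewrite !eE // qdiagM //.
  have -> : (if k == l then qdiag (invmx V) (e k) else 0) = qdiag (invmx V) (if k == l then e k else 0).
    by case: ifP => // _; rewrite /qdiag raddf0 mulmx0 mul0mx.
  by move/(qdiag_inj uV')/rowP/(_ j); rewrite !mxE => ->; case: ifP => // _; rewrite mxE.
have /choice[kk kkP] : forall j, exists k : nat, (k < K)%N /\ forall l, (l < K)%N -> e l 0 j = (l == k)%:R.
  move=> j; have [k kN] : exists k : 'I_K, e k 0 j != 0.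
    apply: contrapT => h; have := esum j; rewrite big1; last first.
      by move=> k _; apply: contrapT => /eqP ek; apply: h; exists k.
    by move/eqP; rewrite eq_sym oner_eq0.
  exists k; split=> // l lK; have := eM l k j lK (ltn_ord k).
  have [->|lk] := eqVneq l (k : nat); first by rewrite -{3}[e k 0 j]mulr1 => h; apply: (mulfI kN).
  by move/eqP; rewrite mulf_eq0 (negPf kN) orbF => /eqP.
exists (invmx V), (fun j => (kk j)%:Z - N%:Z); split=> // c c0; rewrite gC //.
have -> : \sum_(k < K) c ^+ k *: C k = qdiag (invmx V) (\sum_(k < K) c ^+ k *: e k).
  rewrite -(qsum (fun k => c ^+ k *: e k)); apply: eq_bigr => k _.
  by rewrite eE // /qdiag linearZ /= -scalemxAr scalemxAl.
rewrite /qexp /qdiag scalemxAl scalemxAr -linearZ /=; congr (_ *m diag_mx _ *m _).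
apply/rowP => j; rewrite !mxE summxE; have [kK ekk] := kkP j.
rewrite (bigD1 (Ordinal kK)) //= mxE ekk // eqxx mulr1 big1 ?addr0; last first.
  by move=> i ik; rewrite mxE ekk // (negPf (_ : (i : nat) != kk j)) ?mulr0.
by rewrite expfzDr // -exprnN mulrC.
Qed.

(** The number 2 is not a root of unity in characteristic 0, so a single value of a one-parameter
    torus, at 2, records all exponents. *)
Lemma exp2z_inj (a b : int) : (2 : F) ^ a = 2 ^ b -> a = b.
Proof.
have two : (2 : F) != 0 by rewrite pnatr_eq0.
have nat1 m : (2 : F) ^+ m = 1 -> m = 0%N.
  move=> e; have : ((2 ^ m)%N%:R : F) == 1%:R by rewrite natrX e.
  by rewrite eqr_nat; case: m {e} => // m; rewrite expnS => /eqP; case: (2 ^ m)%N => // k; lia.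
move=> e; apply/eqP; rewrite -subr_eq0.
have : (2 : F) ^ (a - b) = 1 by rewrite expfzDr // e -expfzDr // subrr.
case: (a - b) => m; first by move/nat1 ->.
by rewrite -[LHS]/((2 ^+ m.+1)^-1) => /eqP; rewrite invr_eq1 => /eqP/nat1.
Qed.

(** The value at 2 already has the weight spaces of the one-parameter torus as eigenspaces;
    simultaneous diagonalisation of these values diagonalises the tori. *)
Lemma cotor m (Qs : 'I_m -> 'M[F]_n) (a : 'I_m -> 'I_n -> int) :
  (forall k, Qs k \in unitmx) ->
  (forall k l, comm_mx (qexp (Qs k) (a k) 2) (qexp (Qs l) (a l) 2)) ->
  exists Q (A : 'M[int]_(m, n)), Q \in unitmx /\
    forall k b, b != 0 -> qexp (Qs k) (a k) b = qexp Q (A k) b.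
Proof.
move=> uQs com.
have : codiagonalizable [seq qexp (Qs k) (a k) 2 | k <- enum 'I_m].
  apply/codiagonalizableP; split=> [_ _ /mapP[k _ ->] /mapP[l _ ->]|_ /mapP[k _ ->]].
    exact: com.
  exists (invmx (Qs k)); first by rewrite unitmx_inv.
  apply/diagonalizable_forLR; first by rewrite unitmx_inv.
  by eexists; rewrite mxpoly.conjVmx ?unitmx_inv // invmxK.
case=> V uV /allP/= dV; exists (invmx V).
have /choice[A AE] : forall k, exists A : 'I_n -> int,
    forall b, b != 0 -> qexp (Qs k) (a k) b = qexp (invmx V) A b.
  move=> k; have /(diagonalizable_forLR uV)[x xE] : diagonalizable_for V (qexp (Qs k) (a k) 2).
    by apply: dV; apply/mapP; exists k; rewrite ?mem_enum.
  rewrite mxpoly.conjVmx // in xE.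
  have [B Bdef] : exists B, B = V *m Qs k by exists (V *m Qs k).
  have uB : B \in unitmx by rewrite Bdef unitmx_mul uV uQs.
  have BE : B *m diag_mx (\row_j 2 ^ a k j) = diag_mx x *m B.
    have := congr1 (fun Z => V *m Z *m Qs k) xE.
    rewrite /qexp /qdiag !mulmxA mulmxKV ?uQs // mulmxV // mul1mx => e.
    by rewrite Bdef e mulmxA.
  have /choice[A AP] : forall j, exists d : int, forall l, B j l != 0 -> a k l = d.
    move=> j; have [l Bl] : exists l, B j l != 0.
      apply: contrapT => h; move: uB; rewrite unitmxE (expand_det_row _ j) big1 ?unitr0 //.
      by move=> l _; have [->|Bl] := eqVneq (B j l) 0; rewrite ?mul0r //; case: h; exists l.
    have xj l' : B j l' != 0 -> 2 ^ a k l' = x 0 j.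
      move=> Bl'; apply: (mulfI Bl'); move/matrixP/(_ j l'): BE.
      by rewrite mul_mx_diag mul_diag_mx !mxE [x 0 j * _]mulrC.
    by exists (a k l) => l' Bl'; apply: exp2z_inj; rewrite !xj.
  exists A => b b0; rewrite /qexp /qdiag invmxK.
  have BEb : B *m diag_mx (\row_j b ^ a k j) = diag_mx (\row_j b ^ A j) *m B.
    apply/matrixP => j l; rewrite mul_mx_diag mul_diag_mx !mxE.
    have [->|Bl] := eqVneq (B j l) 0; first by rewrite mul0r mulr0.
    by rewrite (AP j l Bl) mulrC.
  apply: (can_inj (mulKmx uV)); apply: (can_inj (mulmxK (uQs k))).
  by rewrite !mulmxA mulmxKV ?uQs // mulmxV // mul1mx -Bdef BEb Bdef mulmxA.
exists (\matrix_(k, j) A k j); split; first by rewrite unitmx_inv.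
move=> k b b0; rewrite AE //; congr (qdiag _ _); apply/rowP => j.
by rewrite !mxE.
Qed.

Lemma qdiag_prod Q r (s : seq 'I_r) (c : 'rV[F]_r) (A : 'M[int]_(r, n)) : Q \in unitmx ->
  \big[mulmx/1%:M]_(k <- s) qexp Q (A k) (c 0 k) = qdiag Q (\row_j \prod_(k <- s) c 0 k ^ A k j).
Proof.
move=> uQ; elim: s => [|k s IH].
  by rewrite big_nil -(qdiag1 uQ); congr (qdiag Q _); apply/rowP => j; rewrite !mxE big_nil.
rewrite big_cons IH /qexp qdiagM //; congr (qdiag Q _); apply/rowP => j.
by rewrite !mxE big_cons.
Qed.

Lemma qdiag_mono Q r (c : 'rV[F]_r) (A : 'M[int]_(r, n)) : Q \in unitmx ->
  qdiag Q (mono c A) = \big[mulmx/1%:M]_(k <- index_enum 'I_r) qexp Q (A k) (c 0 k).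
Proof. by move=> uQ; rewrite qdiag_prod. Qed.

Definition dg r (k : 'I_r) (b : F) : 'M[F]_r := diag_mx (\row_l if l == k then b else 1).

Lemma dg_group r (k : 'I_r) b : b != 0 -> @diag_group F r (dg k b).
Proof.
move=> b0; split; first exact: diag_mx_is_diag.
rewrite unitmxE det_diag unitfE; apply/prodf_neq0 => l _; rewrite mxE.
by case: ifP; rewrite ?oner_neq0.
Qed.

Lemma dg_prod r (c : 'rV[F]_r) (s : seq 'I_r) : uniq s ->
  \big[mulmx/1%:M]_(k <- s) dg k (c 0 k) = diag_mx (\row_l if l \in s then c 0 l else 1).
Proof.
elim: s => [_|k s IH /= /andP[ks us]].
  rewrite big_nil; apply/matrixP => i j; rewrite !mxE; by case: (i == j).
rewrite big_cons IH // mulmx_diag; congr diag_mx; apply/rowP => l; rewrite !mxE inE.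
by have [->|lk] := eqVneq l k; rewrite ?(negPf ks) ?mulr1 ?mul1r.
Qed.

Lemma diag_group_grp r : mxgroup (@diag_group F r).
Proof.
have dE D : is_diag_mx D -> D = diag_mx (\row_i D i i) :> 'M[F]_r.
  move=> /is_diag_mxP dD; apply/matrixP => i j; rewrite !mxE.
  by have [->|ij] := eqVneq i j; rewrite ?mulr1n // mulr0n dD.
have du (x : 'rV[F]_r) : (diag_mx x \in unitmx) <-> nz x.
  rewrite unitmxE det_diag unitfE.
  by split=> [/prodf_neq0 h j|h]; [apply: h|apply/prodf_neq0 => j _; apply: h].
split.
- by move=> D [].
- split; [by rewrite -diag_const_mx diag_mx_is_diag|exact: unitmx1].
- move=> D E [dD uD] [dE' uE]; split; last by rewrite unitmx_mul uD.
  by rewrite (dE D) // (dE E) // mulmx_diag diag_mx_is_diag.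
- move=> D [dD uD]; split; last by rewrite unitmx_inv.
  move: uD; rewrite (dE D) // => uD; have x0 := (du _).1 uD.
  suff -> : invmx (diag_mx (\row_i D i i)) = diag_mx (\row_i (D i i)^-1) by exact: diag_mx_is_diag.
  apply: (can_inj (mulKmx uD)); rewrite mulmxV // mulmx_diag -diag_const_mx.
  congr diag_mx; apply/rowP => i; rewrite !mxE mulfV //.
  by have := x0 i; rewrite mxE.
Qed.

(** The isomorphism with the diagonal group is restricted to the coordinate subgroups [dg k], where
    [gm_hom] applies; the resulting one-parameter tori commute and are merged by [cotor]. *)
Lemma torus_param T : torus T -> exists r Q (A : 'M[int]_(r, n)), Q \in unitmx /\
  forall t, T t <-> exists2 c, nz c & t = qdiag Q (mono c A).
Proof.
move=> [aT [r [f [g [[fT fM fr] [gT gM gr] gf fg]]]]].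
have gT' := alg_grp aT; have gD := @diag_group_grp r.
have g1 : g 1%:M = 1%:M.
  have T1 := gT _ (grp1 gD); have u1 := grpU gT' T1.
  by apply: (can_inj (mulKmx u1)); rewrite mulmx1 -gM ?mulmx1 //; apply: (grp1 gD).
have hk k : exists Qa : 'M[F]_n * ('I_n -> int), Qa.1 \in unitmx /\
    forall c, c != 0 -> g (dg k c) = qexp Qa.1 Qa.2 c.
  have [i j c0 c0N|c d c0 d0||Q [a [uQ h]]] := @gm_hom (fun c => g (dg k c)); last by exists (Q, a).
  - have [p [q [q0 pq]]] := gr i j _ (dg_group k c0N).
    have pol (s : {mpoly F[r * r]}) : exists s' : {poly F}, forall c, mxeval s (dg k c) = s'.[c].
      have [|s' [N sE]] := @rfun_polyf F 1 r (mxeval s) (dg k) (polyf_mxeval s).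
        move=> i' j'; have [->|ij] := eqVneq i' j'; last first.
          by apply: rfun_ext (rfunC 1 0) => x _; rewrite !mxE (negPf ij).
        have [->|jk] := eqVneq j' k.
          by apply: rfun_ext (rfun_poly 1 'X) => x _; rewrite !mxE !eqxx hornerX.
        by apply: rfun_ext (rfunC 1 1) => x _; rewrite !mxE eqxx (negPf jk).
      by exists s' => c; rewrite sE ?poly1N // hornerC expr1n divr1.
    have [p' pE] := pol p; have [q' qE] := pol q; exists p', q'.
    rewrite -qE; split=> // c cN; rewrite -qE -pE => qc.
    by apply: pq => //; apply: dg_group.
  - rewrite -gM; [|exact: dg_group|exact: dg_group]; congr g.
    rewrite /dg mulmx_diag; congr diag_mx; apply/rowP => l; rewrite !mxE.
    by case: ifP; rewrite ?mulr1.
  - rewrite -[RHS]g1; congr g; rewrite /dg -diag_const_mx; congr diag_mx; apply/rowP => l.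
    by rewrite !mxE if_same.
have /choice[Qa QaP] := hk.
have [|k l|Q [A [uQ QA]]] := @cotor r (fun k => (Qa k).1) (fun k => (Qa k).2).
- by move=> k; have [] := QaP k.
- have two : (2 : F) != 0 by rewrite pnatr_eq0.
  rewrite /comm_mx -(QaP k).2 // -(QaP l).2 // -!gM; try exact: dg_group.
  by congr g; rewrite /dg !mulmx_diag; congr diag_mx; apply/rowP => i; rewrite !mxE mulrC.
exists r, Q, A; split=> //.
have gE c : nz c -> g (diag_mx c) = qdiag Q (mono c A).
  move=> c0; rewrite qdiag_mono //.
  have -> : diag_mx c = \big[mulmx/1%:M]_(k <- index_enum 'I_r) dg k (c 0 k).
    rewrite dg_prod ?index_enum_uniq //; congr diag_mx; apply/rowP => l.
    by rewrite mxE mem_index_enum.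
  have [gs ->] // : @diag_group F r (\big[mulmx/1%:M]_(k <- index_enum 'I_r) dg k (c 0 k)) /\
    g (\big[mulmx/1%:M]_(k <- index_enum 'I_r) dg k (c 0 k)) =
    \big[mulmx/1%:M]_(k <- index_enum 'I_r) qexp Q (A k) (c 0 k).
  elim: (index_enum _) => [|k s [IH1 IH2]]; first by rewrite !big_nil; split=> //; apply: grp1 gD.
  rewrite !big_cons; have dk := dg_group k (c0 k); split; first exact: (grpM gD).
  by rewrite gM // IH2 (QaP k).2 // QA.
move=> t; split=> [Tt|[c c0 ->]]; last first.
  rewrite -gE //; apply: gT; split; first exact: diag_mx_is_diag.
  by rewrite unitmxE det_diag unitfE; apply/prodf_neq0.
have [dD uD] := fT t Tt; pose c := \row_i f t i i.
have fE : f t = diag_mx c.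
  apply/matrixP => i j; rewrite !mxE; have [->|ij] := eqVneq i j; rewrite ?mulr1n //.
  by rewrite mulr0n; move/is_diag_mxP: dD => ->.
have c0 : nz c.
  by move: uD; rewrite fE unitmxE det_diag unitfE => /prodf_neq0 h i; apply: h.
by exists c => //; rewrite -gE // -fE gf.
Qed.

Lemma torus_normal T : torus T -> exists Q R S fr, [/\ Q \in unitmx, R *m S = 1%:M,
  S *m R = 1%:M & T = torN Q S fr].
Proof.
move=> /torus_param[r [Q [A [uQ TE]]]].
have [R [S [fr [RS SR h]]]] := tor_smith F A.
exists Q, R, S, fr; split=> //; apply/seteqP; split=> t.
  by move/TE => [c c0 ->]; exists (mono c A) => //; apply/h; exists c.
by move=> [x /h[c c0 ->] ->]; apply/TE; exists c.
Qed.

Lemma torus_absorb G T Q a : mxgroup G -> maximal_torus G T -> Q \in unitmx ->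
  (forall b, b != 0 -> G (qexp Q a b)) ->
  (forall t b, T t -> b != 0 -> t *m qexp Q a b = qexp Q a b *m t) ->
  forall b, b != 0 -> T (qexp Q a b).
Proof.
move=> gG [[tT TG] mT] uQ Ga comT.
have [r [QT [A [uQT TE]]]] := torus_param tT.
have Tk k b : b != 0 -> T (qexp QT (A k) b).
  move=> b0; apply/TE; exists (\row_l if l == k then b else 1).
    by move=> l; rewrite mxE; case: ifP; rewrite ?oner_neq0.
  congr (qdiag QT _); apply/rowP => j; rewrite !mxE (bigD1 k) //= mxE eqxx big1 ?mulr1 //.
  by move=> l /negPf lk; rewrite mxE lk exp1rz.
pose Qs (k : 'I_r.+1) := if unlift ord0 k is Some i then QT else Q.
pose as_ (k : 'I_r.+1) := if unlift ord0 k is Some i then A i : 'I_n -> int else a.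
have two : (2 : F) != 0 by rewrite pnatr_eq0.
have [|k l|Q2 [A2 [uQ2 QA]]] := @cotor r.+1 Qs as_.
- by move=> k; rewrite /Qs; case: unlift.
- rewrite /comm_mx /Qs /as_; case: (unliftP ord0 k) => [i _|_]; case: (unliftP ord0 l) => [j _|_] //.
  + by rewrite !qdiagM //; congr (qdiag QT _); apply/rowP => h; rewrite !mxE mulrC.
  + by apply: comT => //; apply: Tk.
  + by apply/esym; apply: comT => //; apply: Tk.
pose T2 : set 'M[F]_n := [set t | exists2 c, nz c & t = qdiag Q2 (mono c A2)].
have T2s b : b != 0 -> T2 (qexp Q a b).
  move=> b0; have := QA ord0 b b0; rewrite /Qs /as_ unlift_none => ->.
  exists (\row_l if l == ord0 then b else 1).
    by move=> l; rewrite mxE; case: ifP; rewrite ?oner_neq0.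
  congr (qdiag Q2 _); apply/rowP => j; rewrite !mxE (bigD1 ord0) //= mxE eqxx big1 ?mulr1 //.
  by move=> l /negPf lk; rewrite mxE lk exp1rz.
have [R [S [fr [RS SR h]]]] := tor_smith F A2.
have T2E : T2 = torN Q2 S fr.
  apply/seteqP; split=> t; first by move=> [c c0 ->]; exists (mono c A2) => //; apply/h; exists c.
  by move=> [x /h[c c0 ->] ->]; exists c.
have tT2 : torus T2 by rewrite T2E; apply: torN_torus uQ2 RS SR.
have TT2 : T `<=` T2.
  move=> t /TE[c c0 ->]; exists (\row_l if unlift ord0 l is Some i then c 0 i else 1).
    by move=> l; rewrite mxE; case: unlift => *; rewrite ?oner_neq0.
  rewrite !qdiag_mono // -!/(index_enum _).
  rewrite -[LHS]/(\big[mulmx/1%:M]_(k : 'I_r) qexp QT (A k) (c 0 k)).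
  rewrite -[RHS]/(\big[mulmx/1%:M]_(k : 'I_r.+1) qexp Q2 (A2 k) ((\row_l if unlift ord0 l is Some i then c 0 i else 1) 0 k)).
  rewrite [RHS]big_ord_recl mxE unlift_none.
  have -> : qexp Q2 (A2 ord0) 1 = 1%:M.
    by rewrite -(qdiag1 uQ2); congr (qdiag _ _); apply/rowP => j; rewrite !mxE exp1rz.
  rewrite mul1mx; apply: eq_bigr => i _; rewrite mxE liftK -QA //.
  by rewrite /Qs /as_ liftK.
have T2G : T2 `<=` G.
  move=> t [c c0 ->]; rewrite qdiag_mono //; elim: (index_enum _) => [|k s IH].
    by rewrite big_nil; apply: grp1 gG.
  rewrite big_cons; apply: (grpM gG) => //; rewrite -QA // /Qs /as_.
  by case: unliftP => [i _|_]; [apply: TG; apply: Tk|apply: Ga].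
by move=> b b0; rewrite -(mT T2) //; apply: T2s.
Qed.

End TorusNormalForm.

(** * Engel's theorem and unipotent groups *)

Section Engel.
Variables (F : numClosedFieldType) (n' : nat).
Local Notation n := n'.+1.
Implicit Types (X Y Z a s g : 'M[F]_n) (A N W U M H : set 'M[F]_n).

Lemma subsp0 : subsp [set (0 : 'M[F]_n)].
Proof. by split=> // a X Y -> ->; rewrite scaler0 addr0. Qed.

Lemma subsp_max (P : set 'M[F]_n -> Prop) W0 : (forall W, P W -> subsp W) -> P W0 ->
  exists2 W, P W & forall W', P W' -> W `<=` W' -> W' `<=` W.
Proof.
move=> Ps P0.
have dim W : subsp W -> exists2 B : 'M[F]_(n * n), (forall X, W X <-> (mxvec X <= B)%MS) & (\rank B <= n * n)%N.
  by move=> /subsp_basis[B WB]; exists B => //; apply: rank_leq_row.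
have [B0 B0P _] := dim _ (Ps _ P0).
have [m] : exists m, (n * n - \rank B0 <= m)%N by exists (n * n)%N; apply: leq_subr.
elim: m W0 P0 B0 B0P => [|m IH] W P0 B BP hm.
  exists W => // W' P' WW' X W'X; have [B' B'P rB'] := dim _ (Ps _ P').
  have sub : (B <= B')%MS.
    apply/row_subP => i; rewrite -[row i B]vec_mxK; apply/B'P; apply: WW'; apply/BP.
    by rewrite vec_mxK row_sub.
  apply/BP; have : (B' <= B)%MS.
    have/leqifP := mxrank_leqif_sup sub; case: ifP => // _; move: rB' hm; lia.
  by apply: submx_trans; apply/B'P.
have [max|/existsNP[W' /not_implyP[P' /not_implyP[WW' nWW']]]] :=
  pselect (forall W', P W' -> W `<=` W' -> W' `<=` W); first by exists W.
have [B' B'P rB'] := dim _ (Ps _ P').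
have sub : (B <= B')%MS.
  apply/row_subP => i; rewrite -[row i B]vec_mxK; apply/B'P; apply: WW'; apply/BP.
  by rewrite vec_mxK row_sub.
apply: (IH W' P' B' B'P).
have /leqifP := mxrank_leqif_sup sub; case: ifP => [BB' _|_ lt]; last by move: lt hm; lia.
case: nWW' => X /B'P XB'; apply/BP; exact: submx_trans XB' BB'.
Qed.

(** This ascending filtration plays the part of the flag in Engel's theorem, taken in the space of
    matrices; [nils] says that it exhausts everything. *)
Fixpoint ann A k : set 'M[F]_n :=
  if k is j.+1 then [set Z | forall a, A a -> ann A j (a *m Z)] else [set 0].

Definition nils A := exists k, forall Z, ann A k Z.

Section Ann.
Variable A : set 'M[F]_n.

Lemma ann_subsp k : subsp (ann A k).
Proof.
elim: k => [|k [IH0 IHZ]] /=; first exact: subsp0.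
split=> [a Aa|c X Y AX AY a Aa]; first by rewrite mulmx0.
by rewrite mulmxDr -scalemxAr; apply: IHZ; [apply: AX|apply: AY].
Qed.

Lemma annS k : ann A k `<=` ann A k.+1.
Proof.
elim: k => [_ -> a _|k IH Z AZ a Aa]; first by rewrite mulmx0.
by apply: IH; apply: AZ.
Qed.

Lemma ann_le j k : (j <= k)%N -> ann A j `<=` ann A k.
Proof.
move/subnK => <-; elim: (k - j)%N => [|i IH] // Z /IH; apply: annS.
Qed.

Lemma ann_pred k a Z : A a -> ann A k Z -> ann A k.-1 (a *m Z).
Proof.
case: k => [|k] Aa /= AZ; last exact: AZ.
by rewrite AZ mulmx0.
Qed.

Lemma ann_mul k a Z : A a -> ann A k Z -> ann A k (a *m Z).
Proof. by move=> Aa /(ann_pred Aa); apply: ann_le; apply: leq_pred. Qed.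

Definition normalises s := forall a, A a -> A (s *m a - a *m s).

Lemma ann_normal s k Z : subsp A -> normalises s -> ann A k Z -> ann A k (s *m Z).
Proof.
move=> sA nA; elim: k Z => [Z -> /=|k IH Z AZ a Aa]; first by rewrite mulmx0.
have -> : a *m (s *m Z) = s *m (a *m Z) + (- (s *m a - a *m s)) *m Z.
  by rewrite opprB mulmxBl !mulmxA addrC subrK.
by apply: (subspD (ann_subsp k)); [apply: IH; apply: AZ|apply: AZ; apply: (subspN sA); apply: nA].
Qed.

Lemma ann_exp s k i Z : subsp A -> normalises s -> ann A k Z -> ann A k (s ^+ i *m Z).
Proof.
move=> sA nA AZ; elim: i => [|i IH]; first by rewrite expr0 mul1mx.
by rewrite exprS -mulmxA; apply: ann_normal.
Qed.

Definition addl s : set 'M[F]_n := [set X | exists a c, A a /\ X = a + c *: s].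

Lemma addl_subsp s : subsp A -> subsp (addl s).
Proof.
move=> sA; split=> [|e _ _ [a [c [Aa ->]]] [b [d [Ab ->]]]].
  by exists 0, 0; rewrite scale0r addr0; split=> //; case: sA.
exists (e *: a + b), (e * c + d); split; first by case: sA => _; apply.
by rewrite scalerDr scalerDl scalerA addrACA.
Qed.

(** Multiplication by [s] preserves every step of the filtration for [A]. As [s] is nilpotent, each
    layer splits into at most [n] layers for the enlarged space. *)
Lemma nils_addl s : subsp A -> normalises s -> mnilp s -> nils A -> nils (addl s).
Proof.
move=> sA nA ns [k Ak].
suff h j : ann A j `<=` ann (addl s) (j * n) by exists (k * n)%N => Z; apply: h.
elim: j => [|j IH]; first by rewrite mul0n.
suff hi i Z : ann A j.+1 Z -> ann A j (s ^+ i *m Z) -> ann (addl s) (j * n + i) Z.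
  by move=> Z AZ; rewrite mulSn addnC; apply: hi => //; rewrite ns mul0mx; case: (ann_subsp j).
elim: i Z => [|i IHi] Z AZ sZ; first by rewrite addn0; apply: IH; rewrite expr0 mul1mx in sZ.
rewrite addnS => _ [a [c [Aa ->]]]; rewrite mulmxDl -scalemxAl addrC.
have AaZ : ann A j (a *m Z) by apply: AZ.
have ss := ann_subsp j.
apply: IHi.
  apply: (ann_subsp j.+1).2; first exact: ann_normal.
  exact: annS.
have -> : s ^+ i *m (c *: (s *m Z) + a *m Z) = c *: (s ^+ i.+1 *m Z) + s ^+ i *m (a *m Z).
  by rewrite mulmxDr -scalemxAr exprSr -[s ^+ i * s]/(s ^+ i *m s) -mulmxA.
apply: ss.2 => //.
exact: ann_exp.
Qed.

End Ann.

Definition lbr X Y : 'M[F]_n := X *m Y - Y *m X.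

Definition brclosed A := forall X Y, A X -> A Y -> A (lbr X Y).

(* The left and right multiplications by elements of [A] shift the filtration
   [ann A], so long iterated brackets vanish. *)
Lemma iter_lbr0 A k (f : nat -> 'M[F]_n) : subsp A -> (forall Z, ann A k Z) ->
  (forall i, exists2 a, A a & f i.+1 = lbr a (f i)) -> f (k + k)%N = 0.
Proof.
move=> sA Ak fS.
have h m q Z : ann A q Z -> ann A (q + k - m) (f m *m Z).
  elim: m q Z => [|m IH] q Z AZ.
    by rewrite subn0; apply: (ann_le (leq_addl _ _)).
  have [a Aa ->] := fS m; rewrite mulmxBl -!mulmxA.
  apply: (subspB (ann_subsp A _)).
    by rewrite subnS; apply: ann_pred => //; apply: IH.
  case: q AZ => [|q] AZ.
    by rewrite (_ : Z = 0) // !mulmx0; case: (ann_subsp A (0 + k - m.+1)).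
  by rewrite addSn subSS; apply: IH; apply: AZ.
by have := h (k + k)%N k 1%:M (Ak _); rewrite subnn mulmx1.
Qed.

Lemma nilsS A N : A `<=` N -> nils N -> nils A.
Proof.
move=> AN [k Nk]; exists k => Z; have := Nk Z; elim: (k) Z => // j IH Z NZ a Aa.
by apply: IH; apply: NZ; apply: AN.
Qed.

(* Otherwise brackets with [A'] could be iterated forever outside [W]. *)
Lemma lbr_step A A' (V W : set 'M[F]_n) x0 : subsp A -> nils A -> A' `<=` A -> W 0 ->
  (forall a x, A' a -> V x -> V (lbr a x)) -> V x0 -> ~ W x0 ->
  exists s, [/\ V s, ~ W s & forall a, A' a -> W (lbr a s)].
Proof.
move=> sA [k Ak] AA W0 AV Vx0 nWx0; apply: contrapT => nos.
have /choice[nx nxP] : forall s, exists s', V s -> ~ W s ->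
    [/\ V s', ~ W s' & exists2 a, A a & s' = lbr a s].
  move=> s; have [[Vs nWs]|nVs] := pselect (V s /\ ~ W s); last first.
    by exists 0 => Vs nWs; case: nVs.
  have : ~ forall a, A' a -> W (lbr a s) by move=> h; apply: nos; exists s.
  move=> /existsNP[a /not_implyP[Aa nl]]; exists (lbr a s) => _ _; split=> //.
    exact: AV.
  by exists a => //; apply: AA.
pose f i := iter i nx x0.
have fP i : V (f i) /\ ~ W (f i).
  by elim: i => [|i [IH1 IH2]] //=; have [] := nxP _ IH1 IH2.
have := @iter_lbr0 A k f sA Ak (fun i => let: And3 _ _ h := nxP _ (fP i).1 (fP i).2 in h).
by move=> fk; have [_] := fP (k + k)%N; rewrite fk.
Qed.

Lemma addl_brclosed A s : subsp A -> brclosed A -> (forall a, A a -> A (lbr a s)) ->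
  forall X Y, addl A s X -> addl A s Y -> A (lbr X Y).
Proof.
move=> sA bA As _ _ [a [c [Aa ->]]] [b [d [Ab ->]]].
have -> : lbr (a + c *: s) (b + d *: s) = lbr a b + d *: lbr a s - c *: lbr b s.
  rewrite /lbr !mulmxDl !mulmxDr -!scalemxAl -!scalemxAr !scalerBr.
  rewrite !scalerA (mulrC d) !opprD !opprK; set x := (_ * _) *: _.
  move: (a *m b) (b *m a) (d *: (a *m s)) (d *: (s *m a)) (c *: (s *m b)) (c *: (b *m s)) x.
  by move=> y1 y2 y3 y4 y5 y6 y7; apply/matrixP => i j; rewrite !mxE; ring.
apply: (subspB sA); last by apply: (subspZ sA); apply: As.
by apply: (subspD sA); [apply: bA|apply: (subspZ sA); apply: As].
Qed.

Lemma sub_addl A s : A `<=` addl A s.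
Proof. by move=> a Aa; exists a, 0; rewrite scale0r addr0. Qed.

Lemma mem_addl A s : subsp A -> addl A s s.
Proof. by move=> sA; exists 0, 1; rewrite scale1r add0r; split=> //; case: sA. Qed.

(** In a maximal subalgebra satisfying [nils], properness would let [lbr_step] produce an outside
    element normalising it, and this element could be adjoined by [nils_addl]. *)
Lemma engel N : subsp N -> brclosed N -> (forall X, N X -> mnilp X) -> nils N.
Proof.
move=> sN bN nN.
pose P A := [/\ subsp A, brclosed A, A `<=` N & nils A].
have P0 : P [set 0].
  split; [exact: subsp0| | |].
  - by move=> X Y -> ->; rewrite /lbr mulmx0 subrr.
  - by move=> X ->; case: sN.
  - by exists 1%N => Z a ->; rewrite mul0mx.
have [A [sA bA AN nA] maxA] := @subsp_max P _ (fun W PW => let: And4 h _ _ _ := PW in h) P0.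
have [NA|/existsNP[x0 /not_implyP[Nx0 nAx0]]] := pselect (N `<=` A); first exact: nilsS nA.
have [|s [Ns nAs As]] := lbr_step sA nA (@subset_refl _ A) sA.1 _ Nx0 nAx0.
  by move=> a x /AN Na Nx; apply: bN.
case: nAs; apply: (maxA (addl A s)); [|exact: sub_addl|exact: mem_addl].
split.
- exact: addl_subsp.
- by move=> X Y AX AY; apply: sub_addl; apply: addl_brclosed AX AY.
- move=> _ [a [c [Aa ->]]]; apply: (subspD sN); first exact: AN.
  exact: (subspZ sN).
- apply: nils_addl => //; last exact: nN.
  by move=> a Aa; rewrite -opprB; apply: (subspN sA); apply: As.
Qed.

(** This is [k + [u, u]]. With [k] trivial it is the derived algebra, and the weights of the
    quotient are the simple roots. *)
Definition derS u k : set 'M[F]_n := [set X | forall W, subsp W -> k `<=` W ->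
  (forall a b, u a -> u b -> W (lbr a b)) -> W X].

Lemma derS_subsp u k : subsp (derS u k).
Proof.
split=> [W sW _ _|c X Y uX uY W sW kW bW]; first by case: sW.
by apply: sW.2; [apply: uX|apply: uY].
Qed.

(** A maximal proper subalgebra over [k] is normalised by some outside element, which together with
    it spans all of [u]. Hence it contains the brackets of [u], and so all of [k + [u, u]]. *)
Lemma derS_frattini u k : subsp u -> brclosed u -> nils u -> subsp k -> brclosed k ->
  k `<=` u -> u `<=` derS u k -> u `<=` k.
Proof.
move=> su bu nu sk bk ku uD; apply: contrapT => nuk.
pose P W := [/\ subsp W, brclosed W, k `<=` W & W `<=` u] /\ ~ (u `<=` W).
have [A [[sA bA kA Au] nuA] maxA] := @subsp_max P k (fun W PW => let: And4 h _ _ _ := PW.1 in h)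
  (conj (And4 sk bk (@subset_refl _ k) ku) nuk).
have /existsNP[x /not_implyP[ux nAx]] := nuA.
have [|s [us nAs As]] := lbr_step sA (nilsS Au nu) (@subset_refl _ A) sA.1 _ ux nAx.
  by move=> a y /Au ua uy; apply: bu.
have bA' := addl_brclosed sA bA As; have sA' := addl_subsp s sA.
have uA' : u `<=` addl A s.
  apply: contrapT => nuA'; apply: nAs; apply: (maxA (addl A s)); [split=> //|exact: sub_addl|exact: mem_addl].
  split=> //.
  - by move=> X Y AX AY; apply: sub_addl; apply: bA'.
  - by apply: subset_trans kA _; apply: sub_addl.
  - by move=> _ [a [c [Aa ->]]]; apply: (subspD su); [apply: Au|apply: (subspZ su)].
by apply: nuA => y /uD; apply=> // a b /uA' Aa /uA'; apply: bA'.
Qed.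

Lemma nils_mul A X Y : nils A -> A X -> A Y -> mnilp (X *m Y).
Proof.
move=> [k Ak] AX AY; apply: (@mnilpP _ _ _ k).
suff h j Z : ann A j Z -> (X *m Y) ^+ j *m Z = 0 by rewrite -[LHS]mulmx1; apply: h.
elim: j Z => [Z -> |j IH Z AZ]; first by rewrite mulmx0.
rewrite exprSr -mulmxA; apply: IH; rewrite -mulmxA; apply: ann_mul => //.
exact: AZ.
Qed.

End Engel.

Section Unipotent.
Variables (F : numClosedFieldType) (n' : nat).
Local Notation n := n'.+1.
Implicit Types (X Y Z a s g u : 'M[F]_n) (A N W U M H K G : set 'M[F]_n).

Lemma genS A N : A `<=` N -> generated A `<=` generated N.
Proof. by move=> AN g gA H gH NH; apply: gA => //; apply: subset_trans NH. Qed.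

Lemma derivedS H K : H `<=` K -> derived H `<=` derived K.
Proof.
by move=> HK; apply: genS => _ [a [b [Ha Hb ->]]]; exists a, b; split=> //; apply: HK.
Qed.

Lemma solvableS H K : H `<=` K -> solvable K -> solvable H.
Proof.
move=> HK [m Km]; exists m; apply: subset_trans Km.
by elim: m => //= m IH; apply: derivedS.
Qed.

Lemma unipotentS H K : H `<=` K -> unipotent K -> unipotent H.
Proof. by move=> HK uK h /HK/uK. Qed.

Lemma subsp_zcl W : subsp W -> zcl W `<=` W.
Proof.
move=> sW Z zZ; apply: (perp_perp sW) => Y WY.
apply: (zZ (fun Z => \tr (Z *m Y))); last by move=> X; apply: WY.
by apply: polyf_tr; apply: polymapM; [apply: polymap_id|apply: polymapC].
Qed.

(** Elements congruent to 1 up to a shift by [m] in the filtration. [Gam A 1] is unipotent if the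
    filtration is exhaustive, and increasing [m] bounds the derived series. *)
Definition Gam A m : set 'M[F]_n :=
  [set g | g \in unitmx /\ forall q Z, ann A q Z -> ann A (q - m) (g *m Z - Z)].

Lemma Gam_stab A m g q Z : Gam A m g -> ann A q Z -> ann A q (g *m Z).
Proof.
move=> [_ h] AZ; rewrite -[_ *m _](subrK Z); apply: (subspD (ann_subsp A q)) => //.
by apply: (ann_le (leq_subr m q)); apply: h.
Qed.

Lemma Gam_inv A m g q Z : Gam A m.+1 g -> ann A q Z -> ann A q (invmx g *m Z).
Proof.
move=> Gg; have [ug h] := Gg.
elim/ltn_ind: q Z => -[|q] IH Z AZ; first by rewrite (_ : Z = 0) // mulmx0.
have -> : invmx g *m Z = Z - invmx g *m (g *m Z - Z).
  by rewrite mulmxBr mulKmx // opprB addrC subrK.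
apply: (subspB (ann_subsp A _)) => //.
apply: (ann_le (_ : (q.+1 - m.+1 <= q.+1)%N)); first exact: leq_subr.
by apply: IH; [rewrite subSS ltnS leq_subr|apply: h].
Qed.

Lemma Gam_group A m : mxgroup (Gam A m.+1).
Proof.
split.
- by move=> g [].
- split=> [|q Z AZ]; first exact: unitmx1.
  by rewrite mul1mx subrr; case: (ann_subsp A (q - m.+1)).
- move=> a b Ga Gb; have [ua ha] := Ga; have [ub hb] := Gb; split=> [|q Z AZ].
    by rewrite unitmx_mul ua.
  have -> : a *m b *m Z - Z = a *m (b *m Z - Z) + (a *m Z - Z).
    by rewrite mulmxBr mulmxA addrA subrK.
  apply: (subspD (ann_subsp A _)); last exact: ha.
  by apply: (Gam_stab Ga); apply: hb.
- move=> a Ga; have [ua ha] := Ga; split=> [|q Z AZ]; first by rewrite unitmx_inv.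
  have -> : invmx a *m Z - Z = - (invmx a *m (a *m Z - Z)).
    by rewrite mulmxBr mulKmx // opprB.
  apply: (subspN (ann_subsp A _)); apply: (Gam_inv Ga); exact: ha.
Qed.

Lemma Gam_alg A m : alg_group (Gam A m.+1).
Proof.
apply/alg_groupP; split; first exact: Gam_group.
move=> g [zg ug]; split=> // q Z AZ; apply: (subsp_zcl (ann_subsp A _)).
apply: (@zcl_comp F n n (fun g => g *m Z - Z) (Gam A m.+1)) => //; last by move=> h [_]; apply.
by apply: polymapB; [apply: polymapM; [apply: polymap_id|apply: polymapC]|apply: polymapC].
Qed.

Lemma Gam_unip A : nils A -> unipotent (Gam A 1).
Proof.
move=> [k Ak] g [ug h]; exists k.
suff hq q Z : ann A q Z -> (g - 1%:M) ^+ q *m Z = 0 by rewrite -[LHS]mulmx1; apply: hq.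
elim: q Z => [Z -> |q IH Z AZ]; first by rewrite mulmx0.
rewrite exprSr -mulmxA; apply: IH; rewrite mulmxBl mul1mx.
by have := h _ _ AZ; rewrite subn1.
Qed.

(** The commutator of [a] and [b] minus 1 is [((a-1)(b-1) - (b-1)(a-1)) a^-1 b^-1], so the shifts of
    [a] and [b] add up, and [2(m+1)] is at least [m+2]. *)
Lemma Gam_derived A m : derived (Gam A m.+1) `<=` Gam A m.+2.
Proof.
apply: gen_min; first exact: Gam_group.
move=> _ [a [b [Ga Gb ->]]]; have [ua ha] := Ga; have [ub hb] := Gb; split.
  by rewrite !unitmx_mul ua ub !unitmx_inv ua ub.
move=> q Z AZ; pose Y := invmx a *m (invmx b *m Z).
have AY : ann A q Y by apply: (Gam_inv Ga); apply: (Gam_inv Gb).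
have -> : a *m b *m invmx a *m invmx b *m Z - Z =
   (a *m (b *m Y - Y) - (b *m Y - Y)) - (b *m (a *m Y - Y) - (a *m Y - Y)).
  have ZE : Z = b *m (a *m Y) by rewrite /Y mulKVmx // mulKVmx.
  rewrite {2}ZE -!mulmxA -/Y !mulmxBr; move: (a *m (b *m Y)) (b *m (a *m Y)) (a *m Y) (b *m Y).
  by move=> x1 x2 x3 x4; apply/matrixP => i j; rewrite !mxE; ring.
apply: (ann_le (_ : (q - m.+1 - m.+1 <= q - m.+2)%N)); first by lia.
by apply: (subspB (ann_subsp A _)); [apply: ha; apply: hb|apply: hb; apply: ha].
Qed.

Lemma Gam_solvable A : nils A -> solvable (Gam A 1).
Proof.
move=> [k Ak]; exists k.
have h : iter k (@derived F n) (Gam A 1) `<=` Gam A k.+1.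
  by elim: (k) => [|j IH] //=; apply: subset_trans (@Gam_derived A j); apply: derivedS.
move=> g /h [ug hg]; have := hg k 1%:M (Ak _).
rewrite (_ : (k - k.+1 = 0)%N); last by apply/eqP; rewrite subn_eq0.
by rewrite mulmx1 => /= /eqP; rewrite subr_eq0 => /eqP.
Qed.

Lemma mexp_Gam A X : A X -> mnilp X -> Gam A 1 (mexp X).
Proof.
move=> AX nX; split=> [|q Z AZ]; first exact: mexp_unit.
rewrite /mexp big_ord_recl expr0 fact0 invr1 scale1r mulmxDl mul1mx addrC addKr.
rewrite mulmx_suml; apply: (subsp_sum (ann_subsp A _)) => i _.
rewrite -scalemxAl; apply: (subspZ (ann_subsp A _)); rewrite subn1 lift0.
have := ann_pred AX AZ; elim: (nat_of_ord i) => [|j IH] h; first by rewrite expr1.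
by rewrite exprS -mulmxA; apply: ann_mul => //; apply: IH.
Qed.

Lemma exp_curve_irr X : mnilp X -> zirr [set mexp (c *: X) | c in setT].
Proof.
move=> nX; apply: zirr_curves; first by exists (mexp (0 *: X)); exists 0.
move=> _ _ [c _ <-] [d _ <-]; exists 1, (fun x => mexp (x *: X)), c, d; split.
- exact: oner_neq0.
- apply: rcurve_mexp; apply: (@rfun_ext _ _ (fun x => 'X.[x])); first by move=> x _; rewrite hornerX.
  exact: rfun_poly.
- by rewrite poly1N.
- by rewrite poly1N.
- by move=> x _; exists x.
Qed.

Definition expgrp N : set 'M[F]_n := zclg (generated [set mexp X | X in N]).

Section ExpGrp.
Variable N : set 'M[F]_n.
Hypotheses (sN : subsp N) (bN : brclosed N) (nN : forall X, N X -> mnilp X).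

Let EU : [set mexp X | X in N] `<=` @GLset F n.
Proof. by move=> _ [X NX <-]; apply: mexp_unit; apply: nN. Qed.

Lemma expgrp_alg : alg_group (expgrp N).
Proof. by apply: zclg_group; apply: gen_group. Qed.

Lemma expgrp_exp X c : N X -> expgrp N (mexp (c *: X)).
Proof.
move=> NX; have h : [set mexp X | X in N] (mexp (c *: X)).
  by exists (c *: X) => //; apply: (subspZ sN).
by split; [apply: sub_zcl; apply: sub_gen|apply: EU].
Qed.

Lemma expgrp_lie : N `<=` lie_algebra (expgrp N).
Proof. by move=> X NX; apply: exp_lie; [move=> c; apply: expgrp_exp|apply: nN]. Qed.

Lemma expgrp_Gam : expgrp N `<=` Gam N 1.
Proof.
apply: zclg_sub; first exact: Gam_alg.
apply: gen_min; first exact: Gam_group.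
by move=> _ [X NX <-]; apply: mexp_Gam => //; apply: nN.
Qed.

Lemma expgrp_unip : unipotent (expgrp N).
Proof. by apply: unipotentS expgrp_Gam _; apply: Gam_unip; apply: engel. Qed.

Lemma expgrp_solvable : solvable (expgrp N).
Proof. by apply: solvableS expgrp_Gam _; apply: Gam_solvable; apply: engel. Qed.

Lemma expgrp_conn : zconnected (expgrp N).
Proof.
have gE := gen_group EU.
apply: (@zconnected_zcl _ _ (generated [set mexp X | X in N])).
- apply: zconnected_gen => //.
  + move=> _ [X NX <-]; rewrite mexpV; last exact: nN.
    by exists (- X) => //; apply: (subspN sN).
  + move=> _ [X NX <-]; exists [set mexp (c *: X) | c in setT]; split.
    * by apply: exp_curve_irr; apply: nN.
    * by move=> _ [c _ <-]; exists (c *: X) => //; apply: (subspZ sN).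
    * by exists 0 => //; rewrite scale0r mexp0.
    * by exists 1 => //; rewrite scale1r.
- by move=> g gg; split; [apply: sub_zcl|apply: (grpU gE)].
- by move=> g [].
- by exists 1%:M; apply: (grp1 gE).
Qed.

Lemma expgrp_sub G : alg_group G -> N `<=` lie_algebra G -> expgrp N `<=` G.
Proof.
move=> aG NG; apply: zclg_sub => //; apply: gen_min; first exact: alg_grp.
by move=> _ [X NX <-]; rewrite -[X]scale1r; apply: lie_exp => //; [apply: NG|apply: nN].
Qed.

Lemma expgrp_conj g : g \in unitmx -> (forall X, N X -> N (g *m X *m invmx g)) ->
  forall h, expgrp N h -> expgrp N (g *m h *m invmx g).
Proof.
move=> ug Ng.
pose K : set 'M[F]_n := [set h | h \in unitmx /\ expgrp N (g *m h *m invmx g)].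
have cK : polymap (fun h : 'M[F]_n => g *m h *m invmx g).
  by apply: polymapM; [apply: polymapM; [apply: polymapC|apply: polymap_id]|apply: polymapC].
have gE := alg_grp expgrp_alg.
have gK : mxgroup K.
  split.
  - by move=> h [].
  - by split; [exact: unitmx1|rewrite mulmx1 mulmxV //; apply: (grp1 gE)].
  - move=> a b [ua Ka] [ub Kb]; split; first by rewrite unitmx_mul ua.
    have -> : g *m (a *m b) *m invmx g = (g *m a *m invmx g) *m (g *m b *m invmx g).
      by rewrite !mulmxA mulmxKV.
    exact: (grpM gE).
  - move=> a [ua Ka]; split; first by rewrite unitmx_inv.
    have -> : g *m invmx a *m invmx g = invmx (g *m a *m invmx g).
      by rewrite !invmxM ?unitmx_mul ?ug ?ua ?unitmx_inv // invmxK mulmxA.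
    exact: (grpV gE).
have aK : alg_group K.
  apply/alg_groupP; split=> // h [zh uh]; split=> //.
  apply: (alg_zcl expgrp_alg); last by rewrite !unitmx_mul ug uh unitmx_inv.
  by apply: (zcl_comp cK _ zh) => k [].
have : expgrp N `<=` K.
  apply: zclg_sub => //; apply: gen_min => // _ [X NX <-]; have nX := nN NX; split.
    exact: mexp_unit.
  have <- : mexp (g *m X *m invmx g) = g *m mexp X *m invmx g := mexp_conj X ug.
  by rewrite -[_ *m invmx g]scale1r; apply: expgrp_exp; apply: Ng.
by move=> h k /h[].
Qed.

End ExpGrp.

(** The replicas of the semisimple part lie in [U], so they are both diagonalisable and unipotent,
    hence trivial; evaluation at 2 shows that all their exponents are 0. *)
Lemma lie_unip_nilp U X : alg_group U -> unipotent U -> lie_algebra U X -> mnilp X.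
Proof.
move=> aU uU UX.
have [Q [lam [nn [r [w [c [[uQ -> nn0 _] _ lamE cU _]]]]]]] := replicas aU UX.
suff -> : lam = 0 by rewrite /qdiag raddf0 mulmx0 mul0mx add0r.
have two : (2 : F) != 0 by rewrite pnatr_eq0.
apply/rowP => j; rewrite lamE mxE big1 // => k _.
suff -> : c k j = 0 by rewrite mul0r.
have [m qm] := uU _ (cU k 2 (ltn_ord k) two).
have q1 x : qdiag Q x - 1%:M = qdiag Q (\row_j (x 0 j - 1)).
  rewrite -(qdiag1 uQ) /qdiag -mulmxBl -mulmxBr -raddfB; congr (_ *m diag_mx _ *m _).
  by apply/rowP => l; rewrite !mxE.
have qX x i : (qdiag Q x - 1%:M) ^+ i = qdiag Q (\row_j (x 0 j - 1) ^+ i).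
  elim: i => [|i IH].
    by rewrite expr0 -[1]/(1%:M) -(qdiag1 uQ); congr (qdiag Q _); apply/rowP => l; rewrite !mxE.
  rewrite exprS IH q1 -[_ * _]/(_ *m _) qdiagM //.
  by congr (qdiag Q _); apply/rowP => l; rewrite !mxE exprS.
move: qm; rewrite qX => q0.
have : qdiag Q (\row_j0 ((\row_j0 2 ^ c k j0) 0 j0 - 1) ^+ m) = qdiag Q 0.
  by rewrite q0 /qdiag raddf0 mulmx0 mul0mx.
move/(qdiag_inj uQ)/rowP/(_ j); rewrite !mxE => /eqP; rewrite expf_eq0 => /andP[_].
by rewrite subr_eq0 -(expr0z 2) => /eqP/exp2z_inj.
Qed.

Lemma unip_brclosed U : alg_group U -> unipotent U -> brclosed (lie_algebra U).
Proof.
by move=> aU uU X Y UX UY; apply: lie_bracket => //; apply: (lie_unip_nilp aU).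
Qed.

Lemma unip_nils U : alg_group U -> unipotent U -> nils (lie_algebra U).
Proof.
move=> aU uU; apply: engel; [exact: lie_subsp|exact: unip_brclosed|].
by move=> X; apply: lie_unip_nilp.
Qed.

Lemma unip_Gam U : alg_group U -> unipotent U -> U `<=` Gam (lie_algebra U) 1.
Proof.
move=> aU uU u Uu; have [X [nX UX] ->] := log_lie aU Uu (uU u Uu).
exact: mexp_Gam.
Qed.

Lemma unip_conn U : alg_group U -> unipotent U -> zconnected U.
Proof.
move=> aU uU; have gU := alg_grp aU; apply: (zconnected_base (grp1 gU)) => B cB B1 u Uu.
have [X [nX UX] uE] := log_lie aU Uu (uU u Uu).
apply: (clopen_irr cB (exp_curve_irr nX) _ _ B1).
- by move=> _ [c _ <-]; apply: lie_exp.
- by exists 0 => //; rewrite scale0r mexp0.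
- by exists 1 => //; rewrite scale1r.
Qed.

Lemma unip_solvable U : alg_group U -> unipotent U -> solvable U.
Proof.
move=> aU uU; apply: solvableS (unip_Gam aU uU) _; apply: Gam_solvable.
exact: unip_nils.
Qed.

End Unipotent.

(** * The Lie-Kolchin theorem *)

Section LieKolchin.
Variables (F : numClosedFieldType) (n' : nat).
Local Notation n := n'.+1.
Implicit Types (X Y Z a b g h : 'M[F]_n) (M H S B : set 'M[F]_n).

(** Denominators are cleared as in [polyf_inv]; this lets closed conditions be pulled back along
    maps that involve an inverse. *)
Lemma polyf_scale m (f : 'M[F]_m -> F) (N : 'M[F]_n -> 'M[F]_m) (d : 'M[F]_n -> F) :
  polyf f -> polymap N -> polyf d ->
  exists2 g, polyf g & exists k, forall A, d A != 0 -> g A = d A ^+ k * f ((d A)^-1 *: N A).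
Proof.
move=> [p fp] Np dp.
suff [g gp [k gk]] : exists2 g, polyf g & exists k, forall A, d A != 0 ->
    g A = d A ^+ k * mxeval p ((d A)^-1 *: N A).
  by exists g => //; exists k => A dA; rewrite gk // fp.
elim/mpoly_ring_ind: p {fp} => [c|i|p q [g1 gp1 [k1 e1]] [g2 gp2 [k2 e2]]|p q [g1 gp1 [k1 e1]] [g2 gp2 [k2 e2]]].
- exists (fun _ => c); first exact: polyfC.
  by exists 0%N => A _; rewrite /mxeval mevalC mul1r.
- case/mxvec_indexP: i => i j; exists (fun A => N A i j) => //; exists 1%N => A dA.
  by rewrite /mxeval mevalXU mxvecE mxE expr1 mulVKf.
- exists (fun A => d A ^+ k2 * g1 A + d A ^+ k1 * g2 A).
    by apply: polyfD; apply: polyfM => //; apply: polyfX.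
  exists (k1 + k2)%N => A dA; rewrite e1 // e2 // /mxeval mevalD exprD; ring.
- exists (fun A => g1 A * g2 A); first exact: polyfM.
  by exists (k1 + k2)%N => A dA; rewrite e1 // e2 // /mxeval mevalM exprD; ring.
Qed.

Lemma clopen_pre S M B (h : 'M[F]_n -> 'M[F]_n) : (forall x, M x -> S (h x)) ->
  (forall f, polyf f -> exists2 g, polyf g & forall x, M x -> g x = 0 <-> f (h x) = 0) ->
  clopen_in S B -> clopen_in M [set x | M x /\ B (h x)].
Proof.
move=> MS hf [BS [C cC BC] [D cD BD]].
have pre (E : set (zmx F n)) : closed E ->
    exists2 E' : set (zmx F n), closed E' & forall x, M x -> E' x <-> E (h x).
  move=> cE; exists (zcl [set x | M x /\ E (h x)]); first exact: zcl_closed.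
  move=> x Mx; split=> [zx|Ex]; last by apply: sub_zcl.
  rewrite (closed_zcl cE) => f fp fE; have [g gp gf] := hf f fp.
  by apply/(gf x Mx); apply: zx => // y [My Ey]; apply/(gf y My); apply: fE.
have [C' cC' hC'] := pre C cC; have [D' cD' hD'] := pre D cD; split.
- by move=> x [].
- exists C' => //; apply/seteqP; split=> x [Mx h1]; split=> //.
    by apply/(hC' x Mx); move: h1; rewrite BC => -[].
  by rewrite BC; split; [apply: MS|apply/hC'].
- exists D' => //; apply/seteqP; split=> x [Mx h1]; split=> //.
    apply/(hD' x Mx); have : (S `\` B) (h x) by split; [apply: MS|move=> Bx; apply: h1].
    by rewrite BD => -[].
  move=> [_ Bx]; have : (S `\` B) (h x) by rewrite BD; split; [apply: MS|apply/hD'].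
  by case.
Qed.

Lemma commM_unit M : mxgroup M -> [set g | exists a b, [/\ M a, M b &
    g = a *m b *m invmx a *m invmx b]] `<=` @GLset F n.
Proof.
move=> gM _ [a [b [Ma Mb ->]]].
by rewrite /GLset /= !unitmx_mul !unitmx_inv !(grpU gM Ma) !(grpU gM Mb).
Qed.

Lemma derived_group M : mxgroup M -> mxgroup (derived M).
Proof. by move=> gM; apply: gen_group; apply: commM_unit. Qed.

Lemma derived_sub M : mxgroup M -> derived M `<=` M.
Proof.
move=> gM; apply: gen_min => // _ [a [b [Ma Mb ->]]].
by apply: (grpM gM); [apply: (grpJ gM)|apply: (grpV gM)].
Qed.

Lemma derived_normal M g h : mxgroup M -> M g -> derived M h -> derived M (g *m h *m invmx g).
Proof.
move=> gM Mg Dh; have gD := derived_group gM; have ug := grpU gM Mg.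
have Mh : M h by apply: derived_sub.
have uh := grpU gM Mh.
have -> : g *m h *m invmx g = (g *m h *m invmx g *m invmx h) *m h by rewrite mulmxKV.
by apply: (grpM gD) => //; apply: sub_gen; exists g, h.
Qed.

(** For fixed [a] and [y], the map sending [x] to [a] times the commutator of [x] and [y] takes 1 to
    [a]. Connectedness of [M] keeps it in one clopen piece, so words in commutators never leave the
    piece of 1. *)
Lemma derived_conn M : mxgroup M -> zconnected M -> zconnected (derived M).
Proof.
move=> gM cM; have gD := derived_group gM.
apply: (zconnected_base (grp1 gD)) => B cB B1.
have BD : B `<=` derived M by case: cB.
have key a x y : B a -> M x -> M y -> B (a *m (x *m y *m invmx x *m invmx y)).
  move=> Ba Mx My.
  have uy := grpU gM My.
  have := @clopen_pre (derived M) M B (fun x => a *m (x *m y *m invmx x *m invmx y)) _ _ cB.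
  move=> /(_ _ _)/(zconnected_clopen (a := 1%:M) cM) e.
  have : [set x | M x /\ B (a *m (x *m y *m invmx x *m invmx y))] x; last by case.
  rewrite e //.
  - move=> z Mz; apply: (grpM gD); first exact: BD.
    by apply: sub_gen; exists z, y.
  - move=> f fp.
    have Np : polymap (fun z : 'M[F]_n => a *m (z *m y *m \adj z *m invmx y)).
      apply: polymapM; first exact: polymapC.
      apply: polymapM; last exact: polymapC.
      apply: polymapM; last exact: (polymap_adj polymap_id).
      by apply: polymapM; [apply: polymap_id|apply: polymapC].
    have [g gp [k gk]] := polyf_scale fp Np (polyf_det polymap_id).
    exists g => // z Mz; have uz := grpU gM Mz.
    have dz : \det z != 0 by rewrite -unitfE -unitmxE.
    rewrite gk //; have -> : (\det z)^-1 *: (a *m (z *m y *m \adj z *m invmx y)) =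
       a *m (z *m y *m invmx z *m invmx y).
      have -> : invmx z = (\det z)^-1 *: \adj z by rewrite /invmx uz.
      by rewrite -!(scalemxAr, scalemxAl).
    split=> [/eqP|->]; last by rewrite mulr0.
    by rewrite mulf_eq0 expf_eq0 (negPf dz) andbF => /eqP.
  - split; first exact: (grp1 gM).
    by rewrite mul1mx invmx1 mulmx1 mulmxV // mulmx1.
apply: gen_ind => //; first exact: commM_unit.
move=> a _ Ba [x [y [Mx My ->]]]; split; first exact: key.
rewrite !invmxM ?unitmx_mul ?unitmx_inv ?(grpU gM Mx) ?(grpU gM My) // !invmxK !mulmxA.
by have := key a y x Ba My Mx; rewrite !mulmxA.
Qed.

Lemma comm_eigen d (Phi : set 'M[F]_d) : (0 < d)%N ->
  (forall f g : 'M[F]_d, Phi f -> Phi g -> f *m g = g *m f) ->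
  exists2 w : 'rV[F]_d, w != 0 & forall f, Phi f -> exists c, w *m f = c *: w.
Proof.
elim/ltn_ind: d Phi => d IH Phi d0 com.
have [sc|/existsNP[f0 /not_implyP[Pf0 nsc]]] := pselect (forall f, Phi f -> exists c, f = c%:M).
  exists (delta_mx 0 (Ordinal d0)).
    by apply/eqP => /rowP/(_ (Ordinal d0)); rewrite !mxE !eqxx => /eqP; rewrite oner_eq0.
  by move=> f /sc[c ->]; exists c; rewrite mul_mx_scalar.
have [c ec] := spectral.eigenvalue_closed f0 d0.
pose V := eigenspace f0 c.
have rV : (0 < \rank V)%N by rewrite lt0n mxrank_eq0.
have rVd : (\rank V < d)%N.
  rewrite ltn_neqAle rank_leq_row andbT; apply/negP => /eqP full.
  have : row_full V by rewrite /row_full full eqxx.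
  move=> /(submx_full 1%:M)/eigenspaceP; rewrite mul1mx => e; apply: nsc; exists c.
  by rewrite e scalemx1.
have stab f : Phi f -> stablemx V f.
  by move=> Pf; apply: comm_mx_stable_eigenspace; apply: com.
have [||w wN0 wP] := IH _ rVd [set mxpoly.conjmx (row_base V) f | f in Phi].
- by [].
- move=> _ _ [f Pf <-] [g Pg <-].
  by rewrite -!mxpoly.conjmxM ?inE ?stablemx_row_base ?stab // com.
exists (w *m row_base V); first by rewrite mulmx_free_eq0 ?row_base_free.
move=> f Pf; have [e we] := wP _ (ex_intro2 _ _ f Pf erefl).
exists e; rewrite scalemxAl -we /mxpoly.conjmx -[RHS]mulmxA mulmxKpV ?mulmxA //.
by rewrite stablemx_row_base stab.
Qed.

Definition rep M d (r : 'M[F]_n -> 'M[F]_d) := [/\ polymap r, r 1%:M = 1%:M &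
  forall a b, M a -> M b -> r (a *m b) = r a *m r b].

Lemma rep_inv M d (r : 'M[F]_n -> 'M[F]_d) a : mxgroup M -> rep M r -> M a ->
  r (invmx a) *m r a = 1%:M /\ r a *m r (invmx a) = 1%:M.
Proof.
move=> gM [_ r1 rM] Ma; have ua := grpU gM Ma; have Ma' := grpV gM Ma.
by rewrite -!rM // mulVmx // mulmxV // r1.
Qed.

Lemma closed_polyfs (I : Type) (f : I -> 'M[F]_n -> F) : (forall i, polyf (f i)) ->
  closed ([set A | forall i, f i A = 0] : set (zmx F n)).
Proof.
move=> fp; suff -> : [set A | forall i, f i A = 0] = zcl [set A | forall i, f i A = 0].
  exact: zcl_closed.
apply/seteqP; split; first exact: sub_zcl.
by move=> A zA i; apply: (zA (f i)) => // B; apply.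
Qed.

(** A common eigenvector of the derived group has a character [chi]. Its conjugates take finitely
    many values at each element, so connectedness makes [chi] invariant and its eigenspace stable.
    There the derived group acts by scalars of determinant 1, again finitely many, hence trivially,
    and [M] acts by commuting matrices. *)
Lemma lie_kolchin1 m M d (r : 'M[F]_n -> 'M[F]_d) : mxgroup M -> zconnected M ->
  iter m (@derived F n) M `<=` [set 1%:M] -> rep M r -> (0 < d)%N ->
  exists2 w : 'rV[F]_d, w != 0 & forall a, M a -> exists c, w *m r a = c *: w.
Proof.
elim: m M d r => [|m IH] M d r gM cM dM rr d0; have [rp r1 rM] := rr.
  exists (delta_mx 0 (Ordinal d0)).
    by apply/eqP => /rowP/(_ (Ordinal d0)); rewrite !mxE !eqxx => /eqP; rewrite oner_eq0.
  by move=> a /dM -> ; exists 1; rewrite r1 mulmx1 scale1r.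
have gD := derived_group gM; have cD := derived_conn gM cM.
have DM := derived_sub gM.
have rD : rep (derived M) r by split=> // a b /DM Ma /DM Mb; apply: rM.
rewrite iterSr in dM.
have [w0 w0N /choice[chi chiP]] : exists2 w : 'rV[F]_d, w != 0 &
    forall a, exists c, derived M a -> w *m r a = c *: w.
  have [w wN wP] := IH _ _ _ gD cD dM rD d0; exists w => // a.
  have [Da|nDa] := pselect (derived M a); last by exists 0.
  by have [c wc] := wP a Da; exists c.
have w0a a : M a -> w0 *m r a != 0.
  move=> Ma; apply: contraNneq w0N => e.
  by rewrite -[w0]mulmx1 -(rep_inv gM rr Ma).2 mulmxA e mul0mx.
have conj a g : M a -> derived M g -> w0 *m r a *m r g = chi (a *m g *m invmx a) *: (w0 *m r a).
  move=> Ma Dg; have Mg := DM _ Dg; have Ma' := grpV gM Ma; have ua := grpU gM Ma.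
  have Dc := derived_normal gM Ma Dg.
  rewrite scalemxAl -chiP // -mulmxA -rM // -mulmxA -rM; [|exact: DM|by []].
  by rewrite mulmxKV.
have chiC g a : derived M g -> M a -> chi (a *m g *m invmx a) = chi g.
  move=> Dg Ma; have [rs rsE] := closed_field_poly_normal (char_poly (r g)).
  have e1 : g = 1%:M *m g *m invmx 1%:M by rewrite invmx1 mul1mx mulmx1.
  rewrite [in RHS]e1.
  apply: (@zconnected_const F n _ rs M (fun a => chi (a *m g *m invmx a)) 1%:M cM (grp1 gM)) => //.
    move=> b Mb; have : root (char_poly (r g)) (chi (b *m g *m invmx b)).
      rewrite -eigenvalue_root_char; apply/eigenvalueP; exists (w0 *m r b); last exact: w0a.
      exact: conj.
    by rewrite rsE (monicP (char_poly_monic _)) scale1r root_prod_XsubC.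
  move=> v; exists [set a | forall j, (w0 *m r a *m r g - v *: (w0 *m r a)) 0 j = 0].
    apply: closed_polyfs => j.
    apply: (@polyf_ext _ _ (fun a => \sum_l (\sum_i w0 0 i * r a i l) * r g l j - v * \sum_i w0 0 i * r a i j)).
      move=> b; rewrite !mxE; congr (_ - _); apply: eq_bigr => l _; by rewrite mxE.
    apply: polyfB; last by apply: polyfZ; apply: polyf_sum => i _; apply: polyfZ; apply: rp.
    apply: polyf_sum => l _; apply: polyfM; last exact: polyfC.
    by apply: polyf_sum => i _; apply: polyfZ; apply: rp.
  move=> b Mb /=; rewrite conj //; split=> [-> j|h]; first by rewrite subrr mxE.
  have : chi (b *m g *m invmx b) *: (w0 *m r b) - v *: (w0 *m r b) = 0.
    by apply/rowP => j; rewrite h mxE.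
  rewrite -scalerBl => /eqP; rewrite scaler_eq0 (negPf (w0a b Mb)) orbF subr_eq0.
  by move/eqP.
have [||V VP] := @rv_basis F d [set w | forall g, derived M g -> w *m r g = chi g *: w].
- by move=> g _; rewrite mul0mx scaler0.
- by move=> e u v Pu Pv g Dg; rewrite mulmxDl -scalemxAl Pu // Pv // scalerDr !scalerA mulrC.
have stab a : M a -> stablemx V (r a).
  move=> Ma; apply/row_subP => i; rewrite row_mul; apply/VP => g Dg.
  have /VP Vi := row_sub i V; have ua := grpU gM Ma; have Ma' := grpV gM Ma.
  have Dc := derived_normal gM Ma Dg; have Mg := DM _ Dg.
  rewrite -mulmxA -rM // -(chiC g a Dg Ma) scalemxAl -(Vi _ Dc) -mulmxA -rM; [|exact: DM|by []].
  by rewrite mulmxKV.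
pose u := row_base V; pose e := \rank V.
have e0 : (0 < e)%N.
  rewrite lt0n mxrank_eq0; apply: contraNneq w0N => V0.
  by have /VP : (fun w => forall g, derived M g -> w *m r g = chi g *: w) w0 by []; rewrite V0 submx0 => /eqP->.
pose r' a := mxpoly.conjmx u (r a).
have ur a : M a -> u *m r a = r' a *m u.
  by move=> Ma; rewrite /r' /mxpoly.conjmx mulmxKpV // stablemx_row_base stab.
have r'M a b : M a -> M b -> r' (a *m b) = r' a *m r' b.
  move=> Ma Mb; rewrite /r' rM // mxpoly.conjmxM //; by rewrite inE stablemx_row_base stab.
have r'1 : r' 1%:M = 1%:M.
  by rewrite /r' r1 /mxpoly.conjmx mulmx1 mulmxVp ?row_base_free.
have r'D g : derived M g -> r' g = (chi g)%:M.
  move=> Dg; apply: (row_free_inj (row_base_free V)); rewrite -/u -ur; last exact: DM.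
  rewrite mul_scalar_mx; apply/row_matrixP => i; rewrite row_mul linearZ /=.
  by have /VP -> // : (row i u <= V)%MS by rewrite (submx_trans (row_sub i u)) // eq_row_base.
have det1 g : derived M g -> \det (r' g) = 1.
  move=> Dg; suff [] : M g /\ \det (r' g) = 1 by [].
  apply: (Dg [set g | M g /\ \det (r' g) = 1]).
    split.
    - by move=> h [/(grpU gM)].
    - by split; [exact: grp1|rewrite r'1 det1].
    - by move=> a b [Ma da] [Mb db]; split; [exact: grpM|rewrite r'M // det_mulmx da db mulr1].
    - move=> a [Ma da]; have Ma' := grpV gM Ma; split=> //.
      have : \det (r' (a *m invmx a)) = 1 by rewrite mulmxV ?(grpU gM Ma) // r'1 det1.
      by rewrite r'M // det_mulmx da mul1r.
  move=> _ [a [b [Ma Mb ->]]]; have Ma' := grpV gM Ma; have Mb' := grpV gM Mb.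
  split; first by do ![apply: (grpM gM) => //].
  rewrite !r'M //; try by do ![apply: (grpM gM) => //].
  rewrite !det_mulmx -[RHS](det1 F e) -r'1.
  have -> : r' 1%:M = r' (a *m invmx a *m (b *m invmx b)).
    by rewrite !mulmxV ?mulmx1 ?(grpU gM Ma) ?(grpU gM Mb).
  rewrite !r'M //; try by do ![apply: (grpM gM) => //].
  by rewrite !det_mulmx; ring.
have chi1 g : derived M g -> chi g = 1.
  have chi_1 : chi 1%:M = 1.
    have := chiP _ (grp1 gD); rewrite r1 mulmx1 => /eqP; rewrite -subr_eq0 -{1}[w0]scale1r -scalerBl.
    by rewrite scaler_eq0 (negPf w0N) orbF subr_eq0 => /eqP.
  rewrite -[RHS]chi_1.
  have [rs rsE] := closed_field_poly_normal ('X^e - 1 : {poly F}).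
  apply: (@zconnected_const F n _ rs (derived M) chi 1%:M cD (grp1 gD)).
    move=> g' Dg'; have : root ('X^e - 1) (chi g').
      by rewrite rootE !hornerE -(det_scalar e) -r'D // det1 // subrr.
    have -> : 'X^e - 1 = \prod_(z <- rs) ('X - z%:P).
      by rewrite rsE lead_coefDl ?lead_coefXn ?scale1r // size_polyN size_poly1 size_polyXn.
    by rewrite root_prod_XsubC.
  move=> v; exists [set a | forall j, (w0 *m r a - v *: w0) 0 j = 0].
    apply: closed_polyfs => j.
    apply: (@polyf_ext _ _ (fun a => (\sum_i w0 0 i * r a i j) - v * w0 0 j)).
      by move=> b; rewrite !mxE.
    apply: polyfB; last exact: polyfC.
    by apply: polyf_sum => i _; apply: polyfZ; apply: rp.
  move=> b Db /=; rewrite chiP //; split=> [-> j|h]; first by rewrite subrr mxE.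
  have : chi b *: w0 - v *: w0 = 0 by apply/rowP => j; rewrite h mxE.
  by rewrite -scalerBl => /eqP; rewrite scaler_eq0 (negPf w0N) orbF subr_eq0 => /eqP.
have [||w wN wP] := @comm_eigen e [set r' a | a in M].
- by [].
- move=> _ _ [a Ma <-] [b Mb <-]; have Ma' := grpV gM Ma; have Mb' := grpV gM Mb.
  rewrite -!r'M //; have ua := grpU gM Ma; have ub := grpU gM Mb.
  have -> : a *m b = (a *m b *m invmx a *m invmx b) *m (b *m a).
    by rewrite mulmxA mulmxKV // mulmxKV.
  have Dc : derived M (a *m b *m invmx a *m invmx b) by apply: sub_gen; exists a, b.
  by rewrite (r'M _ _ (DM _ Dc) (grpM gM Mb Ma)) r'D // chi1 // mul1mx.
exists (w *m u); first by rewrite mulmx_free_eq0 ?row_base_free.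
move=> a Ma; have [c wc] := wP _ (ex_intro2 _ _ a Ma erefl).
by exists c; rewrite -mulmxA ur // mulmxA wc scalemxAl.
Qed.

Lemma rep_drsub M d (r : 'M[F]_n -> 'M[F]_(1 + d)) : rep M r ->
  (forall a, M a -> ursubmx (r a) = 0) -> rep M (fun a => drsubmx (r a)).
Proof.
move=> [rp r1 rM] r0; split.
- by move=> i j; apply: polyf_ext (rp (rshift 1 i) (rshift 1 j)) => a; rewrite !mxE.
- by rewrite r1 (@scalar_mx_block _ 1 d) block_mxKdr.
- move=> a b Ma Mb; rewrite rM // -{1}[r a]submxK -{1}[r b]submxK mulmx_block block_mxKdr.
  by rewrite r0 // mulmx0 add0r.
Qed.

Lemma lie_kolchin M d (r : 'M[F]_n -> 'M[F]_d) : mxgroup M -> zconnected M -> solvable M -> rep M r ->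
  exists2 P : 'M[F]_d, P \in unitmx & forall a, M a -> is_trig_mx (P *m r a *m invmx P).
Proof.
move=> gM cM [m dM]; elim: d r => [|d IH] r rr.
  by exists 1%:M; rewrite ?unitmx1 // => a _; apply/is_trig_mxP => -[].
have [w wN wP] := lie_kolchin1 gM cM dM rr (ltn0Sn d).
have [P0 uP0 P0w] : exists2 P0 : 'M[F]_(1 + d), P0 \in unitmx & usubmx P0 = w.
  have rw : \rank w = 1%N by apply/eqP; rewrite rank_rV wN.
  have rf : row_free w by rewrite /row_free rw.
  pose C : 'M[F]_(1 + d) := row_ebase w.
  exists (block_mx (col_ebase w) 0 0 1%:M *m C).
    rewrite unitmx_mul row_ebase_unit andbT unitmxE det_ublock det1 mulr1 -unitmxE.
    exact: col_ebase_unit.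
  rewrite -[RHS](mulmx_ebase w) rw -mul_usub_mx; congr (_ *m _).
  rewrite /block_mx col_mxKu; apply/matrixP => i j; rewrite !mxE.
  rewrite big_ord1 [pid_mx _ _ _]mxE.
  case: splitP => k jk; first by rewrite jk (ord1 k) mulr1.
  by rewrite jk mulr0 mxE.
have rr1 : rep M (fun a => P0 *m r a *m invmx P0).
  have [rp r1 rM] := rr; split.
  - by apply: polymapM; [apply: polymapM; [apply: polymapC|]|apply: polymapC].
  - by rewrite r1 mulmx1 mulmxV.
  - by move=> a b Ma Mb; rewrite rM // !mulmxA mulmxKV.
have ur0 a : M a -> ursubmx (P0 *m r a *m invmx P0 : 'M_(1 + d)) = 0.
  move=> Ma; rewrite /ursubmx -!mul_usub_mx P0w; have [c ->] := wP a Ma.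
  rewrite -scalemxAl -P0w mul_usub_mx mulmxV // scalar_mx_block /block_mx col_mxKu.
  by rewrite linearZ /= row_mxKr scaler0.
have [P1 uP1 P1P] := IH _ (rep_drsub rr1 ur0).
pose P2 : 'M[F]_(1 + d) := block_mx 1%:M 0 0 P1.
have uP2 : P2 \in unitmx by rewrite unitmxE det_ublock det1 mul1r -unitmxE.
have P2V : invmx P2 = block_mx 1%:M 0 0 (invmx P1).
  apply: (can_inj (mulKmx uP2)); rewrite mulmxV // /P2 mulmx_block !mulmx0 !mul0mx !mulmx1.
  by rewrite mulmxV // !addr0 add0r -scalar_mx_block.
exists (P2 *m P0); first by rewrite unitmx_mul uP2.
move=> a Ma.
have -> : P2 *m P0 *m r a *m invmx (P2 *m P0) = P2 *m (P0 *m r a *m invmx P0) *m invmx P2.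
  by rewrite invmxM // !mulmxA.
rewrite P2V -[P0 *m _ *m _]submxK ur0 // /P2 !mulmx_block !mulmx0 !mul0mx !mulmx1 !mul1mx !addr0 !add0r.
rewrite mul0mx; apply/is_trig_mxP => i j ij; rewrite !mxE.
have /is_trig_mxP tr := P1P a Ma.
case: splitP => i' ii'; rewrite mxE; case: splitP => j' jj'.
- by move: ij; rewrite ii' jj' !ord1 ltnn.
- by rewrite mxE.
- by move: ij; rewrite ii' jj' !ord1.
- by rewrite tr //; move: ij; rewrite ii' jj'.
Qed.

End LieKolchin.

(** * Weight decompositions *)

Section Grading.
Variables (F : numClosedFieldType) (n' : nat).
Local Notation n := n'.+1.
Implicit Types (X Y Z g t : 'M[F]_n) (W M H T : set 'M[F]_n).

Lemma subsp_coefN0 W K (C : nat -> 'M[F]_n) : subsp W ->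
  (forall c, c != 0 -> W (\sum_(k < K) c ^+ k *: C k)) -> forall k, (k < K)%N -> W (C k).
Proof.
move=> sW h k kK; pose C' i := if i is j.+1 then C j else 0.
apply: (@subsp_coef _ _ _ K.+1 C' sW _ k.+1) => // c.
rewrite big_ord_recl scaler0 add0r.
have [->|c0] := eqVneq c 0.
  by rewrite big1; [case: sW|move=> i _; rewrite exprS mul0r scale0r].
rewrite (_ : \sum_(i < K) _ = c *: \sum_(k < K) c ^+ k *: C k); first exact/(subspZ sW)/h.
by rewrite scaler_sumr; apply: eq_bigr => i _; rewrite scalerA -exprS.
Qed.

Variables (Q : 'M[F]_n) (m : 'I_n -> int).
Hypothesis uQ : Q \in unitmx.

Definition qin X := invmx Q *m X *m Q.
Definition qout X := Q *m X *m invmx Q.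
Definition qe X i j : F := qin X i j.

Lemma qinK X : qout (qin X) = X.
Proof. by rewrite /qin /qout !mulmxA mulmxV // mul1mx mulmxK. Qed.

Lemma qoutK X : qin (qout X) = X.
Proof. by rewrite /qin /qout !mulmxA mulVmx // mul1mx mulmxKV. Qed.

Lemma qe_out A i j : qe (qout A) i j = A i j.
Proof. by rewrite /qe qoutK. Qed.

Lemma qe_ext X Y : (forall i j, qe X i j = qe Y i j) -> X = Y.
Proof. by move=> h; rewrite -[X]qinK -[Y]qinK; congr qout; apply/matrixP => i j; apply: h. Qed.

Lemma qeM X Y i j : qe (X *m Y) i j = \sum_k qe X i k * qe Y k j.
Proof. by rewrite /qe (_ : qin (X *m Y) = qin X *m qin Y) 1?mxE // /qin !mulmxA mulmxK. Qed.

Lemma qeP a X Y i j : qe (a *: X + Y) i j = a * qe X i j + qe Y i j.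
Proof. by rewrite /qe /qin mulmxDr mulmxDl -scalemxAr -scalemxAl [LHS]mxE [in LHS]mxE. Qed.

Lemma qe0 i j : qe 0 i j = 0.
Proof. by rewrite /qe /qin mulmx0 mul0mx mxE. Qed.

Lemma qe1 i j : qe 1%:M i j = (i == j)%:R.
Proof. by rewrite /qe /qin mulmx1 mulVmx // mxE. Qed.

Lemma qeZ a X i j : qe (a *: X) i j = a * qe X i j.
Proof. by rewrite -[a *: X]addr0 qeP qe0 addr0. Qed.

Lemma qeD X Y i j : qe (X + Y) i j = qe X i j + qe Y i j.
Proof. by rewrite -[X]scale1r qeP mul1r scale1r. Qed.

Lemma qe_sum (I : Type) (r : seq I) (f : I -> 'M[F]_n) i j :
  qe (\sum_(k <- r) f k) i j = \sum_(k <- r) qe (f k) i j.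
Proof. by elim: r => [|k r IH]; rewrite ?big_nil ?qe0 // !big_cons qeD IH. Qed.

Lemma qe_diag (x : 'rV[F]_n) i j : qe (qdiag Q x) i j = x 0 i *+ (i == j).
Proof. by rewrite -[qdiag Q x]/(qout (diag_mx x)) qe_out mxE. Qed.

Lemma qe_tr X : \tr X = \sum_i qe X i i.
Proof. by rewrite -[LHS]/(\tr X) -{1}(qinK X) /qout mxtrace_mulC mulmxA mulVmx // mul1mx. Qed.

Lemma qeDl (x : 'rV[F]_n) X i j : qe (qdiag Q x *m X) i j = x 0 i * qe X i j.
Proof.
rewrite qeM (bigD1 i) //= qe_diag eqxx mulr1n big1 ?addr0 // => k ki.
by rewrite qe_diag eq_sym (negPf ki) mulr0n mul0r.
Qed.

Lemma qeDr (x : 'rV[F]_n) X i j : qe (X *m qdiag Q x) i j = x 0 j * qe X i j.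
Proof.
rewrite qeM (bigD1 j) //= qe_diag eqxx mulr1n big1 ?addr0 => [|k kj]; first by rewrite mulrC.
by rewrite qe_diag (negPf kj) mulr0n mulr0.
Qed.

(** The component of weight [d] under conjugation by the one-parameter torus [cochar]. *)
Definition wpart (d : int) X : 'M[F]_n :=
  qout (\matrix_(i, j) if m i - m j == d then qe X i j else 0).

Lemma qe_wpart d X i j : qe (wpart d X) i j = if m i - m j == d then qe X i j else 0.
Proof. by rewrite qe_out mxE. Qed.

Definition whom (d : int) X := forall i j, m i - m j != d -> qe X i j = 0.

Lemma hom_wpart d X : whom d (wpart d X).
Proof. by move=> i j /negPf h; rewrite qe_wpart h. Qed.

Lemma wpart_hom d X : whom d X -> wpart d X = X.
Proof.
move=> hX; apply: qe_ext => i j; rewrite qe_wpart.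
by case: ifP => // /negbT /hX.
Qed.

Lemma wpart_hom0 d e X : whom d X -> e != d -> wpart e X = 0.
Proof.
move=> hX ed; apply: qe_ext => i j; rewrite qe_wpart qe0.
by case: ifP => // /eqP mij; apply: hX; rewrite mij.
Qed.

Lemma wpartP d a X Y : wpart d (a *: X + Y) = a *: wpart d X + wpart d Y.
Proof.
apply: qe_ext => i j; rewrite qeP !qe_wpart qeP.
by case: ifP => //; rewrite mulr0 addr0.
Qed.

Lemma hom_subsp d : subsp (whom d).
Proof.
split=> [i j _|a X Y hX hY i j h]; first exact: qe0.
by rewrite qeP hX // hY // mulr0 addr0.
Qed.

Lemma homM d e X Y : whom d X -> whom e Y -> whom (d + e) (X *m Y).
Proof.
move=> hX hY i j h; rewrite qeM big1 // => k _.
have [ik|] := eqVneq (m i - m k) d; last by move/hX ->; rewrite mul0r.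
have [kj|] := eqVneq (m k - m j) e; last by move/hY ->; rewrite mulr0.
by case/eqP: h; rewrite -ik -kj addrA subrK.
Qed.

Lemma hom_lbr d e X Y : whom d X -> whom e Y -> whom (d + e) (lbr X Y).
Proof.
move=> hX hY; apply: (subspB (hom_subsp _)); first exact: homM.
by rewrite addrC; apply: homM.
Qed.

Lemma hom_tr d e X Y : whom d X -> whom e Y -> d + e != 0 -> \tr (X *m Y) = 0.
Proof.
move=> hX hY de; rewrite qe_tr big1 // => i _.
by apply: (homM hX hY); rewrite subrr eq_sym.
Qed.

(** A bound for all differences of weights; writing a weight as [k - wtop] turns sums over weights
    into sums over natural numbers [k]. *)
Definition wtop : nat := (2 * \sum_i absz (m i))%N.

Lemma wtopP i j : exists2 k, (k < wtop.*2.+1)%N & m i - m j = k%:Z - wtop%:Z.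
Proof.
have hi l : (absz (m l) <= \sum_i absz (m i))%N by rewrite (bigD1 l) //= leq_addr.
have := hi i; have := hi j; rewrite /wtop; set N := (\sum_i _)%N => hj hi'.
exists (absz (m i - m j + (2 * N)%N%:Z)); move: hj hi'; lia.
Qed.

Lemma wtop_uniq (k l : nat) : k%:Z - wtop%:Z = l%:Z - wtop%:Z -> k = l.
Proof. by lia. Qed.

Lemma wpart_sum X : X = \sum_(k < wtop.*2.+1) wpart (k%:Z - wtop%:Z) X.
Proof.
apply: qe_ext => i j; rewrite qe_sum; have [k kb mij] := wtopP i j.
rewrite (bigD1 (Ordinal kb)) //= qe_wpart mij eqxx big1 ?addr0 // => l lk.
rewrite qe_wpart mij; case: eqP => // /wtop_uniq e; case/eqP: lk.
exact: val_inj.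
Qed.

(** Powers of [X] have weights that are multiples of [d], and these leave the bounded range of
    weights. *)
Lemma hom_nilp d X : d != 0 -> whom d X -> mnilp X.
Proof.
move=> d0 hX; pose K := (2 * wtop).+1.
have hK k : whom (d *+ k) (X ^+ k).
  elim: k => [|k IH]; last by rewrite exprS mulrS; apply: homM.
  move=> i j; rewrite mulr0n expr0 qe1; have [->|] := eqVneq i j; last by [].
  by rewrite subrr eqxx.
apply: (@mnilpP _ _ _ K); apply: qe_ext => i j; rewrite qe0; apply: hK.
have [k kb ->] := wtopP i j; apply/eqP => e.
have := congr1 absz e; rewrite -mulr_natr abszM natz.
have d1 : (0 < absz d)%N by rewrite absz_gt0.
have : (K <= absz d * K)%N by rewrite leq_pmull.
rewrite /= /K => h1 h2; move: kb h1 h2; lia.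
Qed.

Definition cochar (b : F) : 'M[F]_n := qexp Q m b.

Lemma cochar_Ad b X : b != 0 -> cochar b *m X *m invmx (cochar b) =
  (b ^+ wtop)^-1 *: \sum_(k < wtop.*2.+1) b ^+ k *: wpart (k%:Z - wtop%:Z) X.
Proof.
move=> b0; have nzb : nz (\row_j b ^ m j) by move=> j; rewrite mxE expfz_neq0.
rewrite {1}/cochar /cochar /qexp qdiagV //.
apply: qe_ext => i j; rewrite qeDr qeDl qeZ qe_sum !mxE.
have [k kb mij] := wtopP i j.
rewrite (bigD1 (Ordinal kb)) //= qeZ qe_wpart mij eqxx big1 ?addr0; last first.
  move=> l lk; rewrite qeZ qe_wpart mij; case: eqP => [/wtop_uniq e|]; last by rewrite mulr0.
  by case/eqP: lk; apply: val_inj.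
rewrite !mulrA; congr (_ * _); rewrite invr_expz -expfzDr // addrC mij expfzDr // -exprnN.
by rewrite mulrC.
Qed.

(** The weight components are the coefficients of the Laurent polynomial in [b] given by
    [cochar_Ad]. *)
Lemma wpart_in W d X : subsp W ->
  (forall b Y, b != 0 -> W Y -> W (cochar b *m Y *m invmx (cochar b))) -> W X -> W (wpart d X).
Proof.
move=> sW Wc WX.
have h k : (k < wtop.*2.+1)%N -> W (wpart (k%:Z - wtop%:Z) X).
  apply: (@subsp_coefN0 W wtop.*2.+1 (fun k => wpart (k%:Z - wtop%:Z) X)) => // c c0.
  have := Wc c X c0 WX; rewrite cochar_Ad // => /(subspZ sW (c ^+ wtop)).
  by rewrite scalerA mulfV ?scale1r // expf_neq0.
have [[k [kb ->]]|nk] := pselect (exists k, (k < wtop.*2.+1)%N /\ d = k%:Z - wtop%:Z); first exact: h.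
rewrite (_ : wpart d X = 0); first by case: sW.
rewrite /wpart (_ : \matrix_(i, j) _ = 0); first by rewrite /qout mulmx0 mul0mx.
apply/matrixP => i j; rewrite !mxE; case: eqP => // e; case: nk.
by have [k kb mij] := wtopP i j; exists k; rewrite -e.
Qed.

Lemma hom0P X : (forall b, b != 0 -> cochar b *m X = X *m cochar b) -> whom 0 X.
Proof.
move=> com.
have nz2 : (2 : F) != 0 by rewrite pnatr_eq0.
move=> i j mij; have := congr1 (fun Z => qe Z i j) (com 2 nz2).
rewrite /cochar /qexp qeDl qeDr !mxE => /eqP; rewrite -subr_eq0 -mulrBl mulf_eq0 => /orP[|/eqP//].
by rewrite subr_eq0 => /eqP/exp2z_inj e; case/eqP: mij; rewrite e subrr.
Qed.

End Grading.

(** * The Lie algebra of a semisimple group *)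

Section TorusWeights.
Variables (F : numClosedFieldType) (n' : nat).
Local Notation n := n'.+1.
Implicit Types (X Y Z g t : 'M[F]_n) (W M H T G : set 'M[F]_n).

Lemma rfun_der_sum (d : {poly F}) (I : Type) (r : seq I) (u : I -> F -> F) c (v : I -> F) :
  d.[c] != 0 -> (forall i, rfun_der d (u i) c (v i)) ->
  rfun_der d (fun x => \sum_(i <- r) u i x) c (\sum_(i <- r) v i).
Proof.
move=> dc h; elim: r => [|i r IH].
  by rewrite big_nil; apply: rfun_der_ext (rfun_derC 0 dc) => x _; rewrite big_nil.
rewrite big_cons; apply: rfun_der_ext (rfun_derD dc (h i) IH) => x _.
by rewrite big_cons.
Qed.

Lemma rfun_der_exprz (a : int) : rfun_der 'X (fun x : F => x ^ a) 1 a%:~R.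
Proof.
have d1 : ('X : {poly F}).[1] != 0 by rewrite hornerX oner_neq0.
case: a => a.
  have := rfun_der_poly 'X^a d1; rewrite derivXn hornerMn hornerXn expr1n.
  by apply: rfun_der_ext => x _; rewrite hornerXn.
exists 1%:P, a.+1; split=> [x|]; first by rewrite hornerX hornerC div1r.
have -> : ('X : {poly F})^`().[1] = 1 by rewrite derivX hornerC.
by rewrite derivC horner0 hornerX hornerC mul0r sub0r !mulr1 expr1n divr1 NegzE rmorphN.
Qed.

Lemma lie_qexp M Q a : Q \in unitmx -> (forall b, b != 0 -> M (qexp Q a b)) ->
  lie_algebra M (qdiag Q (\row_j (a j)%:~R)).
Proof.
move=> uQ Ma; have d1 : ('X : {poly F}).[1] != 0 by rewrite hornerX oner_neq0.
apply: (@lie_curve F n' M 'X (fun x => qexp Q a x) 1) => //.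
- by rewrite polyX_eq0.
- by rewrite -(qdiag1 uQ); congr (qdiag _ _); apply/rowP => j; rewrite !mxE exp1rz.
- by move=> x; rewrite hornerX; apply: Ma.
move=> i j.
have qE (y : 'rV[F]_n) : qdiag Q y i j = \sum_k Q i k * y 0 k * invmx Q k j.
  by rewrite /qdiag mul_mx_diag mxE; apply: eq_bigr => k _; rewrite mxE.
rewrite qE; apply: (@rfun_der_ext _ _ (fun x => \sum_k Q i k * x ^ a k * invmx Q k j)).
  by move=> x _; rewrite /qexp qE; apply: eq_bigr => k _; rewrite mxE.
apply: rfun_der_sum => // k; rewrite mxE.
have := rfun_derM d1 (rfun_derM d1 (rfun_derC (Q i k) d1) (rfun_der_exprz (a k)))
  (rfun_derC (invmx Q k j) d1).
by rewrite mul0r add0r mulr0 addr0.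
Qed.

Lemma tr_qdiagM Q (x y : 'rV[F]_n) : Q \in unitmx ->
  \tr (qdiag Q x *m qdiag Q y) = \sum_j x 0 j * y 0 j.
Proof.
move=> uQ; rewrite qdiagM // (qe_tr uQ); apply: eq_bigr => j _.
by rewrite qe_diag // eqxx mxE.
Qed.

Lemma comm_nilp_tr X Y : mnilp X -> X *m Y = Y *m X -> \tr (X *m Y) = 0.
Proof. by move=> nX XY; apply: nilp_tr; apply: nilpMc. Qed.

Lemma conj_sub1 X Y : X \in unitmx -> X *m Y *m invmx X - 1%:M = X * (Y - 1%:M) * invmx X.
Proof.
by move=> uX; rewrite -[RHS]/(X *m (Y - 1%:M) *m invmx X) mulmxBr mulmxBl mulmx1 mulmxV.
Qed.

Definition radform W : set 'M[F]_n :=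
  [set X | W X /\ forall Y, W Y -> \tr (X *m Y) = 0].

Lemma radform_subsp W : subsp W -> subsp (radform W).
Proof.
move=> sg; split=> [|a X Y [gX hX] [gY hY]].
  by split=> [|Y _]; [case: sg|rewrite mul0mx linear0].
split=> [|Z gZ]; first exact: sg.2.
by rewrite mulmxDl -scalemxAl linearD linearZ /= hX // hY // mulr0 addr0.
Qed.

(** The derivative of a replica, with integral eigenvalues [c k], lies in the Lie algebra.
    Orthogonality to it is a linear relation among the independent [w l]; its coefficient at [l = k]
    is the sum of squares of the [c k j], so these are 0. *)
Lemma radform_nilp G X : alg_group G -> radform (lie_algebra G) X -> mnilp X.
Proof.
move=> aG [gX hX].
have [Q [lam [nn [r [w [c [[uQ XE nn0 _] iw lamE cG com]]]]]]] := replicas aG gX.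
suff c0 k : (k < r)%N -> forall j, c k j = 0.
  have -> : X = nn.
    rewrite XE (_ : lam = 0); first by rewrite /qdiag raddf0 mulmx0 mul0mx add0r.
    by apply/rowP => j; rewrite lamE mxE big1 // => k _; rewrite c0 // mul0r.
  by [].
move=> kr; have two : (2 : F) != 0 by rewrite pnatr_eq0.
pose y : 'rV[F]_n := \row_j (c k j)%:~R.
have gy : lie_algebra G (qdiag Q y) by apply: lie_qexp => // b b0; apply: cG.
have [sX _] := com X erefl.
have nX : nn *m X = X *m nn.
  have -> : nn = X - qdiag Q lam by rewrite XE addrC addKr.
  by rewrite mulmxBl mulmxBr sX.
have [_ ncom] := com nn nX.
have ny : nn *m qdiag Q y = qdiag Q y *m nn.
  apply: (qdiag_comm uQ _ (ncom k 2 kr)) => i j; rewrite !mxE => /exp2z_inj -> //.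
have := hX _ gy; rewrite {1}XE mulmxDl linearD /= tr_qdiagM // comm_nilp_tr // addr0 => h.
have e : \sum_(l < r) (\sum_j c l j * c k j)%:~R * w l = 0.
  rewrite -[RHS]h; under [in RHS]eq_bigr do rewrite lamE mulr_suml.
  rewrite [RHS]exchange_big /=; apply: eq_bigr => l _; rewrite rmorph_sum mulr_suml.
  by apply: eq_bigr => j _; rewrite rmorphM /= mxE mulrAC.
have /eqP := iw (fun l => \sum_j c l j * c k j) e k kr.
rewrite psumr_eq0 => [/allP h0 j|j _]; last by rewrite -expr2 sqr_ge0.
by have := h0 j (mem_index_enum _); rewrite mulf_eq0 orbb => /eqP.
Qed.

Lemma lie_trivial X : lie_algebra [set (1%:M : 'M[F]_n)] X -> X = 0.
Proof.
move/lie_algebraP => h; apply/matrixP => i j; rewrite mxE.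
have [q qE] : polyf (fun A : 'M[F]_n => A i j - (1%:M : 'M[F]_n) i j).
  by apply: polyfB; [apply: polyf_entry|apply: polyfC].
have := h q; have -> : dp q 1%:M X = X i j; last first.
  by apply=> A ->; rewrite -qE subrr.
have -> : q = 'X_(mxvec_index i j) - ((1%:M : 'M[F]_n) i j)%:MP.
  apply: mpoly_ext => A; rewrite -qE /mxeval mevalB mevalXU mevalC mxvecE //.
rewrite -mpolyCN dpD dpC addr0 dpX mxvecE //.
Qed.

Lemma tr_lbr X Y Z : \tr (lbr X Y *m Z) = \tr (X *m lbr Y Z).
Proof.
rewrite /lbr mulmxBl mulmxBr !linearB /= !mulmxA; congr (_ - _).
by rewrite -[Y *m X *m Z]mulmxA mxtrace_mulC.
Qed.

(** The radical of the form consists of nilpotent elements and is stable under brackets and under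
    conjugation by [G]; it exponentiates to a connected solvable normal subgroup, which
    semisimplicity makes trivial. *)
Lemma form_nondeg G X : semisimple G -> radform (lie_algebra G) X -> X = 0.
Proof.
move=> [aG cG ssG] rX; have gG := alg_grp aG.
pose N := radform (lie_algebra G).
have sN : subsp N by apply: radform_subsp; apply: lie_subsp.
have nN Y : N Y -> mnilp Y by apply: radform_nilp.
have bN : brclosed N.
  move=> Y Z NY NZ; have nY := nN _ NY; have nZ := nN _ NZ; case: NY NZ => [gY hY] [gZ hZ].
  split; first exact: lie_bracket.
  by move=> V gV; rewrite tr_lbr; apply: hY; apply: lie_bracket.
have /ssG h : alg_subgroup G (expgrp N).
  by split; [apply: expgrp_alg|apply: expgrp_sub => // Y []].
have e1 : expgrp N `<=` [set 1%:M].
  apply: h; [exact: expgrp_conn|exact: expgrp_solvable|].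
  move=> g k Gg; apply: expgrp_conj => //; first exact: (grpU gG Gg).
  move=> Y [gY hY]; split; first exact: lie_Ad.
  move=> Z gZ; have ug := grpU gG Gg.
  have := hY _ (lie_Ad gG (grpV gG Gg) gZ); rewrite invmxK => <-.
  by rewrite -!mulmxA mxtrace_mulC !mulmxA.
apply: lie_trivial; apply: lieS e1 _ _; apply: expgrp_lie => //.
Qed.

Lemma trig_unip X : (forall i j : 'I_n, (i < j)%N -> X i j = 0) ->
  (exists k, (X - 1%:M) ^+ k = 0) <-> forall i, X i i = 1.
Proof.
move=> tX; split=> [[k Xk] i|X1].
  have dX j : ((X - 1%:M) ^+ j) i i = (X i i - 1) ^+ j /\
      forall a b : 'I_n, (a < b)%N -> ((X - 1%:M) ^+ j) a b = 0.
    elim: j => [|j [IH1 IH2]].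
      rewrite !expr0; split=> [|a b ab]; rewrite mxE ?eqxx //.
      by rewrite -val_eqE /= ltn_eqF.
    split=> [|a b ab]; rewrite exprS -[_ * _]/(_ *m _) mxE.
      rewrite (bigD1 i) //= IH1 exprS [(X - _) i i]mxE [(- 1%:M) i i]mxE [1%:M i i]mxE eqxx.
      rewrite big1 ?addr0 // => l li.
      have [il|il] := ltnP i l; last by rewrite IH2 ?mulr0 // ltn_neqAle li.
      by rewrite [(X - 1%:M) i l]mxE tX // !mxE eq_sym (negPf li) subr0 mul0r.
    rewrite big1 // => l _; have [al|al] := ltnP a l.
      by rewrite [(X - 1%:M) a l]mxE tX // !mxE -val_eqE /= ltn_eqF // subr0 mul0r.
    by rewrite IH2 ?mulr0 // (leq_ltn_trans al).
  have [+ _] := dX k; rewrite Xk mxE => /esym/eqP; rewrite expf_eq0 subr_eq0.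
  by move=> /andP[_ /eqP].
exists n; have low j (a b : 'I_n) : (a < b + j)%N -> ((X - 1%:M) ^+ j) a b = 0.
  elim: j a b => [|j IH] a b ab.
    by rewrite addn0 in ab; rewrite expr0 mxE -val_eqE /= ltn_eqF.
  rewrite exprS -[_ * _]/(_ *m _) mxE big1 // => l _; have [al|al] := leqP a l; last first.
    by rewrite IH ?mulr0 //; move: ab al; lia.
  rewrite [(X - 1%:M) a l]mxE; move: al; rewrite leq_eqVlt => /orP[/eqP/val_inj <-|al].
    by rewrite X1 !mxE eqxx subrr mul0r.
  by rewrite tX // !mxE -val_eqE /= ltn_eqF // subr0 mul0r.
by apply/matrixP => a b; rewrite low ?mxE // (leq_trans (ltn_ord a)) // leq_addl.
Qed.

Section Setup.
Variables (Q : 'M[F]_n) (R S : 'M[int]_n) (fr : pred 'I_n) (th : 'I_n -> int).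
Hypotheses (uQ : Q \in unitmx) (RS : R *m S = 1%:M) (SR : S *m R = 1%:M).
Hypothesis th0 : forall k, ~~ fr k -> th k = 0.

Let T := torN Q S fr.

(** The weight of the [j]-th basis vector under the cocharacter [th]. Regularity of [th], assumed as
    [sep], makes the integer grading as fine as the decomposition under all of [T]. *)
Definition twt j : int := \sum_k th k * R k j.

Hypothesis sep : forall i j i' j', twt i - twt j = twt i' - twt j' ->
  forall k, fr k -> R k i - R k j = R k i' - R k j'.

Definition tcoord t : 'rV[F]_n := mono (qcoord Q t) S.

Lemma tcoordN t k : T t -> ~~ fr k -> tcoord t 0 k = 1.
Proof. by move=> [x [x0 xS] ->] kf; rewrite /tcoord qcoordK // xS. Qed.

Lemma tcoord_nz t : T t -> nz (tcoord t).
Proof. by move=> [x [x0 xS] ->]; rewrite /tcoord qcoordK //; apply: mono_nz. Qed.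

Lemma tcoordK t : T t -> t = qdiag Q (mono (tcoord t) R).
Proof.
by move=> [x [x0 xS] ->]; rewrite /tcoord qcoordK // mono_comp // SR mono1.
Qed.

Lemma torN_par (c : 'rV[F]_n) : nz c -> (forall k, ~~ fr k -> c 0 k = 1) ->
  T (qdiag Q (mono c R)).
Proof.
move=> c0 cf; exists (mono c R) => //; split; first exact: mono_nz.
by move=> k kf; rewrite mono_comp // RS mono1 cf.
Qed.

(** The Lie algebra of [T] in coordinates, [z] being the tangent vector in the parameters of the
    torus. *)
Definition tt : set 'M[F]_n := [set X | exists2 z : 'rV[F]_n,
  (forall k, ~~ fr k -> z 0 k = 0) & X = qdiag Q (\row_j \sum_k z 0 k * (R k j)%:~R)].

Lemma tt_subsp : subsp tt.
Proof.
split=> [|a _ _ [x x0 ->] [y y0 ->]].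
  exists 0 => [k|]; rewrite ?mxE //; apply: (qe_ext uQ) => i j.
  rewrite qe0 qe_diag // mxE big1 ?mul0rn // => k _; by rewrite mxE mul0r.
exists (a *: x + y) => [k kf|]; first by rewrite !mxE x0 // y0 // mulr0 addr0.
apply: (qe_ext uQ) => i j; rewrite qeP // !qe_diag // mulrnAr -mulrnDl !mxE; congr (_ *+ _).
rewrite mulr_sumr -big_split; apply: eq_bigr => k _ /=; rewrite !mxE; ring.
Qed.

Lemma qexp_torN Q' a : Q' \in unitmx -> T (qexp Q' a 2) -> exists c : 'I_n -> int,
  (forall j, (2 : F) ^ c j = qcoord Q (qexp Q' a 2) 0 j) /\
  qdiag Q' (\row_j (a j)%:~R) = qdiag Q (\row_j (c j)%:~R).
Proof.
move=> uQ' [x [x0 xS] xE].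
have [B Bdef] : exists B, B = invmx Q *m Q' by exists (invmx Q *m Q').
have uB : B \in unitmx by rewrite Bdef unitmx_mul unitmx_inv uQ.
have BE : B *m diag_mx (\row_j 2 ^ a j) = diag_mx x *m B.
  have := congr1 (fun Z => invmx Q *m Z *m Q') xE.
  rewrite /qexp /qdiag !mulmxA mulmxKV // mulVmx // mul1mx => e.
  by rewrite Bdef e mulmxA.
have /choice[c cP] : forall j, exists d : int, 2 ^ d = x 0 j /\ forall l, B j l != 0 -> a l = d.
  move=> j; have [l Bl] : exists l, B j l != 0.
    apply: contrapT => h; move: uB; rewrite unitmxE (expand_det_row _ j) big1 ?unitr0 //.
    by move=> l _; have [->|Bl] := eqVneq (B j l) 0; rewrite ?mul0r //; case: h; exists l.
  have xj l' : B j l' != 0 -> 2 ^ a l' = x 0 j.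
    move=> Bl'; apply: (mulfI Bl'); move/matrixP/(_ j l'): BE.
    by rewrite mul_mx_diag mul_diag_mx !mxE [x 0 j * _]mulrC.
  by exists (a l); split=> [|l' Bl']; [apply: xj|apply: (@exp2z_inj F); rewrite !xj].
exists c; split=> [j|]; first by rewrite xE qcoordK //; have [] := cP j.
have BEc : B *m diag_mx (\row_j (a j)%:~R) = diag_mx (\row_j (c j)%:~R) *m B.
  apply/matrixP => j l; rewrite mul_mx_diag mul_diag_mx !mxE.
  have [->|Bl] := eqVneq (B j l) 0; first by rewrite mul0r mulr0.
  by rewrite ((cP j).2 l Bl) mulrC.
have uQV : invmx Q \in unitmx by rewrite unitmx_inv.
apply: (can_inj (mulKmx uQV)); apply: (can_inj (mulmxK uQ')).
by rewrite /qdiag !mulmxA mulmxKV // mulVmx // mul1mx -Bdef BEc Bdef mulmxA.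
Qed.

Lemma qexp_tt Q' a : Q' \in unitmx -> T (qexp Q' a 2) -> tt (qdiag Q' (\row_j (a j)%:~R)).
Proof.
move=> uQ' Ta; have [c [cE ->]] := qexp_torN uQ' Ta.
pose z k : int := \sum_j c j * S j k.
exists (\row_k (z k)%:~R) => [k kf|].
  rewrite mxE; have := tcoordN Ta kf; rewrite /tcoord mxE.
  rewrite (eq_bigr (fun j => (2 : F) ^ (c j * S j k))).
    rewrite -exprz_sum ?pnatr_eq0 // -(expr0z 2) => /exp2z_inj.
    by rewrite -/(z k) => ->.
  by move=> j _; rewrite -cE exprz_exp.
congr (qdiag Q _); apply/rowP => j; rewrite !mxE.
have -> : c j = \sum_k z k * R k j.
  have := congr1 (fun A : 'M[int]_n => (\row_i c i *m A) 0 j) SR.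
  rewrite mulmx1 mulmxA !mxE => <-; apply: eq_bigr => k _; congr (_ * _).
  by rewrite mxE; apply: eq_bigr => i _; rewrite mxE.
by rewrite rmorph_sum; apply: eq_bigr => k _; rewrite rmorphM /= mxE.
Qed.

Lemma tt_lie : tt `<=` lie_algebra T.
Proof.
move=> _ [z zf ->]; have sL := lie_subsp T.
have -> : qdiag Q (\row_j \sum_k z 0 k * (R k j)%:~R) =
    \sum_(k | fr k) z 0 k *: qdiag Q (\row_j (R k j)%:~R).
  rewrite big_mkcond /=; apply: (qe_ext uQ) => i j; rewrite qe_sum // qe_diag // mxE -sumrMnl.
  apply: eq_bigr => k _; case: ifP => [_|/negbT kf]; last by rewrite zf // mul0r mul0rn qe0.
  by rewrite qeZ // qe_diag // mxE mulrnAr.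
apply: (subsp_sum sL) => k kf; apply: (subspZ sL); apply: lie_qexp => // b b0.
have -> : qexp Q (R k) b = qdiag Q (mono (\row_l if l == k then b else 1) R).
  congr (qdiag Q _); apply/rowP => j; rewrite !mxE (bigD1 k) //= mxE eqxx big1 ?mulr1 //.
  by move=> l /negPf lk; rewrite mxE lk exp1rz.
apply: torN_par => [l|l lf]; rewrite mxE; first by case: ifP; rewrite ?oner_neq0.
by case: eqP => // lk; move: lf; rewrite lk kf.
Qed.

Lemma cochar_T b : b != 0 -> T (cochar Q twt b).
Proof.
move=> b0; have -> : cochar Q twt b = qdiag Q (mono (\row_k b ^ th k) R).
  congr (qdiag Q _); apply/rowP => j; rewrite !mxE exprz_sum //; apply: eq_bigr => k _.
  by rewrite mxE exprz_exp.
by apply: torN_par => [k|k kf]; rewrite mxE ?expfz_neq0 // th0 // expr0z.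
Qed.

(** Exponents in the torus parameters of the root that corresponds to the degree [d]. The choice of
    [ij] is immaterial by [sep]; degrees that do not occur get 0. *)
Definition rootv (d : int) k : int :=
  if [pick ij : 'I_n * 'I_n | twt ij.1 - twt ij.2 == d] is Some ij then R k ij.1 - R k ij.2 else 0.

Lemma rootvP i j k : fr k -> rootv (twt i - twt j) k = R k i - R k j.
Proof.
move=> kf; rewrite /rootv; case: pickP => [[a b] /= /eqP e|/(_ (i, j)) /=]; last by rewrite eqxx.
exact: sep.
Qed.

Definition rootc d t : F := \prod_(k | fr k) tcoord t 0 k ^ rootv d k.

Lemma Ad_hom t d X : T t -> whom Q twt d X -> t *m X *m invmx t = rootc d t *: X.
Proof.
move=> Tt hX; have c0 := tcoord_nz Tt; set x := mono (tcoord t) R.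
have x0 : nz x by apply: mono_nz.
have tE : t = qdiag Q x by apply: tcoordK.
rewrite {1 2}tE qdiagV //; apply: (qe_ext uQ) => i j; rewrite qeDr // qeDl // qeZ // mxE.
have [ij|/hX ->] := eqVneq (twt i - twt j) d; last by rewrite !mulr0.
rewrite mulrA; congr (_ * _); rewrite -ij /rootc !mxE -prodfV -big_split [RHS]big_mkcond /=.
apply: eq_bigr => k _; case: ifP => kf; last by rewrite (tcoordN Tt) ?kf // !exp1rz invr1 mulr1.
by rewrite rootvP // expfzDr // invr_expz mulrC.
Qed.

Definition lroot d (z : 'rV[F]_n) : F := \sum_(k | fr k) z 0 k * (rootv d k)%:~R.

Lemma ad_hom (z : 'rV[F]_n) d X : (forall k, ~~ fr k -> z 0 k = 0) -> whom Q twt d X ->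
  lbr (qdiag Q (\row_j \sum_k z 0 k * (R k j)%:~R)) X = lroot d z *: X.
Proof.
move=> zf hX; apply: (qe_ext uQ) => i j; rewrite /lbr -scaleN1r addrC qeP // qeDr // qeDl // qeZ // !mxE.
have [ij|/hX ->] := eqVneq (twt i - twt j) d; last by rewrite !mulr0 addr0.
rewrite mulN1r addrC -mulrBl; congr (_ * _); rewrite -sumrB -ij /lroot [RHS]big_mkcond /=.
apply: eq_bigr => k _; case: ifP => [kf|/negbT kf]; last by rewrite zf // !mul0r subrr.
by rewrite rootvP // rmorphB -mulrBr.
Qed.

Lemma commT_hom X : (forall t, T t -> t *m X = X *m t) <-> whom Q twt 0 X.
Proof.
split=> [com|hX t Tt]; first by apply: hom0P => // b b0; apply: com; apply: cochar_T.
have := Ad_hom Tt hX; have -> : rootc 0 t = 1.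
  rewrite /rootc big1 // => k kf.
  by rewrite -(subrr (twt ord0)) rootvP // subrr expr0z.
have ut : t \in unitmx by apply: (grpU (alg_grp (torN_alg S fr uQ)) Tt).
by rewrite scale1r => /(congr1 (fun Z => Z *m t)); rewrite mulmxKV.
Qed.

Lemma tt_hom : tt `<=` whom Q twt 0.
Proof.
move=> _ [z zf ->] i j ij; rewrite qe_diag //; case: eqP => // e.
by rewrite e subrr eqxx in ij.
Qed.

Lemma conj_int (a : int) : (a%:~R : F)^* = a%:~R.
Proof. by rewrite rmorph_int. Qed.

(** Since [R] is integral, conjugating the parameters stays in [tt], and the trace against the
    conjugate is a sum of squared absolute values. *)
Lemma tt_nondeg X : tt X -> (forall Y, tt Y -> \tr (X *m Y) = 0) -> X = 0.
Proof.
move=> [z zf XE] h; pose y : 'rV[F]_n := \row_j \sum_k z 0 k * (R k j)%:~R.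
have tY : tt (qdiag Q (\row_j (y 0 j)^*)).
  exists (\row_k (z 0 k)^*) => [k kf|]; first by rewrite mxE zf // conjC0.
  congr (qdiag Q _); apply/rowP => j; rewrite !mxE rmorph_sum; apply: eq_bigr => k _.
  by rewrite mxE rmorphM /= conj_int.
have := h _ tY; rewrite {1}XE -/y tr_qdiagM // => /eqP; rewrite psumr_eq0; last first.
  by move=> j _; rewrite mxE mul_conjC_ge0.
move=> /allP h0; rewrite XE -/y (_ : y = 0); first by rewrite /qdiag raddf0 mulmx0 mul0mx.
apply/rowP => j; rewrite [RHS]mxE; have := h0 j (mem_index_enum _).
by rewrite /= mxE mul_conjC_eq0 => /eqP.
Qed.

Lemma tt_alg_comm X Y : whom Q twt 0 X -> tt Y -> X *m Y = Y *m X.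
Proof.
move=> hX [z zf ->]; have := ad_hom zf hX; have -> : lroot 0 z = 0.
  by rewrite /lroot big1 // => k kf; rewrite -(subrr (twt ord0)) rootvP // subrr mulr0.
by rewrite scale0r /lbr => /eqP; rewrite subr_eq0 => /eqP.
Qed.

Variable G : set 'M[F]_n.
Hypotheses (ssG : semisimple G) (maxT : maximal_torus G T).

Let aG : alg_group G. Proof. by case: ssG. Qed.
Let gG : mxgroup G. Proof. exact: alg_grp. Qed.
Let TG : T `<=` G. Proof. by case: maxT => -[]. Qed.
Let gT : mxgroup T. Proof. by apply: alg_grp; apply: torN_alg. Qed.
Let gg := lie_algebra G.
Let sg : subsp gg. Proof. exact: lie_subsp. Qed.

Lemma gg_wpart W d X : subsp W -> (forall t Y, T t -> W Y -> W (t *m Y *m invmx t)) ->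
  W X -> W (wpart Q twt d X).
Proof.
move=> sW WT WX; apply: wpart_in => // b Y b0; apply: WT; exact: cochar_T.
Qed.

(** The replicas of an element commuting with [T] commute with [T] as well, so the maximal torus
    absorbs them and the semisimple part lies in [tt]. *)
Lemma g0_split X : gg X -> whom Q twt 0 X -> exists s nn,
  [/\ X = s + nn, tt s, mnilp nn, gg nn & whom Q twt 0 nn].
Proof.
move=> gX hX; have comT := (commT_hom X).2 hX.
have [Q' [lam [nn [r [w [c [[uQ' XE nn0 gnn] iw lamE cG com]]]]]]] := replicas aG gX.
have two : (2 : F) != 0 by rewrite pnatr_eq0.
have tts : tt (qdiag Q' lam).
  have -> : qdiag Q' lam = \sum_(k < r) w k *: qdiag Q' (\row_j (c k j)%:~R).
    apply: (qe_ext uQ') => i j; rewrite qe_sum // qe_diag // lamE -sumrMnl; apply: eq_bigr => k _.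
    by rewrite qeZ // qe_diag // mxE mulrnAr mulrC.
  apply: (subsp_sum tt_subsp) => k _; apply: (subspZ tt_subsp); apply: qexp_tt => //.
  apply: (torus_absorb gG maxT uQ') two => [b b0|t b Tt b0]; first exact: cG.
  by have [_] := com t (comT t Tt); apply.
exists (qdiag Q' lam), nn; split=> //.
have -> : nn = X - qdiag Q' lam by rewrite XE addrC addKr.
by apply: (subspB (hom_subsp Q twt 0)) => //; apply: tt_hom.
Qed.

Let N0 : set 'M[F]_n := [set X | [/\ gg X, whom Q twt 0 X & mnilp X]].

Lemma N0_tr X : gg X -> whom Q twt 0 X -> (forall Y, tt Y -> \tr (X *m Y) = 0) -> mnilp X.
Proof.
move=> gX hX h; have [s [nn [XE ts nn0 gnn hnn]]] := g0_split gX hX.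
suff s0 : s = 0 by rewrite XE s0 add0r.
apply: tt_nondeg => // Y tY; have := h Y tY.
by rewrite XE mulmxDl linearD /= (comm_nilp_tr nn0) ?addr0 //; apply: tt_alg_comm.
Qed.

(** The nilpotent elements of weight 0 are those orthogonal to [tt], hence a subalgebra, and Engel's
    theorem makes products of two of them nilpotent. So the nilpotent part of [X] is orthogonal to
    weight 0; it is orthogonal to the other weights anyway, and nondegeneracy kills it. *)
Lemma g0_tt X : gg X -> whom Q twt 0 X -> tt X.
Proof.
move=> gX hX; have [s [nn [XE ts nn0 gnn hnn]]] := g0_split gX hX.
have hs := hom_subsp Q twt 0.
have sN : subsp N0.
  split=> [|a Y Z [gY hY nY] [gZ hZ nZ]].
    by split; [case: sg|case: hs|apply: nilp0].
  have gV : gg (a *: Y + Z) by apply: sg.2.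
  have hV : whom Q twt 0 (a *: Y + Z) by apply: hs.2.
  split=> //; apply: N0_tr => // V tV; rewrite mulmxDl -scalemxAl linearD linearZ /=.
  by rewrite !comm_nilp_tr ?mulr0 ?addr0 //; apply: tt_alg_comm.
have bN : brclosed N0.
  move=> Y Z [gY hY nY] [gZ hZ nZ].
  have gV : gg (lbr Y Z) by apply: lie_bracket.
  have hV : whom Q twt 0 (lbr Y Z) by rewrite -[0]addr0; apply: hom_lbr.
  split=> //; apply: N0_tr => // V tV.
  by rewrite tr_lbr /lbr (tt_alg_comm hZ tV) subrr mulmx0 linear0.
have nils0 := engel sN bN (fun Y (h : N0 Y) => let: And3 _ _ e := h in e).
suff n0 : nn = 0 by rewrite XE n0 addr0.
apply: (form_nondeg ssG); split=> // Y gY.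
rewrite (wpart_sum twt uQ Y) mulmx_sumr linear_sum /= big1 // => k _.
set d := _ - _; set Y' := wpart _ _ _ _.
have hY' : whom Q twt d Y' by apply: hom_wpart.
have gY' : gg Y' by apply: (@gg_wpart gg d Y sg) => // t V Tt gV; apply: lie_Ad => //; apply: TG.
have [d0|d0] := eqVneq d 0; last by apply: (hom_tr uQ hnn hY'); rewrite add0r.
rewrite d0 in hY'; have [s' [nn' [-> ts' nn0' gnn' hnn']]] := g0_split gY' hY'.
rewrite mulmxDr linearD /= comm_nilp_tr ?add0r //; last exact: tt_alg_comm.
by apply: nilp_tr; apply: (nils_mul nils0).
Qed.

(* The Lie algebra of [M] is spanned by that of [T] and by weight vectors of
   nonzero weight, which exponentiate into [Mu]. *)
Lemma solv_decomp M : alg_group M -> zconnected M -> solvable M -> T `<=` M -> M `<=` G ->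
  let Mu := [set u | M u /\ exists k, (u - 1%:M) ^+ k = 0] in
  [/\ alg_group Mu, normalised_by M Mu & M = [set t *m u | t in T & u in Mu]].
Proof.
move=> aM cM sM TM MG Mu; have gM := alg_grp aM.
have [|P uP tri] := @lie_kolchin F n' M n id gM cM sM.
  by split=> //; apply: polymap_id.
pose cj g := P *m g *m invmx P.
have cjM a b : cj (a *m b) = cj a *m cj b by rewrite /cj !mulmxA mulmxKV.
have cj1 : cj 1%:M = 1%:M by rewrite /cj mulmx1 mulmxV.
have cjK g : g = invmx P *m cj g *m P by rewrite /cj !mulmxA mulVmx // mul1mx mulmxKV.
have dM a b i : M a -> M b -> (cj (a *m b)) i i = cj a i i * cj b i i.
  move=> /tri/is_trig_mxP ta /tri/is_trig_mxP tb; rewrite cjM mxE (bigD1 i) //= big1 ?addr0 // => j ji.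
  have [ij|ij] := ltnP i j; first by rewrite ta // mul0r.
  by rewrite tb ?mulr0 // ltn_neqAle ji.
have unipP g : M g -> (exists k, (g - 1%:M) ^+ k = 0) <-> forall i, cj g i i = 1.
  move=> Mg; rewrite -(trig_unip (is_trig_mxP (tri g Mg))).
  split=> -[k gk]; exists k; first by rewrite conj_sub1 // conj_exp // gk mulr0 mul0r.
  have -> : g - 1%:M = invmx P * (cj g - 1%:M) * invmx (invmx P).
    by rewrite -conj_sub1 ?unitmx_inv // invmxK -cjK.
  by rewrite conj_exp ?unitmx_inv // gk mulr0 mul0r.
have MuM : Mu `<=` M by move=> u [].
have gMu : mxgroup Mu.
  split.
  - by move=> u [/(grpU gM)].
  - by split; [exact: grp1|exists 1%N; rewrite subrr expr1].
  - move=> a b [Ma /(unipP _ Ma) ua] [Mb /(unipP _ Mb) ub]; have Mab := grpM gM Ma Mb.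
    by split=> //; apply/unipP => // i; rewrite dM // ua ub mulr1.
  - move=> a [Ma /(unipP _ Ma) ua]; have Ma' := grpV gM Ma; split=> //; apply/unipP => // i.
    have := dM a (invmx a) i Ma Ma'.
    by rewrite mulmxV ?(grpU gM Ma) // cj1 mxE eqxx ua mul1r.
have aMu : alg_group Mu.
  apply/alg_groupP; split=> // u [zu uu].
  have Mu' : M u by apply: (alg_zcl aM) => //; apply: zclS zu.
  split=> //; apply/unipP => // i; apply/eqP; rewrite -subr_eq0; apply/eqP.
  apply: (zu (fun g => cj g i i - 1)); last by move=> a [Ma /(unipP _ Ma) ->]; rewrite subrr.
  apply: polyfB; last exact: polyfC.
  exact: (polymapM (polymapM (polymapC P) polymap_id) (polymapC (invmx P)) i i).
have nMu : normalised_by M Mu.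
  move=> k u Mk [Mu' [j uj]]; split; first exact: (grpJ gM).
  exists j; have uk := grpU gM Mk.
  have -> : k *m u *m invmx k - 1%:M = k * (u - 1%:M) * invmx k.
    exact: conj_sub1.
  by rewrite conj_exp // uj mulr0 mul0r.
split=> //.
pose M1 : set 'M[F]_n := [set t *m u | t in T & u in Mu].
have M1M : M1 `<=` M by move=> _ [t Tt [u [Mu' _] <-]]; apply: (grpM gM) => //; apply: TM.
have gM1 : mxgroup M1.
  split.
  - by move=> g /M1M/(grpU gM).
  - by exists 1%:M; [exact: (grp1 gT)|exists 1%:M; [exact: (grp1 gMu)|rewrite mulmx1]].
  - move=> _ _ [t Tt [u Uu <-]] [t' Tt' [u' Uu' <-]]; exists (t *m t'); first exact: (grpM gT).
    have ut' := grpU gT Tt'.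
    exists (invmx t' *m u *m t' *m u'); last by rewrite !mulmxA mulmxK.
    apply: (grpM gMu) => //; have := nMu (invmx t') u _ Uu; rewrite invmxK; apply.
    by apply: (grpV gM); apply: TM.
  - move=> _ [t Tt [u Uu <-]]; exists (invmx t); first exact: (grpV gT).
    have ut := grpU gT Tt; have uu := grpU gMu Uu.
    exists (t *m invmx u *m invmx t); last by rewrite invmxM // !mulmxA mulVmx // mul1mx.
    by apply: nMu; [apply: TM|apply: (grpV gMu)].
have aM1 : alg_group M1 by apply: alg_prod => //; apply: torN_alg.
apply: lie_eq => // X MX.
have sL1 := lie_subsp M1.
rewrite (wpart_sum twt uQ X); apply: (subsp_sum sL1) => k _.
set d := _ - _; set X' := wpart _ _ _ _.
have hX' : whom Q twt d X' by apply: hom_wpart.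
have MX' : lie_algebra M X'.
  apply: (@gg_wpart _ d X (lie_subsp M)) => //.
  by move=> t Y Tt MY; apply: lie_Ad => //; apply: TM.
have [d0|d0] := eqVneq d 0.
  rewrite d0 in hX'; have tX' : tt X' by apply: g0_tt => //; apply: lieS MX'.
  apply: lieS (tt_lie tX'); move=> t Tt; exists t => //; exists 1%:M; rewrite ?mulmx1 //.
  exact: (grp1 gMu).
have nX' := hom_nilp uQ d0 hX'.
apply: exp_lie => // c; exists 1%:M; first exact: (grp1 gT).
exists (mexp (c *: X')); last by rewrite mul1mx.
split; first exact: lie_exp.
by exists n; apply: mexp_unip; apply: nilpZ.
Qed.

End Setup.
End TorusWeights.

(** * Roots of a maximal unipotent subgroup *)

Section RootLemmas.
Variables (F : numClosedFieldType) (n' : nat).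
Local Notation n := n'.+1.
Implicit Types (Q X Y Z a e g t l v : 'M[F]_n) (W M H T G A D V : set 'M[F]_n).

(** Biduality inside [W]: adding to [D] everything orthogonal to [W] reduces to [perp_perp], and
    nondegeneracy shows that the added part of [e] is 0. *)
Lemma perp_in W D e : subsp W -> subsp D -> D `<=` W -> (forall X, radform W X -> X = 0) ->
  W e -> (forall Y, W Y -> (forall X, D X -> \tr (X *m Y) = 0) -> \tr (e *m Y) = 0) -> D e.
Proof.
move=> sW sD DW ndW We h.
pose C := [set X + Y | X in D & Y in [set Y | forall X, W X -> \tr (X *m Y) = 0]].
have sC : subsp C.
  split=> [|c _ _ [X DX [Y Y0 <-]] [X' DX' [Y' Y0' <-]]].
    by exists 0; [case: sD|exists 0; rewrite ?addr0 // => X _; rewrite mulmx0 linear0].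
  exists (c *: X + X'); first exact: sD.2.
  exists (c *: Y + Y'); last by rewrite scalerDr addrACA.
  by move=> Z WZ; rewrite mulmxDr -scalemxAr linearD linearZ /= Y0 // Y0' // mulr0 addr0.
have [X DX [Y Y0 eE]] : C e.
  apply: (perp_perp sC) => Y CY; apply: h => [|X DX]; last first.
    by apply: CY; exists X => //; exists 0; rewrite ?addr0 // => Z _; rewrite mulmx0 linear0.
  apply: (perp_perp sW) => Z Z0; rewrite mxtrace_mulC; apply: CY; exists 0; first by case: sD.
  by exists Z; rewrite ?add0r.
suff Y00 : Y = 0 by rewrite -eE Y00 addr0.
have YE : Y = e - X by rewrite -eE addrC addKr.
apply: ndW; split=> [|Z WZ]; first by rewrite YE; apply: (subspB sW) => //; apply: DW.
by rewrite mxtrace_mulC; apply: Y0.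
Qed.

(* As in the theory of [sl_2], [E K^(j+1) v = (j+1) (lam - j q / 2) K^j v]
   modulo [W]. *)
Lemma sl2_mod W (E K H : 'M[F]_n -> 'M[F]_n) (q lam : F) v N : subsp W ->
  (forall c X Y, K (c *: X + Y) = c *: K X + K Y) ->
  (forall X, W X -> W (K X)) -> (forall X, W X -> W (E X)) ->
  (forall Z, E (K Z) = K (E Z) + H Z) -> (forall Z, H (K Z) = K (H Z) - q *: K Z) ->
  ~ W v -> W (E v) -> W (H v - lam *: v) -> W (iter N K v) ->
  exists k : nat, W (iter k.+1 K v) /\ lam = k%:R * q / 2.
Proof.
move=> sW linK WK WE EK HK nWv WEv WHv WN.
have KB c X Y : K (X - c *: Y) = K X - c *: K Y.
  by rewrite addrC -scaleNr linK scaleNr addrC.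
pose u j := iter j K v.
have Hu j : W (H (u j) - (lam - j%:R * q) *: u j).
  elim: j => [|j IH]; first by rewrite mul0r subr0.
  have := WK _ IH; rewrite KB -[u j.+1]/(K (u j)) HK => h.
  set Y := K (H (u j)) in h *; set Z := K (u j) in h *.
  suff -> : Y - q *: Z - (lam - j.+1%:R * q) *: Z = Y - (lam - j%:R * q) *: Z by [].
  by rewrite -addrA -opprD -scalerDl; congr (_ - _ *: _); rewrite -natr1; ring.
have Eu j : W (E (u j.+1) - (j.+1%:R * (lam - j%:R * q / 2)) *: u j).
  elim: j => [|j IH].
    rewrite -[u 1%N]/(K v) EK -addrA; apply: (subspD sW); first exact: WK.
    by rewrite mul1r !mul0r subr0.
  have := WK _ IH; rewrite KB -[u j.+2]/(K (u j.+1)) EK -[K (u j)]/(u j.+1) => h.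
  have := subspD sW h (Hu j.+1); rewrite addrACA -opprD -scalerDl.
  by congr (W (_ - _ *: _)); rewrite -!natr1; field.
have ex : exists m, `[< W (u m) >] by exists N; apply/asboolP.
have := ex_minnP ex; case=> -[|k] /asboolP Wm min; first by [].
exists k; split=> //.
have nWk : ~ W (u k) by move=> Wk; have := min k (asboolT Wk); rewrite ltnn.
have c0 : W ((k.+1%:R * (lam - k%:R * q / 2)) *: u k).
  by have := subspB sW (WE _ Wm) (Eu k); rewrite opprB addrC subrK.
have [c00|c00] := eqVneq (k.+1%:R * (lam - k%:R * q / 2)) 0.
  by move/eqP: c00; rewrite mulf_eq0 pnatr_eq0 /= subr_eq0 => /eqP.
by case: nWk; rewrite -[u k]scale1r -(mulVf c00) -scalerA; apply: (subspZ sW).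
Qed.

Section LeftWeights.
Variables (Q : 'M[F]_n) (m : 'I_n -> int).
Hypothesis uQ : Q \in unitmx.

Definition lpart (w : int) : 'M[F]_n := qdiag Q (\row_i (m i == w)%:R).

Let N := (\sum_i absz (m i))%N.

(** The analogue of the weight decomposition for left multiplication: the pieces of [Z] are again
    coefficients in [b] of a curve inside [W]. *)
Lemma lweight_ind W V : subsp W -> subsp V ->
  (forall b Z, b != 0 -> W Z -> W (cochar Q m b *m Z)) ->
  (forall w Z, W Z -> lpart w *m Z = Z -> V Z) -> W `<=` V.
Proof.
move=> sW sV WT h Z WZ.
have mN i : exists2 k, (k < N.*2.+1)%N & m i = k%:Z - N%:Z.
  have : (absz (m i) <= N)%N by rewrite /N (bigD1 i) //= leq_addr.
  by move=> le; exists (absz (m i + N%:Z)); lia.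
pose p k : 'M[F]_n := lpart (k%:Z - N%:Z).
have pE k i : (\row_i (m i == k%:Z - N%:Z)%:R : 'rV[F]_n) 0 i = (m i == k%:Z - N%:Z)%:R.
  by rewrite mxE.
have cE b : b != 0 -> b ^+ N *: cochar Q m b = \sum_(k < N.*2.+1) b ^+ k *: p k.
  move=> b0; apply: (qe_ext uQ) => i j; rewrite qeZ // qe_sum // /cochar /qexp qe_diag // mxE.
  have [k0 lt mi] := mN i; rewrite (bigD1 (Ordinal lt)) //= big1 ?addr0 => [|k nk].
    rewrite qeZ // qe_diag // pE mi eqxx !mulrnAr; congr (_ *+ _); rewrite mulr1.
    by rewrite -[b ^+ N]/(b ^ N%:Z) -[b ^+ k0]/(b ^ k0%:Z) -expfzDr //; congr (_ ^ _); lia.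
  rewrite qeZ // qe_diag // pE mi; case: eqP => [e|_]; last by rewrite mul0rn mulr0.
  by case/eqP: nk; apply: val_inj => /=; lia.
have sumE : Z = \sum_(k < N.*2.+1) p k *m Z.
  have := cE 1 (oner_neq0 F); rewrite expr1n scale1r => c1.
  rewrite -mulmx_suml; have -> : \sum_(k < N.*2.+1) p k = cochar Q m 1.
    by rewrite c1; apply: eq_bigr => k _; rewrite expr1n scale1r.
  rewrite (_ : cochar Q m 1 = 1%:M) ?mul1mx // -(qdiag1 uQ) /cochar /qexp.
  by congr (qdiag Q _); apply/rowP => i; rewrite !mxE exp1rz.
rewrite sumE; apply: (subsp_sum sV) => k _; apply: (h (k%:Z - N%:Z)); last first.
  rewrite mulmxA qdiagM //; congr (qdiag Q _ *m _); apply/rowP => i; rewrite !mxE.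
  by case: eqP; rewrite ?mulr1 ?mulr0.
apply: (@subsp_coefN0 _ _ W N.*2.+1 (fun k => p k *m Z) sW) => // b b0.
have -> : \sum_(k0 < N.*2.+1) b ^+ k0 *: (p k0 *m Z) = b ^+ N *: (cochar Q m b *m Z).
  by rewrite scalemxAl cE // mulmx_suml; apply: eq_bigr => i _; rewrite scalemxAl.
by apply: (subspZ sW); apply: WT.
Qed.

Lemma lpart_eigen (x : 'rV[F]_n) w c Z : (forall i, m i = w -> x 0 i = c) ->
  lpart w *m Z = Z -> qdiag Q x *m Z = c *: Z.
Proof.
move=> xc ZE; rewrite -{1}ZE mulmxA qdiagM // -[in RHS]ZE scalemxAl; congr (_ *m _).
apply: (qe_ext uQ) => i j; rewrite qeZ // !qe_diag // !mxE !mulrnAr; congr (_ *+ _).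
by case: eqP => [/xc -> |]; rewrite ?mulr0.
Qed.

End LeftWeights.

Lemma rat_clear (I : finType) (f : I -> rat) :
  exists2 N : int, N != 0 & exists z : I -> int, forall i, N%:~R * f i = (z i)%:~R.
Proof.
exists (\prod_i denq (f i)); first by rewrite prodf_seq_neq0; apply/allP => i _; rewrite denq_neq0.
exists (fun i => (\prod_(j | j != i) denq (f j)) * numq (f i)) => i.
rewrite (bigD1 i) //= !rmorphM /= mulrAC numqE.
by rewrite mulrC; congr (_ * _); apply: mulrC.
Qed.

(** Independence over the integers is independence over the rationals. A one-sided inverse exists
    there, and [N] clears its denominators. *)
Lemma zindep_dual r s (B : 'M[int]_(s, r)) :
  (forall c : 'I_r -> int, (forall k, \sum_i c i * B k i = 0) -> forall i, c i = 0) ->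
  exists2 N : int, N != 0 & exists B' : 'M[int]_(r, s), B' *m B = N%:M.
Proof.
move=> ind; pose A : 'M[rat]_(r, s) := map_mx intr B^T.
have : row_free A.
  rewrite -kermx_eq0; apply/rowV0P => v /sub_kermxP vA.
  have [N N0 [z zE]] := rat_clear (v 0); have z0 : forall i, z i = 0.
    apply: ind => k; apply: (@intr_inj rat); rewrite rmorph_sum /=.
    rewrite (eq_bigr (fun i => N%:~R * (v 0 i * A i k))); last first.
      by move=> i _; rewrite !mxE rmorphM /= -zE mulrA.
    by rewrite -mulr_sumr; move/rowP/(_ k): vA; rewrite !mxE => ->; rewrite mulr0.
  apply/rowP => i; rewrite mxE; apply/eqP; move/eqP: (zE i).
  by rewrite z0 mulf_eq0 intr_eq0 (negPf N0).
move=> /row_freeP[C AC].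
have [N N0 [z zE]] := rat_clear (fun ij : 'I_s * 'I_r => C ij.1 ij.2).
exists N => //; exists (\matrix_(i, k) z (k, i)); apply/matrixP => i j.
apply: (@intr_inj rat); rewrite !mxE rmorph_sum /=.
rewrite (eq_bigr (fun k => N%:~R * (A j k * C k i))); last first.
  by move=> k _; rewrite !mxE rmorphM /= -zE /= -mulrA [C k i * _]mulrC.
rewrite -mulr_sumr; move/matrixP/(_ j i): AC; rewrite !mxE => ->.
by rewrite eq_sym; case: eqP; rewrite ?mulr1 ?mulr0.
Qed.

Lemma unip_filter A g h : nils A -> (forall q Z, ann A q Z -> ann A q (h *m Z)) ->
  (forall q Z, ann A q Z -> ann A q.-1 (g *m Z - h *m Z)) ->
  (exists k, (h - 1%:M) ^+ k = 0) -> exists k, (g - 1%:M) ^+ k = 0.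
Proof.
move=> [K AK] hA ghA [k hk].
have gA q Z : ann A q Z -> ann A q (g *m Z).
  move=> AZ; rewrite -[g *m Z](subrK (h *m Z)); apply: (subspD (ann_subsp A q)); last exact: hA.
  by apply: (ann_le (leq_pred q)); apply: ghA.
have g1A q Z : ann A q Z -> ann A q ((g - 1%:M) *m Z).
  by move=> AZ; rewrite mulmxBl mul1mx; apply: (subspB (ann_subsp A q)) => //; apply: gA.
have h1A q i Z : ann A q Z -> ann A q ((h - 1%:M) ^+ i *m Z).
  elim: i => [|i IH] AZ; first by rewrite expr0 mul1mx.
  rewrite exprS -mulmxA mulmxBl mul1mx; apply: (subspB (ann_subsp A q)); last exact: IH.
  by apply: hA; apply: IH.
have dA q i Z : ann A q Z -> ann A q.-1 ((g - 1%:M) ^+ i *m Z - (h - 1%:M) ^+ i *m Z).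
  move=> AZ; elim: i => [|i IH]; first by rewrite subrr; case: (ann_subsp A q.-1).
  set Y := _ ^+ i *m Z in IH; set Y' := (h - _) ^+ i *m Z in IH.
  have -> : (g - 1%:M) ^+ i.+1 *m Z - (h - 1%:M) ^+ i.+1 *m Z =
     (g - 1%:M) *m (Y - Y') + (g *m Y' - h *m Y').
    rewrite !exprS -[_ * _]/(_ *m _) -[X in _ - X *m _]/(_ *m _) -!mulmxA -/Y -/Y'.
    rewrite mulmxBr ![(_ - 1%:M) *m Y']mulmxBl [(_ - 1%:M) *m Y]mulmxBl !mul1mx.
    move: (g *m Y) (g *m Y') (h *m Y') => y1 y2 y3.
    by apply/matrixP => a b; rewrite !mxE; ring.
  by apply: (subspD (ann_subsp A _)); [apply: g1A|apply: ghA; apply: h1A].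
have step q Z : ann A q Z -> ann A q.-1 ((g - 1%:M) ^+ k *m Z).
  by move=> /(dA q k); rewrite hk mul0mx subr0.
exists (k * K)%N; suff hq q Z : ann A q Z -> (g - 1%:M) ^+ (k * q) *m Z = 0.
  by rewrite -[LHS]mulmx1; apply: hq.
elim: q Z => [Z -> |q IH Z AZ]; first by rewrite mulmx0.
by rewrite mulnSr exprD -[_ * _]/(_ *m _) -mulmxA; apply: IH; apply: (step q.+1).
Qed.

Lemma unip_Ad V l X : alg_group V -> unipotent V -> l \in unitmx ->
  (forall v, V v -> V (l *m v *m invmx l)) -> lie_algebra V X -> lie_algebra V (l *m X *m invmx l).
Proof.
move=> aV uV ul lV VX; have nX := lie_unip_nilp aV uV VX.
apply: exp_lie => [c|]; last exact: nilp_conj.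
have -> : c *: (l *m X *m invmx l) = l * (c *: X) * invmx l.
  by rewrite -[l * _ * _]/(l *m _ *m _) -scalemxAr -scalemxAl.
by rewrite mexp_conj //; apply: lV; apply: lie_exp.
Qed.

(** As [v] acts trivially on the layers of the filtration of [Lie V], the matrices [l] and [l *m v]
    act there in the same way; unipotency can be tested on layers by [unip_filter]. *)
Lemma unip_mod V l v : alg_group V -> unipotent V -> l \in unitmx ->
  (forall v, V v -> V (invmx l *m v *m l)) -> V v ->
  (exists k, (l *m v - 1%:M) ^+ k = 0) <-> (exists k, (l - 1%:M) ^+ k = 0).
Proof.
move=> aV uV ul lV Vv; set A := lie_algebra V.
have lA q Z : ann A q Z -> ann A q (l *m Z).
  elim: q Z => [Z -> /=|q IH Z AZ a Aa]; first by rewrite mulmx0.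
  have -> : a *m (l *m Z) = l *m ((invmx l *m a *m l) *m Z) by rewrite !mulmxA mulmxV // mul1mx.
  apply: IH; apply: AZ; have := @unip_Ad V (invmx l) a aV uV; rewrite invmxK unitmx_inv; exact.
have vA q Z : ann A q Z -> ann A q.-1 (v *m Z - Z).
  by have [_ h] := unip_Gam aV uV Vv => /h; rewrite subn1.
have lvA q Z : ann A q Z -> ann A q.-1 (l *m v *m Z - l *m Z).
  by move=> AZ; rewrite -mulmxA -mulmxBr; apply: lA; apply: vA.
split; apply: (unip_filter (unip_nils aV uV)) => // q Z AZ.
- rewrite -mulmxA; apply: lA; rewrite -[v *m Z](subrK Z); apply: (subspD (ann_subsp A q)) => //.
  by apply: (ann_le (leq_pred q)); apply: vA.
- by rewrite -opprB; apply: (subspN (ann_subsp A _)); apply: lvA.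
Qed.

(** The geometric series makes inversion a polynomial map on unipotent groups, so that closures can
    be taken through it. *)
Lemma unip_inv g : (exists k, (g - 1%:M) ^+ k = 0) ->
  invmx g = \sum_(i < n) (1%:M - g) ^+ i.
Proof.
move=> [k gk]; have nX : (1%:M - g) ^+ n = 0.
  apply: (@mnilpP _ _ _ k); rewrite -opprB exprNn gk mulr0 //.
apply: invmx_eq; have := subrX1 (1%:M - g) n; rewrite nX sub0r.
have -> : 1%:M - g - 1 = - g by rewrite addrAC -[1%:M]/(1 : 'M[F]_n) subrr sub0r.
by rewrite mulNr => /oppr_inj/esym.
Qed.

Lemma polymap_unip_inv : polymap (fun g : 'M[F]_n => \sum_(i < n) (1%:M - g) ^+ i).
Proof.
move=> a b; apply: (@polyf_ext _ _ (fun g : 'M[F]_n => \sum_(i < n) ((1%:M - g) ^+ i) a b)).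
  by move=> g; rewrite summxE.
apply: polyf_sum => i _; apply: (@polymapX _ _ n (fun g : 'M[F]_n => 1%:M - g)).
by apply: polymapB; [apply: polymapC|apply: polymap_id].
Qed.

Lemma rcurve_qexp Q (a : 'I_n -> int) : rcurve 'X (qexp Q a).
Proof.
apply: rcurveM; last exact: rcurveC.
apply: rcurveM; first exact: rcurveC.
move=> i j; have [ij|ij] := eqVneq i j; last first.
  by apply: (@rfun_ext _ _ (fun _ => 0)) => [x _|]; [rewrite !mxE (negPf ij)|apply: rfunC].
apply: (@rfun_ext _ _ (fun x => x ^ a i)) => [x _|]; first by rewrite !mxE -ij eqxx.
by apply/(rfunP _ _ 1); exists (a i)%:~R; apply: rfun_der_exprz.
Qed.

Lemma qexpV Q (a : 'I_n -> int) b : Q \in unitmx -> b != 0 -> invmx (qexp Q a b) = qexp Q a b^-1.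
Proof.
move=> uQ b0; apply: invmx_eq; rewrite /qexp qdiagM // -[RHS](qdiag1 uQ); congr (qdiag Q _).
by apply/rowP => j; rewrite !mxE -expfzMl divff // exp1rz.
Qed.

Lemma qexp1 Q (a : 'I_n -> int) : Q \in unitmx -> qexp Q a 1 = 1%:M.
Proof.
move=> uQ; rewrite /qexp -(qdiag1 uQ); congr (qdiag Q _).
by apply/rowP => j; rewrite !mxE exp1rz.
Qed.

Lemma zirr_qexp Q (a : 'I_n -> int) : zirr [set qexp Q a b | b in [set b | b != 0]].
Proof.
apply: zirr_curves; first by exists (qexp Q a 1); exists 1 => //=; rewrite oner_neq0.
move=> _ _ [x x0 <-] [x' x0' <-]; exists 'X, (qexp Q a), x, x'; split.
- by rewrite polyX_eq0.
- exact: rcurve_qexp.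
- by rewrite hornerX.
- by rewrite hornerX.
- by move=> c; rewrite hornerX => c0; exists c.
Qed.

Lemma torN_conn Q (R S : 'M[int]_n) fr : Q \in unitmx -> R *m S = 1%:M -> S *m R = 1%:M ->
  zconnected (torN Q S fr).
Proof.
move=> uQ RS SR; pose T := torN Q S fr; have gT : mxgroup T by apply: alg_grp; apply: torN_alg.
pose Sg : set 'M[F]_n := [set t | exists k b, [/\ fr k, b != 0 & t = qexp Q (R k) b]].
have SgT : Sg `<=` T.
  move=> _ [k [b [kf b0 ->]]]; have -> : qexp Q (R k) b = qdiag Q (mono (\row_l if l == k then b else 1) R).
    congr (qdiag Q _); apply/rowP => j; rewrite !mxE (bigD1 k) //= mxE eqxx big1 ?mulr1 //.
    by move=> l /negPf lk; rewrite mxE lk exp1rz.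
  apply: torN_par => // [l|l lf]; rewrite mxE; first by case: ifP; rewrite ?oner_neq0.
  by case: eqP => // lk; move: lf; rewrite lk kf.
have SgU : Sg `<=` @GLset F n by move=> t /SgT/(grpU gT).
have gSg := gen_group SgU.
rewrite -/T (_ : T = generated Sg).
  apply: zconnected_gen => // [_ [k [b [kf b0 ->]]]|_ [k [b [kf b0 ->]]]].
    by exists k, b^-1; rewrite invr_eq0 qexpV.
  exists [set qexp Q (R k) b | b in [set b | b != 0]]; split.
  - exact: zirr_qexp.
  - by move=> _ [x x0 <-]; exists k, x.
  - by exists 1; rewrite /= ?oner_neq0 // qexp1.
  - by exists b.
apply/seteqP; split; last exact: gen_min.
move=> t Tt; rewrite (tcoordK uQ SR Tt) qdiag_mono //.
apply: (big_ind (generated Sg)); [exact: (grp1 gSg)|move=> x y; exact: (grpM gSg)|] => k _.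
have [kf|kf] := boolP (fr k); last by rewrite (tcoordN uQ Tt kf) qexp1 //; apply: (grp1 gSg).
apply: sub_gen; exists k, (tcoord Q S t 0 k); split=> //; exact: (tcoord_nz uQ Tt).
Qed.

(** Take the powers [b^k] of one natural number [b]. Two distinct roots with equal degrees would
    make [b] a zero of one of finitely many nonzero polynomials. *)
Lemma regular_cochar (R : 'M[int]_n) (fr : pred 'I_n) : exists th : 'I_n -> int,
  (forall k, ~~ fr k -> th k = 0) /\ forall i j i' j',
    twt R th i - twt R th j = twt R th i' - twt R th j' ->
    forall k, fr k -> R k i - R k j = R k i' - R k j'.
Proof.
pose v (ij : 'I_n * 'I_n * ('I_n * 'I_n)) k : int :=
  R k ij.1.1 - R k ij.1.2 - (R k ij.2.1 - R k ij.2.2).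
pose p ij : {poly F} := \poly_(k < n) (if fr (inord k) then (v ij (inord k))%:~R else 0).
pose P := \prod_ij (if p ij == 0 then 1 else p ij).
have P0 : P != 0 by rewrite prodf_seq_neq0; apply/allP => ij _ /=; case: (eqVneq (p ij) 0); rewrite ?oner_neq0.
have [b Pb] : exists b : nat, P.[b%:R] != 0.
  apply: contrapT => nb; case/eqP: P0; apply: poly_infN => i; apply: contrapT => /eqP h.
  by apply: nb; exists i.
pose th k : int := if fr k then b%:Z ^+ k else 0; exists th; split=> [k /negPf kf|].
  by rewrite /th kf.
move=> i j i' j' e k kf; pose ij := ((i, j), (i', j')).
have sv : \sum_k th k * v ij k = 0.
  rewrite -[RHS](subrr (twt R th i - twt R th j)) [in X in _ = _ - X]e /twt -!sumrB.
  by apply: eq_bigr => l _; rewrite /v /=; ring.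
have pb : (p ij).[b%:R] = 0.
  rewrite horner_poly -[RHS](rmorph0 (intmul (1 : F))) -sv rmorph_sum; apply: eq_bigr => l _ /=.
  rewrite inord_val /th; case: ifP => _; last by rewrite !mul0r.
  by rewrite rmorphM rmorphXn /= mulrC.
have pz : p ij = 0.
  apply/eqP; apply: contraNT Pb => pn; rewrite /P horner_prod (bigD1 ij) //= (negPf pn) pb mul0r //.
have := congr1 (fun q : {poly F} => q`_k) pz; rewrite coef_poly ltn_ord inord_val kf coef0 => /eqP.
by rewrite intr_eq0 /v /= subr_eq0 => /eqP.
Qed.

End RootLemmas.

Section LbrLemmas.
Variables (F : numClosedFieldType) (n' : nat).
Local Notation n := n'.+1.
Implicit Types X Y Z : 'M[F]_n.

Lemma lbrPr c X Y Z : lbr X (c *: Y + Z) = c *: lbr X Y + lbr X Z.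
Proof. by rewrite /lbr mulmxDr mulmxDl -scalemxAr -scalemxAl scalerBr opprD addrACA. Qed.

Lemma lbrC X Y : lbr X Y = - lbr Y X.
Proof. by rewrite /lbr opprB. Qed.

Lemma lbrPl c X Y Z : lbr (c *: X + Y) Z = c *: lbr X Z + lbr Y Z.
Proof. by rewrite lbrC lbrPr opprD -scalerN -!lbrC. Qed.

Lemma lbr0 X : lbr X 0 = 0.
Proof. by rewrite /lbr mulmx0 mul0mx subrr. Qed.

Lemma jacobi X Y Z : lbr X (lbr Y Z) = lbr Y (lbr X Z) + lbr (lbr X Y) Z.
Proof.
rewrite /lbr !mulmxBr !mulmxBl !mulmxA.
by apply/matrixP => i j; rewrite !mxE; ring.
Qed.

Lemma lbr_subsp_r W X : subsp W -> subsp [set Y | W (lbr X Y)].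
Proof. by move=> [W0 WZ]; split=> [|c Y Z WY WZ'] /=; [rewrite lbr0|rewrite lbrPr; apply: WZ]. Qed.

Lemma tr_subsp Y : subsp [set X : 'M[F]_n | \tr (X *m Y) = 0].
Proof.
split=> [|c X Z XY ZY] /=; first by rewrite mul0mx linear0.
by rewrite mulmxDl -scalemxAl linearD linearZ /= XY ZY mulr0 addr0.
Qed.

Lemma iter_lbr_nilp X Z : mnilp X -> exists N, iter N (lbr X) Z = 0.
Proof.
move=> nX; pose A := addl [set (0 : 'M[F]_n)] X.
have s0 : subsp [set (0 : 'M[F]_n)] := subsp0 F n'.
have sA : subsp A := addl_subsp X s0.
have [k Ak] : nils A.
  apply: nils_addl => //; first by move=> a ->; rewrite mulmx0 mul0mx subrr.
  by exists 1%N => Y a ->; rewrite mul0mx.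
exists (k + k)%N; apply: (@iter_lbr0 _ _ A k (fun i => iter i (lbr X) Z) sA Ak) => i.
by exists X => //; apply: mem_addl.
Qed.

End LbrLemmas.

(** * Simple roots of a maximal unipotent subgroup normalised by the torus *)

Section MaxUnipotent.
Variables (F : numClosedFieldType) (n' : nat).
Local Notation n := n'.+1.
Implicit Types (X Y Z a e f h y t : 'M[F]_n) (W M V : set 'M[F]_n).
Variables (Q : 'M[F]_n) (R S : 'M[int]_n) (fr : pred 'I_n) (ct : 'I_n -> int).
Hypotheses (uQ : Q \in unitmx) (RS : R *m S = 1%:M) (SR : S *m R = 1%:M).
Hypothesis ct0 : forall k, ~~ fr k -> ct k = 0.
Let m := twt R ct.
Hypothesis sep : forall i j i' j', m i - m j = m i' - m j' ->
  forall k, fr k -> R k i - R k j = R k i' - R k j'.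
Variable G : set 'M[F]_n.
Hypotheses (ssG : semisimple G) (maxT : maximal_torus G (torN Q S fr)).
Let T := torN Q S fr.
Let tt := tt Q R fr.
Let hom := whom Q m.
Let gg := lie_algebra G.
Let alpha := rootc Q R S fr ct.

Let aG : alg_group G. Proof. by case: ssG. Qed.
Let gG : mxgroup G. Proof. exact: alg_grp. Qed.
Let TG : T `<=` G. Proof. by case: maxT => -[]. Qed.
Let aT : alg_group T. Proof. exact: torN_alg. Qed.
Let gT : mxgroup T. Proof. exact: alg_grp. Qed.
Let sg : subsp gg. Proof. exact: lie_subsp. Qed.
Let st : subsp tt. Proof. exact: tt_subsp. Qed.
Let tth X : tt X -> hom 0 X. Proof. exact: tt_hom. Qed.
Let g0 X : gg X -> hom 0 X -> tt X. Proof. exact: (g0_tt uQ RS SR ct0 sep ssG maxT). Qed.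
Let AdT t d X : T t -> hom d X -> t *m X *m invmx t = alpha d t *: X.
Proof. exact: (Ad_hom uQ SR sep). Qed.
Let wpg W d X : subsp W -> (forall t Y, T t -> W Y -> W (t *m Y *m invmx t)) ->
  W X -> W (wpart Q m d X).
Proof. exact: (gg_wpart uQ RS ct0). Qed.

Lemma graded_ind W V : subsp W -> (forall t Y, T t -> W Y -> W (t *m Y *m invmx t)) ->
  subsp V -> (forall d X, W X -> hom d X -> V X) -> W `<=` V.
Proof.
move=> sW WT sV h X WX; rewrite (wpart_sum m uQ X); apply: (subsp_sum sV) => k _.
apply: (h _ _ _ (hom_wpart uQ _)); exact: wpg.
Qed.

Lemma ad_tt h d X : tt h -> hom d X -> exists c, lbr h X = c *: X.
Proof. by move=> [z zf ->] hX; exists (lroot R fr ct d z); apply: ad_hom. Qed.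

Let ggT t Y : T t -> gg Y -> gg (t *m Y *m invmx t).
Proof. by move=> Tt gY; apply: lie_Ad => //; apply: TG. Qed.

Lemma gg_lbr_nilp X Y : gg X -> gg Y -> mnilp X -> gg (lbr X Y).
Proof. by move=> gX gY nX; apply: lie_bracket. Qed.

Section OneGroup.
Variable U : set 'M[F]_n.
Hypotheses (aU : alg_group U) (uU : unipotent U) (UG : U `<=` G) (TU : normalised_by T U).
Let u := lie_algebra U.

Let su : subsp u. Proof. exact: lie_subsp. Qed.
Let bu : brclosed u. Proof. exact: unip_brclosed. Qed.
Let nu : nils u. Proof. exact: unip_nils. Qed.
Let un X : u X -> mnilp X. Proof. exact: lie_unip_nilp. Qed.
Let ug X : u X -> gg X. Proof. exact: lieS. Qed.

Lemma unip_AdT t Y : T t -> u Y -> u (t *m Y *m invmx t).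
Proof. by move=> Tt; apply: unip_Ad => //; [apply: (grpU gT)|move=> v; apply: TU]. Qed.

Lemma unip_wt0 X : u X -> hom 0 X -> X = 0.
Proof.
move=> uX hX; apply: (tt_nondeg uQ (fr := fr) (R := R)) => [|Y tY]; first by apply: g0 => //; apply: ug.
apply: comm_nilp_tr; first exact: un.
exact: (tt_alg_comm uQ sep).
Qed.

Lemma unip_tt h X : tt h -> u X -> \tr (X *m h) = 0.
Proof.
move=> th; move: X; apply: (graded_ind su unip_AdT (tr_subsp h)) => d X uX hX /=.
have [d0|d0] := eqVneq d 0.
  by rewrite d0 in hX; rewrite (unip_wt0 uX hX) mul0mx linear0.
by apply: (hom_tr uQ hX (tth th)); rewrite addr0.
Qed.

Lemma unip_ad_tt h X : tt h -> u X -> u (lbr h X).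
Proof.
move=> th; move: X; apply: (graded_ind su unip_AdT (lbr_subsp_r h su)) => d X uX hX /=.
by have [c ->] := ad_tt th hX; apply: (subspZ su).
Qed.

Lemma unip_perp X Y : u X -> u Y -> \tr (X *m Y) = 0.
Proof. by move=> uX uY; apply: nilp_tr; apply: (nils_mul nu). Qed.

(** The Lie algebra expected of the Borel subgroup [T U]. *)
Definition bor : set 'M[F]_n := [set h + X | h in tt & X in u].

Lemma bor_subsp : subsp bor.
Proof.
split=> [|c _ _ [h th [X uX <-]] [h' th' [X' uX' <-]]].
  by exists 0; [case: st|exists 0; rewrite ?addr0 //; case: su].
exists (c *: h + h'); first exact: st.2.
by exists (c *: X + X'); [apply: su.2|rewrite scalerDr addrACA].
Qed.

Lemma bor_tt h : tt h -> bor h.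
Proof. by move=> th; exists h => //; exists 0; rewrite ?addr0 //; case: su. Qed.

Lemma bor_u X : u X -> bor X.
Proof. by move=> uX; exists 0; [case: st|exists X; rewrite ?add0r]. Qed.

Lemma bor_perp X Y : u X -> bor Y -> \tr (X *m Y) = 0.
Proof.
move=> uX [h th [Z uZ <-]]; rewrite mulmxDr linearD /= unip_tt // add0r.
exact: unip_perp.
Qed.

Lemma tt_AdT t h : T t -> tt h -> t *m h *m invmx t = h.
Proof.
move=> Tt th; rewrite ((commT_hom uQ RS SR ct0 sep h).2 (tth th) t Tt) mulmxK //.
exact: (grpU gT).
Qed.

Lemma bor_AdT t Y : T t -> bor Y -> bor (t *m Y *m invmx t).
Proof.
move=> Tt [h th [X uX <-]]; exists h => //; exists (t *m X *m invmx t); first exact: unip_AdT.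
by rewrite mulmxDr mulmxDl (tt_AdT Tt th).
Qed.

Lemma bor_ad X Y : u X -> bor Y -> u (lbr X Y).
Proof.
move=> uX [h th [Z uZ <-]]; rewrite -[h]scale1r lbrPr scale1r; apply: (subspD su).
  by rewrite lbrC; apply: (subspN su); apply: unip_ad_tt.
exact: bu.
Qed.

Hypothesis maxU : forall M, alg_group M -> unipotent M -> M `<=` G -> normalised_by T M ->
  U `<=` M -> M `<=` U.

(** Otherwise there is a weight vector [Y] outside [bor], orthogonal to [u], whose brackets with [u]
    fall into [bor]. Orthogonality pushes these brackets into [u], and the weight of [Y] is nonzero,
    so adjoining [Y] to [u] exponentiates to a larger unipotent group normalised by [T]. *)
Lemma perp_bor X : gg X -> (forall Y, u Y -> \tr (Y *m X) = 0) -> bor X.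
Proof.
move=> gX X0.
pose q : set 'M[F]_n := [set X | gg X /\ forall Y, u Y -> \tr (Y *m X) = 0].
have sq : subsp q.
  split=> [|c Y Z [gY Y0] [gZ Z0]]; first by split=> [|Y _]; [case: sg|rewrite mulmx0 linear0].
  split=> [|V uV]; first exact: sg.2.
  by rewrite mulmxDr -scalemxAr linearD linearZ /= Y0 // Z0 // mulr0 addr0.
have qT t Y : T t -> q Y -> q (t *m Y *m invmx t).
  move=> Tt [gY Y0]; have ut := grpU gT Tt; split=> [|Z uZ]; first exact: ggT.
  have -> : \tr (Z *m (t *m Y *m invmx t)) = \tr ((invmx t *m Z *m t) *m Y).
    by rewrite !mulmxA mxtrace_mulC !mulmxA.
  by apply: Y0; have := @unip_AdT (invmx t) Z (grpV gT Tt) uZ; rewrite invmxK.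
suff : q `<=` bor by apply.
move=> {gX X0 X}.
apply: (graded_ind sq qT bor_subsp) => d X qX hX; apply: contrapT => nb.
(* Brackets are restricted to weight vectors so that the element found by [lbr_step] is again a
   weight vector. *)
pose A' : set 'M[F]_n := [set a | u a /\ exists d, hom d a].
pose V : set 'M[F]_n := [set a | q a /\ exists d, hom d a].
have [|||Y [[[gY Y0] [e hY]] nbY bY]] := @lbr_step _ _ u A' V bor X su nu _ bor_subsp.1 _ _ nb.
- by move=> a [].
- move=> a Y [ua [e ha]] [[gY Y0] [e' hY]]; split; last by exists (e + e'); apply: hom_lbr.
  split=> [|Z uZ]; first by apply: gg_lbr_nilp => //; [apply: ug|apply: un].
  by rewrite -tr_lbr; apply: Y0; apply: bu.
- by split=> //; exists d.
have {}bY a : u a -> bor (lbr a Y).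
  move=> ua; suff : bor (lbr Y a) by move/(subspN bor_subsp); rewrite -lbrC.
  move: a ua; apply: (graded_ind su unip_AdT (lbr_subsp_r Y bor_subsp)) => d' a ua ha /=.
  by rewrite lbrC; apply: (subspN bor_subsp); apply: bY; split=> //; exists d'.
have uY a : u a -> u (lbr a Y).
  move=> ua; have [h th [Z uZ E]] := bY _ ua; suff h0 : h = 0 by rewrite -E h0 add0r.
  apply: (tt_nondeg uQ th) => k tk.
  have : \tr (lbr a Y *m k) = 0.
    rewrite mxtrace_mulC -tr_lbr; apply: Y0; exact: unip_ad_tt.
  by rewrite -E mulmxDl linearD /= (unip_tt tk uZ) addr0.
have e0 : e != 0.
  by apply: contra_notN nbY => /eqP e0; apply: bor_tt; apply: g0 => //; rewrite -e0.
have nY := hom_nilp uQ e0 hY.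
pose N := addl u Y; have sN : subsp N := addl_subsp Y su.
have bN : brclosed N by move=> A B NA NB; apply: sub_addl; apply: (addl_brclosed su bu uY).
have [k Nk] : nils N.
  by apply: nils_addl => // a ua; rewrite -opprB; apply: (subspN su); apply: uY.
have nN Z : N Z -> mnilp Z.
  move=> NZ; apply: (@mnilpP _ _ _ k); suff h j Z' : ann N j Z' -> Z ^+ j *m Z' = 0.
    by rewrite -[LHS]mulmx1; apply: h.
  elim: j Z' => [Z' -> |j IH Z' NV]; first by rewrite mulmx0.
  by rewrite exprSr -[_ * _]/(_ *m _) -mulmxA; apply: IH; apply: NV.
apply: nbY; apply: bor_u; apply: lieS (@expgrp_lie _ _ N sN nN Y (mem_addl Y su)).
apply: maxU.
- exact: expgrp_alg.
- exact: expgrp_unip.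
- apply: expgrp_sub => // _ [a [c [ua ->]]]; apply: (subspD sg); first exact: ug.
  exact: (subspZ sg).
- move=> t g Tt; apply: expgrp_conj => //; first exact: (grpU gT).
  move=> _ [a [c [ua ->]]]; exists (t *m a *m invmx t), (c * alpha e t); split.
    exact: unip_AdT.
  by rewrite mulmxDr mulmxDl -scalemxAr -scalemxAl (AdT Tt hY) scalerA.
- move=> v Uv; have [Z [nZ uZ] ->] := log_lie aU Uv (uU Uv).
  by rewrite -[Z]scale1r; apply: expgrp_exp => //; apply: sub_addl.
Qed.

Lemma perp_bor_u X : gg X -> (forall Y, bor Y -> \tr (Y *m X) = 0) -> u X.
Proof.
move=> gX X0; have [h th [Z uZ E]] : bor X by apply: perp_bor => // Y uY; apply: X0; apply: bor_u.
suff h0 : h = 0 by rewrite -E h0 add0r.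
apply: (tt_nondeg uQ th) => k tk; have := X0 _ (bor_tt tk).
by rewrite -E mulmxDr linearD /= [\tr (k *m Z)]mxtrace_mulC (unip_tt tk uZ) addr0 mxtrace_mulC.
Qed.

(** The weights of [u / [u, u]]; the integer [d] stands for a root through the regular grading. *)
Definition sroot (d : int) := exists X, [/\ u X, hom d X & ~ derS u set0 X].

(** By the Frattini argument [t] fixes [u]. A weight vector of [gg] on which [t] acts by a scalar
    other than 1 is then orthogonal to [u], hence in [bor], where [t] acts trivially. So [t] fixes
    the Lie algebra of [G], and its centraliser is all of [G]. *)
Lemma sroots_trivial_center t : trivial_center G -> T t -> (forall d, sroot d -> alpha d t = 1) ->
  t = 1%:M.
Proof.
move=> Z1 Tt at1; have ut := grpU gT Tt.
pose k : set 'M[F]_n := [set X | u X /\ t *m X *m invmx t = X].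
have AdP c X Y : t *m (c *: X + Y) *m invmx t = c *: (t *m X *m invmx t) + t *m Y *m invmx t.
  by rewrite mulmxDr mulmxDl -scalemxAr -scalemxAl.
have sk : subsp k.
  split=> [|c X Y [uX tX] [uY tY]]; first by split; [case: su|rewrite mulmx0 mul0mx].
  by split; [apply: su.2|rewrite AdP tX tY].
have bk : brclosed k.
  move=> X Y [uX tX] [uY tY]; split; first exact: bu.
  rewrite -{2}tX -{2}tY /lbr mulmxBr mulmxBl !mulmxA !mulmxKV //.
have uk : u `<=` k.
  apply: derS_frattini => //; first by move=> X [].
  apply: (graded_ind su unip_AdT (derS_subsp _ _)) => d X uX hX.
  have [DX|nDX] := pselect (derS u set0 X).
    by move=> W sW _; apply: DX.
  move=> W sW kW _; apply: kW; split=> //; rewrite (AdT Tt hX) at1 ?scale1r //.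
  by exists X.
have gk X : gg X -> t *m X *m invmx t = X.
  move: X; apply: (graded_ind sg ggT (V := [set X | t *m X *m invmx t = X])).
    by split=> [|c X Y /= tX tY]; rewrite /= ?mulmx0 ?mul0mx // AdP tX tY.
  move=> d X gX hX /=; rewrite (AdT Tt hX).
  have [->|a1] := eqVneq (alpha d t) 1; first by rewrite scale1r.
  have [h th [Z uZ XE]] : bor X.
    have b1 : alpha d t - 1 != 0 by rewrite subr_eq0.
    rewrite -[X]scale1r -(mulVf b1) -scalerA; apply: (subspZ bor_subsp); apply: perp_bor.
      exact: (subspZ sg).
    move=> Y uY; rewrite scalerBl scale1r -(AdT Tt hX) mulmxBr linearB /=.
    have -> : \tr (Y *m (t *m X *m invmx t)) = \tr ((invmx t *m Y *m t) *m X).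
      by rewrite !mulmxA mxtrace_mulC !mulmxA.
    have [_ tY] := uk _ uY.
    by rewrite -{1}tY !mulmxA mulVmx // mul1mx mulmxKV // subrr.
  by rewrite -(AdT Tt hX) -XE mulmxDr mulmxDl tt_AdT // (uk _ uZ).2.
apply: Z1; first exact: TG.
pose C : set 'M[F]_n := [set g | G g /\ t *m g = g *m t].
have gC : mxgroup C.
  split.
  - by move=> g [/(grpU gG)].
  - by split; [apply: (grp1 gG)|rewrite mulmx1 mul1mx].
  - move=> a b [Ga ta] [Gb tb]; split; first exact: (grpM gG).
    by rewrite mulmxA ta -mulmxA tb mulmxA.
  - move=> a [Ga ta]; split; first exact: (grpV gG).
    have ua := grpU gG Ga; apply: (can_inj (mulKmx ua)); apply: (can_inj (mulmxK ua)).
    by rewrite !mulmxA mulmxKV // mulmxV // mul1mx.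
have aC : alg_group C.
  apply/alg_groupP; split=> // g [zg Ug]; split.
    by apply: (alg_zcl aG) => //; apply: zclS zg => x [].
  apply/matrixP => i j; apply/eqP; rewrite -subr_eq0; apply/eqP.
  apply: (zg (fun g : 'M[F]_n => (t *m g) i j - (g *m t) i j)); last first.
    by move=> g' [_ ->]; rewrite subrr.
  apply: polyfB; [exact: (polymapM (polymapC t) polymap_id i j)|exact: (polymapM polymap_id (polymapC t) i j)].
suff -> : G = C by move=> g [_ ->].
apply: lie_eq => //; first by case: ssG.
  by move=> g [].
apply: (graded_ind sg ggT (lie_subsp C)) => d X gX hX.
have [d0|d0] := eqVneq d 0.
  rewrite d0 in hX; apply: lieS (tt_lie (S := S) uQ RS (g0 gX hX)) => s Ts; split; first exact: TG.
  move: Tt Ts => [x _ ->] [x' _ ->]; rewrite !qdiagM //; congr (qdiag Q _).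
  by apply/rowP => j; rewrite !mxE mulrC.
have nX := hom_nilp uQ d0 hX; apply: exp_lie => // c; split; first exact: lie_exp.
have := mexp_conj (c *: X) ut; have -> : t * (c *: X) * invmx t = c *: X.
  by rewrite -[t * _ * _]/(t *m _ *m _) -scalemxAr -scalemxAl gk.
by move/(congr1 (fun Z => Z *m t)); rewrite -[t * _ * _]/(t *m _ *m _) mulmxKV.
Qed.

(** A triple for a simple root: [y] is the element of [tt] dual to the root under the trace form, by
    [sdata_tr]. Orthogonality of [f] to the brackets of [u] encodes simplicity. *)
Definition sdata (d : int) e f y :=
  [/\ u e, hom d e, gg f & hom (- d) f] /\
  [/\ y = lbr e f, tt y, \tr (e *m f) = 1 & forall a b, u a -> u b -> \tr (lbr a b *m f) = 0].

Lemma tr_wpart d X Y : \tr (X *m wpart Q m (- d) Y) = \tr (wpart Q m d X *m Y).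
Proof.
rewrite !(qe_tr uQ); apply: eq_bigr => i _; rewrite !qeM //; apply: eq_bigr => k _.
rewrite !qe_wpart //; have -> : (m k - m i == - d) = (m i - m k == d).
  by rewrite -opprB eqr_opp.
by case: eqP; rewrite ?mulr0 ?mul0r.
Qed.

Lemma derS_AdT t X : T t -> derS u set0 X -> derS u set0 (t *m X *m invmx t).
Proof.
move=> Tt DX W sW _ bW; have ut := grpU gT Tt.
apply: (DX [set X | W (t *m X *m invmx t)]) => //.
  split=> [|c Y Z WY WZ] /=; first by rewrite mulmx0 mul0mx; case: sW.
  by rewrite mulmxDr mulmxDl -scalemxAr -scalemxAl; apply: sW.2.
move=> a b ua ub /=.
have -> : t *m lbr a b *m invmx t = lbr (t *m a *m invmx t) (t *m b *m invmx t).
  by rewrite /lbr mulmxBr mulmxBl !mulmxA !mulmxKV.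
by apply: bW; apply: unip_AdT.
Qed.

(** As [e] is not in [[u, u]], nondegeneracy yields an element orthogonal to [[u, u]] but not to
    [e]; its component of weight [- d], normalised, is [f]. *)
Lemma sroot_data d : sroot d -> exists e f y, sdata d e f y.
Proof.
move=> [e [ue he nD]]; have sD := derS_subsp u set0.
have Du : derS u set0 `<=` u by move=> X; apply.
have [Y [gY Y0 eY]] : exists Y, [/\ gg Y, forall X, derS u set0 X -> \tr (X *m Y) = 0 & \tr (e *m Y) != 0].
  apply: contrapT => h; apply: nD; apply: (perp_in sg sD) => [X /Du/ug//|X|//|Y gY Y0].
  - exact: form_nondeg.
  - exact: ug.
  - by apply: contrapT => /eqP eY; apply: h; exists Y.
pose f := (\tr (e *m Y))^-1 *: wpart Q m (- d) Y.
have gf : gg f by apply: (subspZ sg); exact: (@wpg gg (- d) Y sg ggT gY).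
have hf : hom (- d) f by apply: (subspZ (hom_subsp Q m (- d))); apply: hom_wpart.
have hy : hom 0 (lbr e f) by rewrite -(subrr d); apply: hom_lbr.
exists e, f, (lbr e f); split=> //; split=> //.
- by apply: g0 => //; apply: gg_lbr_nilp => //; [apply: ug|apply: un].
- by rewrite -scalemxAr linearZ /= tr_wpart wpart_hom // mulVf.
- move=> a b ua ub; rewrite -scalemxAr linearZ /= tr_wpart (Y0 (wpart Q m d (lbr a b))) ?mulr0 //.
  by apply: (@wpg (derS u set0) d _ sD derS_AdT) => W sW _; apply.
Qed.

Lemma hom_wt d X : hom d X -> X != 0 -> exists i j, m i - m j = d.
Proof.
move=> hX X0; apply: contrapT => h; case/eqP: X0; apply: (qe_ext uQ) => i j.
by rewrite qe0 // hX //; apply/eqP => e; apply: h; exists i, j.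
Qed.

Section OneRoot.
Variables (d : int) (e f y : 'M[F]_n).
Hypothesis sd : sdata d e f y.

Let ue : u e. Proof. by case: sd => -[]. Qed.
Let he : hom d e. Proof. by case: sd => -[]. Qed.
Let gf : gg f. Proof. by case: sd => -[]. Qed.
Let hf : hom (- d) f. Proof. by case: sd => -[]. Qed.
Let yE : y = lbr e f. Proof. by case: sd => _ []. Qed.
Let ty : tt y. Proof. by case: sd => _ []. Qed.
Let ef : \tr (e *m f) = 1. Proof. by case: sd => _ []. Qed.

Lemma sdata_e0 : e != 0.
Proof. by apply/eqP => e0; have /eqP := ef; rewrite e0 mul0mx linear0 eq_sym oner_eq0. Qed.

Lemma sdata_d0 : d != 0.
Proof. by apply: contraNN sdata_e0 => /eqP d0; rewrite (unip_wt0 ue) //; rewrite -d0. Qed.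

Lemma sdata_nilp : mnilp f.
Proof. by apply: (hom_nilp uQ _ hf); rewrite oppr_eq0 sdata_d0. Qed.

Lemma sdata_tr (z : 'rV[F]_n) : (forall k, ~~ fr k -> z 0 k = 0) ->
  \tr (y *m qdiag Q (\row_j \sum_k z 0 k * (R k j)%:~R)) = lroot R fr ct d z.
Proof.
move=> zf; rewrite yE mxtrace_mulC -tr_lbr (ad_hom uQ sep zf he) -scalemxAl linearZ /= ef.
by rewrite mulr1.
Qed.

Lemma sdata_ad h X : tt h -> hom d X -> lbr h X = \tr (y *m h) *: X.
Proof. by move=> [z zf ->] hX; rewrite sdata_tr // (ad_hom uQ sep zf hX). Qed.

Lemma sdata_adN h X : tt h -> hom (- d) X -> lbr h X = - \tr (y *m h) *: X.
Proof.
move=> [z zf ->] hX; rewrite sdata_tr // (ad_hom uQ sep zf hX); congr (_ *: _).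
have [i [j ij]] := hom_wt he sdata_e0.
rewrite /lroot -sumrN; apply: eq_bigr => k kf; rewrite -mulrN -rmorphN /=; congr (_ * _%:~R).
by rewrite -ij opprB !(rootvP sep) // opprB.
Qed.

Lemma sdata_f_ad a : u a -> bor (lbr f a).
Proof.
move=> ua; apply: perp_bor => [|b ub]; first by apply: gg_lbr_nilp => //; [apply: ug|apply: sdata_nilp].
by rewrite mxtrace_mulC tr_lbr mxtrace_mulC; case: sd => _ []; auto.
Qed.

Lemma sdata_nf : ~ bor f.
Proof. by move=> bf; have /eqP := bor_perp ue bf; rewrite ef oner_eq0. Qed.

Let q := \tr (y *m y).
Let ye Z : y *m (e *m Z) = e *m (y *m Z) + q *: (e *m Z).
Proof.
rewrite !mulmxA scalemxAl -mulmxDl; congr (_ *m _); rewrite -(sdata_ad ty he).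
by rewrite /lbr addrC subrK.
Qed.
Let yf Z : y *m (f *m Z) = f *m (y *m Z) - q *: (f *m Z).
Proof.
rewrite !mulmxA scalemxAl -mulmxBl; congr (_ *m _); rewrite -scaleNr -(sdata_adN ty hf).
by rewrite /lbr addrC subrK.
Qed.

Lemma iter_mul X Z N : iter N (mulmx X) Z = X ^+ N *m Z.
Proof.
elim: N => [|N IH]; first by rewrite expr0 mul1mx.
by rewrite iterS IH exprS mulmxA.
Qed.

Lemma sdata_string W Z (lam : F) : subsp W -> (forall X, W X -> W (f *m X)) -> (forall X, W X -> W (e *m X)) ->
  ~ W Z -> W (e *m Z) -> y *m Z = lam *: Z ->
  exists k : nat, W (iter k.+1 (mulmx f) Z) /\ lam = k%:R * q / 2.
Proof.
move=> sW Wf We nWZ WeZ yZ.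
apply: (@sl2_mod _ _ W (mulmx e) (mulmx f) (mulmx y) q lam Z n) => //.
- by move=> c X Y; rewrite mulmxDr -scalemxAr.
- by move=> X; rewrite yE /lbr mulmxBl !mulmxA addrC subrK.
- by rewrite yZ subrr; case: sW.
- by rewrite iter_mul sdata_nilp mul0mx; case: sW.
Qed.

(** Applying [e] as long as possible to the eigenvector, [k] times, adds [k q] to the eigenvalue. At
    the top [sl2_mod] gives [l q / 2] for a natural number [l], so the eigenvalue was
    [(l - 2k) q / 2]. *)
Lemma sdata_eigen (x : 'rV[F]_n) i : y = qdiag Q x -> exists z : int, x 0 i = z%:~R * q / 2.
Proof.
move=> yx; pose v : 'M[F]_n := Q *m delta_mx i i.
have yv : y *m v = x 0 i *: v.
  rewrite yx /qdiag /v mulmxA mulmxKV // -mulmxA scalemxAr; congr (_ *m _).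
  apply/matrixP => a b; rewrite mul_diag_mx !mxE; case: (eqVneq a i) => [->|] //=.
  by rewrite !mulr0.
have v0 : v != 0.
  apply/eqP => v0; have := congr1 (fun Z => invmx Q *m Z) v0; rewrite mulmx0 mulKmx //.
  by move/matrixP/(_ i i)/eqP; rewrite !mxE !eqxx oner_eq0.
have yk k : y *m (e ^+ k *m v) = (x 0 i + k%:R * q) *: (e ^+ k *m v).
  elim: k => [|k IH]; first by rewrite expr0 mul1mx yv mul0r addr0.
  rewrite exprS -[e * _]/(e *m _) -mulmxA ye IH -scalemxAr -scalerDl; congr (_ *: _).
  by rewrite -natr1; ring.
have ex : exists k, e ^+ k *m v == 0 by exists n; rewrite (un ue) mul0mx.
have := ex_minnP ex; case=> -[|k] /eqP ek min; first by move: v0; rewrite -[v]mul1mx -[1%:M]/(e ^+ 0) ek eqxx.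
have nk : e ^+ k *m v != 0 by apply/negP => /min; rewrite ltnn.
have [] := @sdata_string [set 0] (e ^+ k *m v) (x 0 i + k%:R * q) (subsp0 F n') _ _ _ _ (yk k).
- by move=> X ->; rewrite mulmx0.
- by move=> X ->; rewrite mulmx0.
- exact/eqP.
- by rewrite mulmxA -[e *m _]/(e * _) -exprS.
move=> l [_ xE]; exists (l%:Z - 2 * k%:Z); rewrite rmorphB rmorphM /=.
by rewrite -[LHS](addrK (k%:R * q)) xE -!pmulrn; field.
Qed.

(** With eigenvalues [z_i q / 2] for integers [z_i], the definition of [q] as the trace of the
    square of [y] reads [q = q^2 s / 4] with [s] the sum of the [z_i^2]. If [q] were 0, then [y]
    would be 0, although it pairs with the derivative of the grading to give the nonzero degree
    [d]. *)
Lemma sdata_real : 0 < q /\ exists2 x : 'rV[F]_n, y = qdiag Q x & forall i, x 0 i \is Num.real.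
Proof.
have [z0 zf yx] := ty; set x := \row_j _ in yx.
have /choice[z zE] : forall i, exists z : int, x 0 i = z%:~R * q / 2.
  by move=> i; apply: sdata_eigen.
have q0 : q != 0.
  apply/eqP => q0; have y0 : y = 0.
    rewrite yx (_ : x = 0) ?/qdiag ?raddf0 ?mulmx0 ?mul0mx //.
    by apply/rowP => i; rewrite zE q0 mulr0 mul0r mxE.
  have tH : tt (qdiag Q (\row_j (m j)%:~R)).
    by apply: (qexp_tt (S := S)) => //; apply: cochar_T => //; rewrite pnatr_eq0.
  have := sdata_ad tH he; rewrite y0 mul0mx linear0 scale0r => H0.
  suff : d%:~R *: e = 0 :> 'M[F]_n.
    move/eqP; rewrite scaler_eq0 (negPf sdata_e0) orbF intr_eq0; exact/negP/sdata_d0.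
  rewrite -H0; apply: (qe_ext uQ) => i j; rewrite /lbr -scaleN1r addrC qeP // qeDr // qeDl // qeZ // !mxE.
  have [ij|/he ->] := eqVneq (m i - m j) d; last by rewrite !mulr0 addr0.
  by rewrite -ij rmorphB /=; ring.
pose s : int := \sum_i z i ^+ 2.
have qs : q * (s%:~R / 4) = 1.
  apply: (mulfI q0); rewrite mulr1 mulrA -expr2 {2}/q {2}yx yx tr_qdiagM // mulrA /s rmorph_sum /=.
  rewrite mulr_sumr mulr_suml; apply: eq_bigr => i _; by rewrite zE rmorphXn /=; field.
have s0 : (0 : F) <= s%:~R / 4 by rewrite divr_ge0 ?ler0n // ler0z; apply: sumr_ge0 => i _; apply: sqr_ge0.
have qpos : 0 < q.
  have sn0 : s%:~R / 4 != 0 :> F by apply/eqP => e0; move/eqP: qs; rewrite e0 mulr0 eq_sym oner_eq0.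
  rewrite lt_def q0 /=; have -> : q = (s%:~R / 4)^-1 by apply: (mulIf sn0); rewrite qs mulVf.
  by rewrite invr_ge0.
split=> //; exists x => // i; rewrite zE; apply: realM; last by rewrite realV realn.
by apply: realM; [apply: realz|apply: gtr0_real].
Qed.

End OneRoot.

(** Distinct simple roots form a non-acute angle. Modulo the span of [bor] and [f], the vector [f']
    is killed by the bracket with [e] and has weight minus the trace under [y]; by [sl2_mod] this
    weight is a nonnegative multiple of [q / 2]. *)
Lemma sdata_pair d e f y d' e' f' y' : sdata d e f y -> sdata d' e' f' y' -> d != d' ->
  \tr (y' *m y) <= 0.
Proof.
move=> sd sd' dd'; have [[ue he gf hf] [yE ty ef fD]] := sd.
have [[ue' he' gf' hf'] [yE' ty' ef' f'D]] := sd'; pose q := \tr (y *m y).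
pose W := addl bor f; have sW : subsp W := addl_subsp f bor_subsp.
have nf' : ~ bor f' := sdata_nf sd'.
have nWf' : ~ W f'.
  move=> [b [c [bb E]]]; apply: nf'; rewrite -(wpart_hom uQ hf') E addrC wpartP //.
  rewrite (wpart_hom0 uQ hf) ?scaler0 ?add0r; last by rewrite eqr_opp eq_sym.
  exact: (@wpg bor (- d') b bor_subsp bor_AdT bb).
have [N fN] := iter_lbr_nilp f' (sdata_nilp sd).
have bW X : bor X -> W X by apply: sub_addl.
have [] := @sl2_mod _ _ W (lbr e) (lbr f) (lbr y) q (- \tr (y' *m y)) f' N sW.
- by move=> c X Y; apply: lbrPr.
- move=> _ [b [c [[h th [a ua <-]] ->]]]; rewrite addrC lbrPr -[h]scale1r lbrPr scale1r.
  apply: (subspD sW); first by rewrite /lbr subrr scaler0; case: sW.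
  apply: (subspD sW); last by apply: bW; apply: (sdata_f_ad sd).
  rewrite lbrC (sdata_adN sd th hf); apply: (subspN sW); apply: (subspZ sW).
  by apply: mem_addl; apply: bor_subsp.
- move=> _ [b [c [bb ->]]]; rewrite addrC lbrPr -yE; apply: (subspD sW).
    by apply: (subspZ sW); apply: bW; apply: bor_tt.
  by apply: bW; apply: bor_u; apply: bor_ad.
- by move=> Z; rewrite jacobi -yE.
- move=> Z; rewrite jacobi (sdata_adN sd ty hf) -/q; congr (_ + _).
  by rewrite -[_ *: f]addr0 lbrPl scaleNr [lbr 0 Z]lbrC lbr0 subr0.
- exact: nWf'.
- by rewrite lbrC; apply: (subspN sW); apply: bW; apply: (sdata_f_ad sd').
- by rewrite (sdata_adN sd' ty hf') subrr; case: sW.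
- by rewrite fN; case: sW.
move=> k [_ kE]; rewrite -oppr_ge0 kE divr_ge0 ?ler0n // mulr_ge0 ?ler0n //.
by case: (sdata_real sd) => /ltW.
Qed.

Lemma tt_eigen y w Z : tt y -> lpart Q m w *m Z = Z -> exists c, y *m Z = c *: Z.
Proof.
move=> [z zf ->] ZE; set x := \row_j _.
have [[i mi]|nmi] := pselect (exists i, m i = w).
  exists (x 0 i); apply: (lpart_eigen uQ _ ZE) => j mj; rewrite !mxE; apply: eq_bigr => k _.
  have [kf|kf] := boolP (fr k); last by rewrite zf // !mul0r.
  congr (_ * _%:~R); apply: (addIr (- R k i)); apply: (sep _ kf); rewrite mi mj //.
exists 0; apply: (lpart_eigen uQ _ ZE) => j mj; by case: nmi; exists j.
Qed.

(* The lowering operators shift the flag [ann u], because the nonnegative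
   weights of all [y d] on its layers have a vanishing positive combination. *)
Lemma sroots_flag (s : seq int) (e f y : int -> 'M[F]_n) (w : int -> F) :
  (forall d, d \in s -> sdata d (e d) (f d) (y d)) -> (forall d, d \in s -> 0 < w d) ->
  \sum_(d <- s) w d *: y d = 0 -> s = [::].
Proof.
move=> sd w0 y0.
have uT b Z j : b != 0 -> ann u j Z -> ann u j (cochar Q m b *m Z).
  move=> b0; have Tb : T (cochar Q m b) by apply: cochar_T.
  have ub := grpU gT Tb; elim: j Z => [Z -> /=|j IH Z AZ a ua]; first by rewrite mulmx0.
  have -> : a *m (cochar Q m b *m Z) =
      cochar Q m b *m ((invmx (cochar Q m b) *m a *m cochar Q m b) *m Z).
    by rewrite !mulmxA mulmxV // mul1mx.
  apply: IH; apply: AZ; have := @unip_AdT (invmx (cochar Q m b)) a (grpV gT Tb) ua.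
  by rewrite invmxK.
have step j : (forall d Z, d \in s -> ann u j Z -> ann u j (f d *m Z)) ->
    forall d Z, d \in s -> ann u j.+1 Z -> ann u j (f d *m Z).
  move=> IH d Z ds; move: Z; have sj := ann_subsp u j.
  apply: (lweight_ind uQ (m := m) (ann_subsp u j.+1)
    (V := [set Z | ann u j (f d *m Z)])).
  - split=> [|c X Y AX AY] /=; first by rewrite mulmx0; case: sj.
    by rewrite mulmxDr -scalemxAr; apply: sj.2.
  - by move=> b Z b0; apply: uT.
  move=> wt Z AZ ZE /=; have [AjZ|nAjZ] := pselect (ann u j Z); first exact: IH.
  have /choice[mu muE] : forall d, exists c, d \in s -> y d *m Z = c *: Z.
    move=> d'; have [d's|] := boolP (d' \in s); last by exists 0.
    have [_ [_ ty _ _]] := sd _ d's; have [c cE] := tt_eigen ty ZE; by exists c.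
  have str d' : d' \in s -> exists k : nat, ann u j (iter k.+1 (mulmx (f d')) Z) /\
      mu d' = k%:R * \tr (y d' *m y d') / 2.
    move=> d's; have [[ue _ _ _] _] := sd _ d's; apply: (sdata_string (sd _ d's)) => //.
    - by move=> X; apply: IH.
    - by move=> X; apply: ann_mul.
    - exact: AZ.
    - exact: muE.
  have mu_ge d' : d' \in s -> 0 <= mu d'.
    move=> d's; have [k [_ ->]] := str _ d's; have [/ltW q0 _] := sdata_real (sd _ d's).
    by rewrite divr_ge0 ?ler0n // mulr_ge0 ?ler0n.
  have Z0 : Z != 0 by apply: contra_notN nAjZ => /eqP ->; case: sj.
  have : \sum_(d' <- s) w d' * mu d' = 0.
    have := congr1 (fun X => X *m Z) y0; rewrite mul0mx mulmx_suml.
    rewrite (eq_big_seq (fun d' => (w d' * mu d') *: Z)) /=; last first.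
      by move=> d' d's; rewrite -scalemxAl muE // scalerA.
    by rewrite -scaler_suml => /eqP; rewrite scaler_eq0 (negPf Z0) orbF => /eqP.
  rewrite big_seq => /eqP; rewrite psumr_eq0; last first.
    by move=> d' d's; rewrite mulr_ge0 ?mu_ge // ltW // w0.
  move=> /allP/(_ _ ds); rewrite ds /= mulf_eq0 (gt_eqF (w0 _ ds)) /= => /eqP mu0.
  have [k [fk muk]] := str _ ds; have [q0 _] := sdata_real (sd _ ds).
  move: muk; rewrite mu0 => /esym/eqP; rewrite mulf_eq0 invr_eq0 pnatr_eq0 orbF mulf_eq0.
  by rewrite (gt_eqF q0) orbF pnatr_eq0 => /eqP k0; rewrite k0 in fk.
have stab j d Z : d \in s -> ann u j Z -> ann u j (f d *m Z).
  elim: j d Z => [d Z _ -> /=|j IH d Z ds AZ]; first by rewrite mulmx0.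
  by apply: annS; apply: step.
(* If [s] were nonempty, [f d] would lower the filtration that [e d] preserves. Then [e d *m f d]
   would be nilpotent, against its trace 1. *)
case: s sd w0 y0 step stab => // d s sd _ _ step stab; have ds : d \in d :: s by rewrite mem_head.
have [[ue _ _ _] [_ _ ef _]] := sd _ ds; have [k uk] := nu.
suff nil : mnilp (e d *m f d) by move/eqP: (nilp_tr nil); rewrite ef oner_eq0.
apply: (@mnilpP _ _ _ k); suff h j Z : ann u j Z -> (e d *m f d) ^+ j *m Z = 0.
  by rewrite -[LHS]mulmx1; apply: h.
elim: j Z => [Z -> |j IH Z AZ]; first by rewrite mulmx0.
rewrite exprSr -[_ * _]/(_ *m _) -mulmxA; apply: IH; rewrite -mulmxA; apply: ann_mul => //.
exact: (step _ (stab j) _ _ ds AZ).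
Qed.

Lemma rdiag_tr X (x : 'rV[F]_n) : X = qdiag Q x -> (forall i, x 0 i \is Num.real) ->
  \tr (X *m X) <= 0 -> X = 0.
Proof.
move=> -> xr; rewrite tr_qdiagM // => le0.
have ge0 i : 0 <= x 0 i * x 0 i by rewrite -expr2 real_exprn_even_ge0.
have : \sum_j x 0 j * x 0 j == 0 by rewrite eq_le le0 sumr_ge0.
rewrite psumr_eq0 // => /allP h; rewrite (_ : x = 0) ?/qdiag ?raddf0 ?mulmx0 ?mul0mx //.
apply/rowP => i; rewrite mxE; have := h i (mem_index_enum _).
by rewrite /= mulf_eq0 orbb => /eqP.
Qed.

(** A relation among the dual elements is split by signs into [yp = ym]. The trace of the square of
    [yp] equals that of [yp *m ym], which is at most 0 by [sdata_pair]; real eigenvalues then give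
    [yp = 0], and [sroots_flag] leaves no term on either side. *)
Lemma sroots_indep (s : seq int) (c : int -> int) : uniq s -> (forall d, d \in s -> sroot d) ->
  (forall k, fr k -> \sum_(d <- s) c d * rootv R ct d k = 0) -> forall d, d \in s -> c d = 0.
Proof.
move=> us ss c0.
have /choice[D DP] : forall d, exists D : 'M[F]_n * 'M[F]_n * 'M[F]_n,
    d \in s -> sdata d D.1.1 D.1.2 D.2.
  move=> d; have [ds|_] := boolP (d \in s); last by exists (0, 0, 0).
  by have [e [f [y sd]]] := sroot_data (ss _ ds); exists (e, f, y).
pose e d := (D d).1.1; pose f d := (D d).1.2; pose y d := (D d).2.
have sd d : d \in s -> sdata d (e d) (f d) (y d) by apply: DP.
pose yp := \sum_(d <- s | 0 < c d) (c d)%:~R *: y d.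
pose ym := \sum_(d <- s | c d < 0) (- c d)%:~R *: y d.
have yE : yp = ym.
  apply/eqP; rewrite -subr_eq0; apply/eqP.
  have -> : yp - ym = \sum_(d <- s) (c d)%:~R *: y d.
    rewrite /yp /ym [X in X - _]big_mkcond [X in _ - X]big_mkcond -sumrB; apply: eq_bigr => d _ /=.
    have [cd|cd|->] := ltrgt0P (c d); rewrite ?subr0 // ?scale0r //.
    by rewrite add0r -scaleNr rmorphN opprK.
  apply: (tt_nondeg uQ (fr := fr) (R := R)).
    by rewrite big_seq; apply: (subsp_sum st) => d ds; apply: (subspZ st); have [_ []] := sd _ ds.
  move=> _ [z zf ->]; rewrite mulmx_suml linear_sum /=.
  rewrite (eq_big_seq (fun d => \sum_(k | fr k) z 0 k * (c d * rootv R ct d k)%:~R)); last first.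
    move=> d ds /=; rewrite -scalemxAl linearZ /= (sdata_tr (sd _ ds)) // /lroot mulr_sumr.
    by apply: eq_bigr => k _; rewrite rmorphM /= mulrCA.
  rewrite exchange_big big1 //= => k kf.
  by rewrite -mulr_sumr -rmorph_sum /= c0 // mulr0.
have yp0 : yp = 0.
  have [x [xE xr]] : exists x : 'rV[F]_n, yp = qdiag Q x /\ forall i, x 0 i \is Num.real.
    rewrite /yp big_seq_cond; apply: (big_ind (fun X => exists x : 'rV[F]_n, X = qdiag Q x /\ forall i, x 0 i \is Num.real)).
    - by exists 0; split=> [|i]; rewrite ?/qdiag ?raddf0 ?mulmx0 ?mul0mx // mxE real0.
    - move=> _ _ [x [-> xr]] [x' [-> xr']]; exists (x + x'); split=> [|i].
        by rewrite /qdiag raddfD /= mulmxDr mulmxDl.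
      by rewrite mxE realD.
    - move=> d /andP[ds _]; have [_ [x -> xr]] := sdata_real (sd _ ds).
      exists ((c d)%:~R *: x); split=> [|i].
        by rewrite /qdiag linearZ /= -scalemxAr -scalemxAl.
      by rewrite mxE; apply: realM => //; apply: realz.
  apply: (rdiag_tr xE xr); rewrite {2}yE /yp /ym mulmx_suml linear_sum big_seq_cond /=.
  apply: sumr_le0 => d /andP[ds cd]; rewrite mulmx_sumr linear_sum big_seq_cond /=.
  apply: sumr_le0 => d' /andP[ds' cd']; rewrite -scalemxAl -scalemxAr !linearZ /= mulrA.
  rewrite mulr_ge0_le0 //; first by rewrite mulr_ge0 // ler0z ?oppr_ge0 ltW.
  apply: (sdata_pair (sd _ ds') (sd _ ds)); apply/eqP => e0; move: cd cd'; rewrite e0 => a b.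
  by have := lt_trans a b; rewrite ltxx.
have flag (P : pred int) (w : int -> F) : (forall d, P d -> 0 < w d) ->
    \sum_(d <- s | P d) w d *: y d = 0 -> forall d, d \in s -> ~~ P d.
  move=> w0 sum0 d ds; apply/negP => Pd.
  have : [seq d <- s | P d] = [::].
    apply: (@sroots_flag _ e f y w); last by rewrite big_filter.
    - by move=> d'; rewrite mem_filter => /andP[_]; apply: sd.
    - by move=> d'; rewrite mem_filter => /andP[]; auto.
  by move/eqP; rewrite -size_eq0 size_filter eqn0Ngt -has_count => /hasPn/(_ _ ds); rewrite Pd.
move=> d ds; apply/eqP; rewrite eq_le !leNgt; apply/andP; split.
  apply: (flag (fun d => 0 < c d) (fun d => (c d)%:~R)) ds => // d' cd; by rewrite ltr0z.
apply: (flag (fun d => c d < 0) (fun d => (- c d)%:~R)) ds; last by rewrite -/ym -yE.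
by move=> d' cd; rewrite ltr0z oppr_gt0.
Qed.

Lemma sroot_list : exists2 s : seq int, uniq s & forall d, sroot d <-> d \in s.
Proof.
exists (undup [seq d <- [seq m ij.1 - m ij.2 | ij : 'I_n * 'I_n] | `[< sroot d >]]).
  exact: undup_uniq.
move=> d; rewrite mem_undup mem_filter; split=> [sd|/andP[/asboolP]//].
rewrite asboolT //=; have [X [uX hX nX]] := sd.
have X0 : X != 0 by apply/eqP => X0; apply: nX; rewrite X0; case: (derS_subsp u set0).
have [i [j <-]] := hom_wt hX X0; apply/mapP; exists (i, j) => //; exact: mem_enum.
Qed.

Lemma alpha_mul d t t' : sroot d -> T t -> T t' -> alpha d (t *m t') = alpha d t * alpha d t'.
Proof.
move=> [X [uX hX nX]] Tt Tt'; have [ut ut'] := (grpU gT Tt, grpU gT Tt').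
have X0 : X != 0 by apply/eqP => X0; apply: nX; rewrite X0; case: (derS_subsp u set0).
have := AdT (grpM gT Tt Tt') hX; rewrite invmxM //.
have -> : t *m t' *m X *m (invmx t' *m invmx t) = t *m (t' *m X *m invmx t') *m invmx t.
  by rewrite !mulmxA.
rewrite (AdT Tt' hX) -scalemxAr -scalemxAl (AdT Tt hX) scalerA => /eqP.
rewrite -subr_eq0 -scalerBl scaler_eq0 (negPf X0) orbF subr_eq0 => /eqP <-.
by rewrite mulrC.
Qed.

Lemma alpha_1 d : sroot d -> alpha d 1%:M = 1.
Proof.
move=> sd; have [X [uX hX nX]] := sd.
have X0 : X != 0 by apply/eqP => X0; apply: nX; rewrite X0; case: (derS_subsp u set0).
have := AdT (grp1 gT) hX; rewrite mul1mx invmx1 mulmx1 => /eqP.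
by rewrite -{1}[X]scale1r -subr_eq0 -scalerBl scaler_eq0 (negPf X0) orbF subr_eq0 => /eqP <-.
Qed.

Lemma alpha_par (c : 'rV[F]_n) d : nz c -> (forall k, ~~ fr k -> c 0 k = 1) ->
  alpha d (qdiag Q (mono c R)) = \prod_(k | fr k) c 0 k ^ rootv R ct d k.
Proof.
by move=> c0 cf; rewrite /alpha /rootc /tcoord qcoordK // mono_comp // RS mono1.
Qed.

(** Let [lam i] be the cocharacters dual to the simple roots up to the factor [N]. For [t] in the
    kernel, the product of the [lam i (b i)] over the simple roots outside [D], with [b i] an [N]-th
    root of the value at [t], has the same simple root values as [t]. So it equals [t], and the
    kernel is generated by these curves. *)
Lemma sroots_ker_conn (D : set int) : trivial_center G -> D `<=` sroot ->
  zconnected [set t | T t /\ forall d, D d -> alpha d t = 1].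
Proof.
move=> Z1 DS; have [s us sP] := sroot_list.
pose r := size s; pose dd (i : 'I_r) := s`_i.
have ddS i : sroot (dd i) by apply/sP; apply: mem_nth.
pose B : 'M[int]_(n, r) := \matrix_(k, i) if fr k then rootv R ct (dd i) k else 0.
have [N N0 [B' BB]] : exists2 N : int, N != 0 & exists B' : 'M[int]_(r, n), B' *m B = N%:M.
  apply: zindep_dual => c c0 i.
  pose c' d := if insub (index d s) is Some j then c j else 0.
  have -> : c i = c' (dd i) by rewrite /c' /dd index_uniq // valK.
  apply: (sroots_indep (c := c') us) => [d /sP//|k kf|]; last exact: mem_nth.
  rewrite -[RHS](c0 k) (big_nth 0) big_mkord; apply: eq_bigr => j _.
  by rewrite /c' index_uniq // valK mxE kf.
pose a (i : 'I_r) (j : 'I_n) : int := \sum_k (if fr k then B' i k else 0) * R k j.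
pose lam i b := qexp Q (a i) b.
have lamE i b : b != 0 -> lam i b = qdiag Q (mono (\row_k b ^ (if fr k then B' i k else 0)) R).
  move=> b0; congr (qdiag Q _); apply/rowP => j; rewrite !mxE exprz_sum //; apply: eq_bigr => k _.
  by rewrite mxE exprz_exp.
have cnz i b : b != 0 -> nz (\row_k b ^ (if fr k then B' i k else 0) : 'rV[F]_n).
  by move=> b0 k; rewrite mxE expfz_neq0.
have cfr i (b : F) k : ~~ fr k -> (\row_k b ^ (if fr k then B' i k else 0) : 'rV[F]_n) 0 k = 1.
  by move=> /negPf kf; rewrite mxE kf expr0z.
have lamT i b : b != 0 -> T (lam i b).
  by move=> b0; rewrite lamE //; apply: torN_par => //; [apply: cnz|apply: cfr].
have lam_al i j b : b != 0 -> alpha (dd j) (lam i b) = if i == j then b ^ N else 1.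
  move=> b0; rewrite lamE // alpha_par; [|exact: cnz|exact: cfr].
  rewrite big_mkcond /= (eq_bigr (fun k => b ^ (B' i k * B k j))).
    rewrite -exprz_sum //; have := congr1 (fun A : 'M[int]_r => A i j) BB; rewrite [(B' *m B) i j]mxE [N%:M i j]mxE => ->.
    by case: eqP => _; rewrite ?mulr1n // mulr0n expr0z.
  move=> k _; rewrite [_ 0 k]mxE [B k j]mxE; case: (fr k); first by rewrite exprz_exp.
  by rewrite mulr0 expr0z.
pose Tx : set 'M[F]_n := [set t | T t /\ forall d, D d -> alpha d t = 1].
pose Sg : set 'M[F]_n := [set t | exists i b, [/\ ~ D (dd i), b != 0 & t = lam i b]].
have SgT : Sg `<=` T by move=> _ [i [b [_ b0 ->]]]; apply: lamT.
have SgU : Sg `<=` @GLset F n by move=> t /SgT/(grpU gT).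
have gTx : mxgroup Tx.
  split.
  - by move=> t [/(grpU gT)].
  - by split=> [|d /DS sd]; [apply: (grp1 gT)|apply: alpha_1].
  - move=> t t' [Tt at1] [Tt' at1']; split=> [|d Dd]; first exact: (grpM gT).
    by rewrite alpha_mul ?at1 ?at1' ?mulr1 //; apply: DS.
  - move=> t [Tt at1]; split=> [|d Dd]; first exact: (grpV gT).
    have := alpha_mul (DS _ Dd) Tt (grpV gT Tt).
    by rewrite mulmxV ?(grpU gT Tt) // alpha_1 ?at1 ?mul1r //; apply: DS.
have ddP d : sroot d -> exists i, d = dd i.
  move=> /sP ds; have lt : (index d s < r)%N by rewrite index_mem.
  by exists (Ordinal lt); rewrite /dd nth_index.
suff TxE : Tx = generated Sg.
  rewrite -/Tx TxE; apply: zconnected_gen => //.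
    move=> _ [i [b [Di b0 ->]]]; exists i, b^-1; split=> //; first by rewrite invr_eq0.
    exact: qexpV.
  move=> _ [i [b [Di b0 ->]]]; exists [set lam i b | b in [set b | b != 0]]; split.
  - exact: zirr_qexp.
  - by move=> _ [x x0 <-]; exists i, x.
  - by exists 1; rewrite /= ?oner_neq0 //; apply: qexp1.
  - by exists b.
apply/seteqP; split; last first.
  apply: gen_min => // _ [i [b [nD b0 ->]]]; split=> [|d Dd]; first exact: lamT.
  have [j dj] := ddP _ (DS _ Dd); rewrite dj lam_al //; case: eqP => // ij.
  by case: nD; rewrite ij -dj.
move=> t [Tt at1]; have al0 i : alpha (dd i) t != 0.
  apply/eqP => a0; have := alpha_mul (ddS i) Tt (grpV gT Tt).
  by rewrite mulmxV ?(grpU gT Tt) // alpha_1 // a0 mul0r => /eqP; rewrite oner_eq0.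
have /choice[b bP] : forall i, exists b, b != 0 /\ b ^ N = alpha (dd i) t.
  by move=> i; have [b b0 bE] := rootz N0 (al0 i); exists b.
pose P i := ~~ `[< D (dd i) >].
pose t' l := \big[mulmx/1%:M]_(i <- l | P i) lam i (b i).
have gSg := gen_group SgU.
have t'S l : generated Sg (t' l).
  apply: (big_ind (generated Sg)); [exact: (grp1 gSg)|move=> x y; exact: (grpM gSg)|].
  by move=> i /asboolPn Pi; apply: sub_gen; exists i, (b i); split=> //; case: (bP i).
have t'T l : T (t' l) by apply: (gen_min gT SgT).
have t'a l j : uniq l -> alpha (dd j) (t' l) = if (j \in l) && P j then alpha (dd j) t else 1.
  elim: l => [_|i l IH /= /andP[il ul]]; first by rewrite /t' big_nil alpha_1.
  have := IH ul; rewrite /t' big_cons in_cons => IHl; case: (boolP (P i)) => Pi; last first.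
    by rewrite IHl eq_sym; case: eqP => // <-; rewrite (negPf il) /= (negPf Pi).
  have [b0 bE] := bP i.
  rewrite alpha_mul //; [|exact: lamT|exact: t'T].
  rewrite IHl lam_al // bE [j == i]eq_sym; case: eqP => [<-|_]; last by rewrite mul1r.
  by rewrite (negPf il) /= Pi mulr1.
suff -> : t = t' (enum 'I_r) by apply: t'S.
have Tx' := t'T (enum 'I_r); have ut' := grpU gT Tx'.
suff e1 : t *m invmx (t' (enum 'I_r)) = 1%:M.
  by rewrite -[LHS](mulmxKV ut') e1 mul1mx.
apply: sroots_trivial_center => // [|d sd]; first by apply: (grpM gT) => //; apply: (grpV gT).
have [j dj] := ddP _ sd; rewrite dj alpha_mul //; last exact: (grpV gT).
have at' : alpha (dd j) (t' (enum 'I_r)) = alpha (dd j) t.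
  rewrite t'a ?enum_uniq // mem_enum /= /P; case: asboolP => //= Dj.
  by rewrite at1.
by rewrite -at' -alpha_mul ?mulmxV ?alpha_1 //; apply: (grpV gT).
Qed.

Section Fixer.
Variable C : set 'M[F]_n.
Hypotheses (aC : alg_group C) (TC : T `<=` C).
Let gC : mxgroup C. Proof. exact: alg_grp. Qed.
Let gU : mxgroup U. Proof. exact: alg_grp. Qed.
(** With [C] the stabiliser of a base point, this is the subgroup of [U] fixing the [U]-orbit of
    that point pointwise. *)
Let K : set 'M[F]_n := [set k | U k /\ forall v, U v -> C (invmx v *m k *m v)].

Let aK : alg_group K.
Proof.
apply/alg_groupP; split; first split.
- by move=> k [/(grpU gU)].
- split=> [|v Uv]; first exact: (grp1 gU).
  by rewrite mulmx1 mulVmx ?(grpU gU Uv) //; apply: (grp1 gC).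
- move=> a b [Ua Ka] [Ub Kb]; split=> [|v Uv]; first exact: (grpM gU).
  have -> : invmx v *m (a *m b) *m v = (invmx v *m a *m v) *m (invmx v *m b *m v).
    by rewrite !mulmxA mulmxK ?(grpU gU Uv).
  by apply: (grpM gC); auto.
- move=> a [Ua Ka]; split=> [|v Uv]; first exact: (grpV gU).
  have uv := grpU gU Uv; have := grpV gC (Ka v Uv).
  by rewrite !invmxM ?unitmx_mul ?unitmx_inv ?uv ?(grpU gU Ua) // invmxK mulmxA.
- move=> k [zk uk]; split=> [|v Uv].
    by apply: (alg_zcl aU) => //; apply: zclS zk => x [].
  have uv := grpU gU Uv; apply: (alg_zcl aC); last by rewrite !unitmx_mul unitmx_inv uv uk.
  apply: (@zcl_comp F n n (fun k => invmx v *m k *m v) K) => // [|x [_ Kx]]; last exact: Kx.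
  by apply: polymapM; [apply: polymapM; [apply: polymapC|apply: polymap_id]|apply: polymapC].
Qed.
Let gK : mxgroup K. Proof. exact: alg_grp. Qed.

Let K_normal v k : U v -> K k -> K (v *m k *m invmx v).
Proof.
move=> Uv [Uk Kk]; have uv := grpU gU Uv; split=> [|x Ux]; first exact: (grpJ gU).
have := Kk _ (grpM gU (grpV gU Uv) Ux); rewrite invmxM ?unitmx_inv ?(grpU gU Ux) // invmxK.
by rewrite !mulmxA.
Qed.

Let K_T t k : T t -> K k -> K (t *m k *m invmx t).
Proof.
move=> Tt [Uk Kk]; have ut := grpU gT Tt; split=> [|x Ux]; first exact: TU.
have ux := grpU gU Ux.
have Ux' : U (invmx t *m x *m t) by have := TU (grpV gT Tt) Ux; rewrite invmxK.
have := grpJ gC (TC Tt) (Kk _ Ux').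
by rewrite !invmxM ?unitmx_mul ?unitmx_inv ?ut ?ux // invmxK !mulmxA mulmxV // mul1mx !mulmxK.
Qed.

Lemma fixer_conn : trivial_center G ->
  zconnected [set t | T t /\ forall v, U v -> C (invmx v *m t *m v)].
Proof.
move=> Z1; pose k := lie_algebra K.
pose D (d : int) := exists X, [/\ u X, hom d X & ~ derS u k X].
have DS : D `<=` sroot.
  move=> d [X [uX hX nX]]; exists X; split=> // dX; apply: nX => W sW kW bW; exact: dX.
suff -> : [set t | T t /\ forall v, U v -> C (invmx v *m t *m v)] =
    [set t | T t /\ forall d, D d -> alpha d t = 1] by apply: sroots_ker_conn.
have expE t d X c : T t -> hom d X -> t *m mexp (c *: X) *m invmx t = mexp ((c * alpha d t) *: X).
  move=> Tt hX; rewrite -[t *m _ *m _]/(t * _ * _) -mexp_conj ?(grpU gT Tt) //; congr mexp.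
  by rewrite -[t * _ * _]/(t *m _ *m _) -scalemxAr -scalemxAl (AdT Tt hX) scalerA.
apply/seteqP; split=> t [Tt h]; split=> //; have ut := grpU gT Tt.
  move=> d [X [uX hX nX]]; apply/eqP; apply: contrapT => /negP a1; apply: nX.
  move=> W sW kW _; apply: kW; have nX := un uX.
  have b1 : alpha d t - 1 != 0 by rewrite subr_eq0.
  apply: exp_lie => // c.
  (* The divisor is chosen so that the commutator of [t] and [g] is exactly [mexp (c *: X)]. *)
  pose g := mexp ((c / (alpha d t - 1)) *: X).
  have Ug x : U (mexp (x *: X)) by apply: lie_exp.
  have -> : mexp (c *: X) = t *m g *m invmx t *m invmx g.
    rewrite /g (expE t d) // (mexpV (nilpZ _ nX)) -scaleNr -[_ *m _]/(_ * _) -mexpDZ //.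
    by congr (mexp (_ *: _)); set b := alpha d t in b1 *; field.
  have Ugg : U (t *m g *m invmx t *m invmx g).
    by apply: (grpM gU); [apply: TU|apply: (grpV gU)]; auto; apply: Ug.
  split=> // v Uv; have uv := grpU gU Uv; have ug' : g \in unitmx by apply: mexp_unit; apply: nilpZ.
  have Ugv : U (invmx g *m v) by apply: (grpM gU) => //; apply: (grpV gU); apply: Ug.
  have := grpM gC (h _ Uv) (grpV gC (h _ Ugv)).
  by rewrite !invmxM ?unitmx_mul ?unitmx_inv ?ut ?uv ?ug' // !invmxK !mulmxA !mulmxK.
(* The elements on which [t] acts trivially modulo [K]. The Lie algebra of this group contains that
   of [K] and the weight vectors fixed by [t], so the Frattini argument makes it all of [u]. *)
pose M : set 'M[F]_n := [set v | U v /\ K (t *m v *m invmx t *m invmx v)].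
have aM : alg_group M.
  apply/alg_groupP; split; first split.
  - by move=> v [/(grpU gU)].
  - by split; [apply: (grp1 gU)|rewrite mulmx1 mulmxV // mul1mx invmx1; apply: (grp1 gK)].
  - move=> a b [Ua Ka] [Ub Kb]; have [ua ub] := (grpU gU Ua, grpU gU Ub).
    split; first exact: (grpM gU).
    have := grpM gK Ka (K_normal Ua Kb); rewrite invmxM // !mulmxA.
    by rewrite mulmxKV // mulmxKV.
  - move=> a [Ua Ka]; have ua := grpU gU Ua; split; first exact: (grpV gU).
    have := K_normal (grpV gU Ua) (grpV gK Ka).
    by rewrite !invmxM ?unitmx_mul ?unitmx_inv ?ut ?ua // !invmxK !mulmxA mulVmx // mul1mx.
  - move=> v [zv uv]; have Uv : U v by apply: (alg_zcl aU) => //; apply: zclS zv => x [].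
    split=> //; rewrite (unip_inv (uU Uv)); apply: (alg_zcl aK); last first.
      by rewrite -(unip_inv (uU Uv)) !unitmx_mul !unitmx_inv ut uv.
    apply: (@zcl_comp F n n (fun v => t *m v *m invmx t *m \sum_(i < n) (1%:M - v) ^+ i) M) => //.
      apply: polymapM; last exact: polymap_unip_inv.
      by apply: polymapM; [apply: polymapM; [apply: polymapC|apply: polymap_id]|apply: polymapC].
    by move=> x [Ux]; rewrite (unip_inv (uU Ux)).
have KM : K `<=` M.
  move=> x Kx; have [Ux _] := Kx; split=> //; apply: (grpM gK); first exact: K_T.
  exact: (grpV gK).
have uM : u `<=` lie_algebra M.
  apply: derS_frattini => //; first exact: lie_subsp.
  - by apply: unip_brclosed => //; apply: unipotentS uU => x [].
  - by apply: lieS => x [].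
  apply: (graded_ind su unip_AdT (derS_subsp _ _)) => d X uX hX.
  have [dX|ndX] := pselect (derS u k X).
    by move=> W sW MW; apply: dX => //; apply: subset_trans MW; apply: lieS.
  move=> W sW MW _; apply: MW; have nX := un uX; apply: exp_lie => // c.
  have Uc : U (mexp (c *: X)) by apply: lie_exp.
  split=> //; rewrite (expE t d) // h ?mulr1; last by exists X.
  by rewrite mulmxV ?(grpU gU Uc) //; apply: (grp1 gK).
move=> v Uv; have [X [nX uX] vE] := log_lie aU Uv (uU Uv).
have [_ [_ Kv]] : M v by rewrite vE -[X]scale1r; apply: lie_exp => //; apply: uM.
have uv := grpU gU Uv; have := grpM gC (Kv v Uv) (TC Tt).
by rewrite !mulmxA mulmxKV // mulmxKV.
Qed.

End Fixer.
End OneGroup.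
End MaxUnipotent.

(** * Stabilisers in a Levi subgroup *)

Section GroupProducts.
Variables (F : numClosedFieldType) (n' : nat).
Local Notation n := n'.+1.
Implicit Types (X Y Z a b g h l t : 'M[F]_n) (A B N H K V E : set 'M[F]_n).

Definition setM A N : set 'M[F]_n := [set a *m b | a in A & b in N].

Lemma grp_prod A N : mxgroup A -> mxgroup N -> normalised_by A N -> mxgroup (setM A N).
Proof.
move=> gA gN AN; split.
- by move=> _ [a Aa [b Nb <-]]; rewrite /GLset /= unitmx_mul (grpU gA Aa) (grpU gN Nb).
- by exists 1%:M; [exact: (grp1 gA)|exists 1%:M; [exact: (grp1 gN)|rewrite mulmx1]].
- move=> _ _ [a Aa [b Nb <-]] [a' Aa' [b' Nb' <-]]; exists (a *m a'); first exact: (grpM gA).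
  have ua' := grpU gA Aa'; exists (invmx a' *m b *m a' *m b'); last by rewrite !mulmxA mulmxK.
  by apply: (grpM gN) => //; have := AN _ _ (grpV gA Aa') Nb; rewrite invmxK.
- move=> _ [a Aa [b Nb <-]]; exists (invmx a); first exact: (grpV gA).
  have [ua ub] := (grpU gA Aa, grpU gN Nb).
  exists (a *m invmx b *m invmx a); last by rewrite invmxM // !mulmxA mulVmx // mul1mx.
  by apply: AN => //; apply: (grpV gN).
Qed.

Lemma sub_setMl A N : mxgroup N -> A `<=` setM A N.
Proof. by move=> gN a Aa; exists a => //; exists 1%:M; rewrite ?mulmx1 //; apply: (grp1 gN). Qed.

Lemma sub_setMr A N : mxgroup A -> N `<=` setM A N.
Proof. by move=> gA b Nb; exists 1%:M; [exact: (grp1 gA)|exists b; rewrite ?mul1mx]. Qed.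

Lemma setM_sub A N H : mxgroup H -> A `<=` H -> N `<=` H -> setM A N `<=` H.
Proof. by move=> gH AH NH _ [a Aa [b Nb <-]]; apply: (grpM gH); [apply: AH|apply: NH]. Qed.

Lemma derived_prod A N : mxgroup A -> mxgroup N -> normalised_by A N ->
  derived (setM A N) `<=` setM (derived A) N.
Proof.
move=> gA gN AN; have gD := derived_group gA; have DA := derived_sub gA.
apply: gen_min; first by apply: grp_prod => // a b /DA; apply: AN.
move=> _ [_ [_ [[a Aa [b Nb <-]] [a' Aa' [b' Nb' <-]] ->]]].
have [ua ub] := (grpU gA Aa, grpU gN Nb); have [ua' ub'] := (grpU gA Aa', grpU gN Nb').
exists (a *m a' *m invmx a *m invmx a'); first by apply: sub_gen; exists a, a'.
have AV x y : A x -> N y -> N (invmx x *m y *m x).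
  by move=> Ax Ny; have := AN _ _ (grpV gA Ax) Ny; rewrite invmxK.
pose c := (invmx a' *m b *m a' *m b') *m invmx (invmx a *m b' *m a *m b).
exists (a' *m a *m c *m invmx (a' *m a)).
  apply: AN; first exact: (grpM gA).
  apply: (grpM gN); first by apply: (grpM gN) => //; apply: AV.
  by apply: (grpV gN); apply: (grpM gN) => //; apply: AV.
rewrite /c !invmxM ?unitmx_mul ?unitmx_inv ?ua ?ub ?ua' ?ub' // !invmxK !mulmxA.
by rewrite !mulmxKV // mulmxK // mulmxK // !mulmxA mulmxK.
Qed.

Lemma iter_derived_group A m : mxgroup A -> mxgroup (iter m (@derived F n) A) /\
  iter m (@derived F n) A `<=` A.
Proof.
move=> gA; elim: m => [|m [IH1 IH2]] /=; first by split.
split; first exact: derived_group.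
exact: subset_trans (derived_sub IH1) IH2.
Qed.

Lemma solvable_prod A N : mxgroup A -> mxgroup N -> normalised_by A N ->
  solvable A -> solvable N -> solvable (setM A N).
Proof.
move=> gA gN AN [m Am] [k Nk]; exists (k + m)%N; rewrite iterD.
have h : iter m (@derived F n) (setM A N) `<=` N.
  have : iter m (@derived F n) (setM A N) `<=` setM (iter m (@derived F n) A) N.
    elim: (m) => [|j IH] //=; have [gj jA] := iter_derived_group j gA.
    apply: subset_trans (derivedS IH) _; apply: derived_prod => // a b /jA; apply: AN.
  by move=> h _ /h [a /Am -> [b Nb <-]]; rewrite mul1mx.
by apply: subset_trans Nk; elim: (k) => [|j IH] //=; apply: derivedS.
Qed.

Lemma zconnected_prod A N : mxgroup A -> mxgroup N -> zconnected A -> zconnected N ->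
  zconnected (setM A N).
Proof.
move=> gA gN cA cN; have A1 := grp1 gA; have N1 := grp1 gN.
have M1 : setM A N 1%:M by apply: sub_setMl.
apply: (zconnected_base M1) => C cC C1 _ [a Aa [b Nb <-]].
have pl x : polymap (fun y : 'M[F]_n => x *m y) by apply: polymapM; [apply: polymapC|apply: polymap_id].
have Ca : C a.
  have e : [set x | A x /\ C x] = A.
    apply: (zconnected_clopen cA _ (conj A1 C1)).
    by apply: (clopen_pre (h := id)) cC => [x Ax|f pf]; [apply: sub_setMl|exists f].
  by have [] : [set x | A x /\ C x] a by rewrite e.
have : [set x | N x /\ C (a *m x)] = N.
  apply: (zconnected_clopen cN (a := 1%:M)); last by rewrite /= mulmx1.
  apply: (clopen_pre (h := fun x => a *m x)) cC => [x Nx|f pf].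
    by exists a => //; exists x.
  by exists (fun x => f (a *m x)) => //; apply: polyf_comp.
by move=> e; have [] : [set x | N x /\ C (a *m x)] b by rewrite e.
Qed.

Lemma unip_zclg E : unipotent E -> unipotent (zclg E).
Proof.
move=> uE g [zg _]; exists n; apply/matrixP => i j; rewrite [RHS]mxE.
apply: (zg (fun g => ((g - 1%:M) ^+ n) i j)).
  by apply: (@polymapX _ _ n (fun g : 'M[F]_n => g - 1%:M)); apply: polymapB; [apply: polymap_id|apply: polymapC].
by move=> h /uE[k hk]; rewrite (mnilpP hk) mxE.
Qed.

Lemma unip_zirr V : alg_group V -> unipotent V -> zirr V.
Proof.
move=> aV uV; have sV := lie_subsp V.
apply: zirr_curves; first by exists 1%:M; apply: (grp1 (alg_grp aV)).
move=> a b Va Vb; have [X [nX VX] aE] := log_lie aV Va (uV _ Va).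
have [Y [nY VY] bE] := log_lie aV Vb (uV _ Vb).
exists 1, (fun c => mexp (X + c *: (Y - X))), 0, 1; split.
- exact: oner_neq0.
- exact: rcurve_mexp_line.
- by rewrite poly1N scale0r addr0.
- by rewrite poly1N scale1r addrC subrK.
- move=> c _; have VZ : lie_algebra V (X + c *: (Y - X)).
    by apply: (subspD sV) => //; apply: (subspZ sV); apply: (subspB sV).
  by rewrite -[_ + _]scale1r; apply: lie_exp => //; apply: (lie_unip_nilp aV).
Qed.

End GroupProducts.

(** * The stabiliser in the Levi subgroup *)

Section Levi.
Variables (F : numClosedFieldType) (n' : nat).
Local Notation n := n'.+1.
Implicit Types (X Y Z a c g h l t u v : 'M[F]_n).
Variables (Q : 'M[F]_n) (R S : 'M[int]_n) (fr : pred 'I_n) (ct : 'I_n -> int).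
Hypotheses (uQ : Q \in unitmx) (RS : R *m S = 1%:M) (SR : S *m R = 1%:M).
Hypothesis ct0 : forall k, ~~ fr k -> ct k = 0.
Hypothesis sep : forall i j i' j', twt R ct i - twt R ct j = twt R ct i' - twt R ct j' ->
  forall k, fr k -> R k i - R k j = R k i' - R k j'.
Variables (G B P L V : set 'M[F]_n).
Let T := torN Q S fr.
Hypotheses (ssG : semisimple G) (Z1 : trivial_center G) (maxT : maximal_torus G T).
Hypotheses (bB : borel G B) (TB : T `<=` B).
Hypotheses (gP : mxgroup P) (BP : B `<=` P) (PG : P `<=` G).
Hypotheses (aL : alg_group L) (TL : T `<=` L) (urV : unipotent_radical P V).
Hypothesis PE : P = setM L V.

Let aG : alg_group G. Proof. by case: ssG. Qed.
Let gG : mxgroup G. Proof. exact: alg_grp. Qed.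
Let TG : T `<=` G. Proof. by case: maxT => -[]. Qed.
Let aT : alg_group T. Proof. exact: torN_alg. Qed.
Let gT : mxgroup T. Proof. exact: alg_grp. Qed.
Let gL : mxgroup L. Proof. exact: alg_grp. Qed.
Let aV : alg_group V. Proof. by case: urV => -[[]]. Qed.
Let gV : mxgroup V. Proof. exact: alg_grp. Qed.
Let uV : unipotent V. Proof. by case: urV => -[]. Qed.
Let VP : V `<=` P. Proof. by case: urV => -[[]]. Qed.
Let PV : normalised_by P V. Proof. by case: urV => -[]. Qed.
Let LP : L `<=` P. Proof. by rewrite PE; apply: sub_setMl. Qed.
Let aP : alg_group P. Proof. by move: gP; rewrite PE => gP'; apply: alg_prod. Qed.
Let aB : alg_group B. Proof. by case: bB => -[[]]. Qed.
Let gB : mxgroup B. Proof. exact: alg_grp. Qed.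
Let BG : B `<=` G. Proof. by case: bB => -[[]]. Qed.
Let cB : zconnected B. Proof. by case: bB => -[]. Qed.
Let sB : solvable B. Proof. by case: bB => -[]. Qed.
Let LG : L `<=` G. Proof. by move=> l /LP/PG. Qed.

Let T_comm s t : T s -> T t -> s *m t = t *m s.
Proof.
move=> [x _ ->] [y _ ->]; rewrite !qdiagM //; congr (qdiag Q _).
by apply/rowP => j; rewrite !mxE mulrC.
Qed.

Let T_solvable : solvable T.
Proof.
exists 1%N => /=; apply: gen_min.
  split=> [_ ->|//|_ _ -> ->|_ ->]; rewrite ?mulmx1 ?invmx1 //=; exact: unitmx1.
move=> _ [a [b [Ta Tb ->]]] /=; rewrite (T_comm Ta Tb).
by rewrite mulmxK ?(grpU gT Ta) // mulmxV ?(grpU gT Tb).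
Qed.

(** The product of [B] and [V] is a connected solvable closed subgroup, so maximality of [B] absorbs
    [V]. *)
Lemma radical_sub_borel : V `<=` B.
Proof.
have BV : normalised_by B V by move=> b v /BP; apply: PV.
have gBV := grp_prod gB gV BV.
have <- : setM B V = B.
  case: bB => _; apply; last exact: sub_setMl.
  split; last by apply: solvable_prod => //; apply: unip_solvable.
    split; first exact: alg_prod.
    by apply: setM_sub => // v /VP/PG.
  by apply: zconnected_prod => //; apply: unip_conn.
exact: sub_setMr.
Qed.

Let Bu : set 'M[F]_n := [set u | B u /\ exists k, (u - 1%:M) ^+ k = 0].
Let BuP : [/\ alg_group Bu, normalised_by B Bu & B = setM T Bu].
Proof. exact: (solv_decomp uQ RS SR ct0 sep ssG maxT). Qed.

Let T_conn : zconnected T. Proof. exact: (@torN_conn _ _ Q R S fr uQ RS SR). Qed.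

Lemma borel_unip_max M : alg_group M -> unipotent M -> M `<=` G -> normalised_by T M ->
  Bu `<=` M -> M `<=` Bu.
Proof.
move=> aM uM MG TM BuM; have [aBu nBu BE] := BuP; have gM := alg_grp aM.
have gTM := grp_prod gT gM TM.
have TME : setM T M = B.
  case: bB => _; apply.
    split; last by apply: solvable_prod => //; apply: unip_solvable.
      by split; [exact: alg_prod|exact: setM_sub].
    by apply: zconnected_prod => //; apply: unip_conn.
  by rewrite BE => _ [t Tt [u Uu <-]]; exists t => //; exists u => //; apply: BuM.
by move=> u Mu; split; [rewrite -TME; apply: sub_setMr|apply: uM].
Qed.

Let gg := lie_algebra G.
Let pp := lie_algebra P.
Let perpP : set 'M[F]_n := [set X | gg X /\ forall Y, pp Y -> \tr (Y *m X) = 0].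

(** As [P] contains [B], its orthogonal complement lies in the unipotent part of the Borel algebra.
    It is stable under brackets and under [P], so it exponentiates to a connected normal unipotent
    subgroup of [P], hence into [V]. *)
Lemma perp_parabolic : perpP `<=` lie_algebra V.
Proof.
have [aBu nBu BE] := BuP; have sg : subsp gg := lie_subsp G.
have uBu : unipotent Bu by move=> u [].
have BuB : Bu `<=` B by move=> u [].
have perpBu : perpP `<=` lie_algebra Bu.
  move=> X [gX X0]; apply: (perp_bor_u uQ RS SR ct0 sep ssG maxT aBu uBu) => //.
  - by move=> u /BuB/BG.
  - by move=> t u Tt; apply: nBu; apply: TB.
  - exact: borel_unip_max.
  - move=> _ [h th [Y uY <-]]; apply: X0; apply: (subspD (lie_subsp P)).
      by apply: lieS (tt_lie (S := S) uQ RS th) => t Tt; apply: BP; apply: TB.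
    by apply: lieS uY => u /BuB/BP.
have nP X : perpP X -> mnilp X by move=> /perpBu; apply: lie_unip_nilp.
have perpp X : perpP X -> pp X by move=> /perpBu; apply: lieS => u /BuB/BP.
have sP : subsp perpP.
  split=> [|c X Y [gX X0] [gY Y0]]; first by split=> [|Y _]; [case: sg|rewrite mulmx0 linear0].
  split=> [|Z pZ]; first exact: sg.2.
  by rewrite mulmxDr -scalemxAr linearD linearZ /= X0 // Y0 // mulr0 addr0.
have brP : brclosed perpP.
  move=> X Y PX PY; have [gX X0] := PX; have [gY Y0] := PY; split.
    by apply: lie_bracket => //; apply: nP.
  move=> Z pZ; rewrite -tr_lbr; apply: Y0; rewrite lbrC; apply: (subspN (lie_subsp P)).
  by apply: lie_bracket => //; [apply: nP|apply: perpp].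
have adP g X : P g -> perpP X -> perpP (g *m X *m invmx g).
  move=> Pg [gX X0]; split=> [|Y pY]; first by apply: lie_Ad => //; apply: PG.
  have -> : \tr (Y *m (g *m X *m invmx g)) = \tr ((invmx g *m Y *m g) *m X).
    by rewrite !mulmxA mxtrace_mulC !mulmxA.
  by apply: X0; have := lie_Ad gP (grpV gP Pg) pY; rewrite invmxK.
have eV : expgrp perpP `<=` V.
  case: urV => _; apply; split.
  - by split; [apply: expgrp_alg|apply: expgrp_sub].
  - exact: expgrp_conn.
  - exact: expgrp_unip.
  - by move=> g h Pg; apply: expgrp_conj => //; [apply: (grpU gP)|move=> X; apply: adP].
by move=> X PX; apply: lieS eV _ _; apply: expgrp_lie.
Qed.

Section MaxUnip.
Variable U : set 'M[F]_n.
Hypothesis muU : maximal_unipotent L U.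
Let aU : alg_group U. Proof. by case: muU => -[[]]. Qed.
Let gU : mxgroup U. Proof. exact: alg_grp. Qed.
Let UL : U `<=` L. Proof. by case: muU => -[[]]. Qed.
Let uU : unipotent U. Proof. by case: muU => -[]. Qed.
Let maxU M : alg_group M -> unipotent M -> M `<=` L -> U `<=` M -> M = U.
Proof. by move=> aM uM ML UM; case: muU => _; apply. Qed.

Let UV : normalised_by U V. Proof. by move=> u v /UL/LP; apply: PV. Qed.

Lemma unip_prod_radical : unipotent (setM U V).
Proof.
move=> _ [u Uu [v Vv <-]]; apply/(unip_mod aV uV (grpU gU Uu) _ Vv); last exact: uU.
by move=> x Vx; have := UV (grpV gU Uu) Vx; rewrite invmxK.
Qed.

(** Products inside [Lie M] are nilpotent, so [Lie M] is orthogonal to [Lie V], hence to the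
    complement of [Lie P], and biduality puts it into [Lie P]. Thus [M] lies in [P], and its part in
    [L] is [U] by maximality. *)
Lemma unip_prod_max M : alg_group M -> unipotent M -> M `<=` G -> normalised_by T M ->
  setM U V `<=` M -> M `<=` setM U V.
Proof.
move=> aM uM MG TM UVM; have gM := alg_grp aM; have sg : subsp gg := lie_subsp G.
have VM : V `<=` M by apply: subset_trans UVM; apply: sub_setMr.
have UM : U `<=` M by apply: subset_trans UVM; apply: sub_setMl.
have mp : lie_algebra M `<=` pp.
  move=> X mX; apply: (perp_in sg (lie_subsp P)) => [Y|Y||Y gY Y0].
  - exact: lieS.
  - exact: form_nondeg.
  - exact: lieS mX.
  - apply: nilp_tr; apply: (nils_mul (unip_nils aM uM)) => //.
    by apply: (lieS VM); apply: perp_parabolic; split.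
have MP : M `<=` P.
  move=> g Mg; have [X [nX mX] ->] := log_lie aM Mg (uM _ Mg).
  by rewrite -[X]scale1r; apply: lie_exp => //; apply: mp.
have MLU : M `&` L = U.
  apply: maxU; last by move=> x Ux; split; [apply: UM|apply: UL].
  - apply/alg_groupP; split; first split.
    + by move=> x [/(grpU gM)].
    + by split; [apply: (grp1 gM)|apply: (grp1 gL)].
    + by move=> a b [Ma La] [Mb Lb]; split; [apply: (grpM gM)|apply: (grpM gL)].
    + by move=> a [Ma La]; split; [apply: (grpV gM)|apply: (grpV gL)].
    + move=> x [zx ux]; split; [apply: (alg_zcl aM)|apply: (alg_zcl aL)] => //.
        by apply: zclS zx => y [].
      by apply: zclS zx => y [].
  - by apply: unipotentS uM => x [].
  - by move=> x [].
move=> g Mg; have := MP _ Mg; rewrite PE => -[l Ll [v Vv gE]].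
exists l; last by exists v.
rewrite -MLU; split=> //; have -> : l = g *m invmx v by rewrite -gE mulmxK ?(grpU gV Vv).
by apply: (grpM gM) => //; apply: (grpV gM); apply: VM.
Qed.

Lemma max_unip_borel : normalised_by T U -> borel L (setM T U).
Proof.
move=> TU; have gTU := grp_prod gT gU TU; split.
  split; last by apply: solvable_prod => //; apply: unip_solvable.
    by split; [exact: alg_prod|exact: setM_sub].
  by apply: zconnected_prod => //; apply: unip_conn.
move=> M [[aM ML] cM sM] TUM.
have TM : T `<=` M by apply: subset_trans TUM; apply: sub_setMl.
have [|aMu nMu ->] := solv_decomp uQ RS SR ct0 sep ssG maxT aM cM sM TM.
  by move=> x /ML/LG.
congr setM; apply: maxU => //.
- by move=> x [].
- by move=> x [/ML].
- by move=> x Ux; split; [apply: TUM; apply: sub_setMr|apply: uU].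
Qed.

Variables (C : set 'M[F]_n) (v : 'M[F]_n) (f : 'M[F]_n -> F).
Hypotheses (aC : alg_group C) (TC : T `<=` C).
Let Cu : set 'M[F]_n := [set u | C u /\ exists k : nat, (u - 1%:M) ^+ k = 0].
Hypothesis CuP : [/\ alg_group Cu, normalised_by C Cu & C = setM T Cu].
Let H : set 'M[F]_n := [set l | L l /\ C (invmx v *m l *m v)].
Hypotheses (Vv : V v) (pf : polyf f) (fv : f v != 0) (UH : U `<=` H).
Hypothesis orbit : forall v', V v' -> f v' != 0 -> exists2 l, L l & C (invmx (l *m v) *m v').

Let gC : mxgroup C. Proof. exact: alg_grp. Qed.
Let uv : v \in unitmx. Proof. exact: (grpU gV Vv). Qed.
Let VL l x : L l -> V x -> V (invmx l *m x *m l).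
Proof. by move=> Ll Vx; have := PV (grpV gP (LP Ll)) Vx; rewrite invmxK. Qed.

Let gH : mxgroup H.
Proof.
split.
- by move=> l [/(grpU gL)].
- by split; [apply: (grp1 gL)|rewrite mulmx1 mulVmx //; apply: (grp1 gC)].
- move=> a b [La Ca] [Lb Cb]; split; first exact: (grpM gL).
  have -> : invmx v *m (a *m b) *m v = (invmx v *m a *m v) *m (invmx v *m b *m v).
    by rewrite !mulmxA mulmxK.
  exact: (grpM gC).
- move=> a [La Ca]; split; first exact: (grpV gL).
  have := grpV gC Ca.
  by rewrite !invmxM ?unitmx_mul ?unitmx_inv ?uv ?(grpU gL La) // invmxK mulmxA.
Qed.

(* The projection to [L] of the unipotent part of [P `&` C]. *)
Let E : set 'M[F]_n := [set l | L l /\ exists2 x, V x & Cu (l *m x)].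

(** Modulo [V] the projection does not affect unipotency, so [E] is a unipotent group. It contains
    [U], because [u] and its conjugate by [v^-1] differ by an element of [V]; maximality of [U]
    applies to the closure of [E]. *)
Let EU : E = U.
Proof.
have [aCu nCu CE] := CuP; have gCu := alg_grp aCu.
have gE : mxgroup E.
  split.
  - by move=> l [/(grpU gL)].
  - by split; [apply: (grp1 gL)|exists 1%:M; rewrite ?mulmx1; [apply: (grp1 gV)|apply: (grp1 gCu)]].
  - move=> a b [La [x Vx Cx]] [Lb [y Vy Cy]]; split; first exact: (grpM gL).
    have ub := grpU gL Lb; exists (invmx b *m x *m b *m y).
      by apply: (grpM gV) => //; apply: VL.
    by have := grpM gCu Cx Cy; rewrite !mulmxA mulmxK.
  - move=> a [La [x Vx Cx]]; split; first exact: (grpV gL).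
    have [ua ux] := (grpU gL La, grpU gV Vx).
    exists (a *m invmx x *m invmx a).
      by have := VL (grpV gL La) (grpV gV Vx); rewrite invmxK.
    by have := grpV gCu Cx; rewrite invmxM // !mulmxA mulVmx // mul1mx.
have uE : unipotent E.
  move=> l [Ll [x Vx [_ lx]]]; apply/(unip_mod aV uV (grpU gL Ll) _ Vx) => //.
  by move=> y; apply: VL.
have UE : U `<=` E.
  move=> u Uu; have [Lu Cvu] := UH Uu; have uu := grpU gU Uu; split=> //.
  exists (invmx u *m invmx v *m u *m v).
    by apply: (grpM gV) => //; apply: VL => //; apply: (grpV gV).
  have -> : u *m (invmx u *m invmx v *m u *m v) = invmx v *m u *m v.
    by rewrite !mulmxA mulmxV // mul1mx.
  split=> //; have [k uk] := uU Uu; exists k.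
  have := @conj_sub1 _ _ (invmx v) u; rewrite invmxK unitmx_inv => -> //.
  by have := @conj_exp _ _ (invmx v) (u - 1%:M) k; rewrite invmxK unitmx_inv => -> //; rewrite uk mulr0 mul0r.
have EL : E `<=` L by move=> l [].
have zE : zclg E = U.
  apply: maxU.
  - exact: zclg_group.
  - exact: unip_zclg.
  - exact: zclg_sub.
  - by move=> u /UE Eu; split; [apply: sub_zcl|apply: (grpU gE)].
apply/seteqP; split=> // l El; rewrite -zE; split; [exact: sub_zcl|exact: (grpU gE)].
Qed.

Let TU : normalised_by T U.
Proof.
have [aCu nCu CE] := CuP; have gCu := alg_grp aCu.
rewrite -EU => t l Tt [Ll [x Vx Cx]]; have ut := grpU gT Tt.
split; first by apply: (grpJ gL) => //; apply: TL.
exists (t *m x *m invmx t); first by apply: PV => //; apply: LP; apply: TL.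
have := nCu _ _ (TC Tt) Cx.
by rewrite !mulmxA mulmxKV.
Qed.

Let decomp l x : L l -> V x -> C (l *m x) -> exists t u, [/\ T t, U u & l = t *m u].
Proof.
move=> Ll Vx Cx; have [aCu nCu CE] := CuP.
move: Cx; rewrite CE => -[t Tt [c Cc lE]]; have ut := grpU gT Tt.
exists t, (invmx t *m l); split=> //; last by rewrite mulKVmx.
rewrite -EU; split; first by apply: (grpM gL) => //; apply: (grpV gL); apply: TL.
by exists x => //; rewrite -mulmxA -lE mulKmx.
Qed.

Let HE : H = setM [set t | T t /\ H t] U.
Proof.
apply/seteqP; split; last first.
  by apply: setM_sub => // t [].
move=> h Hh; have [Lh Ch] := Hh; have uh := grpU gL Lh.
have [||t [u [Tt Uu hE]]] := @decomp h (invmx h *m invmx v *m h *m v) Lh.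
- by apply: (grpM gV) => //; apply: VL => //; apply: (grpV gV).
- by rewrite !mulmxA mulmxV // mul1mx.
exists t; last by exists u.
split=> //; have -> : t = h *m invmx u by rewrite hE mulmxK ?(grpU gU Uu).
by apply: (grpM gH) => //; apply: (grpV gH); apply: UH.
Qed.

Let TH t h : T t -> H h -> H (t *m h *m invmx t).
Proof.
move=> Tt; rewrite {1}HE => -[s [Ts Hs] [u Uu <-]].
have -> : t *m (s *m u) *m invmx t = s *m (t *m u *m invmx t).
  by rewrite !mulmxA (T_comm Tt Ts).
by apply: (grpM gH) => //; apply: UH; apply: TU.
Qed.

(** Where [f] is nonzero, some [l] in [L] takes the point of [v] to that of [v'], and [decomp]
    writes [l^-1] as a product from [T] and [U], which normalise [H]. The remaining points follow
    because [V] is irreducible. *)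
Let H_fix h v' : H h -> V v' -> C (invmx v' *m h *m v').
Proof.
move=> Hh; pose F0 x := (\sum_(i < n) (1%:M - x) ^+ i) *m h *m x.
have FE x : V x -> F0 x = invmx x *m h *m x by move=> Vx; rewrite /F0 -unip_inv //; apply: uV.
have pF : polymap F0.
  apply: polymapM; last exact: polymap_id.
  by apply: polymapM; [exact: polymap_unip_inv|apply: polymapC].
have gen x : V x -> f x != 0 -> C (F0 x).
  move=> Vx fx; rewrite FE //; have [l Ll Cl] := orbit Vx fx.
  have ul := grpU gL Ll; have ux := grpU gV Vx.
  have [t [u [Tt Uu lE]]] : exists t u, [/\ T t, U u & invmx l = t *m u].
    apply: (@decomp (invmx l) (l *m invmx v *m invmx l *m x)); first exact: (grpV gL).
      apply: (grpM gV) => //; have := VL (grpV gL Ll) (grpV gV Vv); by rewrite invmxK.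
    by move: Cl; rewrite invmxM // !mulmxA mulVmx // mul1mx.
  have [_ Cc] : H (invmx l *m h *m l).
    have -> : l = invmx (t *m u) by rewrite -lE invmxK.
    have [ut uu] := (grpU gT Tt, grpU gU Uu).
    rewrite invmxK invmxM //.
    have := TH Tt (grpJ gH (UH Uu) Hh); by rewrite !mulmxA.
  have := grpM gC (grpM gC (grpV gC Cl) Cc) Cl.
  rewrite !invmxM ?unitmx_mul ?unitmx_inv ?ul ?uv ?ux // !invmxK !mulmxA.
  by rewrite !mulmxK // !mulmxKV // mulmxK.
move=> Vv'; rewrite -FE //; apply: (alg_zcl aC); last first.
  have uv' := grpU gV Vv'; rewrite FE // !unitmx_mul unitmx_inv uv' (grpU gL _) //.
  by case: Hh.
move=> g pg gC0; have [_ irr] := unip_zirr aV uV.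
have [] := irr f (fun x => g (F0 x)) pf; first exact: polyf_comp.
- move=> x Vx; have [->|fx] := eqVneq (f x) 0; first by rewrite mul0r.
  by rewrite gC0 ?mulr0 //; apply: gen.
- by move=> f0; move: fv; rewrite f0 ?eqxx.
- by apply.
Qed.

Lemma levi_stab : zconnected H /\ strongly_solvable L H.
Proof.
split; last first.
  exists (setM T U); first exact: max_unip_borel.
  by rewrite HE => _ [t [Tt _] [u Uu <-]]; exists t => //; exists u.
have gUV := grp_prod gU gV UV.
have UVG : setM U V `<=` G by apply: setM_sub => // x; [move=> /UL/LG|move=> /VP/PG].
have TUV : normalised_by T (setM U V).
  move=> t _ Tt [x Ux [y Vy <-]]; exists (t *m x *m invmx t); first exact: TU.
  exists (t *m y *m invmx t); first by apply: PV => //; apply: LP; apply: TL.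
  by rewrite !mulmxA mulmxKV ?(grpU gT Tt).
have conn := fixer_conn uQ RS SR ct0 sep ssG maxT (alg_prod aU aV gUV)
  unip_prod_radical UVG TUV unip_prod_max aC TC Z1.
(* By [H_fix], fixing the single point of [v] amounts to fixing the points of all of [V], and those
   of [U V] since [U] fixes the base point: this is the condition handled by [fixer_conn]. *)
have TxE : [set t | T t /\ H t] = [set t | T t /\ forall x, setM U V x -> C (invmx x *m t *m x)].
  apply/seteqP; split=> t [Tt h]; split=> //.
    move=> _ [x Ux [y Vy <-]]; have [ux uy] := (grpU gU Ux, grpU gV Vy).
    have Vz : V (x *m y *m invmx x) := UV Ux Vy; have uz := grpU gV Vz.
    have Cx : C x by have := H_fix (UH Ux) (grp1 gV); rewrite invmx1 mul1mx mulmx1.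
    have -> : x *m y = (x *m y *m invmx x) *m x by rewrite mulmxKV.
    have := grpM gC (grpM gC (grpV gC Cx) (H_fix h Vz)) Cx.
    by rewrite [invmx (x *m y *m invmx x *m x)]invmxM // !mulmxA.
  by split; [apply: TL|apply: h; apply: sub_setMr].
rewrite HE; apply: zconnected_prod => //; last exact: unip_conn.
  split.
  - by move=> t [/(grpU gT)].
  - by split; [apply: (grp1 gT)|apply: (grp1 gH)].
  - by move=> a b [Ta Ha] [Tb Hb]; split; [apply: (grpM gT)|apply: (grpM gH)].
  - by move=> a [Ta Ha]; split; [apply: (grpV gT)|apply: (grpV gH)].
by rewrite TxE.
Qed.

End MaxUnip.
End Levi.

(** * Hilbert functions *)

Section Hilbert.
Variables (F : numClosedFieldType) (n' : nat).
Local Notation n := n'.+1.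
Local Notation N := (n * n)%N.
Implicit Types (X A g : 'M[F]_n) (S Z : set 'M[F]_n) (f : 'M[F]_n -> F).

Definition pdeg k f := exists2 p : {mpoly F[N]}, (msize p <= k.+1)%N & f =1 mxeval p.

Lemma pdeg_polyf k f : pdeg k f -> polyf f.
Proof. by move=> [p _ fE]; exists p. Qed.

Lemma polyf_pdeg f : polyf f -> exists k, pdeg k f.
Proof. by move=> [p fE]; exists (msize p), p => //; apply: leqnSn. Qed.

Lemma pdeg_ext k f f' : f =1 f' -> pdeg k f -> pdeg k f'.
Proof. by move=> ff [p sp fE]; exists p => // A; rewrite -ff. Qed.

Lemma pdeg_le k l f : (k <= l)%N -> pdeg k f -> pdeg l f.
Proof. by move=> kl [p sp fE]; exists p => //; apply: leq_trans sp _. Qed.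

Lemma pdegC c : pdeg 0 (fun=> c).
Proof.
by exists c%:MP => [|A]; [rewrite msizeC; case: eqP|rewrite /mxeval mevalC].
Qed.

Lemma pdegD k f f' : pdeg k f -> pdeg k f' -> pdeg k (fun A => f A + f' A).
Proof.
move=> [p sp fE] [p' sp' fE']; exists (p + p') => [|A]; last by rewrite mxevalD fE fE'.
by apply: leq_trans (msizeD_le _ _) _; rewrite geq_max sp.
Qed.

Lemma pdegM k l f f' : pdeg k f -> pdeg l f' -> pdeg (k + l) (fun A => f A * f' A).
Proof.
move=> [p sp fE] [p' sp' fE']; exists (p * p') => [|A]; last by rewrite mxevalM fE fE'.
have [->|p0] := eqVneq p 0; first by rewrite mul0r msize0.
have [->|p0'] := eqVneq p' 0; first by rewrite mulr0 msize0.
rewrite msizeM //; move: (mmeasure _ p) (mmeasure _ p') sp sp' => a b; lia.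
Qed.

Lemma pdegZ k c f : pdeg k f -> pdeg k (fun A => c * f A).
Proof. by move=> pf; rewrite -[k]add0n; apply: pdegM => //; apply: pdegC. Qed.

Lemma pdeg_sum k (I : Type) (r : seq I) (P : pred I) (f : I -> 'M[F]_n -> F) :
  (forall i, P i -> pdeg k (f i)) -> pdeg k (fun A => \sum_(i <- r | P i) f i A).
Proof.
move=> pf; elim: r => [|i r IH].
  by apply: (@pdeg_ext _ (fun=> 0)) => [A|]; [rewrite big_nil|apply: (pdeg_le (leq0n k)); apply: pdegC].
have [Pi|nPi] := boolP (P i).
  by apply: pdeg_ext (pdegD (pf i Pi) IH) => A; rewrite big_cons Pi.
by apply: pdeg_ext IH => A; rewrite big_cons (negPf nPi).
Qed.

Lemma pdeg_var i : pdeg 1 (fun A => mxvec A 0 i).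
Proof. by exists 'X_i => [|A]; [rewrite msizeX mdeg1|rewrite /mxeval mevalXU]. Qed.

Lemma pdeg_entry i j : pdeg 1 (fun A => A i j).
Proof. by apply: pdeg_ext (pdeg_var (mxvec_index i j)) => A; rewrite mxvecE. Qed.

Definition indep S r (p : 'I_r -> 'M[F]_n -> F) := forall c : 'I_r -> F,
  (forall A, S A -> \sum_i c i * p i A = 0) -> forall i, c i = 0.

Definition hge S k r := exists2 p : 'I_r -> 'M[F]_n -> F, forall i, pdeg k (p i) & indep S p.

Lemma dep_family r (I : finType) (M : 'I_r -> I -> F) : (#|I| < r)%N ->
  exists2 c : 'I_r -> F, exists i, c i != 0 & forall x, \sum_i c i * M i x = 0.
Proof.
move=> lt; pose A : 'M[F]_(r, #|I|) := \matrix_(i, j) M i (enum_val j).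
have : kermx A != 0.
  by rewrite -mxrank_eq0 mxrank_ker subn_eq0 -ltnNge; apply: leq_ltn_trans (rank_leq_col A) lt.
move=> /rowV0Pn[v vk v0]; have /sub_kermxP vA := vk.
exists (v 0) => [|x].
  by apply: contrapT => h; case/eqP: v0; apply/rowP => i; rewrite mxE; apply: contrapT => /eqP vi; apply: h; exists i.
by move/rowP/(_ (enum_rank x)): vA; rewrite !mxE => h; rewrite -[RHS]h; apply: eq_bigr => i _; rewrite mxE enum_rankK.
Qed.

Lemma hge_bound S k r : hge S k r -> (r <= k.+1 ^ N)%N.
Proof.
move=> [p pk ip]; rewrite leqNgt; apply/negP => lt.
have /choice[q qP] : forall i, exists q : {mpoly F[N]}, (msize q <= k.+1)%N /\ p i =1 mxeval q.
  by move=> i; have [q sq qE] := pk i; exists q.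
have card : (#|{: 'X_{1..N < k.+1}}| <= k.+1 ^ N)%N.
  have := card_ffun ('I_N : finType) ('I_k.+1 : finType); rewrite !card_ord => <-.
  apply: (@leq_card _ _ (fun m : 'X_{1..N < k.+1} => [ffun i => inord (m i) : 'I_k.+1])) => m1 m2.
  move=> /ffunP h; apply: val_inj; apply/mnmP => i; have := h i; rewrite !ffunE => /(congr1 val) /=.
  have lti (m : 'X_{1..N < k.+1}) : (m i < k.+1)%N.
    apply: leq_ltn_trans (bmdeg m); rewrite mdegE (bigD1 i) //=; exact: leq_addr.
  by rewrite !inordK ?lti.
have [c [i ci] cM] := @dep_family r _ (fun i (m : 'X_{1..N < k.+1}) => (q i)@_m) (leq_ltn_trans card lt).
case/eqP: ci; apply: ip => A _.
rewrite (eq_bigr (fun i => \sum_(m : 'X_{1..N < k.+1}) c i * ((q i)@_m * mxeval 'X_[m] A))); last first.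
  move=> j _; rewrite -mulr_sumr (qP j).2 {1}(mpolywE (qP j).1) mxeval_sum; congr (_ * _).
  by apply: eq_bigr => m _; rewrite mxevalZ.
rewrite exchange_big big1 // => m _.
by rewrite (eq_bigr (fun i => (c i * (q i)@_m) * mxeval 'X_[m] A)) => [|j _]; rewrite ?mulrA // -mulr_suml cM mul0r.
Qed.

Lemma hge0 S k : hge S k 0.
Proof. by exists (fun _ _ => 0) => [[]|c _ []]. Qed.

Lemma hdim_ex S k : exists r, `[< hge S k r >].
Proof. by exists 0%N; apply/asboolP; apply: hge0. Qed.

Lemma hdim_bound S k r : `[< hge S k r >] -> (r <= k.+1 ^ N)%N.
Proof. by move/asboolP; apply: hge_bound. Qed.

(** The affine Hilbert function of [S]: the dimension of the space of restrictions to [S] of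
    polynomials of degree at most [k]. *)
Definition hdim S k := ex_maxn (hdim_ex S k) (@hdim_bound S k).

Lemma hdimP S k : hge S k (hdim S k).
Proof. by rewrite /hdim; case: ex_maxnP => r /asboolP. Qed.

Lemma hdim_max S k r : hge S k r -> (r <= hdim S k)%N.
Proof. by move=> h; rewrite /hdim; case: ex_maxnP => m _; apply; apply/asboolP. Qed.

Lemma hdim_le S k : (hdim S k <= k.+1 ^ N)%N.
Proof. exact: hge_bound (hdimP S k). Qed.

Lemma hdim_mono S k l : (k <= l)%N -> (hdim S k <= hdim S l)%N.
Proof.
by move=> kl; apply: hdim_max; have [p pk ip] := hdimP S k; exists p => // i; apply: pdeg_le (pk i).
Qed.

Lemma hdim_zcl S Z k : S `<=` zcl Z -> (hdim S k <= hdim Z k)%N.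
Proof.
move=> SZ; apply: hdim_max; have [p pk ip] := hdimP S k; exists p => // c c0; apply: ip => A /SZ zA.
apply: (zA (fun A => \sum_i c i * p i A)) => //; apply: polyf_sum => i _; apply: polyfZ.
exact: pdeg_polyf (pk i).
Qed.

Lemma hdim_gt0 S k A : S A -> (0 < hdim S k)%N.
Proof.
move=> SA; apply: hdim_max; exists (fun _ _ => 1) => [i|c c0 i].
  by apply: (pdeg_le (leq0n k)); apply: pdegC.
by have := c0 A SA; rewrite big_ord1 mulr1 (ord1 i).
Qed.

Lemma hdim_basis S k : exists p : 'I_(hdim S k) -> 'M[F]_n -> F,
  forall f, pdeg k f -> exists c : 'I_(hdim S k) -> F, forall A, S A -> f A = \sum_i c i * p i A.
Proof.
have [p pk ip] := hdimP S k; exists p => f fk; apply: contrapT => nc.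
have : hge S k (hdim S k).+1.
  exists (fun i => if unlift ord0 i is Some j then p j else f).
    by move=> i; case: (unlift _ _).
  move=> c c0.
  have c0' A : S A -> c ord0 * f A + \sum_i c (lift ord0 i) * p i A = 0.
    move=> SA; rewrite -[RHS](c0 A SA) big_ord_recl unlift_none; congr (_ + _).
    by apply: eq_bigr => i _; rewrite liftK.
  have c00 : c ord0 = 0.
    apply/eqP; apply: contrapT => /negP c1; apply: nc.
    exists (fun i => - (c ord0)^-1 * c (lift ord0 i)) => A SA.
    rewrite (eq_bigr (fun i => - (c ord0)^-1 * (c (lift ord0 i) * p i A))) => [|i _]; last by rewrite mulrA.
    rewrite -mulr_sumr; move/eqP: (c0' A SA); rewrite addrC addr_eq0 => /eqP ->.
    by rewrite mulrNN mulKf.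
  move=> i; case: (unliftP ord0 i) => [j ->|-> //].
  apply: (ip (fun i => c (lift ord0 i))) => A SA.
  by have := c0' A SA; rewrite c00 mul0r add0r.
by move/hdim_max; rewrite ltnn.
Qed.

(** Multiplication by [f] is injective on functions on the irreducible [Z] and yields functions that
    vanish on [S]; these are independent of functions that are independent on [S]. *)
Lemma hdim_step S Z f q k : zirr Z -> S `<=` Z -> pdeg q f -> vanish S f -> ~ vanish Z f ->
  (hdim Z k + hdim S (k + q) <= hdim Z (k + q))%N.
Proof.
move=> [_ irr] SZ fq fS fZ; apply: hdim_max.
have [p pk ip] := hdimP Z k; have [p' pk' ip'] := hdimP S (k + q).
exists (fun i => match fintype.split i with inl a => fun A => f A * p a A | inr b => p' b end).
  by move=> i; case: (fintype.split i) => a //; rewrite addnC; apply: pdegM.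
move=> c c0; have c0' A : Z A -> f A * (\sum_a c (lshift _ a) * p a A) + \sum_b c (rshift _ b) * p' b A = 0.
  move=> ZA; rewrite -[RHS](c0 A ZA) big_split_ord /= mulr_sumr; congr (_ + _); apply: eq_bigr => a _.
    by rewrite (unsplitK (inl a)) mulrCA.
  by rewrite (unsplitK (inr a)).
have cr b : c (rshift _ b) = 0.
  apply: (ip' (fun b => c (rshift _ b))) => A SA; have := c0' A (SZ _ SA).
  by rewrite fS // mul0r add0r.
have cl a : c (lshift _ a) = 0.
  apply: (ip (fun a => c (lshift _ a))).
  have [] := irr f (fun A => \sum_a c (lshift _ a) * p a A) (pdeg_polyf fq).
  - by apply: polyf_sum => i _; apply: polyfZ; apply: pdeg_polyf (pk i).
  - move=> A ZA; have := c0' A ZA; rewrite [X in _ + X]big1 ?addr0 // => b _.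
    by rewrite cr mul0r.
  - by [].
  - by [].
by move=> i; rewrite -(splitK i); case: (fintype.split i) => a; [apply: cl|apply: cr].
Qed.

(** The step with [f] of degree [q] is iterated [k] times, which raises the degree from [k] to
    [(q + 1) k] and gains [k] copies of the value for [S]. *)
Lemma hdim_chain S Z : zirr Z -> S `<=` Z -> ~ Z `<=` zcl S ->
  exists Q, forall k, (k * hdim S k <= hdim Z (Q * k))%N.
Proof.
move=> iZ SZ nZ.
have [f [pf fS fZ]] : exists f, [/\ polyf f, vanish S f & ~ vanish Z f].
  apply: contrapT => h; apply: nZ => A ZA f pf fS; apply: contrapT => fA.
  by apply: h; exists f; split=> // fZ; apply: fA; apply: fZ.
have [q fq] := polyf_pdeg pf; exists q.+1 => k.
suff h j : (j * hdim S k <= hdim Z (k + j * q))%N.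
  by rewrite mulSn [(q * k)%N]mulnC; apply: h.
elim: j => [|j IH]; first by rewrite mul0n.
have := hdim_step (k + j * q) iZ SZ fq fS fZ.
have : (hdim S k <= hdim S (k + j * q + q))%N by apply: hdim_mono; rewrite -addnA leq_addr.
rewrite !mulSn [(q + _)%N]addnC addnA; move: IH; lia.
Qed.

Definition expset X S : set 'M[F]_n := [set mexp (c *: X) *m s | c in setT & s in S].

(** A bidegree: at most [K] in the parameter of a curve, at most [k] in the entries of the
    matrix. *)
Definition cdeg K k (P : 'M[F]_n -> {poly F}) :=
  (forall A, (size (P A) <= K.+1)%N) /\ forall j, pdeg k (fun A => (P A)`_j).

Lemma cdegM K k P K' k' P' : cdeg K k P -> cdeg K' k' P' ->
  cdeg (K + K') (k + k') (fun A => P A * P' A).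
Proof.
move=> [sP pP] [sP' pP']; split=> [A|j].
  by have := size_polyMleq (P A) (P' A); have := sP A; have := sP' A; lia.
apply: (@pdeg_ext _ (fun A => \sum_(i < j.+1) (P A)`_i * (P' A)`_(j - i))) => [A|].
  by rewrite coefM.
by apply: pdeg_sum => i _; apply: pdegM.
Qed.

Lemma cdeg1 : cdeg 0 0 (fun=> 1).
Proof.
split=> [A|j]; first by rewrite size_poly1.
exact: pdegC.
Qed.

Lemma cdeg_le K k K' k' P : (K <= K')%N -> (k <= k')%N -> cdeg K k P -> cdeg K' k' P.
Proof.
move=> KK kk [sP pP]; split=> [A|j]; first by apply: leq_trans (sP A) _.
exact: pdeg_le (pP j).
Qed.

Lemma cdegX K k P r : cdeg K k P -> cdeg (K * r) (k * r) (fun A => P A ^+ r).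
Proof.
move=> cP; elim: r => [|r IH]; first by rewrite !muln0; apply: cdeg1.
rewrite !mulnS; have := cdegM cP IH; congr (cdeg _ _ _).
by apply/funext => A; rewrite exprS.
Qed.

Lemma cdeg_prod (I : Type) (r : seq I) (K k : I -> nat) (P : I -> 'M[F]_n -> {poly F}) :
  (forall i, cdeg (K i) (k i) (P i)) ->
  cdeg (\sum_(i <- r) K i) (\sum_(i <- r) k i) (fun A => \prod_(i <- r) P i A).
Proof.
move=> cP; elim: r => [|i r IH].
  rewrite !big_nil; have := cdeg1; congr (cdeg _ _ _).
  by apply/funext => A; rewrite big_nil.
rewrite !big_cons; have := cdegM (cP i) IH; congr (cdeg _ _ _).
by apply/funext => A; rewrite big_cons.
Qed.

Lemma cdeg_mx (E : 'M[{poly F}]_n) K f k : (forall i j, (size (E i j) <= K.+1)%N) -> pdeg k f ->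
  exists2 P, cdeg (K * k) k P & forall c A, f (pmx_at E c *m A) = (P A).[c].
Proof.
move=> sE [p sp fE].
have /choice[e eP] : forall i : 'I_N, exists P, cdeg K 1 P /\
    forall c A, mxvec (pmx_at E c *m A) 0 i = (P A).[c].
  move=> i; case: (mxvec_indexP i) => a b.
  exists (fun A => \sum_l E a l * (A l b)%:P); split; last first.
    move=> c A; rewrite mxvecE mxE horner_sum; apply: eq_bigr => l _.
    by rewrite hornerM hornerC [pmx_at E c _ _]mxE.
  split=> [A|j].
    apply: (big_ind (fun p : {poly F} => (size p <= K.+1)%N)); rewrite ?size_poly0 //.
      by move=> q q' sq sq'; apply: leq_trans (size_polyD _ _) _; rewrite geq_max sq.
    move=> l _; rewrite mulrC mul_polyC; apply: leq_trans (size_scale_leq _ _) _; exact: sE.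
  apply: (@pdeg_ext _ (fun A => \sum_l (E a l)`_j * A l b)) => [A|].
    by rewrite coef_sum; apply: eq_bigr => l _; rewrite coefMC.
  by apply: pdeg_sum => l _; apply: pdegZ; apply: pdeg_entry.
pose Pm (m : 'X_{1..N}) A := \prod_i e i A ^+ m i.
have cPm m : m \in msupp p -> cdeg (K * k) k (Pm m).
  move=> mp; have md : (mdeg m <= k)%N by rewrite -ltnS; apply: leq_trans sp; apply: msize_mdeg_lt.
  apply: (@cdeg_le (K * mdeg m) (mdeg m)) => //; first by rewrite leq_mul2l md orbT.
  have := cdeg_prod (index_enum 'I_N) (fun i => cdegX (m i) (eP i).1).
  by rewrite -big_distrr /= -mdegE; congr (cdeg _ _ _); rewrite mdegE; apply: eq_bigr => i _; rewrite mul1n.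
exists (fun A => \sum_(m <- msupp p) p@_m *: Pm m A); last first.
  move=> c A; rewrite fE /mxeval mevalE horner_sum; apply: eq_bigr => m _.
  rewrite hornerZ /Pm horner_prod; congr (_ * _); apply: eq_bigr => i _.
  by rewrite horner_exp (eP i).2.
split=> [A|j].
  rewrite big_seq; apply: (big_ind (fun p : {poly F} => (size p <= (K * k).+1)%N)); rewrite ?size_poly0 //.
    by move=> q q' sq sq'; apply: leq_trans (size_polyD _ _) _; rewrite geq_max sq.
  by move=> m mp; apply: leq_trans (size_scale_leq _ _) _; have [] := cPm m mp.
apply: (@pdeg_ext _ (fun A => \sum_(m <- msupp p | m \in msupp p) p@_m * (Pm m A)`_j)) => [A|].
  by rewrite coef_sum -big_seq; apply: eq_bigr => m _; rewrite coefZ.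
by apply: pdeg_sum => m mp; apply: pdegZ; have [_] := cPm m mp; apply.
Qed.

Lemma cdeg_expmx X f k : pdeg k f -> exists2 P, cdeg (n' * k) k P &
  forall c A, f (mexp (c *: X) *m A) = (P A).[c].
Proof.
move=> fk; pose E : 'M[{poly F}]_n := \matrix_(i, l) \poly_(r < n) ((X ^+ r) i l / r`!%:R).
have sE i j : (size (E i j) <= n)%N by rewrite mxE size_poly.
have [P cP PE] := cdeg_mx sE fk; exists P => // c A; rewrite -PE; congr (f (_ *m A)).
apply/matrixP => i l; rewrite !mxE horner_poly /mexp summxE; apply: eq_bigr => r _.
by rewrite mxE exprZn mxE; ring.
Qed.

Lemma pdeg_mull a f k : pdeg k f -> pdeg k (fun A => f (a *m A)).
Proof.
move=> fk; have [|P [_ cP] PE] := @cdeg_mx (map_mx polyC a) 0 f k _ fk.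
  by move=> i j; rewrite mxE size_polyC; case: eqP.
apply: pdeg_ext (cP 0%N) => A; rewrite -horner_coef0 -PE; congr (f (_ *m _)).
by rewrite pmx_atC.
Qed.

Lemma hdim_mull a S k : a \in unitmx -> (hdim S k <= hdim [set a *m s | s in S] k)%N.
Proof.
move=> ua; apply: hdim_max; have [p pk ip] := hdimP S k.
exists (fun i A => p i (invmx a *m A)) => [i|c c0]; first exact: pdeg_mull.
by apply: ip => A SA; rewrite -[RHS](c0 (a *m A)) ?mulKmx //; exists A.
Qed.

(** Along [mexp (c *: X)] a polynomial of degree [k] becomes a polynomial in [c] of degree at most
    [n' * k] whose coefficients have degree at most [k] on [S], so sweeping costs at most a linear
    factor. *)
Lemma hdim_expset X S k : (hdim (expset X S) k <= (n' * k).+1 * hdim S k)%N.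
Proof.
have [p pk ip] := hdimP (expset X S) k; rewrite leqNgt; apply/negP => lt.
have /choice[P PP] : forall i, exists P, cdeg (n' * k) k P /\
    forall c A, p i (mexp (c *: X) *m A) = (P A).[c].
  by move=> i; have [P cP PE] := cdeg_expmx X (pk i); exists P.
have [b bP] := hdim_basis S k.
have /choice[a aP] : forall ij : 'I_(hdim (expset X S) k) * 'I_(n' * k).+1,
    exists a : 'I_(hdim S k) -> F, forall A, S A -> (P ij.1 A)`_(ij.2) = \sum_l a l * b l A.
  by move=> [i j] /=; apply: bP; have [[_ cP] _] := PP i.
have [|c [i0 ci0] cM] := @dep_family _ ('I_(n' * k).+1 * 'I_(hdim S k))%type
  (fun i jl => a (i, jl.1) jl.2); first by rewrite card_prod !card_ord.
case/eqP: ci0; apply: ip => _ [x _ [A SA <-]].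
rewrite (eq_bigr (fun i => \sum_(j < (n' * k).+1) \sum_l (c i * a (i, j) l) * (b l A * x ^+ j))).
  rewrite exchange_big big1 //= => j _; rewrite exchange_big big1 //= => l _.
  by rewrite -mulr_suml (cM (j, l)) mul0r.
move=> i _; have [[sP _] ->] := PP i; rewrite (horner_coef_wide _ (sP A)) mulr_sumr.
apply: eq_bigr => j _; rewrite (aP (i, j)) //= mulr_suml mulr_sumr; apply: eq_bigr => l _.
by rewrite !mulrA.
Qed.

Lemma zirr_setM (A B : set 'M[F]_n) : zirr A -> zirr B -> zirr (setM A B).
Proof.
move=> [[a0 A0] irrA] [[b0 B0] irrB]; split; first by exists (a0 *m b0), a0 => //; exists b0.
move=> f g pf pg fg.
have pr (h : 'M[F]_n -> F) b : polyf h -> polyf (fun x : 'M[F]_n => h (x *m b)).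
  by move=> ph; apply: polyf_comp => //; apply: polymapM; [apply: polymap_id|apply: polymapC].
have pl (h : 'M[F]_n -> F) a : polyf h -> polyf (fun x : 'M[F]_n => h (a *m x)).
  by move=> ph; apply: polyf_comp => //; apply: polymapM; [apply: polymapC|apply: polymap_id].
apply: contrapT => /not_orP[/existsNP[_ /not_implyP[[a1 Aa1 [b1 Bb1 <-]] f1]]].
move=> /existsNP[_ /not_implyP[[a2 Aa2 [b2 Bb2 <-]] g2]].
have [a Aa|h|h] := irrA (fun x => f (x *m b1)) (fun x => g (x *m b2)) (pr _ _ pf) (pr _ _ pg).
- have [b Bb|h|h] := irrB (fun x => f (a *m x)) (fun x => g (a *m x)) (pl _ _ pf) (pl _ _ pg).
  + by apply: fg; exists a => //; exists b.
  + by rewrite h // mul0r.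
  + by rewrite h // mulr0.
- by apply: f1; apply: h.
- by apply: g2; apply: h.
Qed.

Lemma expsetE X S : expset X S = setM [set mexp (c *: X) | c in setT] S.
Proof.
apply/seteqP; split=> [_ [c _ [s Ss <-]]|_ [_ [c _ <-] [s Ss <-]]].
  by exists (mexp (c *: X)); [exists c|exists s].
by exists c => //; exists s.
Qed.

Lemma zirr_expset X S : zirr S -> mnilp X -> zirr (expset X S).
Proof. by move=> iS nX; rewrite expsetE; apply: zirr_setM => //; apply: exp_curve_irr. Qed.

Lemma sub_expset X S : S `<=` expset X S.
Proof. by move=> s Ss; exists 0 => //; exists s => //; rewrite scale0r mexp0 mul1mx. Qed.

Lemma zirr_zcl S Z : zirr S -> S `<=` Z -> Z `<=` zcl S -> zirr Z.
Proof.
move=> [[s Ss] irr] SZ ZS; split=> [|f g pf pg fg]; first by exists s; apply: SZ.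
have [A SA|h|h] := irr f g pf pg; first by apply: fg; apply: SZ.
  by left=> A /ZS; apply.
by right=> A /ZS; apply.
Qed.

(* A strict inclusion gains a factor [k]. *)
Lemma hdim_chains (Y : nat -> set 'M[F]_n) d : (forall i, (i <= d)%N -> zirr (Y i)) ->
  (forall i, (i < d)%N -> Y i `<=` Y i.+1 /\ ~ Y i.+1 `<=` zcl (Y i)) ->
  exists2 Q, (0 < Q)%N & forall k, (k ^ d * hdim (Y 0%N) k <= hdim (Y d) (Q * k))%N.
Proof.
elim: d => [|d IH] iY sY; first by exists 1%N => // k; rewrite mul1n mul1n.
have [||Q Q0 QP] := IH; first by move=> i id; apply: iY; apply: leqW.
  by move=> i id; apply: sY; apply: leqW.
have [s1 s2] := sY d (leqnn _); have [Q' QP'] := hdim_chain (iY _ (leqnn _)) s1 s2.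
exists (Q'.+1 * Q)%N => [|k]; first by rewrite muln_gt0.
apply: (@leq_trans (hdim (Y d.+1) (Q' * (Q * k))%N)); last first.
  by apply: hdim_mono; rewrite -mulnA leq_mul2r leqnSn orbT.
apply: leq_trans (QP' _); rewrite expnS -mulnA.
apply: (@leq_trans (k * hdim (Y d) (Q * k))%N); first by rewrite leq_mul2l QP orbT.
by rewrite leq_mul2r; apply/orP; right; apply: leq_pmull.
Qed.

Lemma hdim_chain_bound (Y : nat -> set 'M[F]_n) d : (forall i, (i <= d)%N -> zirr (Y i)) ->
  (forall i, (i < d)%N -> Y i `<=` Y i.+1 /\ ~ Y i.+1 `<=` zcl (Y i)) -> (d <= N)%N.
Proof.
move=> iY sY; rewrite leqNgt; apply/negP => Nd; have [Q Q0 QP] := hdim_chains iY sY.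
(* This [k] makes [k ^ N.+1] exceed [(Q.+1 * k) ^ N], which bounds the Hilbert function at
   [Q * k]. *)
pose k := (Q.+1 ^ N).+1%N; have := leq_trans (QP k) (hdim_le _ _).
have [[y Y0] _] := iY 0%N (leq0n _); have h0 := hdim_gt0 k Y0.
apply/negP; rewrite -ltnNge.
apply: (@leq_trans (k ^ N.+1)%N); last first.
  apply: leq_trans (leq_pmulr _ h0); rewrite leq_exp2l //.
  by rewrite /k ltnS expn_gt0.
apply: (@leq_ltn_trans ((Q.+1 * k) ^ N)%N); first by rewrite leq_exp2r // mulSn /k; lia.
by rewrite expnMn expnS ltn_pmul2r ?expn_gt0.
Qed.

(** Iteration along the powers of [Q] bounds [h (Q ^ j)] from below by [Q ^ 'C(j, 2)] up to a factor
    [M ^ j]. The exponent is quadratic in [j], while the polynomial bound allows only a linear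
    one. *)
Lemma growth_contra (h : nat -> nat) Q M D : (0 < h 1)%N -> (1 < Q)%N ->
  (forall k, (0 < k)%N -> k * h k <= M * h (Q * k))%N ->
  (forall k, (h k <= k.+1 ^ D)%N) -> False.
Proof.
move=> h1 Q1 hQ hD; have Q0 : (0 < Q)%N by apply: ltnW.
have [e Me] : exists e, (M <= Q ^ e)%N by exists M; apply: ltnW; apply: ltn_expl.
have low j : (Q ^ 'C(j, 2) <= M ^ j * h (Q ^ j))%N.
  elim: j => [|j IH]; first by rewrite bin0n expn0 mul1n.
  rewrite binS bin1 expnD mulnC.
  apply: (@leq_trans (Q ^ j * (M ^ j * h (Q ^ j)))%N); first by rewrite leq_mul2l IH orbT.
  rewrite mulnCA [(M ^ j.+1)%N]expnSr -mulnA leq_mul2l expnS; apply/orP; right.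
  by apply: hQ; rewrite expn_gt0 Q0.
pose j := (2 * e + 4 * D + 3)%N; have j0 : (0 < j)%N by rewrite /j; lia.
have : (Q ^ 'C(j, 2) <= Q ^ (e * j + j.+1 * D))%N.
  apply: leq_trans (low j) _; rewrite expnD leq_mul //; first by rewrite expnM leq_exp2r.
  apply: leq_trans (hD _) _; rewrite expnM; case: (D) => [|D'] //; rewrite leq_exp2r //.
  by rewrite expnS; apply: (@leq_trans (2 * Q ^ j)%N); [rewrite mul2n -addnn -addn1 leq_add2l expn_gt0 Q0|rewrite leq_mul2r Q1 orbT].
rewrite leq_exp2l // bin2; apply/negP; rewrite -ltnNge.
have -> : (j * j.-1)./2 = (j * (e + 2 * D + 1))%N.
  have -> : j.-1 = (2 * (e + 2 * D + 1))%N by rewrite /j; lia.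
  by rewrite mulnCA mul2n doubleK.
rewrite /j; nia.
Qed.

End Hilbert.

(** * Flag varieties *)

Section Conjugation.
Variables (F : numClosedFieldType) (n' : nat).
Local Notation n := n'.+1.
Implicit Types (a b g h w : 'M[F]_n) (A B H K L M : set 'M[F]_n).

Definition conjS w A : set 'M[F]_n := [set g | A (invmx w *m g *m w)].

Section OneElement.
Variable w : 'M[F]_n.
Hypothesis uw : w \in unitmx.

Lemma conjJ g : invmx w *m (w *m g *m invmx w) *m w = g.
Proof. by rewrite !mulmxA mulVmx // mul1mx mulmxKV. Qed.

Lemma conjJV g : w *m (invmx w *m g *m w) *m invmx w = g.
Proof. by rewrite !mulmxA mulmxV // mul1mx mulmxK. Qed.

Lemma conjS_mem A g : A g -> conjS w A (w *m g *m invmx w).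
Proof. by rewrite /conjS /= conjJ. Qed.

Lemma conjS_group A : mxgroup A -> mxgroup (conjS w A).
Proof.
move=> gA; split.
- by move=> g /(grpU gA); rewrite !unitmx_mul unitmx_inv uw /= andbT.
- by rewrite /conjS /= mulmx1 mulVmx //; apply: (grp1 gA).
- move=> a b Aa Ab; rewrite /conjS /=.
  have -> : invmx w *m (a *m b) *m w = (invmx w *m a *m w) *m (invmx w *m b *m w).
    by rewrite !mulmxA mulmxK.
  exact: (grpM gA).
- move=> a Aa; have := grpU gA Aa; rewrite !unitmx_mul unitmx_inv uw /= andbT => ua.
  have := grpV gA Aa.
  by rewrite /conjS /= !invmxM ?unitmx_mul ?unitmx_inv ?uw ?ua // invmxK mulmxA.
Qed.

Lemma polymap_conj : polymap (fun g : 'M[F]_n => invmx w *m g *m w).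
Proof. by apply: polymapM; [apply: polymapM; [apply: polymapC|apply: polymap_id]|apply: polymapC]. Qed.

Lemma conjS_alg A : alg_group A -> alg_group (conjS w A).
Proof.
move=> aA; apply/alg_groupP; split; first exact/conjS_group/alg_grp.
move=> g [zg ug]; apply: (alg_zcl aA); last by rewrite !unitmx_mul unitmx_inv uw ug.
exact: (zcl_comp polymap_conj _ zg).
Qed.

Lemma conjS_conn A : A 1%:M -> zconnected A -> zconnected (conjS w A).
Proof.
move=> A1' cA; have A1 : conjS w A 1%:M by rewrite /conjS /= mulmx1 mulVmx.
apply: (zconnected_base A1) => C cC C1 g Ag.
have e : [set x | A x /\ C (w *m x *m invmx w)] = A.
  apply: (zconnected_clopen cA (a := 1%:M)); last first.
    by split=> //; rewrite mulmx1 mulmxV.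
  apply: (clopen_pre (h := fun x => w *m x *m invmx w)) cC => [x|f pf]; first exact: conjS_mem.
  exists (fun x => f (w *m x *m invmx w)) => //; apply: polyf_comp => //.
  by apply: polymapM; [apply: polymapM; [apply: polymapC|apply: polymap_id]|apply: polymapC].
have [_] : [set x | A x /\ C (w *m x *m invmx w)] (invmx w *m g *m w) by rewrite e.
by rewrite conjJV.
Qed.

Lemma conjS_solv A : mxgroup A -> solvable A -> solvable (conjS w A).
Proof.
move=> gA [m Am]; exists m.
have step K : mxgroup K -> derived (conjS w K) `<=` conjS w (derived K).
  move=> gK; apply: gen_min; first exact/conjS_group/derived_group.
  move=> _ [a [b [Ka Kb ->]]]; apply: sub_gen; exists (invmx w *m a *m w), (invmx w *m b *m w).
  split=> //; have := grpU (conjS_group gK) Ka; have := grpU (conjS_group gK) Kb => ub ua.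
  rewrite !invmxM ?unitmx_mul ?unitmx_inv ?uw ?ua ?ub // invmxK !mulmxA.
  by rewrite !mulmxK // !mulmxKV //.
have h : iter m (@derived F n) (conjS w A) `<=` conjS w (iter m (@derived F n) A).
  elim: (m) => [|j IH] //=; have [gj _] := iter_derived_group j gA.
  by apply: subset_trans (derivedS IH) _; apply: step.
move=> g /h/Am /= e; rewrite -(conjJV g) e mulmx1 mulmxV //.
Qed.

End OneElement.

Lemma conjSK w A : w \in unitmx -> conjS w (conjS (invmx w) A) = A.
Proof.
move=> uw; apply/seteqP; split=> g; rewrite /conjS /= invmxK conjJV //.
Qed.

Lemma borel_conj L B w : mxgroup L -> L w -> borel L B -> borel L (conjS w B).
Proof.
move=> gL Lw [[[aB BL] cB sB] maxB]; have uw := grpU gL Lw; have gB := alg_grp aB.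
have LJ A g : L g -> A `<=` L -> conjS g A `<=` L.
  move=> Lg AL x /AL Lx; rewrite -(conjJV (grpU gL Lg) x); exact: (grpJ gL).
split.
  split; [split; [exact: conjS_alg|exact: LJ]|apply: conjS_conn => //; exact: (grp1 gB)|exact: conjS_solv].
move=> M [[aM ML] cM sM] BM; have uw' : invmx w \in unitmx by rewrite unitmx_inv.
have gM := alg_grp aM.
rewrite -(conjSK M uw); congr (conjS w _); apply: maxB.
  split; [split; [exact: conjS_alg|apply: LJ => //; exact: (grpV gL)]|apply: conjS_conn => //; exact: (grp1 gM)|exact: conjS_solv].
by move=> b Bb; rewrite /conjS /= invmxK; apply: BM; rewrite /conjS /= conjJ.
Qed.

End Conjugation.

(** * Schubert varieties and points in general position *)

Section FlagGeometry.
Variables (F : numClosedFieldType) (n' : nat).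
Local Notation n := n'.+1.
Variables G B : set 'M[F]_n.
Hypotheses (aG : alg_group G) (gB : mxgroup B) (BG : B `<=` G) (iB : zirr B).
Implicit Types (a b g h w : 'M[F]_n) (Z S : set 'M[F]_n) (x : flag G B) (Y C : set (flag G B)).
Let gG : mxgroup G. Proof. exact: alg_grp. Qed.

Lemma mxactM a b (S : set 'M[F]_n) : mxact (a *m b) S = mxact a (mxact b S).
Proof.
apply/seteqP; split=> [_ [s Ss <-]|_ [_ [s Ss <-] <-]].
  by exists (b *m s); [exists s|rewrite mulmxA].
by exists s => //; rewrite mulmxA.
Qed.

Lemma mxact_eq a b : a \in unitmx -> mxact a B = mxact b B <-> B (invmx a *m b).
Proof.
move=> ua; split=> [e|Bab].
  have : mxact b B b by exists 1%:M; [apply: (grp1 gB)|rewrite mulmx1].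
  by rewrite -e => -[c Bc <-]; rewrite mulKmx.
have bE : b = a *m (invmx a *m b) by rewrite mulKVmx.
apply/seteqP; split=> [_ [s Bs <-]|_ [s Bs <-]].
  exists (invmx (invmx a *m b) *m s); first by apply: (grpM gB) => //; apply: (grpV gB).
  by rewrite mulmxA; congr (_ *m _); rewrite [X in X *m _]bE mulmxK ?(grpU gB Bab).
by exists (invmx a *m b *m s); [apply: (grpM gB)|rewrite !mulmxA mulmxV // mul1mx].
Qed.

Lemma mxact_B g b : g \in unitmx -> B b -> mxact (g *m b) B = mxact g B.
Proof. by move=> ug Bb; apply/esym/(mxact_eq _ ug); rewrite mulKmx. Qed.

Definition pre Y : set 'M[F]_n := [set g | G g /\ Y (mxact g B)].

Definition rstable Z := forall z b, Z z -> B b -> Z (z *m b).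

Lemma pre_rstable Y : rstable (pre Y).
Proof.
move=> g b [Gg Yg] Bb; split; first by apply: (grpM gG) => //; apply: BG.
by rewrite mxact_B ?(grpU gG Gg).
Qed.

Lemma flag_closedP C : closed C <-> exists2 V : set (zmx F n), closed V &
  forall g, G g -> C (mxact g B) <-> V g.
Proof.
split=> [cC|[V cV VP]].
  have [V oV VP] : flag_open (~` C : set (flag G B)) by apply: closed_openC cC.
  exists (~` V); first exact: open_closedC.
  by move=> g Gg; have [h1 h2] := VP g Gg; split=> [Cg /h2|nV]; [apply|apply: contrapT => /h1].
rewrite -[C]setCK; apply: open_closedC.
exists (~` V : set (zmx F n)); first exact: closed_openC.
by move=> g Gg; have [h1 h2] := VP g Gg; split=> nC ?; apply: nC; [apply: h2|apply: h1].
Qed.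

Lemma pre_closed C S g : closed C -> S `<=` pre C -> G g -> zcl S g -> C (mxact g B).
Proof.
move=> /flag_closedP[V cV VP] SC Gg zg; apply/VP => //; rewrite (closed_zcl cV).
by apply: zclS zg => s /SC[Gs Cs]; apply/VP.
Qed.

Lemma rstable_zcl Z : rstable Z -> rstable (zcl Z).
Proof.
move=> rZ z b zz Bb; have ph : polymap (fun x : 'M[F]_n => x *m b) by apply: polymapM; [apply: polymap_id|apply: polymapC].
by apply: (zcl_comp ph _ zz) => x Zx; apply: rZ.
Qed.

(** The closed subset of [G/B] whose preimage in [G] is the closure of [Z] when [Z] is stable under
    [B]; this transports closures along the quotient. *)
Definition imz Z : set (flag G B) := [set x | exists g, [/\ G g, zcl Z g & x = mxact g B]].

Lemma imzP Z g : rstable Z -> G g -> imz Z (mxact g B) <-> zcl Z g.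
Proof.
move=> rZ Gg; split=> [[h [Gh zh e]]|zg]; last by exists g.
have uh := grpU gG Gh; have /(mxact_eq _ uh) Bhg := esym e.
have -> : g = h *m (invmx h *m g) by rewrite mulKVmx.
exact: rstable_zcl.
Qed.

Lemma imz_closed Z : rstable Z -> closed (imz Z).
Proof.
move=> rZ; apply/flag_closedP; exists (zcl Z : set (zmx F n)); first exact: zcl_closed.
by move=> g Gg; apply: imzP.
Qed.

Definition coset x := exists2 g, G g & x = mxact g B.

(** The fibres are cosets of the irreducible group [B], so on each fibre one of [f] and [g] vanishes
    identically. The points whose whole fibre is in the zero set of a function form a closed subset
    [Cl], and irreducibility of [Y] chooses one of the two. *)
Lemma pre_irr Y : Y `<=` coset -> irreducible Y -> zirr (pre Y).
Proof.
move=> Yc [[y Yy] irr]; split=> [|f g pf pg fg].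
  by have [h Gh yE] := Yc _ Yy; exists h; split; rewrite -?yE.
pose Cl (k : 'M[F]_n -> F) : set (flag G B) := [set x | forall h, G h -> x = mxact h B -> k h = 0].
have clC k : polyf k -> closed (Cl k).
  move=> pk; apply/flag_closedP; exists ([set A | forall b : {b | B b}, k (A *m sval b) = 0] : set (zmx F n)).
    apply: closed_polyfs => -[b Bb] /=; apply: polyf_comp => //.
    by apply: polymapM; [apply: polymap_id|apply: polymapC].
  move=> h Gh; have uh := grpU gG Gh; split=> [ch [b Bb]|ch h' Gh' e] /=.
    by apply: ch; [apply: (grpM gG) => //; apply: BG|rewrite mxact_B].
  have /(mxact_eq _ uh) Bb := e.
  by have := ch (exist _ _ Bb); rewrite /= mulKVmx.
have [|h|h] := irr _ _ (clC f pf) (clC g pg).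
- move=> x Yx; have [h Gh xE] := Yc _ Yx; have uh := grpU gG Gh.
  have Yb b : B b -> pre Y (h *m b).
    by move=> Bb; apply: pre_rstable => //; split; rewrite -?xE.
  have [_ irrB] := iB.
  have pl (k : 'M[F]_n -> F) : polyf k -> polyf (fun b : 'M[F]_n => k (h *m b)).
    by move=> pk; apply: polyf_comp => //; apply: polymapM; [apply: polymapC|apply: polymap_id].
  have [b Bb|fB|gB'] := irrB _ _ (pl f pf) (pl g pg); first by apply: fg; apply: Yb.
    left=> h' Gh' xE'; have /(mxact_eq _ uh) Bb : mxact h B = mxact h' B by rewrite -xE.
    by have := fB _ Bb; rewrite mulKVmx.
  right=> h' Gh' xE'; have /(mxact_eq _ uh) Bb : mxact h B = mxact h' B by rewrite -xE.
  by have := gB' _ Bb; rewrite mulKVmx.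
- by left=> k [Gk Yk]; apply: (h _ Yk).
- by right=> k [Gk Yk]; apply: (h _ Yk).
Qed.

Lemma zirr_open S Z A0 : zirr Z -> S `<=` Z -> S A0 ->
  (exists p, [/\ polyf p, p A0 != 0 & forall A, Z A -> p A != 0 -> S A]) ->
  zirr S /\ Z `<=` zcl S.
Proof.
move=> [_ irr] SZ SA0 [p [pp pA0 pS]].
have van f : polyf f -> vanish S f -> vanish Z f.
  move=> pf fS; have [A ZA|p0|//] := irr p f pp pf; last by move: pA0; rewrite p0 ?eqxx //; apply: SZ.
  by have [->|pA] := eqVneq (p A) 0; rewrite ?mul0r // fS ?mulr0 //; apply: pS.
split=> [|A ZA f pf fS]; last exact: van.
split=> [|f g pf pg fg]; first by exists A0.
have [|h|h] := irr f g pf pg; first by apply: van => //; apply: polyfM.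
  by left=> A /SZ; apply: h.
by right=> A /SZ; apply: h.
Qed.

Section Schubert.
Variable w : 'M[F]_n.
Hypothesis Gw : G w.
Let X := schubert G B w.

Lemma schubert_closed : closed X.
Proof. exact: closed_closure. Qed.

(** A set of matrices that is not a coset is an open point of the type, so it cannot belong to the
    closure of the cell. *)
Lemma schubert_coset : X `<=` coset.
Proof.
move=> x Xx; apply: contrapT => nx.
have ox : open ([set x] : set (flag G B)).
  exists (set0 : set (zmx F n)); first exact: open0.
  by move=> g Gg; split=> // xE; apply: nx; exists g.
have [_ [[b Bb ->] xE]] := Xx [set x] (open_nbhs_nbhs (conj ox (erefl x))).
by apply: nx; exists (b *m w); rewrite -?xE //; apply: (grpM gG) => //; apply: BG.
Qed.

Lemma schubert_cell b : B b -> X (mxact (b *m w) B).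
Proof. by move=> Bb; apply: subset_closure; exists b. Qed.

Lemma schubert_sub C : closed C -> (forall b, B b -> C (mxact (b *m w) B)) -> X `<=` C.
Proof.
move=> cC h; rewrite ((closure_id C).1 cC); apply: closure_subset => _ [b Bb ->]; exact: h.
Qed.

(** Every [Z i] passes through [x1], so the open set meets it in a dense part; intersecting the
    closures with [O] keeps them irreducible and the inclusions strict. *)
Lemma dim_ge_open (O : set (flag G B)) (Vo : set (flag G B)) (x1 : 'M[F]_n) (Z : nat -> set 'M[F]_n) m :
  open Vo -> O = X `&` Vo -> G x1 -> O (mxact x1 B) -> Z 0%N x1 ->
  (forall i, zirr (Z i)) -> (forall i, rstable (Z i)) -> (forall i, Z i `<=` pre X) ->
  (forall i, Z i `<=` Z i.+1) -> (forall i, (i < m)%N -> ~ Z i.+1 `<=` zcl (Z i)) -> dim_ge O m.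
Proof.
move=> oV OE Gx1 Ox1 Zx1 iZ rZ ZX ZS nZ.
have Zi i : Z i x1 by elim: i => // i IH; apply: ZS.
have [W /zopenP oW WP] := oV.
have [p [px1 pW]] : exists p, mxeval p x1 != 0 /\ forall A, mxeval p A != 0 -> W A.
  by apply: oW; apply/WP => //; move: Ox1; rewrite OE => -[].
pose E i := pre (O `&` imz (Z i)).
have EP i : zirr (E i) /\ Z i `<=` zcl (E i).
  have iG : zirr (G `&` zcl (Z i)).
    apply: (zirr_zcl (iZ i)) => [z Zz|z []//].
    by split; [have [] := ZX _ _ Zz|apply: sub_zcl].
  have [|||zE dE] := @zirr_open (E i) _ x1 iG.
  - by move=> z [Gz [_ iz]]; split=> //; apply/(imzP (rZ i) Gz).
  - by split=> //; split=> //; apply/imzP => //; apply: sub_zcl.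
  - exists (mxeval p); split=> // [|z [Gz zz] pz]; first exact: polyf_mxeval.
    split=> //; split; last exact/imzP.
    rewrite OE; split; last by apply/(WP z Gz); apply: pW.
    exact: (pre_closed schubert_closed (ZX i)).
  split=> // z Zz; apply: dE; split; [by have [] := ZX _ _ Zz|exact: sub_zcl].
exists (fun i => O `&` imz (Z i)); split=> [i im|i im].
  split; last by exists (imz (Z i)) => //; apply: imz_closed.
  split; first by exists (mxact x1 B); split=> //; apply/imzP => //; apply: sub_zcl.
  move=> C D cC cD OCD.
  have /flag_closedP[C' cC' CP] := cC; have /flag_closedP[D' cD' DP] := cD.
  have [g [Gg Eg]|h|h] := zirr_sub2 (EP i).1 cC' cD'.
  - by have [Cg|Dg] := OCD _ Eg; [left; apply/CP|right; apply/DP].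
  - left=> y Ey; have [_ [g [Gg zg yE]]] := Ey; rewrite yE; apply/CP => //; apply: h.
    by split=> //; rewrite -yE.
  - right=> y Ey; have [_ [g [Gg zg yE]]] := Ey; rewrite yE; apply/DP => //; apply: h.
    by split=> //; rewrite -yE.
split=> [y [Oy [g [Gg zg yE]]]|sub].
  by split=> //; exists g; split=> //; apply: zclS zg; apply: ZS.
apply: (nZ i im) => z Zz; have zE := (EP i.+1).2 _ Zz.
apply: zcl_id; apply: zclS zE => g [Gg Eg]; have [_] := sub _ Eg.
by move/(imzP (rZ i) Gg).
Qed.

Section GeneralPosition.
Variables (L U : set 'M[F]_n) (v : 'M[F]_n) (y0 x : flag G B) (Vo : set (flag G B)).
Hypotheses (gL : mxgroup L) (aU : alg_group U) (uU : unipotent U) (UB : U `<=` B).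
Hypothesis cellU : forall b, B b -> exists2 u, U u & exists2 b', B b' & b *m w = u *m w *m b'.
Hypotheses (Uv : U v) (iX : irreducible X).
Hypothesis LX : forall k z, L k -> X z -> X (flag_act G B k z).
Let O := action_orbit L (flag_act G B) y0.
Hypotheses (oV : open Vo) (OE : O = X `&` Vo) (Ox1 : O (mxact (v *m w) B)).

(** Sweeping the fibre of [x1] by unipotent curves, each enlarging the closure, reaches [X] after
    [m] steps and gives a chain of length [m] in [O]. If [x] were outside [O], general position
    would give such a chain in its orbit, which avoids the open set [Vo]; adding [X] makes [m.+1]
    strict inclusions against [m] sweeps. *)
Lemma general_position_open : general_position L (flag_act G B) X x -> O x.
Proof.
move=> [Xx gen]; apply: contrapT => nOx; pose x1 := v *m w.
have Gx1 : G x1 by apply: (grpM gG) => //; apply: BG; apply: UB.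
pose Z0 : set 'M[F]_n := mxact x1 B.
(* A direction that enlarges the closure is chosen whenever one exists, and 0 otherwise. *)
have /choice[xi xiP] : forall Z, exists a, lie_algebra U a /\
    ((exists2 a, lie_algebra U a & ~ expset a Z `<=` zcl Z) -> ~ expset a Z `<=` zcl Z).
  move=> Z; have [[a Ua na]|nb] := pselect (exists2 a, lie_algebra U a & ~ expset a Z `<=` zcl Z).
    by exists a.
  by exists 0; split=> //; case: (lie_subsp U).
pose Z i := iter i (fun Z => expset (xi Z) Z) Z0.
have nxi i : mnilp (xi (Z i)) by apply: (lie_unip_nilp aU uU); have [] := xiP (Z i).
have ZS i : Z i `<=` Z i.+1 by apply: sub_expset.
have iZ i : zirr (Z i).
  by elim: i => [|i IH]; [apply: zirr_mull|apply: zirr_expset].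
have rZ i : rstable (Z i).
  elim: i => [|i IH] z b.
    by move=> [c Bc <-] Bb; exists (c *m b); [apply: (grpM gB)|rewrite mulmxA].
  by move=> [c _ [s Ss <-]] Bb; exists c => //; exists (s *m b); [apply: IH|rewrite mulmxA].
have Zcell i z : Z i z -> exists b b', [/\ B b, B b' & z = b *m w *m b'].
  elim: i z => [|i IH] z.
    by move=> [b Bb <-]; exists v, b; split=> //; apply: UB.
  move=> [c _ [s /IH[b [b' [Bb Bb' ->]]] <-]].
  exists (mexp (c *: xi (Z i)) *m b), b'; split=> //; last by rewrite !mulmxA.
  apply: (grpM gB) => //; apply: UB; apply: lie_exp => //; by have [] := xiP (Z i).
have ZX i : Z i `<=` pre X.
  move=> z /Zcell[b [b' [Bb Bb' ->]]]; have Gbw : G (b *m w) by apply: (grpM gG) => //; apply: BG.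
  split; first by apply: (grpM gG) => //; apply: BG.
  by rewrite mxact_B ?(grpU gG Gbw) //; apply: schubert_cell.
(* The sweeping stops because chains of irreducible sets of matrices have length at most [n * n];
   [m] is the first index with no enlarging direction left. *)
pose bad Z := exists2 a, lie_algebra U a & ~ expset a Z `<=` zcl Z.
have ex : exists i, `[< ~ bad (Z i) >].
  apply: contrapT => nex; have allbad i : bad (Z i).
    by apply: contrapT => nb; apply: nex; exists i; apply/asboolP.
  have : ((n * n).+1 <= n * n)%N.
    apply: (@hdim_chain_bound _ _ Z) => // i _; split; first exact: ZS.
    by have [_] := xiP (Z i); apply; apply: allbad.
  by rewrite ltnn.
have := ex_minnP ex; case=> m /asboolP nbad min.
have nZ i : (i < m)%N -> ~ Z i.+1 `<=` zcl (Z i).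
  move=> im; have [_] := xiP (Z i); apply; apply: contrapT => nb.
  by have := min i (asboolT nb); rewrite leqNgt im.
have dimO : dim_ge O m.
  apply: (dim_ge_open oV OE Gx1 Ox1) nZ => //.
  by exists 1%:M; rewrite ?mulmx1 //; apply: (grp1 gB).
have act1 y : flag_act G B 1%:M y = y.
  apply/seteqP; split=> [_ [z yz <-]|z yz]; first by rewrite mul1mx.
  by exists z; rewrite ?mul1mx.
have Xy0 : X y0.
  have : O y0 by exists 1%:M; [apply: (grp1 gL)|apply: act1].
  by rewrite OE => -[].
have [Y [YP YS]] := gen y0 Xy0 m dimO.
pose orb := action_orbit L (flag_act G B) x.
have orbX : orb `<=` X by move=> _ [k Lk <-]; apply: LX.
have orbV z : orb z -> ~ Vo z.
  move=> oz Vz; have : O z by rewrite OE; split=> //; apply: orbX.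
  case: oz => k Lk <- [l Ll e]; apply: nOx; exists (invmx k *m l).
    by apply: (grpM gL) => //; apply: (grpV gL).
  rewrite /flag_act mxactM -[mxact l y0]/(flag_act G B l y0) e /flag_act -mxactM.
  by rewrite mulVmx ?(grpU gL Lk) //; apply: act1.
have Yorb i : (i <= m)%N -> Y i `<=` orb by move=> im z; have [_ [C _ ->]] := YP i im => -[].
have iW i : (i <= m)%N -> zirr (pre (Y i)).
  move=> im; apply: pre_irr; last by have [] := YP i im.
  by move=> z /(Yorb i im)/orbX; apply: schubert_coset.
(* The chain in the orbit of [x], with [X] put on top as the member of index [m.+1]. *)
pose W i := if (i <= m)%N then pre (Y i) else pre X.
have [i im|i|Q Q0 QP] := @hdim_chains _ _ W m.+1.
- by rewrite /W; case: ifP => [/iW//|_]; apply: pre_irr => //; apply: schubert_coset.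
- rewrite ltnS => im; rewrite /W im; case: ifP => [im'|_]; last first.
    split=> [z [Gz Yz]|h]; first by split=> //; apply: orbX; apply: Yorb Yz.
    have cV : closed (~` Vo) by apply: open_closedC.
    have x1X : pre X x1 by split=> //; move: Ox1; rewrite OE => -[].
    have := pre_closed cV (_ : pre (Y i) `<=` pre (~` Vo)) Gx1 (h _ x1X); apply.
      by move=> z [Gz Yz]; split=> //; apply: orbV; apply: Yorb Yz.
    by move: Ox1; rewrite OE => -[].
  have [sub nsub] := YS i im'; split=> [z [Gz Yz]|h]; first by split=> //; apply: sub.
  apply: nsub => z Yz; have [_ [C cC YE]] := YP i im.
  have Oz := Yorb _ im' _ Yz; have [g Gg zE] := schubert_coset (orbX _ Oz).
  rewrite YE; split=> //; rewrite zE; apply: (pre_closed cC _ Gg (h g _)).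
    by move=> y [Gy]; rewrite YE => -[_ Cy]; split.
  by split=> //; rewrite -zE.
(* A point of the cell is reached from [x1] by one exponential, since the unipotent element that
   carries [x1] to it has a logarithm, and by the choice of [m] this direction does not leave the
   closure. *)
have XZ : pre X `<=` zcl (Z m).
  move=> g [Gg Xg]; apply/(imzP (rZ m) Gg); move: Xg; apply: schubert_sub; first exact: imz_closed.
  move=> b Bb; apply/imzP => //; first by apply: (grpM gG) => //; apply: BG.
  have [u Uu [b' Bb' bE]] := cellU Bb; have gU := alg_grp aU; have uv := grpU gU Uv.
  have Uu' : U (u *m invmx v) by apply: (grpM gU) => //; apply: (grpV gU).
  have [a [na Ua] uE] := log_lie aU Uu' (uU Uu').
  apply: contrapT => nz; apply: nbad; exists a => // h; apply: nz; apply: h.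
  exists 1 => //; exists (x1 *m b'); last by rewrite scale1r -uE bE !mulmxA mulmxKV.
  have : Z 0%N (x1 *m b') by exists b'.
  by elim: (m) => // i IH /IH; apply: ZS.
have hZ i k : (hdim (Z i) k <= (n' * k).+1 ^ i * hdim Z0 k)%N.
  elim: i => [|i IH]; first by rewrite expn0 mul1n.
  apply: leq_trans (hdim_expset _ _ _) _; rewrite expnS -mulnA leq_mul2l; apply/orP; right; exact: IH.
have h0 k : (hdim Z0 k <= hdim (pre (Y 0%N)) k)%N.
  have [[[y Yy] _] _] := YP 0%N (leq0n m).
  have [g Gg yE] := schubert_coset (orbX _ (Yorb _ (leq0n m) _ Yy)).
  have ua : g *m invmx x1 \in unitmx by rewrite unitmx_mul unitmx_inv (grpU gG Gg) (grpU gG Gx1).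
  apply: leq_trans (hdim_mull Z0 k ua) _; apply: hdim_zcl => _ [_ [b Bb <-] <-]; apply: sub_zcl.
  by rewrite mulmxA mulmxKV ?(grpU gG Gx1) //; apply: pre_rstable => //; split; rewrite -?yE.
apply: (@growth_contra (hdim Z0) (2 * Q)%N ((n' * Q).+1 ^ m)%N (n * n)%N).
- by apply: (hdim_gt0 1 (A := x1)); exists 1%:M; rewrite ?mulmx1 //; apply: (grp1 gB).
- by lia.
- move=> k k0; have km : (0 < k ^ m)%N by rewrite expn_gt0 k0.
  rewrite -(leq_pmul2l km) mulnA -expnSr.
  apply: (@leq_trans (k ^ m.+1 * hdim (W 0%N) k)%N).
    by rewrite leq_mul2l /W leq0n h0 orbT.
  apply: leq_trans (QP k) _; rewrite /W ltnn; apply: leq_trans (hdim_zcl _ XZ) _.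
  apply: leq_trans (hZ _ _) _; rewrite [leqRHS]mulnA; apply: leq_mul.
    rewrite -expnMn; case: (m) => [|m'] //; rewrite leq_exp2r //; nia.
  by apply: hdim_mono; rewrite leq_mul2r leq_pmull ?orbT.
- by move=> k; apply: hdim_le.
Qed.

End GeneralPosition.
End Schubert.
End FlagGeometry.

Section TorusIrreducible.
Variables (F : numClosedFieldType) (n' : nat).
Local Notation n := n'.+1.

Lemma zirr_mono Q r (A : 'M[int]_(r, n)) : Q \in unitmx ->
  zirr [set qdiag Q (mono c A) | c in [set c : 'rV[F]_r | nz c]].
Proof.
move=> uQ.
pose Ps (s : seq 'I_r) : set 'M[F]_n :=
  [set \big[mulmx/1%:M]_(k <- s) qexp Q (A k) (c 0 k) | c in [set c : 'rV[F]_r | nz c]].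
have nz1 : nz (const_mx 1 : 'rV[F]_r) by move=> k; rewrite mxE oner_neq0.
have -> : [set qdiag Q (mono c A) | c in [set c : 'rV[F]_r | nz c]] = Ps (index_enum 'I_r).
  by apply/seteqP; split=> [_ [c cn <-]|_ [c cn <-]]; exists c => //; rewrite qdiag_mono.
elim: (index_enum 'I_r) (index_enum_uniq 'I_r) => [_|k s IH /= /andP[ks us]].
  have P0 g : Ps [::] g -> g = 1%:M by move=> [c _ <-]; rewrite big_nil.
  have P1 : Ps [::] 1%:M by exists (const_mx 1) => //; rewrite big_nil.
  split=> [|f g _ _ fg]; first by exists 1%:M.
  have /eqP := fg _ P1; rewrite mulf_eq0 => /orP[] /eqP e; [left|right] => x /P0 ->; exact: e.
have -> : Ps (k :: s) = setM [set qexp Q (A k) b | b in [set b | b != 0]] (Ps s).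
  apply/seteqP; split=> [_ [c cn <-]|_ [_ [b b0 <-] [_ [c cn <-] <-]]].
    rewrite big_cons; exists (qexp Q (A k) (c 0 k)); first by exists (c 0 k) => //; apply: cn.
    by eexists; [exists c|].
  exists (\row_l if l == k then b else c 0 l).
    by move=> l; rewrite mxE; case: ifP.
  rewrite big_cons mxE eqxx; congr (_ *m _); apply: eq_big_seq => l ls.
  by rewrite mxE; case: eqP => // lk; move: ks; rewrite -lk ls.
by apply: zirr_setM; [apply: zirr_qexp|apply: IH].
Qed.

Lemma torN_zirr Q (R S : 'M[int]_n) fr : Q \in unitmx -> R *m S = 1%:M -> S *m R = 1%:M ->
  zirr (@torN F n' Q S fr).
Proof.
move=> uQ RS SR; pose A : 'M[int]_n := \matrix_(k, j) if fr k then R k j else 0.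
have monoE (c : 'rV[F]_n) : mono c A = mono (\row_k if fr k then c 0 k else 1) R.
  apply/rowP => j; rewrite [LHS]mxE [RHS]mxE; apply: eq_bigr => k _; rewrite !mxE.
  by case: (fr k); rewrite ?expr0z ?exp1rz.
suff -> : torN Q S fr = [set qdiag Q (mono c A) | c in [set c : 'rV[F]_n | nz c]] by apply: zirr_mono.
apply/seteqP; split=> [t Tt|_ [c cn <-]].
  exists (tcoord Q S t); first exact: (tcoord_nz uQ Tt).
  rewrite monoE [RHS](tcoordK uQ SR Tt); congr (qdiag Q (mono _ R)); apply/rowP => k; rewrite [LHS]mxE.
  by case: ifP => // /negbT kf; rewrite (tcoordN uQ Tt kf).
rewrite monoE; apply: torN_par => // k; rewrite mxE; first by case: ifP; rewrite ?oner_neq0.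
by move/negPf ->.
Qed.

End TorusIrreducible.

(** * Proof of the theorem *)

Section Main.
Variables (F : numClosedFieldType) (n' : nat).
Local Notation n := n'.+1.

Lemma unip_conj (g u : 'M[F]_n) : g \in unitmx -> (exists k, (u - 1%:M) ^+ k = 0) ->
  exists k, (g *m u *m invmx g - 1%:M) ^+ k = 0.
Proof.
by move=> ug [k uk]; exists k; rewrite conj_sub1 // conj_exp // uk mulr0 mul0r.
Qed.

Lemma connected_stabilizer (G B T : set 'M[F]_n) (w : set 'M[F]_n) (wdot : 'M[F]_n)
    (J : set ('M[F]_n -> F)) (L : set 'M[F]_n) :
  semisimple G -> trivial_center G -> borel G B -> maximal_torus G T -> T `<=` B ->
  weyl_group G T w -> w wdot -> levi (parabolic G B T J) L -> T `<=` L ->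
  horospherical (flag_regular G B) L (flag_act G B) (schubert G B wdot) ->
  forall x : flag G B, general_position L (flag_act G B) (schubert G B wdot) x ->
    zconnected (stabilizer L (flag_act G B) x) /\
    strongly_solvable L (stabilizer L (flag_act G B) x).
Proof.
move=> ssG Z1 bB maxT TB ww wwd [[aL _] [V [urV PE _]]] TL.
move=> [irrX _ LX [y0 [Vo [Xy0 oV OE]]] maxU] x gpx.
have [[torT TG] _] := maxT.
have [Q [R [S [fr [uQ RS SR TE]]]]] := torus_normal torT.
have [ct [ct0 sep]] := @regular_cochar F n' R fr.
have [aG cG _] := ssG; have gG := alg_grp aG; have gL := alg_grp aL.
have [[[aB BG] cB sB] _] := bB; have gB := alg_grp aB.
have [aT _] := torT; have gT := alg_grp aT.
pose P := parabolic G B T J; rewrite -/P in urV PE.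
have PGg : B `|` [set g | exists a U,
    [/\ J a, root_subgroup G T (char_opp a) U & U g]] `<=` G.
  by move=> g [/BG//|[a [U [_ [[_ UG] _] /UG]]]].
have gP : mxgroup P by apply: gen_group => g /PGg/(grpU gG).
have PG : P `<=` G by apply: gen_min.
have BP : B `<=` P by move=> b Bb; apply: sub_gen; left.
have [g [Gg gTg] wE] := ww; have [t0 Tt0 wdE] : mxact g T wdot by rewrite wE.
have ug := grpU gG Gg; have ut0 := grpU gT Tt0.
have Gw : G wdot by rewrite -wdE; apply: (grpM gG) => //; apply: TG.
have uw := grpU gG Gw.
have wT t : T t -> T (invmx wdot *m t *m wdot).
  move=> Tt; have Ts : T (invmx g *m t *m g) by apply/gTg; rewrite conjJV.
  have := grpM gT (grpM gT (grpV gT Tt0) Ts) Tt0.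
  by rewrite -wdE invmxM // !mulmxA.
have wT' t : T t -> T (wdot *m t *m invmx wdot).
  move=> Tt; have /gTg := grpJ gT Tt0 Tt; by rewrite -wdE invmxM // !mulmxA.
rewrite TE in maxT TB TL wT wT' *.
pose Bu : set 'M[F]_n := [set u | B u /\ exists k, (u - 1%:M) ^+ k = 0].
have [aBu nBu BE] : [/\ alg_group Bu, normalised_by B Bu & B = setM (torN Q S fr) Bu].
  exact: (solv_decomp uQ RS SR ct0 sep ssG maxT).
have uBu : unipotent Bu by move=> u [].
have BuB : Bu `<=` B by move=> u [].
have iB : zirr B by rewrite BE; apply: zirr_setM; [apply: torN_zirr uQ RS SR|apply: unip_zirr].
have VB := radical_sub_borel ssG bB BP PG urV.
have [[[aV VP] _ uV PV] _] := urV; have gV := alg_grp aV.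
pose act := flag_act G B; pose O := action_orbit L act y0.
have actM a b y : act (a *m b) y = act a (act b y) by apply: mxactM.
have act1 y : act 1%:M y = y.
  apply/seteqP; split=> [_ [z yz <-]|z yz]; first by rewrite mul1mx.
  by exists z; rewrite ?mul1mx.
have actV l y y' : L l -> act l y = y' -> act (invmx l) y' = y.
  by move=> Ll <-; rewrite -actM mulVmx ?(grpU gL Ll).
have OX y : O y -> schubert G B wdot y by rewrite /O OE => -[].
have Otrans y y' : O y -> O y' -> exists2 l, L l & act l y = y'.
  move=> [k Lk kE] [k' Lk' kE']; exists (k' *m invmx k).
    by apply: (grpM gL) => //; apply: (grpV gL).
  by rewrite actM (actV _ _ _ Lk kE).
have Ol l y : L l -> O y -> O (act l y).
  by move=> Ll [k Lk <-]; exists (l *m k); [apply: (grpM gL)|apply: actM].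
(* The open set [Vo] meets the cell because the Schubert variety is its closure. Writing the element
   of [B] as [l *m v] in [P = L V], the factor [l] can be removed inside the orbit. *)
have [v Vv Ox1] : exists2 v, V v & O (mxact (v *m wdot) B).
  have Vy0 : Vo y0.
    have : O y0 by exists 1%:M; [apply: (grp1 gL)|apply: act1].
    by rewrite /O OE => -[].
  have [_ [[b Bb ->] Vob]] := Xy0 Vo (open_nbhs_nbhs (conj oV Vy0)).
  have Ob : O (mxact (b *m wdot) B) by rewrite /O OE; split=> //; apply: schubert_cell.
  move: (BP _ Bb); rewrite PE => -[l Ll [v Vv bE]]; exists v => //.
  have := Ol _ _ (grpV gL Ll) Ob; rewrite /act /flag_act -mxactM -bE !mulmxA.
  by rewrite mulVmx ?mul1mx ?(grpU gL Ll).
set x1 : flag G B := mxact (v *m wdot) B in Ox1.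
have uv := grpU gV Vv; have uvw : v *m wdot \in unitmx by rewrite unitmx_mul uv.
have Ox : O x.
  apply: (general_position_open aG gB BG iB Gw gL aBu uBu BuB _ _ irrX LX oV OE Ox1 gpx).
    move=> b; rewrite {1}BE => -[t Tt [u Bu' <-]]; exists (t *m u *m invmx t).
      by apply: nBu => //; apply: TB.
    have ut : t \in unitmx by apply: (grpU gB); apply: TB.
    exists (invmx wdot *m t *m wdot); first by apply: TB; apply: wT.
    by rewrite !mulmxA mulmxK // mulmxKV.
  by split; [apply: VB|apply: uV].
have [l0 Ll0 xE] := Otrans _ _ Ox1 Ox; have ul0 := grpU gL Ll0.
(* The horospherical condition is applied at [x1], whose representative has its factor [v] in [V];
   the stabiliser of [x] is conjugate to that of [x1] by [l0]. *)
have gpx1 : general_position L act (schubert G B wdot) x1.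
  split=> [|y Xy]; first exact: OX.
  have -> : action_orbit L act x1 = action_orbit L act x; last by case: gpx => _; apply.
  apply/seteqP; split=> [_ [k Lk <-]|_ [k Lk <-]].
    exists (k *m invmx l0); first by apply: (grpM gL) => //; apply: (grpV gL).
    by rewrite actM (actV _ _ _ Ll0 xE).
  by exists (k *m l0); [apply: (grpM gL)|rewrite actM xE].
have [U muU UH] := maxU x1 gpx1.
pose C := conjS wdot B.
have stabE l : L l -> act l x1 = x1 <-> C (invmx v *m l *m v).
  move=> Ll; rewrite /act /flag_act /x1 -mxactM /C /conjS /=.
  have := mxact_eq gB (l *m (v *m wdot)) uvw; rewrite invmxM // !mulmxA => <-.
  by split=> ->.
pose Cu : set 'M[F]_n := [set u | C u /\ exists k, (u - 1%:M) ^+ k = 0].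
have CuE : Cu = conjS wdot Bu.
  apply/seteqP; split=> u [Cu' uu]; split=> //.
    by have := @unip_conj (invmx wdot) u; rewrite invmxK unitmx_inv; apply.
  by rewrite -(conjJV uw u); apply: unip_conj.
have gC : mxgroup C := conjS_group uw gB.
have CuP : [/\ alg_group Cu, normalised_by C Cu & C = setM (torN Q S fr) Cu].
  split.
  - by rewrite CuE; apply: conjS_alg.
  - move=> c u Cc [Cu' uu]; split; first exact: (grpJ gC).
    by apply: unip_conj => //; apply: (grpU gC).
  - apply/seteqP; split=> [h|_ [t Tt [u [Cu' _] <-]]].
      rewrite {1}/C /conjS /= {1}BE => -[t Tt [u Bu' hE]].
      exists (wdot *m t *m invmx wdot); first exact: wT'.
      exists (wdot *m u *m invmx wdot); first by rewrite CuE; apply: conjS_mem.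
      by rewrite -(conjJV uw h) -hE !mulmxA mulmxKV.
    by apply: (grpM gC) => //; apply: TB; apply: wT.
have [W /zopenP oW WP] := oV.
have [p [pv pW]] : exists p, mxeval p (v *m wdot) != 0 /\ forall A, mxeval p A != 0 -> W A.
  apply: oW; apply/WP; last by move: Ox1; rewrite /O OE => -[].
  by apply: (grpM gG) => //; apply: BG; apply: VB.
have HE : stabilizer L act x1 = [set l | L l /\ C (invmx v *m l *m v)].
  by apply/seteqP; split=> l [Ll h]; split=> //; apply/stabE.
have [cH [B1 bB1 HB1]] :
    zconnected (stabilizer L act x1) /\ strongly_solvable L (stabilizer L act x1).
  rewrite HE; apply: (levi_stab uQ RS SR ct0 sep ssG Z1 maxT bB TB gP BP PG aL TL urV PE muU
    (f := fun v => mxeval p (v *m wdot)) _ _ CuP Vv) => //.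
  - exact: conjS_alg.
  - by move=> t Tt; apply: TB; apply: wT.
  - apply: polyf_comp; first exact: polyf_mxeval.
    by apply: polymapM; [apply: polymap_id|apply: polymapC].
  - by rewrite -HE.
  - move=> v' Vv' pv'; have Bv' := VB _ Vv'.
    have Ov' : O (mxact (v' *m wdot) B).
      rewrite /O OE; split; first exact: schubert_cell.
      by apply/WP; [apply: (grpM gG) => //; apply: BG|apply: pW].
    have [l Ll lE] := Otrans _ _ Ox1 Ov'; exists l => //.
    have ul := grpU gL Ll; have ulvw : l *m (v *m wdot) \in unitmx by rewrite unitmx_mul ul.
    have := mxact_eq gB (v' *m wdot) ulvw; rewrite mxactM => -[h _]; have := h lE.
    by rewrite /C /conjS /= !invmxM ?unitmx_mul ?ul ?uv ?uw // !mulmxA.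
have -> : stabilizer L act x = conjS l0 (stabilizer L act x1).
  apply/seteqP; split=> l [Ll h].
    split; first by apply: (grpM gL) => //; apply: (grpM gL) => //; apply: (grpV gL).
    by rewrite !actM xE h (actV _ _ _ Ll0 xE).
  split; first by rewrite -(conjJV ul0 l); apply: (grpJ gL).
  by rewrite -xE -actM -(conjJV ul0 l) mulmxKV // actM h.
split; last first.
  exists (conjS l0 B1); first exact: borel_conj.
  by move=> l; apply: HB1.
apply: conjS_conn => //; split; [exact: (grp1 gL)|exact: act1].
Qed.

End Main.

(** Size 0 is treated apart: the ring structure on matrices used above exists in positive size, and
    here all matrices coincide. *)
Lemma zconnected_dim0 (F : fieldType) (S : set 'M[F]_0) : zconnected S.
Proof.
move=> A [a Aa] _ [C _ AE]; apply/seteqP; split=> [b|b Sb]; first by rewrite AE => -[].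
by rewrite [b](_ : _ = a) // [LHS]flatmx0 [RHS]flatmx0.
Qed.

Lemma strongly_solvable_dim0 (F : fieldType) (L S : set 'M[F]_0) :
  alg_group L -> S `<=` L -> strongly_solvable L S.
Proof.
move=> aL SL; exists L => //; split=> [|H [[_ HL] _ _] LH]; last exact/seteqP.
split; [by split|exact: zconnected_dim0|].
by exists 0%N => g _; rewrite /= [LHS]flatmx0 [RHS]flatmx0.
Qed.

Theorem proposition7p5 (R : realType) (n : nat) (G B T : set 'M[R[i]]_n)
    (w : set 'M[R[i]]_n) (wdot : 'M[R[i]]_n) (J : set ('M[R[i]]_n -> R[i]))
    (L : set 'M[R[i]]_n) :
  semisimple G -> trivial_center G ->
  borel G B -> maximal_torus G T -> T `<=` B ->
  weyl_group G T w -> w wdot ->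
  J `<=` left_descents B T wdot ->
  levi (parabolic G B T J) L -> T `<=` L ->
  horospherical (flag_regular G B) L (flag_act G B) (schubert G B wdot) ->
  forall x : flag G B,
    general_position L (flag_act G B) (schubert G B wdot) x ->
    zconnected (stabilizer L (flag_act G B) x) /\
    strongly_solvable L (stabilizer L (flag_act G B) x).
Proof.
case: n G B T w wdot J L => [|n'] G B T w wdot J L ssG Z1 bB maxT TB ww wwd JL lev TL hor x gp.
  split; first exact: zconnected_dim0.
  by apply: strongly_solvable_dim0 => [|l []//]; case: lev => -[].
exact: (connected_stabilizer ssG Z1 bB maxT TB ww wwd lev TL hor gp).
Qed.
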